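(* Let $\Omega\subset\mathbb R^n$ be a bounded open set with $C^2$ boundary, let $L,F,G$ satisfy the assumptions below, $H$ as below, and let $(u,m)$ be a mild solution of the constrained MFG problem in $\overline\Omega$. Then: (i) for every $(t,x)\in(0,T)\times\Omega$, $\limsup_{(s,y)\in(0,T)\times\Omega,\,(s,y)\to(t,x)}D^+u(s,y)\subset D^+u(t,x)$; in particular, for every $(t,x)\in Q_m$, $\limsup_{(s,y)\in(0,T)\times\Omega,\,(s,y)\to(t,x)}D^+u(s,y)=\{(\partial_tu(t,x),Du(t,x))\}$; (ii) for every $(t,x)\in\partial Q_m$, $$\lim_{\substack{(s,y)\in(0,T)\times\Omega,\ u\text{ differentiable at }(s,y)\\ (s,y)\to(t,x)}}(\partial_tu(s,y),Du(s,y))=\big(\partial_tu(t,x),\,D^\tau_xu(t,x)+\lambda_+(t,x)\nu(x)\big),$$ and moreover $-\partial_tu(t,x)+H(x,D^\tau_xu(t,x)+\lambda_+(t,x)\nu(x))=F(x,m(t))$; (iii) for every $(t,x)\in\partial Q_m$, $$\lim_{(s,y)\in\partial Q_m,\ (s,y)\to(t,x)}\big(\partial_tu(s,y),\,D^\tau_xu(s,y)+\lambda_+(s,y)\nu(y)\big)=\big(\partial_tu(t,x),\,D^\tau_xu(t,x)+\lambda_+(t,x)\nu(x)\big).$$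
   Context: $T>0$; $U\supset\overline\Omega$ open; $\nu(x)$ outward unit normal at $x\in\partial\Omega$. $\mathcal P(\overline\Omega)$ with the Kantorovich–Rubinstein distance $d_1$. Assumptions: (D1) $|F(x,m_1)-F(x,m_2)|+|G(x,m_1)-G(x,m_2)|\le\kappa d_1(m_1,m_2)$; (D2) $F(\cdot,m),G(\cdot,m)\in C^1_b(U)$, $|D_xF|+|D_xG|\le\kappa$; (D3) $x\mapsto F(x,m)$ semiconcave with linear modulus uniformly in $m$; (L0) $L\in C^1(U\times\mathbb R^n)$, $|L(x,0)|+|D_xL(x,0)|+|D_vL(x,0)|\le M$; (L1) $D_vL$ differentiable, $I/\mu\le D^2_{vv}L\le\mu I$, $\|D^2_{vx}L(x,v)\|\le\mu(1+|v|)$; (L2) $|D_xL(x,v)-D_xL(x,w)|\le C(R)|v-w|$ for $v,w\in B_R$; (L3) $x\mapsto L(x,v)$ semiconcave with linear modulus uniformly in $v\in B_R$. $H(x,p)=\sup_v\{-\langle p,v\rangle-L(x,v)\}$. $\Gamma$: absolutely continuous curves $[0,T]\to\overline\Omega$; $\Gamma_t[x]=\{\gamma:\gamma(t)=x\}$; $e_t(\gamma)=\gamma(t)$; $m^\eta(t)=e_t\sharp\eta$; $J_\eta[\gamma]=\int_0^T[L(\gamma,\dot\gamma)+F(\gamma,m^\eta(t))]dt+G(\gamma(T),m^\eta(T))$; $\Gamma^\eta[x]$ minimizers of $J_\eta$ over $\Gamma_0[x]$. Constrained MFG equilibrium for $m_0$: Borel probability $\eta$ on $\Gamma$ with $e_0\sharp\eta=m_0$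 and $\mathrm{supp}\,\eta\subset\bigcup_x\Gamma^\eta[x]$. Mild solution: $(u,m)\in C([0,T]\times\overline\Omega)\times C([0,T];\mathcal P(\overline\Omega))$ with, for some equilibrium $\eta$, $m(t)=e_t\sharp\eta$ and $u(t,x)=\inf_{\gamma\in\Gamma_t[x]}\{\int_t^T[L(\gamma,\dot\gamma)+F(\gamma(s),m(s))]ds+G(\gamma(T),m(T))\}$. $Q_m=\{(t,x)\in(0,T)\times\Omega:x\in\mathrm{supp}(m(t))\}$, $\partial Q_m=\{(t,x)\in(0,T)\times\partial\Omega:x\in\mathrm{supp}(m(t))\}$. $D^+u(t,x)$: set of $(p_1,p_2)\in\mathbb R\times\mathbb R^n$ with $\limsup_{(s,y)\to(t,x),(s,y)\in(0,T)\times\overline\Omega}\frac{u(s,y)-u(t,x)-p_1(s-t)-\langle p_2,y-x\rangle}{|s-t|+|y-x|}\le0$; $D^+_xu(t,x)$: set of $p$ with $\limsup_{y\to x,y\in\overline\Omega}\frac{u(t,y)-u(t,x)-\langle p,y-x\rangle}{|y-x|}\le0$. The $\limsup$ of sets is the set of all limits of convergent sequences $q_k\in D^+u(s_k,y_k)$ with $(s_k,y_k)\to(t,x)$. For $(t,x)\in\partial Q_m$, the partial derivative $\partial_tu(t,x)$ exists and all elements of $D^+_xu(t,x)$ have the same tangential component $p-\langle p,\nu(x)\rangle\nu(x)$, denoted $D^\tau_xu(t,x)$; $\lambda_+(t,x):=\max\{\lambda\in\mathbb R:D^\tau_xu(t,x)+\lambda\nu(x)\in D^+_xu(t,x)\}$.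 *)

(* Defs.v *)
From HB Require Import structures.
From mathcomp Require Import all_boot all_order all_algebra.
From mathcomp Require Import all_classical all_reals all_analysis.
Import Order.TTheory GRing.Theory Num.Theory.
Import numFieldNormedType.Exports.
Local Open Scope classical_set_scope.
Local Open Scope ring_scope.

Definition dotv {R : realType} {n : nat} (p q : 'rV[R]_n) : R :=
  \sum_(i < n) p ord0 i * q ord0 i.
Definition enorm {R : realType} {n : nat} (v : 'rV[R]_n) : R :=
  Num.sqrt (dotv v v).

Notation BorelV R n := (g_sigma_algebraType (@open 'rV[R]_n)).
(* Borel probability measures on R^n (an element of P(cl Omega) is one
   that gives full mass to cl Omega). *)
Notation PrV R n := (probability (BorelV R n) R).

Definition is_in_P {R : realType} {n : nat} (Om : set 'rV[R]_n) (mu : PrV R n) : Prop :=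
  mu (closure Om) = 1%E.

Definition grad {R : realType} {n : nat} (f : 'rV[R]_n -> R) (x : 'rV[R]_n) : 'rV[R]_n :=
  \row_(i < n) derive f x (delta_mx ord0 i).

Definition C2 {R : realType} {n : nat} (f : 'rV[R]_n -> R) : Prop :=
  (forall x, differentiable f x) /\
  (forall (i : 'I_n) x, differentiable (fun y => derive f y (delta_mx ord0 i)) x) /\
  (forall (i j : 'I_n),
      continuous (fun y => derive (fun z => derive f z (delta_mx ord0 i)) y (delta_mx ord0 j))).

Definition bounded_C2_domain {R : realType} {n : nat} (Om : set 'rV[R]_n)
    (rho : 'rV[R]_n -> R) : Prop :=
  open Om /\ (exists C : R, forall x, Om x -> enorm x <= C) /\
  C2 rho /\ (forall x, Om x <-> rho x < 0) /\
  (forall x, rho x = 0 -> grad rho x != 0).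

Definition nu {R : realType} {n : nat} (rho : 'rV[R]_n -> R) (x : 'rV[R]_n) : 'rV[R]_n :=
  (enorm (grad rho x))^-1 *: grad rho x.

Definition bdry {R : realType} {n : nat} (Om : set 'rV[R]_n) : set 'rV[R]_n :=
  closure Om `\` Om.

Definition lip1_on {R : realType} {n : nat} (A : set 'rV[R]_n) (f : 'rV[R]_n -> R) : Prop :=
  forall x y, A x -> A y -> `|f x - f y| <= enorm (x - y).

Definition d1 {R : realType} {n : nat} (Om : set 'rV[R]_n) (m1 m2 : PrV R n) : R :=
  sup [set Rintegral m1 (closure Om) f - Rintegral m2 (closure Om) f
      | f in lip1_on (closure Om)].

Definition in_supp {R : realType} {n : nat} (mu : PrV R n) (x : 'rV[R]_n) : Prop :=
  forall e : R, 0 < e -> (0 < mu [set y | (enorm (y - x) < e)%R])%E.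

Definition abs_cont_on {R : realType} {n : nat} (T : R) (g : R -> 'rV[R]_n) : Prop :=
  forall e : R, 0 < e -> exists2 d : R, 0 < d &
    forall (k : nat) (a b : nat -> R),
      (forall i, (i < k)%N -> 0 <= a i /\ a i <= b i /\ b i <= T) ->
      (forall i j, (i < k)%N -> (j < k)%N -> i <> j -> b i <= a j \/ b j <= a i) ->
      \sum_(i < k) (b i - a i) < d ->
      \sum_(i < k) enorm (g (b i) - g (a i)) < e.

(* Gamma: absolutely continuous curves [0,T] -> cl Omega
   (curves are functions R -> R^n, only their restriction to [0,T] matters) *)
Definition Gamma {R : realType} {n : nat} (Om : set 'rV[R]_n) (T : R) : set (R -> 'rV[R]_n) :=
  [set g | abs_cont_on T g /\ forall t, 0 <= t <= T -> closure Om (g t)].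

Definition dunif {R : realType} {n : nat} (T : R) (g g' : R -> 'rV[R]_n) : R :=
  sup [set enorm (g s - g' s) | s in `[0, T]%classic].

Definition Gamma_open {R : realType} {n : nat} (Om : set 'rV[R]_n) (T : R) :
    set (set (R -> 'rV[R]_n)) :=
  [set A | A `<=` Gamma Om T /\
     forall g, A g -> exists2 e : R, 0 < e &
       forall g', Gamma Om T g' -> dunif T g g' < e -> A g'].

(* Borel sigma-algebra of Gamma (sets outside Gamma are irrelevant since the
   measures considered give full mass to Gamma) *)
Notation CurveSpace Om T := (g_sigma_algebraType (Gamma_open Om T)).

Definition in_supp_curve {R : realType} {n : nat} (Om : set 'rV[R]_n) (T : R)
    (eta : probability (CurveSpace Om T) R) (g : R -> 'rV[R]_n) : Prop :=
  Gamma Om T g /\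
  forall e : R, 0 < e ->
    (0 < eta [set g' | Gamma Om T g' /\ (dunif T g g' < e)%R])%E.

Definition cost {R : realType} {n : nat} (L : 'rV[R]_n -> 'rV[R]_n -> R)
    (F G : 'rV[R]_n -> PrV R n -> R) (m : R -> PrV R n) (T t : R)
    (g : R -> 'rV[R]_n) : \bar R :=
  (\int[@lebesgue_measure R]_(s in `[t, T]%classic)
      (L (g s) (derive1 g s) + F (g s) (m s))%:E
   + (G (g T) (m T))%:E)%E.

Definition minimizer {R : realType} {n : nat} (Om : set 'rV[R]_n) (T : R)
    (L : 'rV[R]_n -> 'rV[R]_n -> R) (F G : 'rV[R]_n -> PrV R n -> R)
    (m : R -> PrV R n) (x : 'rV[R]_n) (g : R -> 'rV[R]_n) : Prop :=
  Gamma Om T g /\ g 0 = x /\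
  forall g', Gamma Om T g' -> g' 0 = x -> (cost L F G m T 0 g <= cost L F G m T 0 g')%E.

(* eta is a constrained MFG equilibrium (for m0 = e_0 # eta) and m(t) = e_t # eta *)
Definition equilibrium_for {R : realType} {n : nat} (Om : set 'rV[R]_n) (T : R)
    (L : 'rV[R]_n -> 'rV[R]_n -> R) (F G : 'rV[R]_n -> PrV R n -> R)
    (m : R -> PrV R n) (eta : probability (CurveSpace Om T) R) : Prop :=
  eta (Gamma Om T) = 1%E /\
  (forall t, 0 <= t <= T -> forall B : set (BorelV R n), measurable B ->
      m t B = eta (Gamma Om T `&` (fun g => g t) @^-1` B)) /\
  (forall g, in_supp_curve Om T eta g -> minimizer Om T L F G m (g 0) g).

Definition mild_solution {R : realType} {n : nat} (Om : set 'rV[R]_n) (T : R)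
    (L : 'rV[R]_n -> 'rV[R]_n -> R) (F G : 'rV[R]_n -> PrV R n -> R)
    (u : R -> 'rV[R]_n -> R) (m : R -> PrV R n) : Prop :=
  (forall t x, 0 <= t <= T -> closure Om x ->
     forall e : R, 0 < e -> exists2 d : R, 0 < d & forall s y,
       0 <= s <= T -> closure Om y -> `|s - t| + enorm (y - x) < d ->
       `|u s y - u t x| < e) /\
  (forall t, 0 <= t <= T -> is_in_P Om (m t)) /\
  (forall t, 0 <= t <= T -> forall e : R, 0 < e -> exists2 d : R, 0 < d &
     forall s, 0 <= s <= T -> `|s - t| < d -> d1 Om (m s) (m t) < e) /\
  exists eta : probability (CurveSpace Om T) R,
    equilibrium_for Om T L F G m eta /\
    forall t x, 0 <= t <= T -> closure Om x ->
      (u t x)%:E = ereal_inf [set cost L F G m T t g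
                             | g in [set g | Gamma Om T g /\ g t = x]].

Definition C1b_on {R : realType} {n : nat} (U : set 'rV[R]_n) (f : 'rV[R]_n -> R) : Prop :=
  (forall x, U x -> differentiable f x) /\
  (forall x, U x -> {for x, continuous (grad f)}) /\
  (exists C : R, forall x, U x -> `|f x| <= C /\ enorm (grad f x) <= C).

Definition semiconcave_on {R : realType} {n : nat} (U : set 'rV[R]_n) (C : R)
    (f : 'rV[R]_n -> R) : Prop :=
  forall x h, (forall th : R, -1 <= th <= 1 -> U (x + th *: h)) ->
    f (x + h) + f (x - h) - 2 * f x <= C * enorm h ^+ 2.

Definition DxL {R : realType} {n : nat} (L : 'rV[R]_n -> 'rV[R]_n -> R) x v : 'rV[R]_n :=
  grad (fun y => L y v) x.
Definition DvL {R : realType} {n : nat} (L : 'rV[R]_n -> 'rV[R]_n -> R) x v : 'rV[R]_n :=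
  grad (L x) v.

Definition hyp_D {R : realType} {n : nat} (Om U : set 'rV[R]_n) (kappa : R)
    (F G : 'rV[R]_n -> PrV R n -> R) : Prop :=
  (forall x, U x -> forall m1 m2, is_in_P Om m1 -> is_in_P Om m2 ->
     `|F x m1 - F x m2| + `|G x m1 - G x m2| <= kappa * d1 Om m1 m2) /\
  (forall m, is_in_P Om m ->
     C1b_on U (F ^~ m) /\ C1b_on U (G ^~ m) /\
     forall x, U x -> enorm (grad (F ^~ m) x) + enorm (grad (G ^~ m) x) <= kappa) /\
  (exists C : R, forall m, is_in_P Om m -> semiconcave_on U C (F ^~ m)).

Definition hyp_L {R : realType} {n : nat} (U : set 'rV[R]_n) (M mu : R)
    (L : 'rV[R]_n -> 'rV[R]_n -> R) : Prop :=
  (forall x v, U x ->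
     differentiable (fun p : 'rV[R]_n * 'rV[R]_n => L p.1 p.2) (x, v) /\
     {for (x, v), continuous (fun p : 'rV[R]_n * 'rV[R]_n => DxL L p.1 p.2)} /\
     {for (x, v), continuous (fun p : 'rV[R]_n * 'rV[R]_n => DvL L p.1 p.2)}) /\
  (forall x, U x -> `|L x 0| + enorm (DxL L x 0) + enorm (DvL L x 0) <= M) /\
  (forall x v, U x ->
     differentiable (fun p : 'rV[R]_n * 'rV[R]_n => DvL L p.1 p.2) (x, v) /\
     (forall xi, enorm xi ^+ 2 / mu <= derive (fun w => dotv (DvL L x w) xi) v xi
                 <= mu * enorm xi ^+ 2) /\
     (forall xi zeta, `|derive (fun y => dotv (DvL L y v) zeta) x xi|
                      <= mu * (1 + enorm v) * enorm xi * enorm zeta)) /\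
  (forall r : R, 0 < r -> exists C : R, forall x v w, U x -> enorm v <= r -> enorm w <= r ->
     enorm (DxL L x v - DxL L x w) <= C * enorm (v - w)) /\
  (forall r : R, 0 < r -> exists C : R, forall v, enorm v <= r ->
     semiconcave_on U C (fun y => L y v)).

Definition Ham {R : realType} {n : nat} (L : 'rV[R]_n -> 'rV[R]_n -> R)
    (x p : 'rV[R]_n) : R :=
  sup [set - dotv p v - L x v | v in [set: 'rV[R]_n]].

Definition superdiff {R : realType} {n : nat} (Om : set 'rV[R]_n) (T : R)
    (u : R -> 'rV[R]_n -> R) (t : R) (x : 'rV[R]_n) (p1 : R) (p2 : 'rV[R]_n) : Prop :=
  forall e : R, 0 < e -> exists2 d : R, 0 < d & forall s y,
    0 < s < T -> closure Om y -> `|s - t| + enorm (y - x) < d ->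
    u s y - u t x - p1 * (s - t) - dotv p2 (y - x) <= e * (`|s - t| + enorm (y - x)).

Definition superdiff_x {R : realType} {n : nat} (Om : set 'rV[R]_n)
    (u : R -> 'rV[R]_n -> R) (t : R) (x : 'rV[R]_n) (p : 'rV[R]_n) : Prop :=
  forall e : R, 0 < e -> exists2 d : R, 0 < d & forall y,
    closure Om y -> enorm (y - x) < d ->
    u t y - u t x - dotv p (y - x) <= e * enorm (y - x).

Definition limsup_superdiff {R : realType} {n : nat} (Om : set 'rV[R]_n) (T : R)
    (u : R -> 'rV[R]_n -> R) (t : R) (x : 'rV[R]_n) (q1 : R) (q2 : 'rV[R]_n) : Prop :=
  exists (s : nat -> R) (y : nat -> 'rV[R]_n) (p1 : nat -> R) (p2 : nat -> 'rV[R]_n),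
    (forall k, 0 < s k < T /\ Om (y k)) /\
    s @ \oo --> t /\ y @ \oo --> x /\
    (forall k, superdiff Om T u (s k) (y k) (p1 k) (p2 k)) /\
    p1 @ \oo --> q1 /\ p2 @ \oo --> q2.

Definition diff_at {R : realType} {n : nat} (Om : set 'rV[R]_n) (T : R)
    (u : R -> 'rV[R]_n -> R) (t : R) (x : 'rV[R]_n) (p1 : R) (p2 : 'rV[R]_n) : Prop :=
  forall e : R, 0 < e -> exists2 d : R, 0 < d & forall s y,
    0 < s < T -> Om y -> `|s - t| + enorm (y - x) < d ->
    `|u s y - u t x - p1 * (s - t) - dotv p2 (y - x)| <= e * (`|s - t| + enorm (y - x)).

Definition dt_at {R : realType} {n : nat} (T : R)
    (u : R -> 'rV[R]_n -> R) (t : R) (x : 'rV[R]_n) (p1 : R) : Prop :=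
  forall e : R, 0 < e -> exists2 d : R, 0 < d & forall s,
    0 < s < T -> `|s - t| < d -> `|u s x - u t x - p1 * (s - t)| <= e * `|s - t|.

Definition is_Dtau {R : realType} {n : nat} (Om : set 'rV[R]_n) (rho : 'rV[R]_n -> R)
    (u : R -> 'rV[R]_n -> R) (t : R) (x : 'rV[R]_n) (ptau : 'rV[R]_n) : Prop :=
  forall p, superdiff_x Om u t x p -> p - dotv p (nu rho x) *: nu rho x = ptau.

Definition is_lambda_plus {R : realType} {n : nat} (Om : set 'rV[R]_n) (rho : 'rV[R]_n -> R)
    (u : R -> 'rV[R]_n -> R) (t : R) (x : 'rV[R]_n) (ptau : 'rV[R]_n) (lam : R) : Prop :=
  superdiff_x Om u t x (ptau + lam *: nu rho x) /\
  forall l : R, superdiff_x Om u t x (ptau + l *: nu rho x) -> l <= lam.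

Definition Qm {R : realType} {n : nat} (Om : set 'rV[R]_n) (T : R) (m : R -> PrV R n)
    (t : R) (x : 'rV[R]_n) : Prop :=
  0 < t < T /\ Om x /\ in_supp (m t) x.
Definition bQm {R : realType} {n : nat} (Om : set 'rV[R]_n) (T : R) (m : R -> PrV R n)
    (t : R) (x : 'rV[R]_n) : Prop :=
  0 < t < T /\ bdry Om x /\ in_supp (m t) x.

(* Main.v *)
Require Import Defs.
From HB Require Import structures.
From mathcomp Require Import all_boot all_order all_algebra.
From mathcomp Require Import all_classical all_reals all_analysis.
From mathcomp Require Import measurable_realfun ring lra.
Import Order.TTheory GRing.Theory Num.Theory.
Import numFieldNormedType.Exports.
Local Open Scope classical_set_scope.
Local Open Scope ring_scope.

(* Near-optimal arcs started at time 0 pass arbitrarily close to any point x of the support of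
   m(t).  Comparing such an arc with the chords between its points, bent inwards along the normal
   so as to stay in the closed domain, bounds the oscillation of its velocity near t, so that the
   arcs have a common limit velocity v at x, tangential if x is a boundary point.  Dynamic
   programming along the arcs before and after t then gives the expansion of u at (t,x), relative
   to the closed domain, with space slope q = - D_v L(x,v) and time slope <D_v L(x,v), v> - L - F.
   At a boundary point the superdifferential in x is contained in the half-line q - [0,oo) nu,
   whence lambda_+ is the normal component of q.  Slopes at nearby points satisfy the
   Hamilton-Jacobi inequality, and the uniform convexity of L forces them to converge to the
   slope at (t,x); in the interior, approximate semiconcavity makes the superdifferential
   upper semicontinuous. *)

(** The coupling [F x (m t)] is merely continuous in time and curves are confined to the closed
    domain, so all regularity is drawn from comparison of costs, with remainders measured against
    the duration of the arc. Minimizers are given only on the support of the equilibrium; at other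
    points there are curves optimal up to [e], and the estimates carry this [e], which is made small
    once the duration has been fixed. At a boundary point a displacement [h] is admissible under the
    condition [dotv G h + K * enorm h * c <= 0], a cone that fills the inward half-space as [c]
    tends to 0. Expansions are proved on such cones and carried to the whole closed domain by local
    Lipschitz continuity of [u], which has to be established first. The cost contains [derive1] of
    an absolutely continuous curve; before any comparison this is replaced by an integrable
    velocity, which rests on the density theorem for absolutely continuous functions, obtained from
    total variation and Radon-Nikodym. Order of quantifiers matters throughout: error and cone
    first, then the duration [tau], then the radius [d] of the perturbation. *)

Section euclid.
Context {R : realType} {n : nat}.
Implicit Types (p q v w : 'rV[R]_n) (a b c : R).

(** * Euclidean geometry of row vectors *)

Lemma dotvC p q : dotv p q = dotv q p.
Proof. by apply: eq_bigr => i _; rewrite mulrC. Qed.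

Lemma dotvDl p q v : dotv (p + q) v = dotv p v + dotv q v.
Proof. by rewrite /dotv -big_split; apply: eq_bigr => i _; rewrite mxE mulrDl. Qed.

Lemma dotvZl a p v : dotv (a *: p) v = a * dotv p v.
Proof. by rewrite /dotv big_distrr; apply: eq_bigr => i _; rewrite mxE /= mulrA. Qed.

Lemma dotvDr p q v : dotv v (p + q) = dotv v p + dotv v q.
Proof. by rewrite !(dotvC v) dotvDl. Qed.

Lemma dotvZr a p v : dotv v (a *: p) = a * dotv v p.
Proof. by rewrite !(dotvC v) dotvZl. Qed.

Lemma dotvNl p v : dotv (- p) v = - dotv p v.
Proof. by rewrite -scaleN1r dotvZl mulN1r. Qed.

Lemma dotvNr p v : dotv v (- p) = - dotv v p.
Proof. by rewrite !(dotvC v) dotvNl. Qed.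

Lemma dotvBl p q v : dotv (p - q) v = dotv p v - dotv q v.
Proof. by rewrite dotvDl dotvNl. Qed.

Lemma dotvBr p q v : dotv v (p - q) = dotv v p - dotv v q.
Proof. by rewrite dotvDr dotvNr. Qed.

Lemma dot0v v : dotv 0 v = 0.
Proof. by rewrite -(scale0r 0) dotvZl mul0r. Qed.

Lemma dotv0 v : dotv v 0 = 0.
Proof. by rewrite dotvC dot0v. Qed.

Definition dotvE := (dotvDl, dotvDr, dotvBl, dotvBr, dotvNl, dotvNr, dotvZl,
  dotvZr, dot0v, dotv0).

Lemma dotv_ge0 v : 0 <= dotv v v.
Proof. by apply: sumr_ge0 => i _; rewrite -expr2 sqr_ge0. Qed.

Lemma enorm_ge0 v : 0 <= enorm v.
Proof. exact: sqrtr_ge0. Qed.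

Lemma sqr_enorm v : enorm v ^+ 2 = dotv v v.
Proof. by rewrite sqr_sqrtr // dotv_ge0. Qed.

Lemma enorm0 : enorm (0 : 'rV[R]_n) = 0.
Proof. by rewrite /enorm dot0v sqrtr0. Qed.

Lemma enorm0_eq0 v : enorm v = 0 -> v = 0.
Proof.
move=> /eqP; rewrite sqrtr_eq0 => v0.
have {}v0 : dotv v v = 0 by apply/eqP; rewrite eq_le v0 dotv_ge0.
apply/rowP => i; rewrite mxE; apply/eqP; rewrite -sqrf_eq0 expr2; apply/eqP.
have /psumr_eq0P -> // : \sum_(i < n) (v ord0 i * v ord0 i) = 0 by exact: v0.
by move=> j _; rewrite -expr2 sqr_ge0.
Qed.

Lemma enorm_gt0 v : v != 0 -> 0 < enorm v.
Proof.
move=> v0; rewrite lt_neqAle enorm_ge0 andbT eq_sym.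
by apply: contra_neq v0 => /enorm0_eq0.
Qed.

Lemma enormZ a v : enorm (a *: v) = `|a| * enorm v.
Proof. by rewrite /enorm dotvZl dotvZr mulrA -expr2 sqrtrM ?sqr_ge0// sqrtr_sqr. Qed.

Lemma enormN v : enorm (- v) = enorm v.
Proof. by rewrite -scaleN1r enormZ normrN1 mul1r. Qed.

Lemma enormB v w : enorm (v - w) = enorm (w - v).
Proof. by rewrite -enormN opprB. Qed.

Lemma cauchy_schwarz v w : dotv v w <= enorm v * enorm w.
Proof.
have [->|v0] := eqVneq v 0; first by rewrite dot0v enorm0 mul0r.
have [->|w0] := eqVneq w 0; first by rewrite dotv0 enorm0 mulr0.
have := dotv_ge0 (enorm w *: v - enorm v *: w).
rewrite !dotvE (dotvC w v) -!sqr_enorm.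
have := enorm_gt0 _ v0; have := enorm_gt0 _ w0.
move: (enorm v) (enorm w) (dotv v w) => a b c b0 a0.
rewrite (_ : _ + _ = (2 * a * b) * (a * b - c)); last by ring.
by rewrite pmulr_rge0 ?subr_ge0// !mulr_gt0.
Qed.

Lemma cauchy_schwarz_norm v w : `|dotv v w| <= enorm v * enorm w.
Proof.
rewrite ler_norml cauchy_schwarz andbT lerNl -dotvNl.
by rewrite (le_trans (cauchy_schwarz _ _))// enormN.
Qed.

Lemma enormD v w : enorm (v + w) <= enorm v + enorm w.
Proof.
rewrite -(@ler_pXn2r _ 2)// ?nnegrE ?addr_ge0 ?enorm_ge0//.
rewrite sqrrD !sqr_enorm !dotvE (dotvC w v).
have := cauchy_schwarz v w; lra.
Qed.

Lemma enormBD v w : enorm (v - w) <= enorm v + enorm w.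
Proof. by rewrite (le_trans (enormD _ _))// enormN. Qed.

Lemma enorm_triangle v w p : enorm (v - p) <= enorm (v - w) + enorm (w - p).
Proof. by rewrite -(subrKA w) enormD. Qed.

Lemma ler_enormB v w : enorm v - enorm w <= enorm (v - w).
Proof. by rewrite lerBlDr (le_trans _ (enormD _ _))// subrK. Qed.

Lemma coord_le_enorm v i : `|v ord0 i| <= enorm v.
Proof.
rewrite -sqrtr_sqr ler_wsqrtr// /dotv (bigD1 i)//= -expr2 lerDl.
by apply: sumr_ge0 => j _; rewrite -expr2 sqr_ge0.
Qed.

Lemma enorm_le_sum v : enorm v <= \sum_(i < n) `|v ord0 i|.
Proof.
rewrite -(@ler_pXn2r _ 2)// ?nnegrE ?enorm_ge0 ?sumr_ge0// sqr_enorm.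
rewrite [leRHS]expr2 mulr_suml; apply: ler_sum => i _.
rewrite (le_trans (ler_norm _))// normrM ler_wpM2l//.
by rewrite (bigD1 i)//= lerDl sumr_ge0.
Qed.

Lemma norm_le_enorm v : `|v| <= enorm v.
Proof.
rewrite [leLHS]mx_normrE; apply: bigmax_le => [|[i j] _]; first exact: enorm_ge0.
by rewrite ord1 coord_le_enorm.
Qed.

Lemma coord_le_norm v i : `|v ord0 i| <= `|v|.
Proof. by rewrite [leRHS]mx_normrE (le_bigmax _ (fun ij => `|v ij.1 ij.2|) (ord0, i)). Qed.

Lemma enorm_le_norm v : enorm v <= n%:R * `|v|.
Proof.
rewrite (le_trans (enorm_le_sum v))// -[X in _ <= X%:R * _]card_ord.
by rewrite mulr_natl -sumr_const; apply: ler_sum => i _; exact: coord_le_norm.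
Qed.

End euclid.

(** * Differential calculus and topology in terms of the Euclidean norm *)

Section calculus.
Context {R : realType}.

Lemma is_derive_segment (V : normedModType R) (f : V -> R) (x h : V) (s : R) :
  derivable f (x + s *: h) h ->
  is_derive s (1 : R) (fun r : R => f (x + r *: h)) ('D_h f (x + s *: h)).
Proof.
have E : (fun k : R => k^-1 *: (((fun r : R => f (x + r *: h)) \o shift s) (k *: (1 : R))
                         - f (x + s *: h))) =
         (fun k : R => k^-1 *: ((f \o shift (x + s *: h)) (k *: h) - f (x + s *: h))).
  apply/funext => k /=; do 2 f_equal; congr f.
  by rewrite scalerDl addrCA -[k *: (1:R)]/(k * 1) mulr1.
move=> df; apply: DeriveDef.
  by rewrite /derivable E.
by rewrite /derive E.
Qed.

Lemma mvt01 (f df : R -> R) :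
  (forall s : R, 0 <= s <= 1 -> is_derive s (1 : R) f (df s)) ->
  exists2 c : R, 0 < c < 1 & f 1 - f 0 = df c.
Proof.
move=> fdf.
have [||c] := @MVT R f df 0 1 ltr01.
- by move=> s; rewrite in_itv/= => /andP[s0 s1]; apply: fdf; rewrite !ltW.
- apply: derivable_within_continuous => s; rewrite in_itv/= => s01.
  by have [] := fdf s s01.
by rewrite in_itv/= => c01; rewrite subr0 mulr1 => E; exists c.
Qed.

Context {n : nat}.
Implicit Types (x y h v : 'rV[R]_n).

Lemma derive_grad (f : 'rV[R]_n -> R) x h :
  differentiable f x -> 'D_h f x = dotv (grad f x) h.
Proof.
move=> df; rewrite deriveE// [in LHS](row_sum_delta h) linear_sum.
by apply: eq_bigr => i _; rewrite linearZ/= -deriveE// mxE mulrC.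
Qed.

Lemma mvt_grad (f : 'rV[R]_n -> R) x y :
  (forall s : R, 0 <= s <= 1 -> differentiable f (x + s *: (y - x))) ->
  exists2 c : R, 0 < c < 1 & f y - f x = dotv (grad f (x + c *: (y - x))) (y - x).
Proof.
move=> df.
have [s s01|c c01 E] := @mvt01 (fun r : R => f (x + r *: (y - x)))
    (fun s => dotv (grad f (x + s *: (y - x))) (y - x)).
  rewrite -derive_grad; last exact: df.
  by apply: is_derive_segment; apply: diff_derivable; exact: df.
by exists c => //; rewrite -E scale1r scale0r addr0 [x + _]addrC subrK.
Qed.

(** The topology of row vectors comes from the maximum norm, comparable to the Euclidean one with
    factors 1 and [n]; [n + 1] replaces [n] so that division is possible also for [n = 0]. *)
Lemma nbhs_enormP x (A : set 'rV[R]_n) :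
  nbhs x A <-> exists2 d : R, 0 < d & forall y, enorm (y - x) < d -> A y.
Proof.
split=> [|[d d0 dA]]; first rewrite -nbhs_nbhs_norm => -[d /= d0 dA].
  exists d => // y yx; apply: dA; rewrite /= distrC.
  exact: le_lt_trans (norm_le_enorm _) yx.
have n1 : 0 < n%:R + 1 :> R by rewrite ltr_wpDl.
rewrite -nbhs_nbhs_norm; exists (d / (n%:R + 1)); first by rewrite /= divr_gt0.
move=> y /= yx; apply: dA; rewrite enormB (le_lt_trans (enorm_le_norm _))//.
rewrite ltr_pdivlMr// in yx.
rewrite (le_lt_trans _ yx)// mulrC ler_wpM2l// lerDl//.
Qed.

Lemma closure_enormP (A : set 'rV[R]_n) x :
  closure A x <-> forall e : R, 0 < e -> exists2 y, A y & enorm (y - x) < e.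
Proof.
split=> [xA e e0|xA B /nbhs_enormP[d d0 dB]].
  have [|y [Ay ey]] := xA [set y | enorm (y - x) < e]; last by exists y.
  by apply/nbhs_enormP; exists e.
by have [y Ay yd] := xA d d0; exists y; split => //; exact: dB.
Qed.

Lemma open_enormP (A : set 'rV[R]_n) :
  open A <-> forall x, A x -> exists2 d : R, 0 < d & forall y, enorm (y - x) < d -> A y.
Proof.
rewrite openE; split=> [oA x /oA|oA x /oA Ax]; first by move/nbhs_enormP.
exact/nbhs_enormP.
Qed.

Lemma cvg_enormP (T : Type) (F : set_system T) {FF : Filter F} (f : T -> 'rV[R]_n) x :
  f @ F --> x <-> forall e : R, 0 < e -> \forall t \near F, enorm (f t - x) < e.
Proof.
split=> [fx e e0|fx A].
  by apply: (fx [set y | enorm (y - x) < e]); apply/nbhs_enormP; exists e.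
by move=> /nbhs_enormP[d d0 dA]; near=> t; apply: dA; near: t; exact: fx.
Unshelve. all: by end_near. Qed.

Lemma compact_enorm_ball (r : R) : compact [set x : 'rV[R]_n | enorm x <= r].
Proof.
apply: bounded_closed_compact.
  exists r; split; first by rewrite num_real.
  by move=> M rM x /= xr; rewrite (le_trans (norm_le_enorm _))// (le_trans xr)// ltW.
move=> x /closure_enormP xr; apply/ler_addgt0Pr => e e0 /=.
have [y yr yx] := xr e e0.
rewrite -(subrK y x) (le_trans (enormD _ _))// addrC lerD//.
by rewrite enormB ltW.
Qed.

Lemma continuous_bounded_ball (f : 'rV[R]_n -> R) (r : R) : continuous f ->
  exists2 C : R, 0 <= C & forall x, enorm x <= r -> `|f x| <= C.
Proof.
move=> cf; have := compact_bounded (continuous_compact (continuous_subspaceT cf)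
  (compact_enorm_ball r)).
move=> [M [_ MC]]; exists (`|M| + 1) => [|x xr]; first by rewrite addr_ge0.
apply: (MC (`|M| + 1)); last by exists x.
by rewrite ltr_pwDr// ler_norm.
Qed.

(** The second partial derivatives are bounded on the compact ball, and the ball is convex, so the
    mean value theorem applies to each first partial derivative. The sum of the finitely many bounds
    serves as a common one. *)
Lemma C2_grad_lipschitz (f : 'rV[R]_n -> R) (r : R) : C2 f ->
  exists2 K : R, 0 <= K & forall x y, enorm x <= r -> enorm y <= r ->
    enorm (grad f x - grad f y) <= K * enorm (x - y).
Proof.
move=> [_ [df d2f]].
have [B B0 fB] : exists2 B : R, 0 <= B & forall (i j : 'I_n) x, enorm x <= r ->
    `|derive (fun z => derive f z (delta_mx ord0 i)) x (delta_mx ord0 j)| <= B.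
  have H (ij : 'I_n * 'I_n) : exists C : R, 0 <= C /\ forall x, enorm x <= r ->
      `|derive (fun z => derive f z (delta_mx ord0 ij.1)) x (delta_mx ord0 ij.2)| <= C.
    by have [C C0 HC] := continuous_bounded_ball _ r (d2f ij.1 ij.2); exists C.
  have [C HC] := choice H.
  exists (\sum_ij C ij); first by apply: sumr_ge0 => ij _; case: (HC ij).
  move=> i j x xr; have [_ /(_ _ xr) Hij] := HC (i, j).
  rewrite (le_trans Hij)// (bigD1 (i, j))//= lerDl.
  by apply: sumr_ge0 => ij _; case: (HC ij).
have Bi (i : 'I_n) x y : enorm x <= r -> enorm y <= r ->
    `|derive f x (delta_mx ord0 i) - derive f y (delta_mx ord0 i)| <=
    n%:R * B * enorm (x - y).
  move=> xr yr.
  have [s _|c c01 ->] := @mvt_grad (fun y => derive f y (delta_mx ord0 i)) y x; first exact: df.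
  rewrite (le_trans (cauchy_schwarz_norm _ _))// ler_wpM2r ?enorm_ge0//.
  rewrite (le_trans (enorm_le_sum _))// -[X in _ <= X%:R * _]card_ord.
  rewrite mulr_natl -sumr_const; apply: ler_sum => j _; rewrite mxE; apply: fB.
  have -> : y + c *: (x - y) = c *: x + (1 - c) *: y.
    by rewrite scalerBr scalerBl scale1r addrCA addrA.
  rewrite (le_trans (enormD _ _))// !enormZ ger0_norm ?ger0_norm; try lra.
  have : c * enorm x <= c * r by rewrite ler_wpM2l; lra.
  have : (1 - c) * enorm y <= (1 - c) * r by rewrite ler_wpM2l; lra.
  lra.
exists (n%:R * (n%:R * B)); first by rewrite !mulr_ge0.
move=> x y xr yr; rewrite (le_trans (enorm_le_sum _))//.
rewrite -mulrA -[X in _ <= X%:R * _]card_ord mulr_natl -sumr_const.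
by apply: ler_sum => i _; rewrite !mxE; exact: Bi.
Qed.

Lemma C2_taylor (f : 'rV[R]_n -> R) (r : R) : C2 f ->
  exists2 K : R, 0 <= K & forall x y, enorm x <= r -> enorm y <= r ->
    `|f y - f x - dotv (grad f x) (y - x)| <= K * enorm (y - x) ^+ 2.
Proof.
move=> Cf; have [K K0 fK] := @C2_grad_lipschitz f r Cf.
exists K => // x y xr yr.
have [s _|c c01 ->] := @mvt_grad f x y; first exact: Cf.1.
rewrite -dotvBl (le_trans (cauchy_schwarz_norm _ _))// expr2 mulrA.
rewrite ler_wpM2r ?enorm_ge0//.
have xyr : enorm (x + c *: (y - x)) <= r.
  have -> : x + c *: (y - x) = c *: y + (1 - c) *: x.
    by rewrite scalerBr scalerBl scale1r addrCA addrA.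
  rewrite (le_trans (enormD _ _))// !enormZ ger0_norm ?ger0_norm; try lra.
  have : c * enorm y <= c * r by rewrite ler_wpM2l; lra.
  have : (1 - c) * enorm x <= (1 - c) * r by rewrite ler_wpM2l; lra.
  lra.
rewrite (le_trans (fK _ _ xyr xr))// ler_wpM2l// addrAC subrr add0r enormZ.
by rewrite ger0_norm ?ler_piMl ?enorm_ge0//; lra.
Qed.

End calculus.

(** * Local geometry of the domain near a point of its closure *)

Section domain.
Context {R : realType} {n : nat}.
Implicit Types (x y h v d G N : 'rV[R]_n) (Om : set 'rV[R]_n).

(* At a boundary point, [G] is the gradient of the defining function and [N]
   satisfies [dotv G N = 1]; at an interior point [G], [N] and [K] vanish, so
   that the same statements apply without any constraint. *)
Definition chart Om (rho : 'rV[R]_n -> R) x0 G N (r K : R) : Prop :=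
  [/\ 0 < r /\ 0 <= K,
      Om x0 -> [/\ G = 0, N = 0 & K = 0],
      ~ Om x0 -> G = grad rho x0 /\ dotv G N = 1,
      forall y, closure Om y -> enorm (y - x0) <= r ->
        dotv G (y - x0) <= K * enorm (y - x0) ^+ 2 &
      (forall y d, closure Om y -> enorm (y - x0) <= r -> enorm d <= r ->
        dotv G d + K * enorm d * (enorm (y - x0) + enorm d) <= 0 ->
        closure Om (y + d)) /\
      (forall y1 y2 (th : R), closure Om y1 -> closure Om y2 ->
        enorm (y1 - x0) <= r -> enorm (y2 - x0) <= r -> 0 <= th <= 1 ->
        closure Om ((1 - th) *: y1 + th *: y2
                    - (K * th * (1 - th) * enorm (y1 - y2) ^+ 2) *: N))].

Lemma continuous_enormP (f : 'rV[R]_n -> R) x : {for x, continuous f} <->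
  forall e : R, 0 < e -> exists2 d : R, 0 < d &
    forall y, enorm (y - x) < d -> `|f y - f x| < e.
Proof.
split=> [cf e e0|H].
  apply/(nbhs_enormP x [set y | `|f y - f x| < e]).
  have /(@cvgrPdist_lt _ _ _ (nbhs x) (nbhs_filter x))/(_ e e0) := cf.
  by apply: (@filterS _ (nbhs x) (nbhs_filter x)) => y /=; rewrite distrC.
apply/(@cvgrPdist_lt _ _ _ (nbhs x) (nbhs_filter x)) => e e0.
by have [d d0 fd] := H e e0; apply/nbhs_enormP; exists d => // y /fd; rewrite distrC.
Qed.

Context (Om : set 'rV[R]_n) (rho : 'rV[R]_n -> R).
Context (dom : bounded_C2_domain Om rho).

(** A zero of [rho] is approached from inside along minus the gradient, which does not vanish there:
    for short steps the first-order decrease beats the Taylor error. *)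
Lemma closure_domainP x : closure Om x <-> rho x <= 0.
Proof.
have [oOm [_ [Crho [OmE grad0]]]] := dom.
split=> [/closure_enormP xOm|].
  apply/ler_addgt0Pr => e e0.
  have /continuous_enormP/(_ e e0)[d d0 rd] : {for x, continuous rho}.
    by apply: differentiable_continuous; exact: Crho.1.
  have [y /OmE ry /rd] := xOm d d0; rewrite ltr_norml => /andP[]; lra.
rewrite le_eqVlt => /predU1P[rx0|/OmE]; last exact: subset_closure.
set g := grad rho x; have g0 : 0 < enorm g by exact/enorm_gt0/grad0.
have [K K0 rK] := @C2_taylor _ _ rho (enorm x + enorm g) Crho.
apply/closure_enormP => e e0.
(* The last bound gives [s * K <= 1 / 2], so that the quadratic error is at most half of the
   first-order decrease. *)
pose s := Num.min 1 (Num.min (e / 2 / enorm g) (2^-1 / (K + 1))).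
have s0 : 0 < s by rewrite !lt_min ltr01 !divr_gt0// ltr_wpDl.
have s1 : s <= 1 by rewrite ge_min lexx.
have se : s * enorm g <= e / 2.
  by rewrite -ler_pdivlMr// !ge_min lexx orbT.
have sK : s * (K + 1) <= 2^-1.
  by rewrite -ler_pdivlMr ?ltr_wpDl// !ge_min lexx !orbT.
exists (x - s *: g); last first.
  by rewrite addrAC subrr add0r enormN enormZ gtr0_norm//; lra.
apply/OmE.
have := rK x (x - s *: g); rewrite [x - _ - x]addrAC subrr add0r enormN enormZ (gtr0_norm s0).
rewrite lerDl enorm_ge0 (le_trans (enormBD _ _))//; last first.
  by rewrite enormZ gtr0_norm// lerD2l ler_piMl ?enorm_ge0.
move=> /(_ isT isT); rewrite rx0 subr0 -/g dotvNr dotvZr -sqr_enorm opprK.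
rewrite ler_norml => /andP[_].
have -> : K * (s * enorm g) ^+ 2 = (s * K) * (s * enorm g ^+ 2) by ring.
have sg : 0 < s * enorm g ^+ 2 by rewrite mulr_gt0// exprn_gt0.
have : (s * K) * (s * enorm g ^+ 2) <= 2^-1 * (s * enorm g ^+ 2).
  by rewrite ler_wpM2r ?(ltW sg)//; lra.
lra.
Qed.

Lemma bdry_rho x : closure Om x -> ~ Om x -> rho x = 0.
Proof.
move=> /closure_domainP rx Omx; apply/eqP; rewrite eq_le rx/= leNgt.
by apply/negP => r0; apply: Omx; have [_ [_ [_ [->]]]] := dom.
Qed.

Lemma convex_comb_dist y1 y2 x0 (r th : R) : 0 <= th <= 1 ->
  enorm (y1 - x0) <= r -> enorm (y2 - x0) <= r ->
  enorm ((1 - th) *: y1 + th *: y2 - x0) <= r.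
Proof.
move=> th01 h1 h2.
have -> : (1 - th) *: y1 + th *: y2 - x0 = (1 - th) *: (y1 - x0) + th *: (y2 - x0).
  rewrite !scalerBr addrACA; congr (_ + _).
  by rewrite -opprD -scalerDl subrK scale1r.
rewrite (le_trans (enormD _ _))// !enormZ !ger0_norm; try lra.
have : (1 - th) * enorm (y1 - x0) <= (1 - th) * r by rewrite ler_wpM2l; lra.
have : th * enorm (y2 - x0) <= th * r by rewrite ler_wpM2l; lra.
lra.
Qed.

(** At an interior point a small ball suffices. At a boundary point all clauses are Taylor
    expansions of [rho], whose sign decides membership in the closure; [N] is the multiple of the
    gradient along which [rho] grows at unit rate. *)
Lemma exists_chart x0 : closure Om x0 -> exists G N (r K : R), chart Om rho x0 G N r K.
Proof.
move=> clx0; have [oOm [_ [Crho [OmE grad0]]]] := dom.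
have [Omx0|Omx0] := pselect (Om x0).
  have [d d0 dOm] := (open_enormP _).1 oOm x0 Omx0.
  exists 0, 0, (d / 3), 0; split=> //.
  - by split => //; lra.
  - by move=> y _ _; rewrite dot0v mul0r.
  split=> [y h _ yd hd _|y1 y2 th _ _ y1d y2d th01]; apply: subset_closure; apply: dOm.
    rewrite addrAC (le_lt_trans (enormD _ _))//; lra.
  rewrite scaler0 subr0 (@le_lt_trans _ _ (d / 3))//; last lra.
  exact: convex_comb_dist.
set g := grad rho x0.
have g0 : 0 < enorm g by apply/enorm_gt0/grad0/bdry_rho.
pose N := (enorm g ^+ 2)^-1 *: g.
have gN : dotv g N = 1 by rewrite dotvZr -sqr_enorm mulVf// expf_neq0// gt_eqF.
have [K1 K10 rT] := @C2_taylor _ _ rho (enorm x0 + 3) Crho.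
have [K2 K20 rG] := @C2_grad_lipschitz _ _ rho (enorm x0 + 3) Crho.
pose K := K1 + K2; have K0 : 0 <= K by rewrite addr_ge0.
(* Makes [r * (K * enorm N)] at most 1/4, so that within distance [r] of [x0] the derivative of
   [rho] along [N] stays above 3/4. *)
pose r := (4 * (K * enorm N + 1))^-1.
have KN0 : 0 <= K * enorm N by rewrite mulr_ge0 ?enorm_ge0.
have r0 : 0 < r by rewrite invr_gt0; lra.
have rE : r * (4 * (K * enorm N + 1)) = 1 by rewrite mulVf// gt_eqF//; lra.
have rKN0 : 0 <= r * (K * enorm N) by rewrite mulr_ge0// ltW.
have r1 : r <= 1 by lra.
have rKN : r * (K * enorm N) <= 4^-1 by lra.
have near y : enorm (y - x0) <= 3 -> enorm y <= enorm x0 + 3.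
  by move=> h; rewrite -(subrK x0 y) (le_trans (enormD _ _))//; lra.
have x0near : enorm x0 <= enorm x0 + 3 by lra.
exists g, N, r, (2 * K); split => //.
- by split => //; lra.
- move=> y /closure_domainP ry yr.
  have := rT x0 y x0near (near _ _); rewrite (bdry_rho _ clx0 Omx0) subr0.
  move=> /(_ ltac:(lra)); rewrite ler_norml => /andP[+ _]; rewrite -/g.
  have : K1 * enorm (y - x0) ^+ 2 <= 2 * K * enorm (y - x0) ^+ 2.
    by rewrite ler_wpM2r ?sqr_ge0// /K; lra.
  lra.
split=> [y d /closure_domainP ry yr dr H|y1 y2 th].
  apply/closure_domainP.
  have ny : enorm y <= enorm x0 + 3 by apply: near; lra.
  have nyd : enorm (y + d) <= enorm x0 + 3.
    by apply: near; rewrite addrAC (le_trans (enormD _ _))//; lra.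
  have := rT y (y + d) ny nyd; rewrite [y + d - y]addrAC subrr add0r ler_norml => /andP[_].
  have : dotv (grad rho y - g) d <= K2 * enorm (y - x0) * enorm d.
    rewrite (le_trans (cauchy_schwarz _ _))// ler_wpM2r ?enorm_ge0//.
    exact: rG.
  rewrite dotvBl.
  have : K2 * enorm (y - x0) * enorm d <= 2 * K * enorm d * enorm (y - x0).
    have ab := mulr_ge0 (enorm_ge0 (y - x0)) (enorm_ge0 d).
    have := mulr_ge0 K10 ab; have := mulr_ge0 K20 ab; rewrite /K; lra.
  have : K1 * enorm d ^+ 2 <= 2 * K * enorm d * enorm d.
    have ab := mulr_ge0 (enorm_ge0 d) (enorm_ge0 d).
    have := mulr_ge0 K10 ab; have := mulr_ge0 K20 ab; rewrite /K; lra.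
  lra.
move=> /closure_domainP ry1 /closure_domainP ry2 y1r y2r th01.
set z := (1 - th) *: y1 + th *: y2; set D := enorm (y1 - y2) ^+ 2.
set c := 2 * K * th * (1 - th) * D.
have zr : enorm (z - x0) <= r by exact: convex_comb_dist.
have D0 : 0 <= D by exact: sqr_ge0.
have D4 : D <= 4 * r ^+ 2.
  have h : enorm (y1 - y2) <= 2 * r.
    rewrite (le_trans (enorm_triangle _ x0 _))// (enormB x0); lra.
  have -> : 4 * r ^+ 2 = (2 * r) ^+ 2 by ring.
  by rewrite lerXn2r ?nnegrE ?enorm_ge0//; lra.
have tt0 : 0 <= th * (1 - th) by rewrite mulr_ge0; lra.
have tt4 : th * (1 - th) <= 4^-1.
  have := sqr_ge0 (th - 2^-1); rewrite sqrrB; lra.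
have ttD : 0 <= th * (1 - th) * D by rewrite mulr_ge0.
have cE : c = 2 * K * (th * (1 - th) * D) by rewrite /c; ring.
have K20' : 0 <= 2 * K by lra.
have c0 : 0 <= c by rewrite cE mulr_ge0.
have cr : c <= 2 * K * r ^+ 2.
  rewrite cE ler_wpM2l// (@le_trans _ _ (4^-1 * (4 * r ^+ 2)))//; last by rewrite mulrA mulVf ?mul1r.
  by rewrite ler_pM.
have cN : c * enorm N <= r / 2.
  apply: (@le_trans _ _ (2 * K * r ^+ 2 * enorm N)).
    by rewrite ler_wpM2r ?enorm_ge0.
  have -> : 2 * K * r ^+ 2 * enorm N = 2 * r * (r * (K * enorm N)) by ring.
  apply: (@le_trans _ _ (2 * r * 4^-1)); last by lra.
  by rewrite ler_wpM2l//; lra.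
apply/closure_domainP.
have nz : enorm z <= enorm x0 + 3 by apply: near; lra.
have nzc : enorm (z - c *: N) <= enorm x0 + 3.
  apply: near; rewrite addrAC (le_trans (enormBD _ _))// enormZ ger0_norm//; lra.
have near_r y : enorm (y - x0) <= r -> enorm y <= enorm x0 + 3 by move=> h; apply: near; lra.
(* Expanding [rho] around [z] at both ends of the chord, the first-order terms cancel in the convex
   combination and only the quadratic defect remains. *)
have rz : rho z <= K1 * (th * (1 - th) * D).
  have := rT z y1 nz (near_r _ y1r); have := rT z y2 nz (near_r _ y2r).
  have -> : y2 - z = (- (1 - th)) *: (y1 - y2).
    apply/rowP => i; rewrite !mxE; ring.
  have -> : y1 - z = th *: (y1 - y2).
    apply/rowP => i; rewrite !mxE; ring.
  rewrite !enormZ !exprMn !real_normK ?num_real// sqrrN !dotvZr -/D !ler_norml.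
  set q := dotv _ _ => /andP[h2 _] /andP[h1 _].
  have : (1 - th) * (rho y1 - rho z - th * q) >= (1 - th) * (- (K1 * (th ^+ 2 * D))).
    by rewrite ler_wpM2l//; lra.
  have : th * (rho y2 - rho z - (- (1 - th)) * q) >= th * (- (K1 * ((1 - th) ^+ 2 * D))).
    by rewrite ler_wpM2l//; lra.
  have : (1 - th) * rho y1 <= 0 by rewrite mulr_ge0_le0//; lra.
  have : th * rho y2 <= 0 by rewrite mulr_ge0_le0//; lra.
  have -> : K1 * (th * (1 - th) * D) =
    (1 - th) * (K1 * (th ^+ 2 * D)) + th * (K1 * ((1 - th) ^+ 2 * D)) by ring.
  lra.
(* The displacement by [c *: N] lowers [rho] by at least [3 * c / 4] up to a second-order error
   [c / 4], which compensates the defect of at most [c / 2]. *)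
have := rT z (z - c *: N) nz nzc.
rewrite [z - _ - z]addrAC subrr add0r enormN enormZ (ger0_norm c0) dotvNr dotvZr ler_norml => /andP[_].
have : `|dotv (grad rho z - g) N| <= K2 * r * enorm N.
  rewrite (le_trans (cauchy_schwarz_norm _ _))// ler_wpM2r ?enorm_ge0//.
  by rewrite (le_trans (rG _ _ nz x0near))// ler_wpM2l.
rewrite dotvBl gN ler_norml => /andP[h _].
have K2r : K2 * r * enorm N <= r * (K * enorm N).
  rewrite [K2 * r]mulrC -mulrA ler_wpM2l ?(ltW r0)// ler_wpM2r ?enorm_ge0// /K; lra.
have cg : c * (3 / 4) <= c * dotv (grad rho z) N by rewrite ler_wpM2l//; lra.
have : K1 * (c * enorm N) ^+ 2 <= c / 4.
  have -> : K1 * (c * enorm N) ^+ 2 = c * (K1 * enorm N * (c * enorm N)) by ring.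
  rewrite ler_wpM2l// (@le_trans _ _ (K1 * enorm N * (r / 2)))//.
    by rewrite ler_wpM2l ?mulr_ge0 ?enorm_ge0.
  have : K1 * enorm N * r <= r * (K * enorm N).
    by rewrite mulrC ler_wpM2l ?(ltW r0)// ler_wpM2r ?enorm_ge0// /K; lra.
  lra.
have : K1 * (th * (1 - th) * D) <= c / 2.
  have -> : c / 2 = K * (th * (1 - th) * D) by rewrite /c; field.
  by rewrite ler_wpM2r// /K; lra.
lra.
Qed.

End domain.

(** * Quantitative bounds on the Lagrangian *)

Lemma is_derive_quadratic (R : realType) (a b s : R) :
  is_derive s (1 : R) (fun r : R => r * a + b * (r * r)) (a + b * (2 * s)).
Proof.
have -> : (fun r : R => r * a + b * (r * r)) =
    a *: (id : R -> R) + b *: ((id : R -> R) * (id : R -> R)).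
  by apply/funext => r; rewrite /= mulrC.
have I := @is_derive_id R R s 1.
have H := is_deriveD (is_deriveZ a I) (is_deriveZ b (is_deriveM I I)).
by apply: (is_derive_eq H); rewrite -?[_ *: _]/(_ * _) /=; ring.
Qed.

Section lagrangian.
Context {R : realType} {n : nat}.
Implicit Types (x y h v w z : 'rV[R]_n).

Lemma derivable_dotvl (V : normedModType R) (f : V -> 'rV[R]_n) (a b : V) z :
  derivable f a b -> derivable (fun t => dotv (f t) z) a b.
Proof.
move=> /derivable_mxP df.
have -> : (fun t => dotv (f t) z) =
    \sum_(i < n) ((fun t => z ord0 i *: f t ord0 i) : V -> R).
  by apply/funext => t; rewrite fct_sumE; apply: eq_bigr => i _; rewrite mulrC.
by apply: derivable_sum => i; exact/derivableZ/df.
Qed.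

Context (U : set 'rV[R]_n) (M mu : R) (L : 'rV[R]_n -> 'rV[R]_n -> R).
Context (mu0 : 0 < mu) (hL : hyp_L U M mu L).

Lemma lagrangian_differentiable_l x v : U x -> differentiable (fun y => L y v) x.
Proof.
move=> Ux; have [dL _] := hL.1 x v Ux.
have -> : (fun y => L y v) = (fun p => L p.1 p.2) \o (fun y : 'rV[R]_n => (y, v)) by [].
by apply: differentiable_comp => //; exact: differentiable_pair.
Qed.

Lemma lagrangian_differentiable_r x v : U x -> differentiable (L x) v.
Proof.
move=> Ux; have [dL _] := hL.1 x v Ux.
have -> : L x = (fun p => L p.1 p.2) \o (fun w : 'rV[R]_n => (x, w)) by [].
by apply: differentiable_comp => //; exact: differentiable_pair.
Qed.

Lemma DvL_differentiable_l x v : U x -> differentiable (fun y => DvL L y v) x.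
Proof.
move=> Ux; have [dL _] := hL.2.2.1 x v Ux.
have -> : (fun y => DvL L y v) =
  (fun p => DvL L p.1 p.2) \o (fun y : 'rV[R]_n => (y, v)) by [].
by apply: differentiable_comp => //; exact: differentiable_pair.
Qed.

Lemma DvL_differentiable_r x v : U x -> differentiable (DvL L x) v.
Proof.
move=> Ux; have [dL _] := hL.2.2.1 x v Ux.
have -> : DvL L x = (fun p => DvL L p.1 p.2) \o (fun w : 'rV[R]_n => (x, w)) by [].
by apply: differentiable_comp => //; exact: differentiable_pair.
Qed.

Lemma is_derive_lagrangian x v h (s : R) : U x ->
  is_derive s (1 : R) (fun r : R => L x (v + r *: h)) (dotv (DvL L x (v + s *: h)) h).
Proof.
move=> Ux; have dL := lagrangian_differentiable_r x (v + s *: h) Ux.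
by rewrite -derive_grad//; apply: is_derive_segment; exact: diff_derivable.
Qed.

(** Mean value theorem for the scalar function [dotv (DvL L x w) h] along the direction [s *: h];
    the Hessian bounds are stated for the direction [h], and linearity of the differential extracts
    the factor [s]. *)
Lemma DvL_monotone x v h (s : R) : U x -> 0 <= s ->
  s * (enorm h ^+ 2 / mu) <= dotv (DvL L x (v + s *: h)) h - dotv (DvL L x v) h
    <= s * (mu * enorm h ^+ 2).
Proof.
move=> Ux s0.
have [r _|c c01] := @mvt01 R (fun r => dotv (DvL L x (v + r *: (s *: h))) h)
   (fun r => 'D_(s *: h) (fun w => dotv (DvL L x w) h) (v + r *: (s *: h))).
  apply: (@is_derive_segment R _ (fun w => dotv (DvL L x w) h)).
  apply/derivable_dotvl/diff_derivable; exact: DvL_differentiable_r.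
rewrite scale1r scale0r addr0 => ->.
set w := v + _.
have -> : 'D_(s *: h) (fun w => dotv (DvL L x w) h) w =
    s * 'D_h (fun w => dotv (DvL L x w) h) w.
  have df : derivable (DvL L x) w h by apply: diff_derivable; exact: DvL_differentiable_r.
  have E k : derivable (DvL L x) w k ->
      'D_k (fun w => dotv (DvL L x w) h) w = dotv ('D_k (DvL L x) w) h.
    move=> dk; rewrite derive_mx//.
    have -> : (fun y => dotv (DvL L x y) h) =
        \sum_(i < n) ((fun y => h ord0 i *: DvL L x y ord0 i) : 'rV[R]_n -> R).
      by apply/funext => y; rewrite fct_sumE; apply: eq_bigr => i _; rewrite mulrC.
    have dki := (derivable_mxP _ _ _).1 dk.
    rewrite derive_sum; last by move=> i; exact/derivableZ/dki.
    apply: eq_bigr => i _; rewrite deriveZ; last exact: dki.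
    by rewrite !mxE -[_ *: _]/(_ * _) mulrC.
  have dD := DvL_differentiable_r x w Ux.
  rewrite (E _ df) (E (s *: h) (diff_derivable dD)) !(deriveE _ dD).
  by rewrite linearZ dotvZl.
have [_ [H _]] := hL.2.2.1 x w Ux.
by have /andP[H1 H2] := H h; rewrite !ler_wpM2l.
Qed.

(** Subtracting [(k / 2) * r ^ 2] before applying the mean value theorem turns the bounds on
    increments of the gradient into quadratic bounds with the sharp factor 1/2, without an
    integration. *)
Lemma lagrangian_quadratic x v h : U x ->
  enorm h ^+ 2 / (2 * mu) <= L x (v + h) - L x v - dotv (DvL L x v) h <= mu / 2 * enorm h ^+ 2.
Proof.
move=> Ux.
have H (k : R) : exists2 c : R, 0 < c < 1 &
    L x (v + h) - L x v - dotv (DvL L x v) h - k / 2 =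
    dotv (DvL L x (v + c *: h)) h - dotv (DvL L x v) h - c * k.
  have [s _|c c01 E] := @mvt01 R
     (fun r => L x (v + r *: h) - (r * dotv (DvL L x v) h + (k / 2) * (r * r)))
     (fun r => dotv (DvL L x (v + r *: h)) h - (dotv (DvL L x v) h + (k / 2) * (2 * r))).
    apply: is_deriveB; first exact: is_derive_lagrangian.
    exact: is_derive_quadratic.
  exists c => //; rewrite scale1r scale0r addr0 in E.
  have -> : c * k = (k / 2) * (2 * c) by field.
  lra.
apply/andP; split.
- have [c c01 E] := H (enorm h ^+ 2 / mu).
  have /andP[+ _] := @DvL_monotone x v h c Ux ltac:(lra).
  rewrite invfM; lra.
- have [c c01 E] := H (mu * enorm h ^+ 2).
  have /andP[_ +] := @DvL_monotone x v h c Ux ltac:(lra).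
  lra.
Qed.

(* Cocoercivity argument: evaluate the quadratic bounds at [w - g / mu]. *)
Lemma DvL_lipschitz x v w : U x -> enorm (DvL L x w - DvL L x v) <= mu * enorm (w - v).
Proof.
move=> Ux; have [g gE] : exists g, g = DvL L x w - DvL L x v by eexists.
rewrite -gE; have /andP[_ h1] := @lagrangian_quadratic x w (- (mu^-1 *: g)) Ux.
have /andP[_ h2] := @lagrangian_quadratic x v (w - v) Ux.
have /andP[h3 _] := @lagrangian_quadratic x v (w - mu^-1 *: g - v) Ux.
have {}h3 : 0 <= L x (w - mu^-1 *: g) - L x v - dotv (DvL L x v) (w - mu^-1 *: g - v).
  rewrite [v + _]addrC subrK in h3; apply: le_trans h3.
  by rewrite divr_ge0 ?sqr_ge0 ?mulr_ge0 ?(ltW mu0).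
rewrite [v + _]addrC subrK in h2.
have gg : dotv (DvL L x w) g = dotv (DvL L x v) g + enorm g ^+ 2.
  by rewrite sqr_enorm {3}gE dotvBl; lra.
rewrite enormN enormZ gtr0_norm ?invr_gt0// exprMn in h1.
rewrite !dotvE in h1 h2 h3; rewrite gg in h1.
have E : mu / 2 * (mu^-1 ^+ 2 * enorm g ^+ 2) = mu^-1 * enorm g ^+ 2 / 2.
  by field; rewrite gt_eqF.
rewrite E in h1.
have : mu^-1 * enorm g ^+ 2 <= mu * enorm (w - v) ^+ 2 by lra.
rewrite ler_pdivrMl// mulrA -expr2 -exprMn ler_pXn2r// nnegrE ?enorm_ge0//.
by rewrite mulr_ge0 ?enorm_ge0// ltW.
Qed.

Definition segment_in x y := forall s : R, 0 <= s <= 1 -> U (x + s *: (y - x)).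

(** The mean value theorem is applied to the scalar product with the increment [g] itself; dividing
    by [enorm g] then leaves the norm of the increment. *)
Lemma DvL_lipschitz_l x y v : segment_in x y ->
  enorm (DvL L x v - DvL L y v) <= mu * (1 + enorm v) * enorm (x - y).
Proof.
move=> xyU; set g := DvL L x v - DvL L y v.
have [s s01|c c01] := @mvt01 R (fun r => dotv (DvL L (x + r *: (y - x)) v) g)
   (fun r => 'D_(y - x) (fun z => dotv (DvL L z v) g) (x + r *: (y - x))).
  apply: (@is_derive_segment R _ (fun z => dotv (DvL L z v) g)).
  by apply/derivable_dotvl/diff_derivable/DvL_differentiable_l/xyU.
rewrite scale1r scale0r addr0 [x + _]addrC subrK => E.
have Uc : U (x + c *: (y - x)) by apply: xyU; lra.
have [_ [_ /(_ (y - x) g)]] := hL.2.2.1 _ v Uc.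
rewrite -E -dotvBl -opprB -/g dotvNl normrN -sqr_enorm ger0_norm ?sqr_ge0//.
rewrite (enormB y x) expr2.
have [->|g0] := eqVneq (enorm g) 0; last by rewrite ler_pM2r// lt_neqAle eq_sym g0 enorm_ge0.
by move=> _; rewrite !mulr_ge0 ?enorm_ge0 ?addr_ge0 ?enorm_ge0// ltW.
Qed.

Lemma lagrangian_hyp0 x : U x ->
  [/\ `|L x 0| <= M, enorm (DxL L x 0) <= M & enorm (DvL L x 0) <= M].
Proof.
move=> Ux; have := hL.2.1 x Ux.
have := enorm_ge0 (DxL L x 0); have := enorm_ge0 (DvL L x 0); have := normr_ge0 (L x 0).
move: (enorm (DxL L x 0)) (enorm (DvL L x 0)) `|L x 0| => a b c.
by split; lra.
Qed.

(** The difference of the two Lagrangians is controlled at velocity 0 by the bound on [DxL L x 0],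
    and its derivative in the velocity by the mixed second derivatives; hence the quadratic growth
    of the Lipschitz constant in [v]. *)
Lemma lagrangian_lipschitz_l x y v : segment_in x y ->
  `|L x v - L y v| <= (M + mu * (1 + enorm v) * enorm v) * enorm (x - y).
Proof.
move=> xyU.
have Ux : U x by have := xyU 0; rewrite scale0r addr0; apply; rewrite lexx ler01.
have Uy : U y.
  by have := xyU 1; rewrite scale1r [x + _]addrC subrK; apply; rewrite lexx ler01.
have [s s01|c c01 E] := @mvt01 R (fun r => L x (0 + r *: v) - L y (0 + r *: v))
  (fun r => dotv (DvL L x (0 + r *: v)) v - dotv (DvL L y (0 + r *: v)) v).
  by apply: is_deriveB; exact: is_derive_lagrangian.
rewrite !add0r scale1r scale0r -dotvBl in E.
have h1 : `|L x 0 - L y 0| <= M * enorm (x - y).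
  have [s s01|d d01 ->] := @mvt_grad R n (fun z => L z 0) y x.
    rewrite (_ : _ + _ = x + (1 - s) *: (y - x)); last first.
      by apply/rowP => i; rewrite !mxE; ring.
    by apply/lagrangian_differentiable_l/xyU; lra.
  rewrite (le_trans (cauchy_schwarz_norm _ _))// ler_wpM2r ?enorm_ge0//.
  rewrite (_ : _ + _ = x + (1 - d) *: (y - x)); last first.
    by apply/rowP => i; rewrite !mxE; ring.
  have Uz : U (x + (1 - d) *: (y - x)) by apply: xyU; lra.
  by have [_ h _] := lagrangian_hyp0 _ Uz; exact: h.
have h2 : `|dotv (DvL L x (c *: v) - DvL L y (c *: v)) v| <=
    mu * (1 + enorm v) * enorm v * enorm (x - y).
  rewrite (le_trans (cauchy_schwarz_norm _ _))// [leRHS]mulrAC ler_wpM2r ?enorm_ge0//.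
  rewrite (le_trans (DvL_lipschitz_l _ _ _ xyU))// ler_wpM2r ?enorm_ge0//.
  rewrite ler_wpM2l ?(ltW mu0)// lerD2l enormZ gtr0_norm; last lra.
  by rewrite ler_piMl ?enorm_ge0//; lra.
have -> : L x v - L y v = (L x 0 - L y 0) + (dotv (DvL L x (c *: v) - DvL L y (c *: v)) v) by lra.
by rewrite (le_trans (ler_normD _ _))// mulrDl lerD.
Qed.

(* All that is used of the Lagrangian, with a single constant. *)
Definition lagrangian_bounds (C : R) : Prop :=
  [/\ 0 < C,
      forall x v, U x -> enorm v ^+ 2 <= C * (C + L x v) /\ `|L x v| <= C * (1 + enorm v ^+ 2),
      forall x v, U x -> enorm (DvL L x v) <= C * (1 + enorm v),
      (forall x v h, U x ->
        enorm h ^+ 2 <= C * (L x (v + h) - L x v - dotv (DvL L x v) h) /\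
        L x (v + h) - L x v - dotv (DvL L x v) h <= C * enorm h ^+ 2) /\
      (forall x v w, U x -> enorm (DvL L x w - DvL L x v) <= C * enorm (w - v)) &
      (forall x y v, segment_in x y -> `|L x v - L y v| <= C * (1 + enorm v ^+ 2) * enorm (x - y)) /\
      (forall x y v, segment_in x y ->
         enorm (DvL L x v - DvL L y v) <= C * (1 + enorm v) * enorm (x - y))].

(** Coercivity: the quadratic lower bound at velocity 0 absorbs the affine part
    [L x 0 + dotv (DvL L x 0) v]. *)
Lemma exists_lagrangian_bounds : exists C : R, lagrangian_bounds C.
Proof.
have mu0' := mu0.
have [A A0 MA] : exists2 A : R, 0 <= A & M <= A by exists `|M|; rewrite ?ler_norm.
have [B BE] : exists B : R, B = mu * A ^+ 2 by eexists.
have mA : 0 <= B by rewrite BE mulr_ge0 ?sqr_ge0// ltW.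
have LA x v : U x -> - (A + A * enorm v) <= L x 0 + dotv (DvL L x 0) v <= A + A * enorm v.
  move=> Ux; have [h1 _ h3] := lagrangian_hyp0 _ Ux.
  have : `|dotv (DvL L x 0) v| <= A * enorm v.
    rewrite (le_trans (cauchy_schwarz_norm _ _))// ler_wpM2r ?enorm_ge0//; lra.
  move: h1; rewrite !ler_norml => /andP[? ?] /andP[? ?]; lra.
(* A completed square that spends one half of the available [enorm v ^+ 2 / (2 * mu)]. *)
have AGM x v : A * enorm v <= enorm v ^+ 2 / (4 * mu) + B.
  have -> : enorm v ^+ 2 / (4 * mu) + B =
     A * enorm v + mu * (enorm v / (2 * mu) - A) ^+ 2 by rewrite BE; field; rewrite gt_eqF.
  by rewrite lerDl mulr_ge0 ?sqr_ge0// ltW.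
have lin v : enorm v <= (1 + enorm v ^+ 2) / 2.
  have := sqr_ge0 (enorm v - 1); rewrite sqrrB; lra.
have Alin v : A * enorm v <= A * ((1 + enorm v ^+ 2) / 2) by rewrite ler_wpM2l.
have mlin v : mu * enorm v <= mu * ((1 + enorm v ^+ 2) / 2) by rewrite ler_wpM2l// ltW.
have Av v := mulr_ge0 A0 (sqr_ge0 (enorm v)).
have muv v := mulr_ge0 (ltW mu0) (sqr_ge0 (enorm v)).
have mAv v := mulr_ge0 mA (sqr_ge0 (enorm v)).
have mv v := mulr_ge0 (ltW mu0) (enorm_ge0 v).
have Aev v := mulr_ge0 A0 (enorm_ge0 v).
have mAev v := mulr_ge0 mA (enorm_ge0 v).
have quad x v : U x -> enorm v ^+ 2 <= 4 * mu * (L x v + (A + B)).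
  move=> Ux; have /andP[h1 _] := lagrangian_quadratic x 0 v Ux.
  rewrite add0r in h1; have := LA x v Ux; have := AGM x v => h2 /andP[h3 h4].
  have h5 : enorm v ^+ 2 / (4 * mu) <= L x v + (A + B).
    have E : enorm v ^+ 2 / (2 * mu) = 2 * (enorm v ^+ 2 / (4 * mu)).
      by field; rewrite gt_eqF.
    rewrite E in h1; lra.
  by rewrite mulrC -ler_pdivrMr// mulr_gt0.
have low x v : U x -> 0 <= L x v + (A + B).
  move=> Ux; have := le_trans (sqr_ge0 _) (quad x v Ux).
  by rewrite pmulr_rge0// mulr_gt0.
have [C CE] : exists C : R, C = A *+ 4 + mu *+ 8 + B *+ 2 + 2 by eexists.
have C0 : 0 < C by rewrite CE; lra.
exists C; split => //.
- move=> x v Ux; split.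
    rewrite (le_trans (quad x v Ux))// (@le_trans _ _ (C * (L x v + (A + B))))//.
      by rewrite ler_wpM2r ?low// CE; lra.
    by rewrite ler_wpM2l ?(ltW C0)// addrC lerD2r CE; lra.
  have /andP[_ h1] := lagrangian_quadratic x 0 v Ux; rewrite add0r in h1.
  have /andP[_ h2] := LA x v Ux; have h3 := low x v Ux.
  have := Alin v; have := Av v; have := muv v; have := mAv v; have := sqr_ge0 (enorm v).
  rewrite ler_norml; move: h1 h2 h3; rewrite CE => *; apply/andP; split; lra.
- move=> x v Ux; have [_ _ h] := lagrangian_hyp0 _ Ux.
  have := DvL_lipschitz x 0 v Ux; rewrite subr0 => h2.
  have h3 : enorm (DvL L x v) <= enorm (DvL L x v - DvL L x 0) + enorm (DvL L x 0).
    by rewrite (le_trans _ (enormD _ _))// subrK.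
  have := mv v; have := Aev v; have := mAev v; have := enorm_ge0 v; rewrite CE; lra.
- split=> [x v h Ux|x v w Ux].
    have /andP[h1 h2] := lagrangian_quadratic x v h Ux; split.
      rewrite ler_pdivrMr in h1; last lra.
      rewrite (le_trans h1)// mulrC ler_wpM2r//; last by rewrite CE; lra.
      have h3 : 0 <= enorm h ^+ 2 by exact: sqr_ge0.
      by rewrite -(pmulr_lge0 _ (_ : 0 < 2 * mu)) ?(le_trans h3)//; lra.
    by rewrite (le_trans h2)// ler_wpM2r ?sqr_ge0// CE; lra.
  by rewrite (le_trans (DvL_lipschitz _ _ _ Ux))// ler_wpM2r ?enorm_ge0// CE; lra.
split=> x y v xyU.
  rewrite (le_trans (lagrangian_lipschitz_l _ _ _ xyU))// ler_wpM2r ?enorm_ge0//.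
  have := mlin v; have := Av v; have := muv v; have := mAv v; have := sqr_ge0 (enorm v); rewrite CE; lra.
rewrite (le_trans (DvL_lipschitz_l _ _ _ xyU))// ler_wpM2r ?enorm_ge0//.
by rewrite ler_wpM2r ?addr_ge0 ?enorm_ge0// CE; lra.
Qed.

End lagrangian.

(** * Absolutely continuous functions: families of intervals and total variation *)

Section interval_families.
Context {R : realType}.
Implicit Types (s J : seq (R * R)) (p q : R * R) (a b c d e x : R) (g F : R -> R).

Definition apart p q := (p.2 <= q.1) || (q.2 <= p.1).
Definition family_in a b s :=
  all (fun p => [&& a <= p.1, p.1 <= p.2 & p.2 <= b]) s && pairwise apart s.
Definition fvar g s := \sum_(p <- s) `|g p.2 - g p.1|.
(** For [g = id] this is the total length of the family. *)
Definition finc g s := \sum_(p <- s) (g p.2 - g p.1).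

Lemma family_cons a b p s : family_in a b (p :: s) =
  [&& a <= p.1, p.1 <= p.2, p.2 <= b, all (apart p) s & family_in a b s].
Proof. by rewrite /family_in /= -!andbA; do !bool_congr; rewrite andbCA. Qed.

Lemma familyW a b a' b' s : a' <= a -> b <= b' -> family_in a b s -> family_in a' b' s.
Proof.
move=> aa bb /andP[h pw]; apply/andP; split=> //.
apply: sub_all h => p /and3P[h1 -> h3].
by rewrite (le_trans aa h1) (le_trans h3 bb).
Qed.

(** The intervals after the first one lie on its left or on its right; the induction, on the size,
    applies to each of the two groups. *)
Lemma finc_id_le a b s : a <= b -> family_in a b s -> finc id s <= b - a.
Proof.
have [m] := ubnP (size s); elim: m s a b => // m IH [|p s] a b; rewrite ltnS => sm ab.
  by rewrite /finc big_nil; lra.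
rewrite family_cons => /and5P[h1 h2 h3 ps /andP[/allP al pw]].
rewrite /finc big_cons (bigID (fun q => q.2 <= p.1))/=.
rewrite -big_filter -[X in _ + (_ + X)]big_filter.
have IHf (P : pred (R * R)) a' b' : a' <= b' ->
    (forall q, q \in s -> P q -> a' <= q.1 /\ q.2 <= b') ->
    \sum_(q <- [seq q <- s | P q]) (q.2 - q.1) <= b' - a'.
  move=> ab' H; apply: IH => //.
    by rewrite size_filter (leq_ltn_trans (count_size _ _)).
  apply/andP; split; last exact: pairwise_filter.
  apply/allP => q; rewrite mem_filter => /andP[Pq qs].
  by have [-> ->] := H q qs Pq; have /and3P[_ ->] := al _ qs.
have := IHf (fun q => q.2 <= p.1) a p.1 h1 _.
have := IHf (fun q => ~~ (q.2 <= p.1)) p.2 b h3 _.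
move=> H1 H2; have {}H1 : \sum_(q <- [seq q <- s | ~~ (q.2 <= p.1)]) (q.2 - q.1) <= b - p.2.
  apply: H1 => q qs qp; have := allP ps _ qs; rewrite /apart (negbTE qp) orbF => ->.
  by have /and3P[_ _ ->] := al _ qs.
have {}H2 : \sum_(q <- [seq q <- s | q.2 <= p.1]) (q.2 - q.1) <= p.1 - a.
  by apply: H2 => q qs qp; split => //; have /and3P[->] := al _ qs.
lra.
Qed.

(** Intervals on the wrong side of [c] are kept as degenerate intervals at [c], which contribute
    nothing to any sum. *)
Definition cutl c s := [seq (Num.min p.1 c, Num.min p.2 c) | p <- s].
Definition cutr c s := [seq (Num.max p.1 c, Num.max p.2 c) | p <- s].

Lemma family_cutl a b c s : a <= c -> family_in a b s -> family_in a c (cutl c s).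
Proof.
move=> ac /andP[al pw]; apply/andP; split.
  rewrite all_map; apply: sub_all al => p /and3P[h1 h2 h3] /=.
  by rewrite le_min h1 ac/= le_min2//= ge_min lexx orbT.
rewrite pairwise_map; apply: sub_pairwise pw => p q /= /orP[] h; apply/orP; [left|right] => /=;
  by rewrite le_min2.
Qed.

Lemma family_cutr a b c s : c <= b -> family_in a b s -> family_in c b (cutr c s).
Proof.
move=> cb /andP[al pw]; apply/andP; split.
  rewrite all_map; apply: sub_all al => p /and3P[h1 h2 h3] /=.
  by rewrite le_max lexx orbT/= le_max2//= ge_max h3.
rewrite pairwise_map; apply: sub_pairwise pw => p q /= /orP[] h; apply/orP; [left|right] => /=;
  by rewrite le_max2.
Qed.

Lemma fvar_cut g a b c s : family_in a b s -> fvar g s <= fvar g (cutl c s) + fvar g (cutr c s).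
Proof.
move=> /andP[al _]; rewrite /fvar !big_map -big_split/= !big_seq; apply: ler_sum => p ps.
have /and3P[_ pp _] := allP al _ ps.
case: (leP p.2 c) => h2; case: (leP p.1 c) => h1 //=.
- by rewrite lerDl.
- by have := lt_le_trans h1 (le_trans pp h2); rewrite ltxx.
- by rewrite addrC -(subrKA (g c)) ler_normD.
- by rewrite lerDr.
Qed.

(* Absolute continuity on [0, T], with lists of intervals instead of sequences. *)
Definition abs_cont_seq (T : R) g := forall e, 0 < e -> exists2 d, 0 < d &
  forall s, family_in 0 T s -> finc id s < d -> fvar g s < e.

(** The variation over an interval shorter than [d] is less than 1, so the induction peels off
    pieces of length [d / 2] from the right. *)
Lemma abs_cont_seq_bounded T g : 0 <= T -> abs_cont_seq T g ->
  exists B, forall s, family_in 0 T s -> fvar g s <= B.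
Proof.
move=> T0 /(_ 1 ltr01)[d d0 gd].
have H : forall (k : nat) x s, 0 <= x <= T -> x <= k%:R * (d / 2) -> family_in 0 x s ->
    fvar g s <= k%:R.
  elim=> [|k IH] x s /andP[x0 xT] xk sx.
    rewrite mul0r in xk; rewrite /fvar big_seq big1// => p ps.
    move: sx => /andP[/allP/(_ _ ps)/and3P[h1 h2 h3] _].
    have -> : p.1 = p.2 by lra.
    by rewrite subrr normr0.
  pose c := Num.max 0 (x - d / 2).
  have c0 : 0 <= c by rewrite le_max lexx.
  have cx : c <= x by rewrite ge_max x0/=; lra.
  have xc : x - c < d.
    have : x - d / 2 <= c by rewrite le_max lexx orbT.
    lra.
  have ck : c <= k%:R * (d / 2).
    rewrite ge_max mulr_ge0//=; last by lra.
    by rewrite -natr1 mulrDl mul1r in xk; lra.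
  have h1 : fvar g (cutl c s) <= k%:R.
    by apply: (IH c) => //; [rewrite c0 (le_trans cx)|exact: family_cutl sx].
  have fr := family_cutr _ _ _ _ cx sx.
  have h2 : fvar g (cutr c s) < 1.
    apply: gd; first exact: familyW fr.
    exact: le_lt_trans (finc_id_le _ _ _ cx fr) xc.
  have := fvar_cut g _ _ c _ sx; rewrite -natr1; lra.
have Td : 0 <= T / (d / 2) by rewrite divr_ge0//; lra.
exists (Num.bound (T / (d / 2)))%:R => s sT; apply: (H _ T) => //; first by rewrite T0 lexx.
by rewrite -ler_pdivrMr ?divr_gt0// ltW// archi_boundP.
Qed.

Definition variation_upto g x := sup [set fvar g s | s in [set s | family_in 0 x s]].

Section variation.
Context (T : R) (T0 : 0 <= T) g (acg : abs_cont_seq T g).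
Local Notation V := (variation_upto g).

Lemma has_sup_variation x : 0 <= x <= T ->
  has_sup [set fvar g s | s in [set s | family_in 0 x s]].
Proof.
move=> /andP[x0 xT]; split; first by exists (fvar g [::]), [::].
have [B HB] := abs_cont_seq_bounded T g T0 acg.
exists B => _ [s sx <-]; apply: HB; exact: familyW sx.
Qed.

Lemma variation_ub x s : 0 <= x <= T -> family_in 0 x s -> fvar g s <= V x.
Proof. by move=> /has_sup_variation[_ hub] sx; apply: ub_le_sup => //; exists s. Qed.

(** A family nearly realising the supremum up to [d] is cut at [c]; its left part accounts for at
    most [V c]. *)
Lemma variation_increment c d (eta : R) : 0 < eta -> 0 <= c -> c <= d -> d <= T ->
  exists2 s, family_in c d s & V d - V c <= fvar g s + eta.
Proof.
move=> e0 c0 cd dT; have d0T : 0 <= d <= T by rewrite dT (le_trans c0 cd).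
have [_ [s sd <-] h] := sup_adherent e0 (has_sup_variation d d0T).
exists (cutr c s); first exact: family_cutr sd.
have := fvar_cut g 0 d c s sd.
have : fvar g (cutl c s) <= V c.
  by apply: variation_ub; [rewrite c0 (le_trans cd)|exact: family_cutl sd].
rewrite -/(V d) in h; lra.
Qed.

Lemma variation_ge_increment c d : 0 <= c -> c <= d -> d <= T -> `|g d - g c| <= V d - V c.
Proof.
move=> c0 cd dT; rewrite lerBrDr -lerBrDl; apply: ge_sup.
  by case: (has_sup_variation c); rewrite ?c0 ?(le_trans cd).
move=> _ [s sc <-]; rewrite lerBrDr.
have -> : fvar g s + `|g d - g c| = fvar g ((c, d) :: s) by rewrite /fvar big_cons addrC.
apply: variation_ub; first by rewrite dT (le_trans c0 cd).
rewrite family_cons /= c0 cd lexx/= (familyW _ _ _ _ _ _ _ sc)//.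
rewrite andbT; move: sc => /andP[+ _]; apply: sub_all => p /and3P[_ _ pc].
by rewrite /apart pc orbT.
Qed.

(** Each interval of [J] is replaced by a family inside it that nearly realises the increment of
    [V], so the total length does not grow. The last clause locates the new intervals and keeps them
    apart in the induction. *)
Lemma variation_families (eta : R) J : 0 < eta -> family_in 0 T J ->
  exists s, [/\ family_in 0 T s, finc id s <= finc id J,
    finc V J <= fvar g s + eta * (size J)%:R &
    forall p, p \in s -> exists2 q, q \in J & q.1 <= p.1 /\ p.2 <= q.2].
Proof.
move=> e0; elim: J => [_|q J IH].
  by exists [::]; split; rewrite /finc ?big_nil// /fvar big_nil mulr0 addr0.
rewrite family_cons => /and5P[h1 h2 h3 qJ famJ].
have [s [fs ls vs ins]] := IH famJ.
have [sq fsq vsq] := variation_increment q.1 q.2 eta e0 h1 h2 h3.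
exists (sq ++ s); split.
- move: (fs) (fsq) => /andP[a1 w1] /andP[a2 w2].
  rewrite /family_in all_cat pairwise_cat a1 w1 w2 !andbT.
  have -> /= : all (fun p => [&& 0 <= p.1, p.1 <= p.2 & p.2 <= T]) sq.
    apply: sub_all a2 => p /and3P[k1 -> k3].
    by rewrite (le_trans h1 k1) (le_trans k3 h3).
  apply/allrelP => p p' psq p's.
  have [q' q'J [k1 k2]] := ins _ p's.
  have /and3P[k3 _ k4] := allP a2 _ psq.
  case/orP: (allP qJ _ q'J) => k; apply/orP; [left|right].
    by rewrite (le_trans k4)// (le_trans k).
  by rewrite (le_trans k2)// (le_trans k).
- rewrite /finc big_cat big_cons/= lerD//.
  exact: finc_id_le fsq.
- rewrite /fvar big_cat /finc big_cons/= -/(fvar _ _) -/(fvar _ _) -/(finc _ _).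
  by rewrite -[(size J).+1%:R]/((1 + size J)%:R) natrD mulrDr mulr1; lra.
- move=> p; rewrite mem_cat => /orP[psq|/ins[q' q'J k]].
    exists q; first by rewrite mem_head.
    by case/andP: fsq => /allP/(_ _ psq)/and3P[].
  by exists q' => //; rewrite in_cons q'J orbT.
Qed.

End variation.

(* Functions inducing a Stieltjes measure dominated by the Lebesgue measure. *)
Definition mono_ac T F := (forall c d, 0 <= c -> c <= d -> d <= T -> F c <= F d) /\
  (forall e, 0 < e -> exists2 d, 0 < d &
    forall J, family_in 0 T J -> finc id J < d -> finc F J <= e).

Lemma variation_mono_ac T g : 0 <= T -> abs_cont_seq T g -> mono_ac T (variation_upto g).
Proof.
move=> T0 acg; split=> [c d c0 cd dT|e e0].
  by rewrite -subr_ge0 (le_trans _ (variation_ge_increment T T0 g acg c d c0 cd dT)).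
have e20 : 0 < e / 2 by lra.
have [d d0 gd] := acg (e / 2) e20; exists d => // J fJ Jd.
(* The tolerance is shared among the intervals of [J]; the added 1 covers the empty family. *)
have eta0 : 0 < e / 2 / ((size J)%:R + 1) by rewrite divr_gt0// ltr_wpDl.
have [s [fs ls vs _]] := variation_families T T0 g acg _ J eta0 fJ.
have := gd s fs (le_lt_trans ls Jd) => h.
have : e / 2 / ((size J)%:R + 1) * (size J)%:R <= e / 2.
  rewrite mulrAC ler_pdivrMr ?ltr_wpDl// ler_wpM2l//; first lra.
  by rewrite lerDl.
lra.
Qed.

Lemma variationB_mono_ac T g : 0 <= T -> abs_cont_seq T g ->
  mono_ac T (fun x => variation_upto g x - g x).
Proof.
move=> T0 acg; have Vg := variation_ge_increment T T0 g acg.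
have [_ H] := variation_mono_ac T g T0 acg; split=> [c d c0 cd dT|e e0].
  have := le_trans (ler_norm _) (Vg c d c0 cd dT); lra.
have e20 : 0 < e / 2 by lra.
have [d d0 Vd] := H (e / 2) e20; exists d => // J fJ Jd.
have := Vd J fJ Jd.
suff : finc (fun x => variation_upto g x - g x) J <= 2 * finc (variation_upto g) J by lra.
rewrite /finc mulr_sumr !big_seq; apply: ler_sum => p pJ.
move: fJ => /andP[/allP/(_ _ pJ)/and3P[p0 pp pT] _].
have := Vg _ _ p0 pp pT; rewrite ler_norml => /andP[]; lra.
Qed.

End interval_families.

(** * Approximation of open sets from inside by dyadic intervals *)

Section dyadic.
Context {R : realType} (T : R) (T0 : 0 < T).
Local Notation mu := (@lebesgue_measure R).

Definition dyadic (N k : nat) : R := T * (k%:R / (2 ^ N)%:R).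
Definition dyadic_in (O : set R) (N : nat) (i : 'I_(2 ^ N)) : bool :=
  `[< `]dyadic N i, dyadic N i.+1]%classic `<=` O >].
(** Half-open cells are pairwise disjoint and are the intervals on which a Stieltjes measure is
    prescribed. *)
Definition dyadic_inner (O : set R) (N : nat) : set R :=
  \big[setU/set0]_(i < 2 ^ N)
    (if dyadic_in O N i then `]dyadic N i, dyadic N i.+1]%classic else set0).
Definition dyadic_family (O : set R) (N : nat) : seq (R * R) :=
  [seq (dyadic N i, dyadic N i.+1) | i : 'I_(2 ^ N) <- enum 'I_(2 ^ N) & dyadic_in O N i].

Lemma pow2_gt0 N : 0 < (2 ^ N)%:R :> R.
Proof. by rewrite ltr0n expn_gt0. Qed.

Lemma dyadic_homo N i j : (i <= j)%N -> dyadic N i <= dyadic N j.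
Proof.
by move=> ij; rewrite ler_wpM2l ?(ltW T0)// ler_wpM2r ?ler_nat.
Qed.

Lemma dyadic0 N : dyadic N 0 = 0.
Proof. by rewrite /dyadic mul0r mulr0. Qed.

Lemma dyadic_pow N : dyadic N (2 ^ N) = T.
Proof. by rewrite /dyadic divff ?mulr1// gt_eqF// pow2_gt0. Qed.

Lemma dyadic_double N k : dyadic N.+1 (2 * k) = dyadic N k.
Proof.
rewrite /dyadic expnS !natrM; have := pow2_gt0 N => h; field.
by rewrite gt_eqF.
Qed.

Lemma dyadic_familyP O N : family_in 0 T (dyadic_family O N).
Proof.
apply/andP; split.
  apply/allP => p /mapP[i _ ->] /=; rewrite dyadic_homo// andTb.
  by rewrite -(dyadic0 N) dyadic_homo// -[leRHS](dyadic_pow N) dyadic_homo// ltn_ord.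
rewrite pairwise_map; apply: pairwise_filter.
rewrite -(pairwise_map val (fun i j => apart (dyadic N i, dyadic N i.+1) (dyadic N j, dyadic N j.+1))).
rewrite val_enum_ord.
apply/(pairwiseP 0%N) => i j; rewrite !inE size_iota => iN jN ij.
rewrite !nth_iota// !add0n; apply/orP; left => /=.
by rewrite dyadic_homo.
Qed.

Lemma bigsetU_ordP (I : finType) (U : Type) (F : I -> set U) x :
  (\big[setU/set0]_(i : I) F i) x <-> exists i, F i x.
Proof.
split=> [|[i Fi]]; last by rewrite (bigD1 i)//=; left.
elim/big_ind: _ => // [A B HA HB [/HA|/HB]//|i _ Fi]; by exists i.
Qed.

Lemma dyadic_innerP O N x : dyadic_inner O N x <->
  exists i : 'I_(2 ^ N), [/\ `]dyadic N i, dyadic N i.+1]%classic `<=` O,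
    dyadic N i < x & x <= dyadic N i.+1].
Proof.
split=> [/bigsetU_ordP[i]|[i [iO h1 h2]]].
  case: ifPn => // /asboolP iO; rewrite /= in_itv/= => /andP[h1 h2]; by exists i.
apply/bigsetU_ordP; exists i; rewrite ifT; last exact/asboolP.
by rewrite /= in_itv/= h1 h2.
Qed.

(** Used once for Lebesgue measure, with [F = id], and once for a Stieltjes measure: a bound on the
    total length becomes a bound on the increments of [F]. *)
Lemma measure_dyadic_inner (m : {measure set (measurableTypeR R) -> \bar R}) (F : R -> R) O N :
  (forall a b : R, 0 <= a -> a <= b -> b <= T -> m `]a, b]%classic = (F b - F a)%:E) ->
  m (dyadic_inner O N) = (finc F (dyadic_family O N))%:E.
Proof.
move=> mF; rewrite measure_semi_additive_ord//=.
- rewrite /finc big_map big_filter big_enum_cond/= -sumEFin [RHS]big_mkcond/=.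
  apply: eq_bigr => i _; case: ifP => _; last exact: measure0.
  apply: mF; rewrite ?dyadic_homo//.
    by rewrite -(dyadic0 N) dyadic_homo.
  by rewrite -[leRHS](dyadic_pow N) dyadic_homo.
- by move=> i; case: ifP => _ //; exact: measurable_itv.
- apply/trivIsetP => i j _ _ ij; apply/seteqP; split => // x [].
  have H (k l : 'I_(2 ^ N)) : (k < l)%N -> dyadic N k < x <= dyadic N k.+1 ->
      dyadic N l < x <= dyadic N l.+1 -> False.
    move=> kl /andP[_ h1] /andP[h2 _].
    by have := le_lt_trans (dyadic_homo N _ _ kl) h2; rewrite ltNge h1.
  case: ifP => // _; case: ifP => // _; rewrite /= !in_itv/= => hi hj.
  have [lij|lji|/val_inj eij] := ltngtP i j; [exact: H hi hj|exact: H hj hi|].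
  by rewrite eij eqxx in ij.
- by apply: bigsetU_measurable => i _; case: ifP => _ //; exact: measurable_itv.
Qed.

Lemma dyadic_inner_sub O N : dyadic_inner O N `<=` O.
Proof. by move=> x /dyadic_innerP[i [iO h1 h2]]; apply: iO; rewrite /= in_itv/= h1. Qed.

Lemma dyadic_inner_mono O : nondecreasing_seq (dyadic_inner O).
Proof.
apply/nondecreasing_seqP => N; apply/subsetPset => x /dyadic_innerP[i [iO h1 h2]].
have h (k : nat) : (k < 2 ^ N.+1)%N -> dyadic N i <= dyadic N.+1 k ->
    dyadic N.+1 k.+1 <= dyadic N i.+1 -> dyadic N.+1 k < x -> x <= dyadic N.+1 k.+1 ->
    dyadic_inner O N.+1 x.
  move=> kN k1 k2 k3 k4; apply/dyadic_innerP; exists (Ordinal kN); split => //= y.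
  rewrite /= in_itv/= => /andP[y1 y2]; apply: iO.
  by rewrite /= in_itv/= (le_lt_trans k1)//= (le_trans y2).
have iN : (2 * i + 1 < 2 ^ N.+1)%N.
  have := ltn_ord i; rewrite -(@leq_pmul2l 2)// mulnS -expnS => h2N.
  by rewrite (leq_trans _ h2N)// addnC.
have i2 : dyadic N.+1 (2 * i + 1).+1 = dyadic N i.+1.
  by rewrite -(dyadic_double N i.+1) mulnS addnC.
have le1 : dyadic N i <= dyadic N.+1 (2 * i + 1).
  by rewrite -dyadic_double dyadic_homo// leq_addr.
have le2 : dyadic N.+1 (2 * i + 1) <= dyadic N i.+1.
  by rewrite -i2 dyadic_homo.
have [xm|xm] := leP x (dyadic N.+1 (2 * i + 1)).
  apply: (h (2 * i)%N); rewrite -?[(2 * i).+1]addn1 ?dyadic_double//.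
  exact: ltnW.
by apply: (h (2 * i + 1)%N); rewrite ?i2.
Qed.

Lemma dyadic_inner_cover O : open O -> O `&` `]0, T]%classic `<=` \bigcup_N dyadic_inner O N.
Proof.
move=> oO x [Ox]; rewrite /= in_itv/= => /andP[x0 xT].
have [r /= r0 rO] := open_nbhs_nbhs (conj oO Ox).
have [N TN] : exists N, T / (2 ^ N)%:R < r.
  exists (Num.bound (T / r)); rewrite ltr_pdivrMr ?pow2_gt0// mulrC -ltr_pdivrMr//.
  rewrite (lt_le_trans (archi_boundP _))// ?divr_ge0 ?ltW//.
  by rewrite ltr_nat ltn_expl.
exists N => //; apply/dyadic_innerP.
(* Cells are closed on the right, so the least such index designates the cell that contains [x]. *)
have ex : exists k, x <= dyadic N k.+1.
  exists (2 ^ N).-1; rewrite prednK ?expn_gt0// dyadic_pow//.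
case: (ex_minnP ex) => k xk kmin.
have kN : (k < 2 ^ N)%N.
  rewrite -[X in (_ < X)%N]prednK ?expn_gt0// ltnS; apply: kmin.
  by rewrite prednK ?expn_gt0// dyadic_pow.
have kx : dyadic N k < x.
  case: k kmin {xk kN} => [|k] kmin; first by rewrite dyadic0.
  by rewrite ltNge; apply/negP => /kmin; rewrite ltnn.
exists (Ordinal kN); split => //= y; rewrite /= in_itv/= => /andP[y1 y2].
apply: rO => /=.
have E : dyadic N k.+1 = dyadic N k + T / (2 ^ N)%:R.
  by rewrite /dyadic -natr1 mulrDl mul1r mulrDr.
rewrite ltr_norml; apply/andP; split; lra.
Qed.

End dyadic.

(** * The density of a monotone absolutely continuous function *)

Section density.
Context {R : realType}.
Local Notation mu := (@lebesgue_measure R).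

(** Projection onto [0, T]; composition with it extends a function to the whole line by its end
    values. *)
Definition clip (T x : R) : R := Num.max 0 (Num.min x T).

Lemma clip_ge0 T x : 0 <= clip T x.
Proof. by rewrite le_max lexx. Qed.

Lemma clip_le T x : 0 <= T -> clip T x <= T.
Proof. by move=> T0; rewrite ge_max T0 ge_min lexx orbT. Qed.

Lemma clip_homo T x y : x <= y -> clip T x <= clip T y.
Proof. by move=> xy; rewrite le_max2// le_min2. Qed.

Lemma clip_id T x : 0 <= x -> x <= T -> clip T x = x.
Proof. by move=> x0 xT; rewrite /clip min_l// max_r. Qed.

Lemma clip_dist T x y : x <= y -> clip T y - clip T x <= y - x.
Proof.
move=> xy; rewrite lerBlDr {1}/clip ge_max addr_ge0 ?subr_ge0 ?clip_ge0//=.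
have [xT|Tx] := leP x T.
  have : x <= clip T x by rewrite /clip (min_l xT) le_max lexx orbT.
  have : Num.min y T <= y by rewrite ge_min lexx.
  lra.
have : T <= clip T x by rewrite /clip (min_r (ltW Tx)) le_max lexx orbT.
have : Num.min y T <= T by rewrite ge_min lexx orbT.
lra.
Qed.

Lemma lebesgue_measure_oc (a b : R) : a <= b -> mu (`]a, b]%classic : set R) = (b - a)%:E.
Proof.
move=> ab; rewrite lebesgue_measure_itv/= lte_fin; case: ltP => // ba.
by rewrite (_ : a = b) ?subrr//; lra.
Qed.

(** The Stieltjes measure of the extended function is dominated by Lebesgue measure: a null set lies
    in an open set of small measure, whose dyadic approximations from inside are finite families, to
    which the absolute continuity of [F] applies. Radon-Nikodym then yields the density. *)
Lemma mono_ac_density (T : R) (F : R -> R) : 0 < T -> mono_ac T F ->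
  exists w : R -> R, mu.-integrable setT (EFin \o w) /\
    forall a b, 0 <= a -> a <= b -> b <= T -> F b - F a = \int[mu]_(x in `]a, b]) w x.
Proof.
move=> T0 [Fmono Fac].
pose Fc x := F (clip T x).
have Fnd : nondecreasing Fc.
  move=> x y xy; apply: Fmono; [exact: clip_ge0|exact: clip_homo|exact/clip_le/ltW].
have Frc : right_continuous Fc.
  apply: right_continuousW => x; apply/(@cvgrPdist_lt _ R^o) => e e0.
  have [d d0 Fd] := Fac (e / 2) (ltac:(lra)).
  have H y z : y <= z -> z - y < d -> Fc z - Fc y <= e / 2.
    move=> yz zyd; have := Fd [:: (clip T y, clip T z)]; rewrite /finc !big_seq1 /=.
    apply; last by rewrite (le_lt_trans (clip_dist _ _ _ yz)).
    by rewrite /family_in /= clip_ge0 clip_homo//= clip_le// ltW.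
  exists d => //= y; rewrite /ball_/= => xyd.
  move: xyd; rewrite !ltr_norml => /andP[xd1 xd2].
  have [xy|/ltW yx] := leP x y.
    have h1 : Fc y - Fc x <= e / 2 by apply: H => //; lra.
    have h2 : Fc x <= Fc y by exact: Fnd.
    by apply/andP; split; lra.
  have h1 : Fc x - Fc y <= e / 2 by apply: H => //; lra.
  have h2 : Fc y <= Fc x by exact: Fnd.
  by apply/andP; split; lra.
pose C : cumulative R R := HB.pack_for (cumulative R R) Fc (isCumulative.Build R _ R Fc Fnd Frc).
pose m := lebesgue_stieltjes_measure C.
have mE (a b : R) : 0 <= a -> a <= b -> b <= T -> m `]a, b]%classic = (F b - F a)%:E.
  move=> a0 ab bT.
  have -> : m `]a, b]%classic = wlength C `]a, b]%classic.
    exact: (@measurable_mu_extE _ R _ (wlength C) `]a, b]%classic (is_ocitv a b)).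
  rewrite wlength_itv_bnd//= /Fc.
  by rewrite (clip_id T b (le_trans a0 ab) bT) (clip_id T a a0 (le_trans ab bT)).
have mD : measurable (`]0, T]%classic : set (measurableTypeR R)) by exact: measurable_itv.
have mDoo : (m `]0%R, T]%classic < +oo)%E by rewrite (mE 0 T (lexx 0) (ltW T0) (lexx T)) ltry.
(* The restriction to ]0, T], where the total mass is [F T - F 0]. *)
pose nu : {finite_measure set (measurableTypeR R) -> \bar R} := mfrestr mD mDoo.
have nu_mu : nu `<< mu.
  apply/null_content_dominatesP => A mA A0.
  rewrite /nu /= /mfrestr /mrestr; apply/eqP; rewrite eq_le measure_ge0 andbT.
  apply/lee_addgt0Pr => e e0; rewrite add0e.
  have [d d0 Fd] := Fac e e0.
  have Aoo : (mu A < +oo)%E by rewrite A0 ltry.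
  have [Q [oQ AQ QA]] := lebesgue_regularity_outer mA Aoo d0.
  have Qd : (mu Q < d%:E)%E.
    rewrite (le_lt_trans _ QA)// -[leRHS]adde0 -A0.
    rewrite -measureU//; last by rewrite setDKI.
      by apply: le_measure; rewrite ?inE; [exact: open_measurable|apply: measurableU => //; apply: measurableD => //; exact: open_measurable|move=> x Qx; have [Ax|nAx] := pselect (A x); [right|left]].
    by apply: measurableD => //; exact: open_measurable.
  have mN N : measurable (dyadic_inner T Q N).
    by apply: bigsetU_measurable => i _; case: ifP => _ //; exact: measurable_itv.
  have mU : measurable (\bigcup_N dyadic_inner T Q N) by exact: bigcupT_measurable.
  apply: (@le_trans _ _ (m (\bigcup_N dyadic_inner T Q N))).
    apply: le_measure; rewrite ?inE//; first exact: measurableI.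
    apply: subset_trans (dyadic_inner_cover T T0 Q oQ); exact: setSI.
  have cv := @nondecreasing_cvg_mu _ _ _ m _ mN mU (dyadic_inner_mono T T0 Q).
  apply: (@le_trans _ _ (limn (m \o dyadic_inner T Q))).
    by rewrite (cvg_lim (@ereal_hausdorff R) cv).
  apply: lime_le; first exact: cvgP cv.
  apply: nearW => N.
  have E : (m \o dyadic_inner T Q) N = (finc F (dyadic_family T Q N))%:E.
    exact: (measure_dyadic_inner T T0 m F).
  rewrite [leLHS]E lee_fin.
  apply: Fd; first exact: dyadic_familyP.
  rewrite -lte_fin (le_lt_trans _ Qd)//.
  rewrite -(measure_dyadic_inner T T0 mu id).
    apply: le_measure; [by rewrite inE; exact: mN|by rewrite inE; exact: open_measurable|].
    exact: dyadic_inner_sub.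
  by move=> a b _ ab _; exact: lebesgue_measure_oc.
have [f [f0 ffin intf nuE]] := radon_nikodym_sigma_finite nu_mu.
have fE : EFin \o (fine \o f) = f by apply/funext => x /=; rewrite fineK.
exists (fine \o f); split; first by rewrite fE.
move=> a b a0 ab bT.
have -> : \int[mu]_(x in `]a, b]) fine (f x) = fine (nu `]a, b]%classic).
  rewrite nuE; last exact: measurable_itv.
  by congr fine; apply: eq_integral => x _; rewrite fineK.
have -> : nu `]a, b]%classic = m `]a, b]%classic.
  rewrite /nu/= /mfrestr /mrestr setIidl// => x; rewrite /= !in_itv/= => /andP[ax xb].
  by rewrite (le_lt_trans a0)//= (le_trans xb).
by rewrite mE.
Qed.

End density.

(** * Primitives of integrable functions *)

Section primitives.
Context {R : realType}.
Local Notation mu := (@lebesgue_measure R).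

(** The density is integrable on the whole line, so that its integral from minus infinity exists and
    the differentiation theorem applies to it. *)
Definition primitive (T : R) (g w : R -> R) : Prop :=
  mu.-integrable setT (EFin \o w) /\
  forall a b, 0 <= a -> a <= b -> b <= T -> g b - g a = \int[mu]_(x in `]a, b]) w x.

Lemma integrable_itv (w : R -> R) (i : interval R) :
  mu.-integrable setT (EFin \o w) -> mu.-integrable [set` i] (EFin \o w).
Proof. by move=> iw; apply: integrableS iw. Qed.

(** Jordan decomposition: [g] is its total variation minus [variation_upto g x - g x], and both are
    monotone and absolutely continuous. *)
Lemma abs_cont_primitive T g : 0 < T -> abs_cont_seq T g -> exists w, primitive T g w.
Proof.
move=> T0 acg; have T0' := ltW T0.
have [w1 [i1 h1]] := mono_ac_density T _ T0 (variation_mono_ac T g T0' acg).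
have [w2 [i2 h2]] := mono_ac_density T _ T0 (variationB_mono_ac T g T0' acg).
exists (w1 \- w2); split.
  have -> : EFin \o (w1 \- w2) = ((EFin \o w1) \- (EFin \o w2))%E by apply/funext.
  exact: integrableB.
move=> a b a0 ab bT; rewrite RintegralB//; try exact: integrable_itv.
by rewrite -h1// -h2//; lra.
Qed.

Lemma primitive_derivable T g w : primitive T g w ->
  {ae mu, forall x, 0 < x < T -> derivable g x 1 /\ derive1 g x = w x}.
Proof.
move=> [iw gw].
have := @FTC1Ny R w (fun y => integrable_itv w _ iw).
have li : locally_integrable setT w by apply: open_integrable_locally => //; exact: openT.
move=> /(_ li) /=; apply: filterS; first exact: (ae_filter_ringOfSetsType mu).
move=> x /=.
set F := (fun y => \int[mu]_(t in `]-oo, y]) w t) => -[dF Fx] /andP[x0 xT].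
have near : {near x, F + cst (g 0 - F 0) =1 g}.
  have : \forall y \near x, 0 < y < T.
    near=> y; apply/andP; split; near: y; [exact: lt_nbhsr|exact: lt_nbhsl].
  apply: filterS => y /andP[y0 yT]; rewrite -[LHS]/(F y + (g 0 - F 0)).
  have h := gw 0 y (lexx 0) (ltW y0) (ltW yT).
  have : F y - F 0 = \int[mu]_(t in `]0, y]) w t.
    by rewrite /F Rintegral_itvB ?bnd_simp ?(ltW y0)//; exact: integrable_itv.
  by rewrite -h; lra.
have dc : derivable (cst (g 0 - F 0) : R -> R) x 1 by exact: derivable_cst.
split; first exact: (near_eq_derivable near (derivableD dF dc)).
rewrite derive1E -(@near_eq_derive R R R _ _ x 1 near).
by rewrite (deriveD dF dc) derive_cst addr0 -derive1E.
Unshelve. all: by end_near. Qed.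

(** Absolute continuity of the integral of [w], applied to the union [A] of the half-open intervals
    of the family, whose measure is at most their total length. The inclusion clause on [A] gives
    disjointness from the next interval. *)
Lemma primitive_abs_cont T g w : primitive T g w -> abs_cont_seq T g.
Proof.
move=> [iw gw] e e0.
have [d [d0 wd]] := integral_normr_continuous iw e0.
exists d => // s fs sd.
suff [A [mA As muA gA]] : exists A : set R, [/\ measurable A,
    A `<=` [set x | exists2 p, p \in s & p.1 < x <= p.2],
    (mu A <= (finc id s)%:E)%E & fvar g s <= \int[mu]_(x in A) `|w x|].
  by rewrite (le_lt_trans gA)//; apply: wd => //; rewrite (le_lt_trans muA)// lte_fin.
elim: s fs {sd} => [_|p s IH].
  exists set0; split => //; first by rewrite measure0 /finc big_nil.
  by rewrite Rintegral_set0 /fvar big_nil.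
rewrite family_cons => /and5P[h1 h2 h3 /allP ps fs].
have [A [mA As muA gA]] := IH fs.
have mI : measurable (`]p.1, p.2]%classic : set (measurableTypeR R)) by exact: measurable_itv.
have iabs B : measurable B -> mu.-integrable B (EFin \o (fun x => `|w x|)).
  by move=> mB; apply: (integrableS _ _ _ (integrable_abse iw)).
exists (`]p.1, p.2]%classic `|` A); split.
- exact: measurableU.
- move=> x [|/As[q qs xq]]; last by exists q => //; rewrite in_cons qs orbT.
  by rewrite /= in_itv/= => xp; exists p => //; rewrite mem_head.
- rewrite (le_trans (measureU2 _ _ _))// /finc big_cons EFinD leeD//.
  by rewrite le_eqVlt; apply/orP; left; apply/eqP; exact: lebesgue_measure_oc.
- rewrite Rintegral_setU//.
  + rewrite /fvar big_cons lerD// gw// le_normr_Rintegral//.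
    exact: integrable_itv.
  + exact/iabs/measurableU.
  + apply/disj_setPS => x [/=]; rewrite in_itv/= => /andP[x1 x2] /As[q qs /andP[q1 q2]].
    have /orP[h|h] := ps _ qs.
      by have := le_lt_trans (le_trans x2 h) q1; rewrite ltxx.
    by have := le_lt_trans (le_trans q2 h) x1; rewrite ltxx.
Qed.

End primitives.

(** * Absolutely continuous curves and their velocities *)

Section trajectories.
Context {R : realType} {n : nat}.
Local Notation mu := (@lebesgue_measure R).
Implicit Types (g w : R -> 'rV[R]_n).

Definition traj (T : R) g w : Prop :=
  forall i, primitive T (fun s => g s ord0 i) (fun s => w s ord0 i).

Lemma abs_cont_traj T g : 0 < T -> abs_cont_on T g -> exists w, traj T g w.
Proof.
move=> T0 acg.
have H (i : 'I_n) : exists w1 : R -> R, primitive T (fun s => g s ord0 i) w1.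
  apply: abs_cont_primitive => // e e0; have [d d0 gd] := acg e e0.
  exists d => // s fs sd; move: (fs) => /andP[/all_nthP al /pairwiseP pw].
  have := gd (size s) (fun k => (nth (0, 0) s k).1) (fun k => (nth (0, 0) s k).2).
  have h1 k : (k < size s)%N -> 0 <= (nth (0, 0) s k).1 /\
      (nth (0, 0) s k).1 <= (nth (0, 0) s k).2 /\ (nth (0, 0) s k).2 <= T.
    by move=> ks; have /and3P[] := al (0, 0) k ks.
  move=> /(_ h1) H; apply: le_lt_trans (H _ _).
  - rewrite /fvar (big_nth (0, 0)) big_mkord; apply: ler_sum => k _.
    have := coord_le_enorm (g (nth (0, 0) s k).2 - g (nth (0, 0) s k).1) i.
    by rewrite !mxE.
  - move=> k l ks ls /eqP; rewrite neq_ltn => /orP[kl|lk].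
      have := pw (0, 0) k l; rewrite !inE => /(_ ks ls kl)/orP[]; by [left|right].
    have := pw (0, 0) l k; rewrite !inE => /(_ ls ks lk)/orP[]; by [left|right].
  - by move: sd; rewrite /finc (big_nth (0, 0)) big_mkord.
have [w wP] := choice H.
exists (fun s => \row_i w i s) => i.
have -> : (fun s => (\row_i w i s) ord0 i) = w i by apply/funext => s; rewrite mxE.
exact: wP.
Qed.

Lemma traj_abs_cont T g w : traj T g w -> abs_cont_on T g.
Proof.
move=> gw e e0.
have e'0 : 0 < e / (n%:R + 1) by rewrite divr_gt0// ltr_wpDl.
have H (i : 'I_n) : exists d : R, 0 < d /\ forall s, family_in 0 T s -> finc id s < d ->
    fvar (fun s => g s ord0 i) s < e / (n%:R + 1).
  by have [d d0 h] := primitive_abs_cont _ _ _ (gw i) _ e'0; exists d.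
have [d dP] := choice H.
exists (\big[Num.min/1]_(i < n) d i).
  elim/big_ind: _ => [|x y x0 y0|i _] //; first by rewrite lt_min x0 y0.
  by have [] := dP i.
move=> k a b ab disj sd.
pose s := [seq (a i, b i) | i <- iota 0 k].
have fs : family_in 0 T s.
  apply/andP; split.
    apply/allP => p /mapP[i]; rewrite mem_iota add0n => /andP[_ ik] -> /=.
    by have [-> [-> ->]] := ab i ik.
  rewrite pairwise_map; apply/(pairwiseP 0%N) => i j; rewrite !inE size_iota => ik jk ij.
  rewrite !nth_iota// !add0n /apart /=.
  by have [->|->] := disj i j ik jk (ltac:(by move=> E; rewrite E ltnn in ij)); rewrite ?orbT.
have sums (h : R -> R) : finc h s = \sum_(i < k) (h (b i) - h (a i)).
  by rewrite /finc big_map -(big_mkord predT (fun i => h (b i) - h (a i))) /index_iota subn0.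
have sumv (h : R -> R) : fvar h s = \sum_(i < k) `|h (b i) - h (a i)|.
  by rewrite /fvar big_map -(big_mkord predT (fun i => `|h (b i) - h (a i)|)) /index_iota subn0.
apply: (@le_lt_trans _ _ (\sum_(j < n) fvar (fun s => g s ord0 j) s)).
  under [leRHS]eq_bigr do rewrite sumv.
  rewrite exchange_big/=; apply: ler_sum => i _.
  rewrite (le_trans (enorm_le_sum _))//; apply: ler_sum => j _.
  by rewrite !mxE.
apply: (@le_lt_trans _ _ (\sum_(j < n) e / (n%:R + 1))).
  apply: ler_sum => j _; apply: ltW; have [_] := dP j; apply => //.
  rewrite sums; apply: lt_le_trans sd _.
  exact: bigmin_le_cond.
rewrite sumr_const card_ord -[X in X < _]mulr_natl mulrCA gtr_pMr//.
by rewrite ltr_pdivrMr ?ltr_wpDl// mul1r ltrDl.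
Qed.

Lemma traj_derive T g w : traj T g w ->
  {ae mu, forall x, 0 < x < T -> derive1 g x = w x}.
Proof.
move=> gw.
have : {ae mu, forall x (i : 'I_n), 0 < x < T ->
    derivable (fun s => g s ord0 i) x 1 /\ derive1 (fun s => g s ord0 i) x = w x ord0 i}.
  apply: filter_forall => i; exact: primitive_derivable (gw i).
apply: filterS; first exact: (ae_filter_ringOfSetsType mu).
move=> x H xT.
have dg : derivable g x 1.
  by apply/derivable_mxP => i j; rewrite ord1; have [] := H j xT.
apply/rowP => j; rewrite derive1E derive_mx// mxE -derive1E.
by have [] := H j xT.
Qed.

End trajectories.

(** * Integrals of real functions over compact intervals *)

Section interval_integrals.
Context {R : realType}.
Local Notation mu := (@lebesgue_measure R).
Implicit Types (f g : R -> R) (a b c k : R).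

Definition itg a b f := mu.-integrable `[a, b] (EFin \o f).
Definition int a b f : R := \int[mu]_(x in `[a, b]) f x.

Lemma measurable_cc a b : measurable (`[a, b]%classic : set (measurableTypeR R)).
Proof. exact: measurable_itv. Qed.
Local Hint Resolve measurable_cc : core.

Lemma itg_sub a b a' b' f : a <= a' -> b' <= b -> itg a b f -> itg a' b' f.
Proof.
move=> aa bb; apply: integrableS => // x; rewrite /= !in_itv/= => /andP[x1 x2].
by rewrite (le_trans aa)//= (le_trans x2).
Qed.

Lemma itgD a b f g : itg a b f -> itg a b g -> itg a b (fun x => f x + g x).
Proof. by move=> hf hg; exact: (integrableD _ hf hg). Qed.

Lemma itgZ a b k f : itg a b f -> itg a b (fun x => k * f x).
Proof. by move=> hf; exact: (integrableZl _ _ hf). Qed.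

Lemma itgB a b f g : itg a b f -> itg a b g -> itg a b (fun x => f x - g x).
Proof. by move=> hf hg; exact: (integrableB _ hf hg). Qed.

Lemma itg_abs a b f : itg a b f -> itg a b (fun x => `|f x|).
Proof. by move=> hf; exact: (integrable_abse hf). Qed.

Lemma lebesgue_measure_cc a b : a <= b -> mu (`[a, b]%classic : set R) = (b - a)%:E.
Proof.
move=> ab; rewrite lebesgue_measure_itv/= lte_fin; case: ltP => // ba.
by rewrite (_ : a = b) ?subrr//; lra.
Qed.

Lemma itg_cst a b c : itg a b (fun=> c).
Proof.
apply/integrableP; split; first exact/measurable_EFinP.
under eq_integral do rewrite /=.
rewrite integral_cst//=; have [ab|ba] := leP a b.
  by rewrite lebesgue_measure_cc// -EFinM ltry.
by rewrite set_itv_ge ?measure0 ?mule0 ?ltry// bnd_simp -ltNge.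
Qed.

Lemma itg_measurable a b f : itg a b f -> measurable_fun `[a, b] f.
Proof. by move=> /measurable_int/measurable_EFinP. Qed.

Lemma itg_le a b f g : measurable_fun `[a, b] f ->
  (forall x, a <= x <= b -> `|f x| <= g x) -> itg a b g -> itg a b f.
Proof.
move=> mf fg; apply: le_integrable => //; first exact/measurable_EFinP.
move=> x; rewrite /= in_itv/= lee_fin => /fg h.
by rewrite (le_trans h)// ler_norm.
Qed.

Lemma intD a b f g : itg a b f -> itg a b g ->
  int a b (fun x => f x + g x) = int a b f + int a b g.
Proof. by move=> hf hg; rewrite /int RintegralD. Qed.

Lemma intB a b f g : itg a b f -> itg a b g ->
  int a b (fun x => f x - g x) = int a b f - int a b g.
Proof. by move=> hf hg; rewrite /int RintegralB. Qed.

Lemma intZ a b k f : itg a b f -> int a b (fun x => k * f x) = k * int a b f.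
Proof. by move=> hf; rewrite /int RintegralZl. Qed.

Lemma int_cst a b c : a <= b -> int a b (fun=> c) = (b - a) * c.
Proof. by move=> ab; rewrite /int Rintegral_cst//= lebesgue_measure_cc//= mulrC. Qed.

Lemma eq_int a b f g : (forall x, a <= x <= b -> f x = g x) -> int a b f = int a b g.
Proof.
move=> fg; apply: eq_Rintegral => x; rewrite inE/= in_itv/=; exact: fg.
Qed.

Lemma eq_itg a b f g : (forall x, a <= x <= b -> f x = g x) -> itg a b f -> itg a b g.
Proof.
move=> fg; apply: eq_integrable => // x; rewrite inE/= in_itv/= => /fg.
by move=> ->.
Qed.

Lemma int_le a b f g : itg a b f -> itg a b g ->
  (forall x, a <= x <= b -> f x <= g x) -> int a b f <= int a b g.
Proof. by move=> hf hg fg; apply: le_Rintegral => // x; rewrite /= in_itv/=; exact: fg. Qed.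

Lemma int_ge0 a b f : (forall x, a <= x <= b -> 0 <= f x) -> 0 <= int a b f.
Proof. by move=> f0; apply: Rintegral_ge0 => x; rewrite /= in_itv/=; exact: f0. Qed.

Lemma int_abs a b f : itg a b f -> `|int a b f| <= int a b (fun x => `|f x|).
Proof. by move=> hf; exact: le_normr_Rintegral. Qed.

Lemma int_cat a b c f : a <= c -> c <= b -> itg a b f -> int a b f = int a c f + int c b f.
Proof.
move=> ac cb hf.
have := @Rintegral_itvB R f (BLeft a) (BRight b) c hf.
rewrite !bnd_simp => /(_ ac cb) h; rewrite /int.
rewrite -(Rintegral_itv_obnd_cbnd (r := c) (b := BRight b)).
  by rewrite -h; lra.
apply: integrableS hf => //.
by move=> x; rewrite /= !in_itv/= => /andP[cx ->]; rewrite andbT (le_trans ac)// ltW.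
Qed.

Lemma itg_cat a b c f : a <= c -> c <= b -> itg a c f -> itg c b f -> itg a b f.
Proof.
move=> ac cb h1 h2.
have E : `[a, b]%classic = `[a, c]%classic `|` `]c, b]%classic.
  apply/seteqP; split=> x /=; rewrite !in_itv/=.
    by move=> /andP[ax xb]; case: (leP x c) => xc; [left|right]; rewrite ?ax ?xb.
  by move=> [] /andP[h h']; rewrite ?h ?h' ?(le_trans h')//= (le_trans ac)// ltW.
have {}h2 : mu.-integrable `]c, b] (EFin \o f).
  apply: integrableS h2 => //.
  by move=> x; rewrite /= !in_itv/= => /andP[/ltW -> ->].
have mcb : measurable (`]c, b]%classic : set (measurableTypeR R)) by exact: measurable_itv.
have mf : measurable_fun (`[a, c]%classic `|` `]c, b]%classic : set (measurableTypeR R)) (EFin \o f).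
  by apply/measurable_funU => //; split; apply: measurable_int; [exact: h1|exact: h2].
rewrite /itg E; apply/integrableP; split => //.
rewrite ge0_integral_setU//.
- by apply: lte_add_pinfty; [case/integrableP: h1|case/integrableP: h2].
- by apply: measurableT_comp mf.
- apply/disj_setPS => x [/=]; rewrite !in_itv/= => /andP[_ xc] /andP[cx _].
  by have := le_lt_trans xc cx; rewrite ltxx.
Qed.

Lemma primitive_int T g w : primitive T g w ->
  itg 0 T w /\ forall a b, 0 <= a -> a <= b -> b <= T -> g b - g a = int a b w.
Proof.
move=> [iw gw]; split; first exact: integrable_itv.
move=> a b a0 ab bT; rewrite gw// /int Rintegral_itv_obnd_cbnd//.
exact: integrable_itv.
Qed.

Lemma continuous_on_clip (T : R) f : 0 <= T ->
  (forall x, 0 <= x <= T -> forall e, 0 < e -> exists2 d, 0 < d &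
     forall y, 0 <= y <= T -> `|y - x| < d -> `|f y - f x| < e) ->
  continuous (fun x => f (clip T x)).
Proof.
move=> T0 cf x; apply/(@cvgrPdist_lt _ R^o) => e e0.
have cT y : 0 <= clip T y <= T by rewrite clip_ge0 clip_le.
have [d d0 fd] := cf (clip T x) (cT x) e e0.
exists d => //= y; rewrite /ball_/= distrC => xy; rewrite distrC; apply: fd => //.
rewrite (le_lt_trans _ xy)//.
have [h|/ltW h] := leP x y; have := clip_dist T _ _ h; have := clip_homo T _ _ h => h1 h2.
  by rewrite !ger0_norm; lra.
by rewrite !ler0_norm; lra.
Qed.

Lemma continuous_on_itg (T : R) f : 0 <= T ->
  (forall x, 0 <= x <= T -> forall e, 0 < e -> exists2 d, 0 < d &
     forall y, 0 <= y <= T -> `|y - x| < d -> `|f y - f x| < e) ->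
  itg 0 T f /\ exists B, forall x, 0 <= x <= T -> `|f x| <= B.
Proof.
move=> T0 /(continuous_on_clip T f T0) cf.
have fE x : 0 <= x <= T -> f (clip T x) = f x by move=> /andP[x1 x2]; rewrite clip_id.
have cf' := continuous_subspaceT cf.
split.
  apply: (eq_itg _ _ _ _ fE).
  by apply: continuous_compact_integrable; [exact: segment_compact|exact: cf'].
have [M [_ MB]] := compact_bounded (continuous_compact (cf' `[0, T]%classic) (@segment_compact R 0 T)).
exists (`|M| + 1) => x xT; apply: (MB (`|M| + 1)).
  by rewrite ltr_pwDr// ler_norm.
by exists x; [rewrite /= in_itv|rewrite fE].
Qed.

End interval_integrals.

(** * Affine change of variables *)

Definition affine_map {R : realType} (k c : R) (r : measurableTypeR R) : measurableTypeR R :=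
  k * r + c.

Lemma measurable_affine_map {R : realType} (k c : R) : measurable_fun setT (affine_map k c).
Proof. by apply: measurable_funD => //; exact: measurable_funM. Qed.

Section substitution.
Context {R : realType}.
Local Notation mu := (@lebesgue_measure R).
Context (k c : R) (k0 : 0 < k).
Local Notation aff := (affine_map k c).
Let maff := measurable_affine_map k c.
Let push : {measure set (measurableTypeR R) -> \bar R} :=
  measure_function_pushforward__canonical__measure_function_Measure mu maff.

Let aff_le x y : (k * x + c <= y) = (x <= (y - c) / k).
Proof. by rewrite -lerBrDr ler_pdivlMr// mulrC. Qed.

(** The scaled image of Lebesgue measure has the right value on half-open intervals, and these
    determine Lebesgue measure. *)
Let lebesgue_aff A : measurable A ->
  mu A = mscale (NngNum (ltW k0)) push A.
Proof.
apply: lebesgue_measure_unique => _ [[a b] _ <-] /=.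
rewrite /mscale /push /= /pushforward.
have -> : aff @^-1` `]a, b]%classic = `](a - c) / k, (b - c) / k]%classic.
  by apply/seteqP; split=> x; rewrite /= !in_itv/= /affine_map !ltNge !aff_le.
have [ab|ba] := leP a b.
  have h : (a - c) / k <= (b - c) / k by rewrite ler_wpM2r ?invr_ge0 ?(ltW k0)//; lra.
  rewrite !lebesgue_measure_oc// -EFinM; congr EFin; field; exact: lt0r_neq0.
rewrite set_itv_ge ?bnd_simp -?leNgt ?(ltW ba)// measure0 set_itv_ge ?measure0 ?mule0//.
by rewrite bnd_simp -leNgt ler_wpM2r ?invr_ge0 ?(ltW k0)//; lra.
Qed.

Let aff_preimage a b : aff @^-1` `[k * a + c, k * b + c]%classic = `[a, b]%classic.
Proof.
apply/seteqP; split=> x; rewrite /= !in_itv/= /affine_map !lerD2r !ler_pM2l//.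
Qed.

Let ge0_aff (f : R -> \bar R) a b : 
  measurable_fun (`[k * a + c, k * b + c]%classic : set (measurableTypeR R)) f ->
  (forall x, 0 <= f x)%E ->
  (\int[mu]_(x in `[(k * a + c)%R, (k * b + c)%R]) f x = k%:E * \int[mu]_(x in `[a, b]) f (k * x + c)%R)%E.
Proof.
move=> mf f0.
rewrite (@eq_measure_integral _ _ _ _ (mscale (NngNum (ltW k0)) push)); last first.
  by move=> A mA _; exact: lebesgue_aff.
rewrite (ge0_integral_mscale push (measurable_cc _ _) _ mf)//.
congr (_ * _)%E; rewrite (ge0_integral_pushforward maff mu (measurable_cc _ _) mf)//.
by rewrite aff_preimage.
Qed.

(** The formula for nonnegative functions is applied to the absolute value, which gives
    integrability, and then to the positive and the negative part. *)
Lemma int_subst (f : R -> R) a b : itg (k * a + c) (k * b + c) f ->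
  itg a b (fun r => f (k * r + c)) /\
  int (k * a + c) (k * b + c) f = k * int a b (fun r => f (k * r + c)).
Proof.
move=> hf; have mf := measurable_int _ hf.
have mfc : measurable_fun (`[a, b]%classic : set (measurableTypeR R)) (EFin \o (fun r => f (k * r + c))).
  have -> : EFin \o (fun r => f (k * r + c)) = (EFin \o f) \o aff by [].
  apply: (measurable_comp (F := `[k * a + c, k * b + c]%classic)) => //.
  - by move=> _ [r + <-]; rewrite -aff_preimage.
  - by apply: measurable_funS maff.
have key (h : \bar R -> \bar R) : measurable_fun setT h -> (forall x, 0 <= h x)%E ->
   (\int[mu]_(x in `[(k * a + c)%R, (k * b + c)%R]) h (f x)%:E =
    k%:E * \int[mu]_(x in `[a, b]) h (f (k * x + c)%R)%:E)%E.
  move=> mh h0; apply: (ge0_aff (fun x => h (f x)%:E)) => //.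
  exact: measurableT_comp mf.
have hfc : itg a b (fun r => f (k * r + c)).
  apply/integrableP; split => //.
  have /integrableP[_] := hf.
  have := key abse (ltac:(exact: abse_measurable)) (@abse_ge0 _).
  move=> /= -> h; rewrite ltNge leye_eq; apply/negP => /eqP E.
  by rewrite E mulry gtr0_sg// mul1e ltxx in h.
split=> //.
have := key (fun x => maxe x 0)%E; have := key (fun x => maxe (- x) 0)%E.
have m1 : measurable_fun setT (fun x : \bar R => maxe (- x) 0)%E.
  by apply: measurable_maxe => //; exact: measurable_oppe.
have m2 : measurable_fun setT (fun x : \bar R => maxe x 0)%E by exact: measurable_maxe.
move=> /(_ m1) kn /(_ m2) kp.
rewrite /int /Rintegral integralE [in RHS]integralE.
have Ep g x y : (\int[mu]_(z in `[x, y]) (EFin \o g)^\+ z = \int[mu]_(z in `[x, y]) maxe (g z)%:E 0)%E.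
  by apply: eq_integral => z _; rewrite unlock.
have En g x y : (\int[mu]_(z in `[x, y]) (EFin \o g)^\- z = \int[mu]_(z in `[x, y]) maxe (- (g z)%:E) 0)%E.
  by apply: eq_integral => z _; rewrite unlock.
have fp := integrable_pos_fin_num _ hfc; have fn := integrable_neg_fin_num _ hfc.
rewrite Ep in fp; rewrite En in fn.
rewrite !Ep !En kp; last by move=> x; rewrite le_max lexx orbT.
rewrite kn; last by move=> x; rewrite le_max lexx orbT.
have H (A B : \bar R) : A \is a fin_num -> B \is a fin_num ->
    fine (k%:E * A - k%:E * B)%E = k * fine (A - B)%E.
  by case: A => [x| |]//; case: B => [y| |]// _ _; rewrite /= mulrBr.
exact: H (fp (measurable_cc a b)) (fn (measurable_cc a b)).
Qed.

End substitution.

(** * Integrands known only off a null set *)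

Section integral_ae.
Context {R : realType}.
Local Notation mu := (@lebesgue_measure R).
Local Open Scope ereal_scope.
Import HBNNSimple.

(* The integral of a function that is not known to be measurable. *)
Lemma integral_eq_off_null (D N : set (measurableTypeR R)) (f g : R -> \bar R) :
  measurable D -> measurable N -> mu N = 0 -> measurable_fun D g ->
  (forall x, D x -> ~ N x -> f x = g x) ->
  \int[mu]_(x in D) f x = \int[mu]_(x in D) g x.
Proof.
move=> mD mN muN mg fg.
have nn (f1 g1 : R -> \bar R) : (forall x, 0 <= f1 x) -> (forall x, 0 <= g1 x) ->
    measurable_fun D g1 -> (forall x, D x -> ~ N x -> f1 x = g1 x) ->
    \int[mu]_(x in D) f1 x = \int[mu]_(x in D) g1 x.
  move=> f0 g0 mg1 fg1; apply/eqP; rewrite eq_le; apply/andP; split.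
  (* The integral of [f1] is a supremum over the simple functions below it, and each of these is
     dominated by [g1] off [N]. *)
  - rewrite [X in X <= _]ge0_integralE//; apply: ge_ereal_sup => _ [h hf <-].
    rewrite -integralT_nnsfun.
    rewrite (@ge0_negligible_integral _ _ _ mu setT N)//; last 2 first.
      exact/measurable_EFinP.
      by move=> x _; rewrite lee_fin.
    rewrite [leRHS]integral_mkcond.
    have mgD : measurable_fun setT (g1 \_ D) by exact/(measurable_restrictT _ mD).
    have gD0 x : 0 <= (g1 \_ D) x by rewrite patchE; case: ifP.
    apply: (@le_trans _ _ (\int[mu]_(x in setT `\` N) (g1 \_ D) x)).
      apply: ge0_le_integral => //.
      + exact: measurableD.
      + by move=> x _; rewrite lee_fin.
      + by apply: measurable_funTS; exact/measurable_EFinP.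
      + exact: measurable_funTS.
      + move=> x [_ nNx]; rewrite (le_trans (hf x))// !patchE; case: ifP => // xD.
        by rewrite fg1//; exact: set_mem.
    by apply: ge0_subset_integral => //; exact: measurableD.
  - rewrite (@ge0_negligible_integral _ _ _ mu D N)// !ge0_integralE//.
    apply: le_ereal_sup => _ [h hf <-]; exists h => //= x.
    rewrite (le_trans (hf x))// !patchE; case: ifPn => [|_]; last by case: ifP.
    by rewrite in_setD => /andP[xD /negP xN]; rewrite xD fg1//; [exact: set_mem|move=> /mem_set].
rewrite integralE [RHS]integralE; congr (_ - _); apply: nn => //.
- exact: measurable_funepos.
- by move=> x Dx nNx; rewrite unlock fg.
- exact: measurable_funeneg.
- by move=> x Dx nNx; rewrite unlock fg.
Qed.

End integral_ae.

(** * Measurability of a continuous function of two measurable vectors *)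

Section measurable_pair.
Context {R : realType} {n : nat}.
Implicit Types (f : R -> 'rV[R]_n) (x y v w : 'rV[R]_n).

Lemma rational_approx x (e : R) : (0 < e)%R ->
  exists q : 'rV[rat]_n, forall i, (`|x ord0 i - ratr (q ord0 i)| < e)%R.
Proof.
move=> e0.
have H (i : 'I_n) : exists q : rat, `|x ord0 i - ratr q| < e.
  have [q] : exists q : rat, (ratr q \in `]x ord0 i - e, x ord0 i + e[).
    by apply: rat_in_itvoo; lra.
  by rewrite in_itv/= => /andP[q1 q2]; exists q; rewrite ltr_norml; apply/andP; split; lra.
have [q qP] := choice H; exists (\row_i q i) => i; rewrite mxE; exact: qP.
Qed.

(** An open set of pairs is a countable union of boxes with rational centres, and the preimage of a
    box is a finite intersection of conditions on coordinates. *)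
Lemma measurable_open_pair (D : set (measurableTypeR R)) (f1 f2 : R -> 'rV[R]_n) (O : 'rV[R]_n -> 'rV[R]_n -> Prop) :
  measurable D ->
  (forall i, measurable_fun D (fun r => f1 r ord0 i)) ->
  (forall i, measurable_fun D (fun r => f2 r ord0 i)) ->
  (forall x v, O x v -> exists2 e : R, 0 < e & forall y w,
     enorm (y - x) < e -> enorm (w - v) < e -> O y w) ->
  measurable (D `&` [set r | O (f1 r) (f2 r)]).
Proof.
move=> mD m1 m2 oO.
pose box (p : 'rV[rat]_n * 'rV[rat]_n * nat) : set (measurableTypeR R) :=
  (\big[setI/D]_(i < n) (D `&` [set r | `|f1 r ord0 i - ratr (p.1.1 ord0 i)| < p.2.+1%:R^-1])) `&`
  (\big[setI/D]_(i < n) (D `&` [set r | `|f2 r ord0 i - ratr (p.1.2 ord0 i)| < p.2.+1%:R^-1])).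
have boxP p r : box p r <-> [/\ D r, forall i, `|f1 r ord0 i - ratr (p.1.1 ord0 i)| < p.2.+1%:R^-1 &
    forall i, `|f2 r ord0 i - ratr (p.1.2 ord0 i)| < p.2.+1%:R^-1].
  have bigP (A : 'I_n -> set R) : (\big[setI/D]_(i < n) (D `&` A i)) r <-> D r /\ forall i, A i r.
    split; last first.
      by move=> [Dr Ar]; elim/big_ind: _ => // i _; split.
    move=> H; split; last by move=> i; move: H; rewrite (bigD1 i)//= => -[[]].
    elim/big_ind: _ H => // [B C HB HC [/HB]|i _ []] //.
  rewrite /box /=; split.
    by move=> [/bigP[Dr h1] /bigP[_ h2]].
  by move=> [Dr h1 h2]; split; apply/bigP.
have mbox p : measurable (box p).
  have msub (h : R -> R) (q e : R) : measurable_fun D h ->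
      measurable (D `&` [set r | `|h r - q| < e]).
    move=> mf; have mfq : measurable_fun D (fun r => `|h r - q|).
      apply: measurableT_comp => //; exact: measurable_funB.
    have := mfq mD `]-oo, e[%classic (measurable_itv _).
    by congr (measurable (_ `&` _)); apply/seteqP; split=> r; rewrite /= in_itv.
  by apply: measurableI; elim/big_ind: _ => // [A B|i _]; [exact: measurableI|exact: msub|exact: measurableI|exact: msub].
pose G p := if `[< box p `<=` [set r | O (f1 r) (f2 r)] >] then box p else set0.
have -> : D `&` [set r | O (f1 r) (f2 r)] = \bigcup_p G p.
  apply/seteqP; split=> r.
    move=> [Dr /= Or]; have [e e0 eO] := oO _ _ Or.
    have [k ke] : exists k : nat, k.+1%:R^-1 < e / (2 * (n%:R + 1)).
      have h : 0 < e / (2 * (n%:R + 1)) by rewrite divr_gt0// mulr_gt0// ltr_wpDl.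
      exists (Num.bound (e / (2 * (n%:R + 1)))^-1).
      rewrite invf_plt ?posrE ?ltr0n//.
      rewrite (lt_le_trans (archi_boundP _))// ?invr_ge0 ?(ltW h)//.
      by rewrite ler_nat.
    have k0 : 0 < k.+1%:R^-1 :> R by rewrite invr_gt0 ltr0n.
    have [q1 h1] := rational_approx (f1 r) _ k0.
    have [q2 h2] := rational_approx (f2 r) _ k0.
    exists (q1, q2, k) => //; rewrite /G ifT; first by apply/boxP.
    have small (x y : 'rV[R]_n) (q : 'rV[rat]_n) :
        (forall i, `|x ord0 i - ratr (q ord0 i)| < k.+1%:R^-1) ->
        (forall i, `|y ord0 i - ratr (q ord0 i)| < k.+1%:R^-1) -> enorm (y - x) < e.
      move=> hx hy; rewrite (le_lt_trans (enorm_le_sum _))//.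
      apply: (@le_lt_trans _ _ (\sum_(i < n) (2 * k.+1%:R^-1))).
        apply: ler_sum => i _; rewrite !mxE -(subrKA (ratr (q ord0 i))).
        rewrite (le_trans (ler_normD _ _))// (distrC _ (x _ _)).
        by rewrite mulrDl !mul1r lerD// ltW.
      rewrite sumr_const card_ord -[X in X < _]mulr_natl.
      have n1 : 0 < 2 * (n%:R + 1) :> R by rewrite mulr_gt0// ltr_wpDl.
      rewrite ltr_pdivlMr// in ke.
      have : n%:R * (2 * k.+1%:R^-1) < k.+1%:R^-1 * (2 * (n%:R + 1)) :> R.
        rewrite mulrDr mulr1 mulrDr; have -> : n%:R * (2 * k.+1%:R^-1) = k.+1%:R^-1 * (2 * n%:R) :> R by ring.
        by rewrite ltrDl mulr_gt0.
      by move/lt_trans; apply.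
    apply/asboolP => s /boxP[_ s1 s2]; apply: eO; [exact: small h1 s1|exact: small h2 s2].
  move=> [p _]; rewrite /G; case: ifPn => // /asboolP pO rp.
  by split; [have /boxP[] := rp|exact: pO].
apply: countable_bigcupT_measurable; first exact: countableP.
by move=> p; rewrite /G; case: ifP.
Qed.

(** Continuity of [K] holds over [U] only; intersecting its superlevel sets with [U], where [f1]
    takes its values, makes them open. *)
Lemma measurable_continuous_pair (U : set 'rV[R]_n) (K : 'rV[R]_n -> 'rV[R]_n -> R)
    (D : set (measurableTypeR R)) (f1 f2 : R -> 'rV[R]_n) :
  measurable D -> open U ->
  (forall i, measurable_fun D (fun r => f1 r ord0 i)) ->
  (forall i, measurable_fun D (fun r => f2 r ord0 i)) ->
  (forall r, D r -> U (f1 r)) ->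
  (forall x v, U x -> forall e : R, 0 < e -> exists2 d : R, 0 < d & forall y w,
     enorm (y - x) < d -> enorm (w - v) < d -> `|K y w - K x v| < e) ->
  measurable_fun D (fun r => K (f1 r) (f2 r)).
Proof.
move=> mD oU m1 m2 DU cK.
apply: (measurability _ (RGenOInfty.measurableE R)) => //= _ [_ [a ->] <-].
have -> : D `&` (fun r => K (f1 r) (f2 r)) @^-1` `]a, +oo[%classic =
    D `&` [set r | U (f1 r) /\ a < K (f1 r) (f2 r)].
  apply/seteqP; split=> r /= [Dr]; rewrite in_itv/= andbT.
    by move=> h; split=> //; split=> //; exact: DU.
  by move=> [_ h].
apply: (measurable_open_pair D f1 f2 (fun x v => U x /\ a < K x v)) => // x v [Ux ax].
have [d1 d10 h1] := (open_enormP _).1 oU x Ux.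
have [d2 d20 h2] := cK x v Ux (K x v - a) (ltac:(by rewrite subr_gt0)).
exists (Num.min d1 d2); first by rewrite lt_min d10.
move=> y w; rewrite !lt_min => /andP[y1 y2] /andP[_ w2].
split; first exact: h1.
by have := h2 y w y2 w2; rewrite ltr_norml => /andP[]; lra.
Qed.

End measurable_pair.

(** * Curves of finite energy *)

Section curves.
Context {R : realType} {n : nat}.
Implicit Types (g w : R -> 'rV[R]_n) (x y v : 'rV[R]_n) (A : set 'rV[R]_n).

(** The velocity is carried along as an integrable function, so that restriction, gluing and
    reparametrisation are statements about integrals. Square integrability is what finite cost
    forces. *)
Definition curve A (a b : R) g w : Prop :=
  [/\ forall i, itg a b (fun r => w r ord0 i),
      forall i r s, a <= r -> r <= s -> s <= b ->
        g s ord0 i - g r ord0 i = int r s (fun z => w z ord0 i),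
      forall r, a <= r <= b -> A (g r) &
      itg a b (fun r => enorm (w r) ^+ 2)].

Lemma curve_sub A a b a' b' g w : a <= a' -> b' <= b -> curve A a b g w -> curve A a' b' g w.
Proof.
move=> aa bb [h1 h2 h3 h4]; split.
- by move=> i; exact: itg_sub (h1 i).
- by move=> i r s ar rs sb; apply: h2; [exact: le_trans ar| |exact: le_trans bb].
- by move=> r /andP[ar rb]; apply: h3; rewrite (le_trans aa)//= (le_trans rb).
- exact: itg_sub h4.
Qed.

Lemma measurable_enorm_sqr (D : set (measurableTypeR R)) w v : measurable D ->
  (forall i, measurable_fun D (fun r => w r ord0 i)) ->
  measurable_fun D (fun r => enorm (w r - v) ^+ 2).
Proof.
move=> mD mw.
have -> : (fun r => enorm (w r - v) ^+ 2) =
    (fun r => \sum_(i < n) (w r ord0 i - v ord0 i) ^+ 2).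
  by apply/funext => r; rewrite sqr_enorm; apply: eq_bigr => i _; rewrite !mxE expr2.
apply: measurable_sum => i; apply: measurable_funX.
exact: measurable_funB.
Qed.

Lemma measurable_enorm (D : set (measurableTypeR R)) w : measurable D ->
  (forall i, measurable_fun D (fun r => w r ord0 i)) ->
  measurable_fun D (fun r => enorm (w r)).
Proof.
move=> mD mw; apply: (measurable_continuous_pair setT (fun _ v => enorm v) D w w) => //.
  exact: openT.
move=> x v _ e e0; exists e => // y w' _ h.
rewrite (le_lt_trans _ h)// ler_norml ler_enormB andbT.
by rewrite lerNl opprB (le_trans (ler_enormB _ _))// enormB.
Qed.

Lemma curve_itg_sqrB A a b g w v : curve A a b g w -> itg a b (fun r => enorm (w r - v) ^+ 2).
Proof.
move=> [h1 _ _ h4]; apply: (itg_le _ _ _ (fun r => 2 * enorm (w r) ^+ 2 + 2 * enorm v ^+ 2)).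
- by apply: measurable_enorm_sqr => // i; exact: itg_measurable (h1 i).
- move=> r _; rewrite ger0_norm ?sqr_ge0//.
  have := sqr_ge0 (enorm (w r) - enorm v); rewrite sqrrB.
  have h := enormBD (w r) v.
  have : enorm (w r - v) ^+ 2 <= (enorm (w r) + enorm v) ^+ 2.
    by rewrite lerXn2r// ?nnegrE ?addr_ge0 ?enorm_ge0.
  rewrite sqrrD; lra.
- by apply: itgD; [exact: itgZ|exact: itg_cst].
Qed.

Lemma amgm (x l : R) : 0 < l -> x <= l * x ^+ 2 / 2 + 1 / (2 * l).
Proof.
move=> l0; have -> : l * x ^+ 2 / 2 + 1 / (2 * l) = x + (l * x - 1) ^+ 2 / (2 * l).
  by field; rewrite gt_eqF.
by rewrite lerDl divr_ge0 ?sqr_ge0// mulr_ge0// ltW.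
Qed.

Lemma curve_itg_enorm A a b g w : curve A a b g w -> itg a b (fun r => enorm (w r)).
Proof.
move=> [h1 _ _ h4]; apply: (itg_le _ _ _ (fun r => 2^-1 * enorm (w r) ^+ 2 + 2^-1)).
- by apply: measurable_enorm => // i; exact: itg_measurable (h1 i).
- move=> r _; rewrite ger0_norm ?enorm_ge0//.
  by have := amgm (enorm (w r)) 1 ltr01; lra.
- by apply: itgD; [exact: itgZ|exact: itg_cst].
Qed.

Lemma itg_sum (I : finType) a b (h : I -> R -> R) : (forall i, itg a b (h i)) ->
  itg a b (fun r => \sum_i h i r) /\ int a b (fun r => \sum_i h i r) = \sum_i int a b (h i).
Proof.
move=> hi.
have H (s : seq I) : itg a b (fun r => \sum_(i <- s) h i r) /\
    int a b (fun r => \sum_(i <- s) h i r) = \sum_(i <- s) int a b (h i).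
  elim: s => [|i s [IH1 IH2]].
    have E : (fun r => \sum_(i <- [::]) h i r) = (fun=> 0) by apply/funext => r; rewrite big_nil.
    rewrite E big_nil; split; first exact: itg_cst.
    by have := @intB R a b (fun=> 0) (fun=> 0) (itg_cst _ _ _) (itg_cst _ _ _);
      under eq_int do rewrite subr0; rewrite subrr.
  have E : (fun r => \sum_(j <- i :: s) h j r) = (fun r => h i r + \sum_(j <- s) h j r).
    by apply/funext => r; rewrite big_cons.
  by rewrite E big_cons -IH2; split; [exact: itgD|exact: intD].
by have := H (index_enum I).
Qed.

Lemma curve_dotv A a b g w v r s : curve A a b g w -> a <= r -> r <= s -> s <= b ->
  itg r s (fun z => dotv (w z) v) /\ dotv (g s - g r) v = int r s (fun z => dotv (w z) v).
Proof.
move=> [h1 h2 _ _] ar rs sb.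
have hi i : itg r s (fun z => v ord0 i * w z ord0 i) by apply/itgZ/(itg_sub _ _ _ _ _ ar sb).
have E : (fun z => dotv (w z) v) = (fun z => \sum_i v ord0 i * w z ord0 i).
  by apply/funext => z; apply: eq_bigr => i _; rewrite mulrC.
have [k1 k2] := itg_sum _ r s _ hi.
rewrite E; split=> //; rewrite k2; apply: eq_bigr => i _.
by rewrite intZ ?(itg_sub _ _ _ _ _ ar sb)// !mxE h2// mulrC.
Qed.

(** The increment is tested against itself, and Cauchy-Schwarz is applied under the integral. *)
Lemma curve_dist A a b g w r s : curve A a b g w -> a <= r -> r <= s -> s <= b ->
  enorm (g s - g r) <= int r s (fun z => enorm (w z)).
Proof.
move=> cw ar rs sb.
have [->|d0] := eqVneq (g s - g r) 0; first by rewrite enorm0; apply: int_ge0 => *; exact: enorm_ge0.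
have [k1 k2] := curve_dotv _ _ _ _ _ (g s - g r) _ _ cw ar rs sb.
have ie := itg_sub _ _ _ _ _ ar sb (curve_itg_enorm _ _ _ _ _ cw).
rewrite -(ler_pM2l (enorm_gt0 _ d0)) -expr2 sqr_enorm k2 -intZ//.
by apply: int_le => //; [exact: itgZ|move=> z _; rewrite mulrC cauchy_schwarz].
Qed.

(* The free parameter [l] plays the role of an optimised Cauchy-Schwarz inequality. *)
Lemma curve_dist_energy A a b g w r s l : curve A a b g w -> a <= r -> r <= s -> s <= b -> 0 < l ->
  enorm (g s - g r) <= l / 2 * int r s (fun z => enorm (w z) ^+ 2) + (s - r) / (2 * l).
Proof.
move=> cw ar rs sb l0; rewrite (le_trans (curve_dist _ _ _ _ _ _ _ cw ar rs sb))//.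
have ie := itg_sub _ _ _ _ _ ar sb (curve_itg_enorm _ _ _ _ _ cw).
have [_ _ _ h4] := cw; have {}h4 := itg_sub _ _ _ _ _ ar sb h4.
have -> : (s - r) / (2 * l) = int r s (fun=> 1 / (2 * l)) by rewrite int_cst// mul1r.
rewrite -intZ// -intD//; [|exact: itgZ|exact: itg_cst].
apply: int_le => //; first by apply: itgD; [exact: itgZ|exact: itg_cst].
by move=> z _; have := amgm (enorm (w z)) l l0; rewrite mulrAC.
Qed.

Lemma curve_continuous A a b g w r : curve A a b g w -> a <= r <= b ->
  forall e : R, 0 < e -> exists2 d : R, 0 < d &
    forall s, a <= s <= b -> `|s - r| < d -> enorm (g s - g r) < e.
Proof.
move=> cw /andP[ar rb] e e0.
have [_ _ _ h4] := cw.
pose E := int a b (fun z => enorm (w z) ^+ 2).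
have E0 : 0 <= E by apply: int_ge0 => z _; exact: sqr_ge0.
(* With this weight the energy term is at most [e / 2]; time steps below [e * l] keep the other term
   below [e / 2]. *)
have [l l0 lE] : exists2 l : R, 0 < l & l * (E + 1) = e.
  exists (e / (E + 1)); first by rewrite divr_gt0//; lra.
  by rewrite mulfVK// gt_eqF//; lra.
have main s1 s2 : a <= s1 -> s1 <= s2 -> s2 <= b -> s2 - s1 < e * l -> enorm (g s2 - g s1) < e.
  move=> a1 s12 b2 d12.
  rewrite (le_lt_trans (curve_dist_energy _ _ _ _ _ _ _ _ cw a1 s12 b2 l0))//.
  have EE : int s1 s2 (fun z => enorm (w z) ^+ 2) <= E.
    have i1 := itg_sub _ _ _ _ _ a1 (lexx b) h4.
    rewrite /E (int_cat a b s1)//; last exact: le_trans b2.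
    rewrite (int_cat s1 b s2)// addrCA lerDl addr_ge0// int_ge0// => *; exact: sqr_ge0.
  have h1 : l / 2 * int s1 s2 (fun z => enorm (w z) ^+ 2) <= l / 2 * E.
    by rewrite ler_wpM2l//; lra.
  have h2 : (s2 - s1) / (2 * l) < e / 2.
    by rewrite ltr_pdivrMr ?mulr_gt0//; lra.
  lra.
exists (e * l); first exact: mulr_gt0.
move=> s /andP[as_ sb]; rewrite ltr_norml => /andP[d1 d2].
have [rs|/ltW sr] := leP r s; first by apply: main => //; lra.
by rewrite enormB; apply: main => //; lra.
Qed.

End curves.

(** * The control problem with frozen measure flow *)

Section control.
Context {R : realType} {n : nat}.
Implicit Types (g w : R -> 'rV[R]_n) (x y v : 'rV[R]_n) (A U : set 'rV[R]_n).

(** With the measure flow frozen, [f x t] stands for [F x (m t)]: Lipschitz in [x], and continuous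
    in [t] uniformly over [A]. One constant [C] serves for all bounds, and [U] contains the
    [d0]-neighbourhood of [A]. *)
Record control_data A U (T : R) (L : 'rV[R]_n -> 'rV[R]_n -> R)
    (f : 'rV[R]_n -> R -> R) (C d0 : R) : Prop := {
  cd_T : 0 < T;
  cd_open : open U;
  cd_d0 : 0 < d0;
  cd_nbhd : forall x y, A x -> enorm (y - x) <= d0 -> U y;
  cd_L : lagrangian_bounds U L C;
  cd_Lcont : forall x v, U x -> forall e : R, 0 < e -> exists2 d : R, 0 < d &
    forall y (w' : 'rV[R]_n), enorm (y - x) < d -> enorm (w' - v) < d -> `|L y w' - L x v| < e;
  cd_flip : forall (t : R) x y, 0 <= t <= T -> segment_in U x y ->
    `|f x t - f y t| <= C * enorm (x - y);
  cd_fcont : forall t : R, 0 <= t <= T -> forall e : R, 0 < e -> exists2 d : R, 0 < d &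
    forall s, 0 <= s <= T -> `|s - t| < d -> forall x, A x -> `|f x s - f x t| <= e;
  cd_fbd : forall (t : R) x, 0 <= t <= T -> A x -> `|f x t| <= C }.

Definition lag L (f : 'rV[R]_n -> R -> R) g w (r : R) : R := L (g r) (w r) + f (g r) r.
Definition running L f (a b : R) g w : R := int a b (lag L f g w).

(** The value function as an infimum over curves of finite energy with terminal cost [h]; [vd_opt]
    supplies near-optimal curves instead of minimizers. *)
Record value_data A (T : R) L f (C : R) (h : 'rV[R]_n -> R) (u : R -> 'rV[R]_n -> R) : Prop := {
  vd_h : forall x, A x -> `|h x| <= C;
  vd_le : forall (t : R) g w, 0 <= t <= T -> curve A t T g w ->
    u t (g t) <= running L f t T g w + h (g T);
  vd_opt : forall (t : R) x, 0 <= t <= T -> A x -> forall e : R, 0 < e ->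
    exists g w, [/\ curve A t T g w, g t = x & running L f t T g w + h (g T) <= u t x + e] }.

Section lag.
Context (A U : set 'rV[R]_n) (T : R) (L : 'rV[R]_n -> 'rV[R]_n -> R)
  (f : 'rV[R]_n -> R -> R) (C d0 : R) (cd : control_data A U T L f C d0).

Lemma cd_sub x : A x -> U x.
Proof. by move=> Ax; apply: (cd_nbhd _ _ _ _ _ _ _ cd x) => //; rewrite subrr enorm0 ltW// (cd_d0 _ _ _ _ _ _ _ cd). Qed.

Lemma cd_segment x y : A x -> enorm (y - x) <= d0 -> segment_in U x y.
Proof.
move=> Ax yx s /andP[s0 s1]; apply: (cd_nbhd _ _ _ _ _ _ _ cd x) => //.
rewrite addrAC subrr add0r enormZ ger0_norm// (le_trans _ yx)//.
by rewrite ler_piMl ?enorm_ge0.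
Qed.

Lemma lag_potential_continuous a b g : 0 <= a -> b <= T ->
  (forall r, a <= r <= b -> A (g r)) ->
  (forall r, a <= r <= b -> forall e : R, 0 < e -> exists2 d : R, 0 < d &
    forall s, a <= s <= b -> `|s - r| < d -> enorm (g s - g r) < e) ->
  forall r, a <= r <= b -> forall e : R, 0 < e -> exists2 d : R, 0 < d &
    forall s, a <= s <= b -> `|s - r| < d -> `|f (g s) s - f (g r) r| < e.
Proof.
move=> a0 bT gA cg r rab e e0.
have ab s : a <= s <= b -> 0 <= s <= T.
  by move=> /andP[h1 h2]; rewrite (le_trans a0)//= (le_trans h2).
have e40 : 0 < e / 4 by lra.
have C0 : 0 < C by have [] := cd_L _ _ _ _ _ _ _ cd.
have d00 := cd_d0 _ _ _ _ _ _ _ cd.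
have [d1 d10 h1] := cd_fcont _ _ _ _ _ _ _ cd r (ab _ rab) _ e40.
have m0 : 0 < Num.min d0 (e / 4 / C) by rewrite lt_min d00 divr_gt0.
have [d2 d20 h2] := cg r rab _ m0.
exists (Num.min d1 d2); first by rewrite lt_min d10.
move=> s sab; rewrite lt_min => /andP[s1 s2].
have := h2 s sab s2; rewrite lt_min => /andP[g1 g2].
have seg : segment_in U (g r) (g s) by apply: cd_segment; [exact: gA|exact: ltW].
have k1 := h1 s (ab _ sab) s1 _ (gA _ rab).
have k2 := cd_flip _ _ _ _ _ _ _ cd s _ _ (ab _ sab) seg.
have k3 : C * enorm (g r - g s) <= e / 4.
  by rewrite enormB mulrC -ler_pdivlMr// ltW.
move: k1 k2; rewrite !ler_norml ltr_norml => /andP[? ?] /andP[? ?].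
by apply/andP; split; lra.
Qed.

Lemma continuous_on_int_itg a b (h : R -> R) : a <= b ->
  (forall r, a <= r <= b -> forall e : R, 0 < e -> exists2 d : R, 0 < d &
    forall s, a <= s <= b -> `|s - r| < d -> `|h s - h r| < e) -> itg a b h.
Proof.
move=> ab ch.
have ba0 : 0 <= b - a by lra.
have [|i _] := continuous_on_itg (b - a) (fun r => h (r + a)) ba0.
  move=> x xab e e0; have [|d dp hd] := ch (x + a) _ e e0; first by lra.
  exists d => // y yab xy; apply: hd; first by lra.
  by rewrite opprD addrACA subrr addr0.
have := @int_subst R 1 (- a) ltr01 (fun r => h (r + a)) a b.
rewrite !mul1r subrr => /(_ i)[+ _].
by apply: eq_itg => x _; rewrite mul1r subrK.
Qed.

Lemma curve_potential_itg a b g w : 0 <= a -> a <= b -> b <= T -> curve A a b g w ->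
  itg a b (fun r => f (g r) r).
Proof.
move=> a0 ab bT cw; apply: continuous_on_int_itg => //.
have [_ _ h3 _] := cw.
by apply: lag_potential_continuous => // r; exact: curve_continuous cw.
Qed.

Lemma curve_lagrangian_measurable (D : set (measurableTypeR R)) g w : measurable D ->
  (forall i, measurable_fun D (fun r => g r ord0 i)) ->
  (forall i, measurable_fun D (fun r => w r ord0 i)) ->
  (forall r, D r -> A (g r)) -> measurable_fun D (fun r => L (g r) (w r)).
Proof.
move=> mD mg mw DA.
apply: (measurable_continuous_pair U L D g w) => //; first exact: cd_open cd.
  by move=> r Dr; exact/cd_sub/DA.
exact: cd_Lcont cd.
Qed.

Lemma curve_coord_itg a b g w i : a <= b -> curve A a b g w -> itg a b (fun r => g r ord0 i).
Proof.
move=> ab cw; apply: continuous_on_int_itg => // r rab e e0.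
have [d d10 h] := curve_continuous _ _ _ _ _ _ cw rab e e0; exists d => // s sab sr.
apply: le_lt_trans (h s sab sr).
by have := coord_le_enorm (g s - g r) i; rewrite !mxE.
Qed.

Lemma curve_lagrangian_itg a b g w : a <= b -> curve A a b g w ->
  itg a b (fun r => L (g r) (w r)).
Proof.
move=> ab cw; have [h1 _ h3 h4] := cw.
apply: (itg_le _ _ _ (fun r => C * (1 + enorm (w r) ^+ 2))).
- apply: curve_lagrangian_measurable => // [i|i].
  + exact: itg_measurable (curve_coord_itg _ _ _ _ i ab cw).
  + exact: itg_measurable (h1 i).
- move=> r rab; have [_ H _ _ _] := cd_L _ _ _ _ _ _ _ cd.
  by have [] := H (g r) (w r) (cd_sub _ (h3 _ rab)).
- by apply/itgZ/itgD => //; exact: itg_cst.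
Qed.

Lemma curve_lag_itg a b g w : 0 <= a -> a <= b -> b <= T -> curve A a b g w ->
  itg a b (lag L f g w).
Proof.
move=> a0 ab bT cw; apply: itgD; first exact: curve_lagrangian_itg cw.
exact: curve_potential_itg cw.
Qed.

Lemma runningE a b g w : 0 <= a -> a <= b -> b <= T -> curve A a b g w ->
  running L f a b g w = int a b (fun r => L (g r) (w r)) + int a b (fun r => f (g r) r).
Proof.
move=> a0 ab bT cw; apply: intD; first exact: curve_lagrangian_itg cw.
exact: curve_potential_itg cw.
Qed.

Lemma running_cat a b c g w : 0 <= a -> a <= c -> c <= b -> b <= T -> curve A a b g w ->
  running L f a b g w = running L f a c g w + running L f c b g w.
Proof. by move=> a0 ac cb bT cw; apply: int_cat => //; apply: curve_lag_itg => //; exact: le_trans cb. Qed.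

End lag.
End control.

(** * Pointwise perturbation of the Lagrangian *)

Section perturbation.
Context {R : realType} {n : nat}.
Implicit Types (x y v w h : 'rV[R]_n).

(** Young's inequality with weight [lam] on the cross terms [Z * (1 + W)], where [Z] stands for
    [enorm (w - v)] and [W] for [enorm w]. *)
Lemma perturbation_scalar (C V W Z a r lam tau : R) : 0 <= C -> 0 <= V -> 0 <= W -> 0 <= Z ->
  0 <= a -> 0 <= r -> 0 <= tau -> 0 < lam ->
  C * (3 * (1 + V) * Z * (1 + W) + 3 * (1 + V) ^+ 2 * r * (1 + W)) + 12 * C * (1 + W ^+ 2) * (a + tau)
  <= 12 * C * (1 + V) ^+ 2 * (Z ^+ 2 / lam + (lam + r + tau + a) * (1 + W ^+ 2)).
Proof.
move=> C0 V0 W0 Z0 a0 r0 t0 l0.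
have h1 : Z * (1 + W) <= Z ^+ 2 / lam + lam * (1 + W ^+ 2).
  have h : 0 <= (Z / lam - (1 + W) / 2) ^+ 2 by exact: sqr_ge0.
  have {}h : 0 <= lam * (Z / lam - (1 + W) / 2) ^+ 2 by apply: mulr_ge0 => //; exact: ltW.
  have e : lam * (Z / lam - (1 + W) / 2) ^+ 2 = Z ^+ 2 / lam - Z * (1 + W) + lam * (1 + W) ^+ 2 / 4.
    by field; rewrite gt_eqF.
  have k : 0 <= lam * (1 - W) ^+ 2 by apply: mulr_ge0; [exact: ltW|exact: sqr_ge0].
  have k2 : 0 <= lam * (1 + W ^+ 2) by apply: mulr_ge0; [exact: ltW|rewrite addr_ge0 ?sqr_ge0].
  rewrite e in h; move: h k k2; move: (Z ^+ 2 / lam) => q; nra.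
have h2 : 1 + W <= 2 * (1 + W ^+ 2) by nra.
have Q0 : 0 <= Z ^+ 2 / lam by rewrite divr_ge0 ?sqr_ge0 ?ltW.
have W2 : 0 <= 1 + W ^+ 2 by rewrite addr_ge0 ?sqr_ge0.
have VV : 1 + V <= (1 + V) ^+ 2 by nra.
have V1 : 1 <= (1 + V) ^+ 2 by nra.
have V20 : 0 <= (1 + V) ^+ 2 by exact: sqr_ge0.
move: h1 h2 Q0 W2 VV V1 V20; move: (Z ^+ 2 / lam) (1 + W ^+ 2) ((1 + V) ^+ 2) => q p b h1 h2 q0 p0 VV V1 b0.
have s1 : (1 + V) * (Z * (1 + W)) <= b * (q + lam * p).
  apply: ler_pM => //; [lra|rewrite mulr_ge0//; lra].
have s2 : b * r * (1 + W) <= b * r * (2 * p) by rewrite ler_wpM2l// mulr_ge0.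
have s3 : p * (a + tau) <= b * (p * (a + tau)) by rewrite ler_peMl// mulr_ge0// addr_ge0.
have s4 : 0 <= b * q by exact: mulr_ge0.
have s5 : 0 <= b * (lam * p) by rewrite !mulr_ge0// ltW.
have s6 : 0 <= b * r * p by rewrite !mulr_ge0.
have -> : 12 * C * b * (q + (lam + r + tau + a) * p) =
  C * (12 * (b * q) + 12 * (b * (lam * p)) + 12 * (b * r * p) + 12 * (b * (p * (a + tau)))) by ring.
have -> : C * (3 * (1 + V) * Z * (1 + W) + 3 * b * r * (1 + W)) + 12 * C * p * (a + tau) =
  C * (3 * ((1 + V) * (Z * (1 + W))) + 3 * (b * r * (1 + W)) + 12 * (p * (a + tau))) by ring.
rewrite ler_wpM2l//; lra.
Qed.

(** First-order expansion of the cost of a modified arc: the point [y] moves to [y + phi *: h], the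
    velocity [w] becomes [(1 - al)^-1 *: (w + be *: h)], and time is dilated by [1 - al]. The linear
    part is frozen at [(x, v)]; its coefficient in [al] is the Legendre energy. The weight [lam]
    balances the deviation of [w] from [v] against the other errors. *)
Lemma perturbation_pointwise (U : set 'rV[R]_n) L (C V : R) : lagrangian_bounds U L C -> 0 <= V ->
  forall x y v w h (al be phi tau r lam : R),
  U y -> segment_in U y (y + phi *: h) -> segment_in U y x ->
  enorm v <= V -> `|phi| <= 1 -> `|al| + `|be| * enorm h <= 1 / 2 ->
  0 <= tau -> enorm h <= tau * (`|al| + `|be| * enorm h) -> enorm (y - x) <= r -> 0 < lam ->
  (1 - al) * L (y + phi *: h) ((1 - al)^-1 *: (w + be *: h)) <=
    L y w + al * (dotv (DvL L x v) v - L x v) + be * dotv (DvL L x v) h +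
    12 * C * (1 + V) ^+ 2 * (`|al| + `|be| * enorm h) *
      (enorm (w - v) ^+ 2 / lam + (lam + r + tau + (`|al| + `|be| * enorm h)) * (1 + enorm w ^+ 2)).
Proof.
move=> [C0 HL HD [HQ HDL] [HLx HDx]] V0 x y v w h al be phi tau r lam Uy seg1 seg2 vV phi1 ale tau0 htau yr lam0.
have W0 := enorm_ge0 w; have Z0 := enorm_ge0 (w - v); have h0 := enorm_ge0 h.
have r0 : 0 <= r by apply: le_trans yr; exact: enorm_ge0.
have bh0 : 0 <= `|be| * enorm h by rewrite mulr_ge0.
have al0 := normr_ge0 al.
have al2 : `|al| <= 1 / 2 by lra.
have k0 : 0 < 1 - al by move: al2; rewrite ler_norml => /andP[]; lra.
have k32 : 1 - al <= 3 / 2 by move: al2; rewrite ler_norml => /andP[]; lra.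
have l2 : (1 - al)^-1 <= 2.
  rewrite -[leLHS]mul1r ler_pdivrMr//; move: al2; rewrite ler_norml => /andP[]; lra.
have l0 : 0 < (1 - al)^-1 by rewrite invr_gt0.
have [w' ew'] : exists w', w' = (1 - al)^-1 *: (w + be *: h) by eexists.
rewrite -ew'.
have nbh : enorm (be *: h) = `|be| * enorm h by rewrite enormZ.
have nw' : enorm w' <= 2 * (enorm w + 1 / 2).
  rewrite ew' enormZ gtr0_norm// (ler_pM (ltW l0) (enorm_ge0 _))//.
  by have := enormD w (be *: h); rewrite nbh; lra.
have dw : (1 - al) *: (w' - w) = al *: w + be *: h.
  rewrite ew' scalerBr scalerA mulfV ?gt_eqF// scale1r scalerBl scale1r.
  by rewrite opprB addrC addrA subrK.
have ndw : enorm (w' - w) <= 2 * ((`|al| + `|be| * enorm h) * (1 + enorm w)).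
  have : enorm ((1 - al) *: (w' - w)) <= `|al| * enorm w + `|be| * enorm h.
    by rewrite dw -(enormZ al) -(enormZ be) enormD.
  rewrite enormZ gtr0_norm// => k.
  have : enorm (w' - w) <= 2 * (`|al| * enorm w + `|be| * enorm h).
    have -> : enorm (w' - w) = (1 - al)^-1 * ((1 - al) * enorm (w' - w)).
      by rewrite mulrA mulVf ?mul1r ?gt_eqF.
    by rewrite (ler_pM (ltW l0))// mulr_ge0 ?enorm_ge0// ltW.
  move=> /le_trans; apply; rewrite ler_pM2l//.
  have := mulr_ge0 bh0 W0; lra.
have F1 : L (y + phi *: h) w' - L y w' <= 8 * C * (1 + enorm w ^+ 2) * enorm h.
  have := HLx _ _ w' seg1; rewrite opprD addNKr enormN enormZ distrC.
  move=> /(le_trans (ler_norm _)) /le_trans; apply.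
  have -> : 8 * C * (1 + enorm w ^+ 2) * enorm h = C * (8 * (1 + enorm w ^+ 2)) * enorm h by ring.
  have C0' := ltW C0.
  apply: ler_pM; [by rewrite mulr_ge0 ?addr_ge0 ?sqr_ge0|by rewrite mulr_ge0| |by rewrite ler_piMl].
  rewrite ler_pM2l//; move: nw' (enorm_ge0 w'); move: (enorm w') (enorm w) W0 => a b b0 ab a0.
  have : a ^+ 2 <= (2 * (b + 1 / 2)) ^+ 2 by rewrite lerXn2r// nnegrE; lra.
  have := sqr_ge0 (2 * b - 1); rewrite !expr2; lra.
(* The dilation factor disappears from the linear term because [(1 - al) *: (w' - w)] equals
   [al *: w + be *: h]. *)
have F2 : (1 - al) * (L y w' - L y w) <= al * dotv (DvL L y w) w + be * dotv (DvL L y w) h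
    + 12 * C * (`|al| + `|be| * enorm h) ^+ 2 * (1 + enorm w ^+ 2).
  have [_] := HQ y w (w' - w) Uy; rewrite (addrC w) subrK => q.
  have e : (1 - al) * dotv (DvL L y w) (w' - w) = al * dotv (DvL L y w) w + be * dotv (DvL L y w) h.
    by rewrite -[al * _]dotvZr -[be * _]dotvZr -dotvDr -dw dotvZr.
  rewrite -e.
  have q2 : (1 - al) * (C * enorm (w' - w) ^+ 2) <= 12 * C * (`|al| + `|be| * enorm h) ^+ 2 * (1 + enorm w ^+ 2).
    have -> : 12 * C * (`|al| + `|be| * enorm h) ^+ 2 * (1 + enorm w ^+ 2) =
       3 / 2 * (C * (8 * (`|al| + `|be| * enorm h) ^+ 2 * (1 + enorm w ^+ 2))) by field.
    apply: ler_pM => //; first exact: ltW.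
      by rewrite mulr_ge0 ?sqr_ge0 ?ltW.
    rewrite ler_pM2l//.
    move: ndw (enorm_ge0 (w' - w)); move: (enorm (w' - w)) (enorm w) W0 => d b b0.
    have : 0 <= `|al| + `|be| * enorm h by lra.
    move: (`|al| + `|be| * enorm h) => a a0 hd d0.
    have : d ^+ 2 <= (2 * (a * (1 + b))) ^+ 2 by rewrite lerXn2r// nnegrE mulr_ge0// mulr_ge0//; lra.
    have := mulr_ge0 (sqr_ge0 a) (sqr_ge0 (b - 1)); rewrite !expr2; lra.
  move: q => /(ler_wpM2l (ltW k0)); move: q2; move: (dotv _ (w' - w)) (enorm (w' - w) ^+ 2) => d1 d2.
  move: (12 * _ * _ * _) => d3; rewrite !mulrBr; lra.
have FD : enorm (DvL L y w - DvL L x v) <= C * enorm (w - v) + C * (1 + V) * r.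
  apply: (le_trans (enorm_triangle _ (DvL L y v) _)).
  apply: lerD; first exact: HDL.
  apply: (le_trans (HDx _ _ v seg2)).
  have C0' := ltW C0.
  apply: ler_pM => //; rewrite ?mulr_ge0 ?addr_ge0 ?enorm_ge0//.
  by rewrite ler_pM2l// lerD2l.
have F3 : be * dotv (DvL L y w) h - be * dotv (DvL L x v) h <= `|be| * enorm h * (C * enorm (w - v) + C * (1 + V) * r).
  rewrite -mulrBr -dotvBl (le_trans (ler_norm _))// normrM -mulrA ler_wpM2l//.
  by rewrite (le_trans (cauchy_schwarz_norm _ _))// mulrC ler_wpM2l.
(* Freezing the energy at [(x, v)]: the difference is split into pieces each of which carries a
   factor [enorm (w - v)] or [r]. *)
have F4 : `|dotv (DvL L y w) w - L y w - (dotv (DvL L x v) v - L x v)| <=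
    C * (3 * (1 + V) * enorm (w - v) * (1 + enorm w) + 3 * (1 + V) ^+ 2 * r * (1 + enorm w)).
  have -> : dotv (DvL L y w) w - L y w - (dotv (DvL L x v) v - L x v) =
      dotv (DvL L y w - DvL L x v) w + dotv (DvL L x v - DvL L y v) (w - v)
      - (L y w - L y v - dotv (DvL L y v) (w - v)) - (L y v - L x v).
    by rewrite !dotvE; ring.
  have g1 : `|dotv (DvL L y w - DvL L x v) w| <= (C * enorm (w - v) + C * (1 + V) * r) * enorm w.
    by rewrite (le_trans (cauchy_schwarz_norm _ _))// ler_wpM2r.
  have nn : C * (1 + enorm v) * enorm (y - x) <= C * (1 + V) * r.
    have C0' := ltW C0.
    apply: ler_pM => //; rewrite ?mulr_ge0 ?addr_ge0 ?enorm_ge0//.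
    by rewrite ler_pM2l// lerD2l.
  have wv : enorm (w - v) <= enorm w + V by have := enormBD w v; lra.
  have g2 : `|dotv (DvL L x v - DvL L y v) (w - v)| <= C * (1 + V) * r * (enorm w + V).
    rewrite (le_trans (cauchy_schwarz_norm _ _))// ler_pM ?enorm_ge0//.
    by rewrite enormB (le_trans (HDx _ _ v seg2)).
  have g3 : `|L y w - L y v - dotv (DvL L y v) (w - v)| <= C * (enorm (w - v) * (enorm w + V)).
    have [q1 q2] := HQ y v (w - v) Uy; rewrite (addrC v) subrK in q1 q2.
    rewrite ger0_norm; last first.
      by rewrite -(pmulr_rge0 _ C0) (le_trans _ q1)// sqr_ge0.
    rewrite (le_trans q2)// ler_pM2l// expr2 ler_wpM2l//.
  have g4 : `|L y v - L x v| <= C * (1 + V ^+ 2) * r.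
    have C0' := ltW C0.
    apply: (le_trans (HLx _ _ v seg2)); apply: ler_pM => //;
      rewrite ?mulr_ge0 ?addr_ge0 ?sqr_ge0 ?enorm_ge0//.
    by rewrite ler_pM2l// lerD2l lerXn2r ?nnegrE ?enorm_ge0.
  apply: (@le_trans _ _ ((C * enorm (w - v) + C * (1 + V) * r) * enorm w + C * (1 + V) * r * (enorm w + V)
      + C * (enorm (w - v) * (enorm w + V)) + C * (1 + V ^+ 2) * r)).
    apply: (le_trans (ler_normB _ _)); apply: lerD => //.
    apply: (le_trans (ler_normB _ _)); apply: lerD => //.
    by apply: (le_trans (ler_normD _ _)); apply: lerD.
  have := mulr_ge0 Z0 W0; have := mulr_ge0 V0 W0; have := mulr_ge0 r0 (mulr_ge0 V0 W0).
  have := mulr_ge0 V0 Z0; have := mulr_ge0 r0 W0; have := mulr_ge0 r0 V0.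
  have := mulr_ge0 V0 (mulr_ge0 Z0 W0); have := mulr_ge0 r0 (mulr_ge0 V0 V0).
  have := mulr_ge0 (mulr_ge0 r0 (mulr_ge0 V0 V0)) W0.
  move: (enorm (w - v)) (enorm w) W0 Z0 => z W W0 z0.
  have -> : (C * z + C * (1 + V) * r) * W + C * (1 + V) * r * (W + V) + C * (z * (W + V)) + C * (1 + V ^+ 2) * r
    = C * ((z + (1 + V) * r) * W + (1 + V) * r * (W + V) + z * (W + V) + (1 + V ^+ 2) * r) by ring.
  move=> ? ? ? ? ? ? ? ? ?; rewrite ler_pM2l//; rewrite !expr2; lra.
have A0 : 0 <= `|al| + `|be| * enorm h by lra.
have sc := perturbation_scalar C V (enorm w) (enorm (w - v)) _ r lam tau (ltW C0) V0 W0 Z0 A0 r0 tau0 lam0.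
have F5 : al * (dotv (DvL L y w) w - L y w) - al * (dotv (DvL L x v) v - L x v) <=
    `|al| * (C * (3 * (1 + V) * enorm (w - v) * (1 + enorm w) + 3 * (1 + V) ^+ 2 * r * (1 + enorm w))).
  by rewrite -mulrBr (le_trans (ler_norm _))// normrM ler_wpM2l.
have F6 : `|be| * enorm h * (C * enorm (w - v) + C * (1 + V) * r) <= `|be| * enorm h *
    (C * (3 * (1 + V) * enorm (w - v) * (1 + enorm w) + 3 * (1 + V) ^+ 2 * r * (1 + enorm w))).
  rewrite ler_wpM2l// -mulrA -mulrDr ler_pM2l//.
  have := mulr_ge0 V0 Z0; have := mulr_ge0 V0 (mulr_ge0 Z0 W0); have := mulr_ge0 r0 V0.
  have := mulr_ge0 r0 (mulr_ge0 V0 V0); have := mulr_ge0 (mulr_ge0 r0 (mulr_ge0 V0 V0)) W0.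
  have := mulr_ge0 r0 W0; have := mulr_ge0 r0 (mulr_ge0 V0 W0); have := mulr_ge0 Z0 W0.
  move: (enorm (w - v)) (enorm w) W0 Z0 => z W W0 z0; rewrite !expr2; lra.
have F7 : (1 - al) * (8 * C * (1 + enorm w ^+ 2) * enorm h) <=
    12 * C * (1 + enorm w ^+ 2) * (tau * (`|al| + `|be| * enorm h)).
  have -> : 12 * C * (1 + enorm w ^+ 2) * (tau * (`|al| + `|be| * enorm h)) =
    3 / 2 * (8 * C * (1 + enorm w ^+ 2) * (tau * (`|al| + `|be| * enorm h))) by field.
  apply: ler_pM => //; [exact: ltW| |].
    by rewrite !mulr_ge0 ?addr_ge0 ?sqr_ge0// ltW.
  by rewrite ler_wpM2l// !mulr_ge0 ?addr_ge0 ?sqr_ge0// ltW.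
have F1' := ler_wpM2l (ltW k0) F1.
move: (ler_wpM2l A0 sc) F1' F2 F3 F5 F6 F7.
have : `|be| * enorm h = `|al| + `|be| * enorm h - `|al| by ring.
move: A0; move: (`|al| + `|be| * enorm h) => a; move: (`|be| * enorm h) => b a0 ->.
move: (C * (3 * _ * _ * _ + _)) (C * enorm _ + _) (enorm _ ^+ 2 / lam) (enorm w ^+ 2) => c1 c2 c3 c4.
move: (dotv (DvL L y w) w) (dotv (DvL L y w) h) (dotv (DvL L x v) h) (L y w') (dotv (DvL L x v) v - L x v).
move: (L (y + phi *: h) w') (L y w) ((1 + V) ^+ 2) => c5 c6 c7 c8 c9 c10 c11 c12.
rewrite !expr2; lra.
Qed.

End perturbation.

(** * Affine displacement and reparametrisation of curves *)

Section affine_curve.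
Context {R : realType} {n : nat}.
Implicit Types (g w : R -> 'rV[R]_n) (x y v h : 'rV[R]_n) (A U : set 'rV[R]_n).

Lemma eq_curve A a b g w g' w' : (forall r, a <= r <= b -> g r = g' r) ->
  (forall r, a <= r <= b -> w r = w' r) -> curve A a b g w -> curve A a b g' w'.
Proof.
move=> gg ww [h1 h2 h3 h4]; split.
- by move=> i; apply: eq_itg (h1 i) => r rab; rewrite ww.
- move=> i r s ar rs sb; rewrite -!gg ?ar ?rs ?sb ?(le_trans ar)//; last exact: le_trans sb.
  rewrite h2//; apply: eq_int => z /andP[z1 z2].
  by rewrite ww// (le_trans ar)//= (le_trans z2).
- by move=> r rab; rewrite -gg//; exact: h3.
- by apply: eq_itg h4 => r rab; rewrite ww.
Qed.

Lemma curve_perturb A a b g w h (be be0 : R) : a <= b -> curve A a b g w ->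
  (forall z, a <= z <= b -> A (g z + (be * z + be0) *: h)) ->
  curve A a b (fun z => g z + (be * z + be0) *: h) (fun z => w z + be *: h).
Proof.
move=> ab cw hA; have [h1 h2 _ _] := cw; split => //.
- move=> i; apply: (eq_itg _ _ (fun r => w r ord0 i + be * h ord0 i)).
    by move=> r _; rewrite !mxE.
  by apply: itgD => //; exact: itg_cst.
- move=> i r s ar rs sb.
  rewrite (eq_int _ _ _ (fun r => w r ord0 i + be * h ord0 i)); last by move=> ? _; rewrite !mxE.
  rewrite intD ?itg_cst//; last exact: itg_sub (h1 i).
  by rewrite int_cst// -h2// !mxE; ring.
- apply: (eq_itg _ _ (fun r => enorm (w r - (- be) *: h) ^+ 2)).
    by move=> r _; rewrite scaleNr opprK.
  exact: curve_itg_sqrB cw.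
Qed.

Lemma curve_affine A a b g w (l c : R) : 0 < l -> curve A a b g w ->
  curve A (l * a + c) (l * b + c) (fun r => g (l^-1 * r + - (c / l)))
    (fun r => l^-1 *: w (l^-1 * r + - (c / l))).
Proof.
move=> l0 cw; have [h1 h2 h3 h4] := cw.
have k0 : 0 < l^-1 by rewrite invr_gt0.
have e (t : R) : l^-1 * (l * t + c) + - (c / l) = t by field; rewrite gt_eqF.
have mono (p q : R) : p <= q -> l^-1 * p + - (c / l) <= l^-1 * q + - (c / l).
  by move=> pq; rewrite lerD2r ler_pM2l.
have S f (p q : R) : l * a + c <= p -> q <= l * b + c -> itg a b f ->
    itg p q (fun r => f (l^-1 * r + - (c / l))) /\
    int (l^-1 * p + - (c / l)) (l^-1 * q + - (c / l)) f =
    l^-1 * int p q (fun r => f (l^-1 * r + - (c / l))).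
  move=> ap qb fi; apply: int_subst => //; apply: itg_sub fi.
    by rewrite -[leLHS]e mono.
  by rewrite -[leRHS]e mono.
split.
- move=> i; apply: (eq_itg _ _ (fun r => l^-1 * w (l^-1 * r + - (c / l)) ord0 i)).
    by move=> r _; rewrite mxE.
  by apply: itgZ; have [] := S _ _ _ (lexx _) (lexx _) (h1 i).
- move=> i r s ar rs sb; have [i1 e1] := S _ _ _ ar sb (h1 i).
  rewrite h2 ?mono//; first last.
  + by rewrite -[leRHS]e mono.
  + by rewrite -[leLHS]e mono.
  rewrite e1 -intZ//; apply: eq_int => z _; by rewrite mxE.
- move=> r /andP[r1 r2]; apply: h3; apply/andP; split.
  + by rewrite -[leLHS]e mono.
  + by rewrite -[leRHS]e mono.
- apply: (eq_itg _ _ (fun r => l^-1 ^+ 2 * enorm (w (l^-1 * r + - (c / l))) ^+ 2)).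
    by move=> r _; rewrite enormZ exprMn ger0_norm// ltW.
  by apply: itgZ; have [] := S _ _ _ (lexx _) (lexx _) h4.
Qed.

End affine_curve.

(** * The variation of the cost of an arc *)

Section variation.
Context {R : realType} {n : nat}.
Implicit Types (g w : R -> 'rV[R]_n) (x y v h : 'rV[R]_n).
Context (A U : set 'rV[R]_n) (T : R) (L : 'rV[R]_n -> 'rV[R]_n -> R)
  (f : 'rV[R]_n -> R -> R) (C d0 : R) (cd : control_data A U T L f C d0).

(** The arc is moved by the affine multiple [be * z + be0] of [h] and reparametrised by [l * z + c].
    Substitution brings its cost back to [a, b] with the factor [l], and the pointwise expansion,
    with [al = 1 - l], is integrated. *)
Lemma variation (V a b : R) g w x v h (l c be be0 r lam : R) :
  0 <= V -> a <= b -> curve A a b g w ->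
  (forall z, a <= z <= b -> A (g z + (be * z + be0) *: h)) ->
  (forall z, a <= z <= b -> `|be * z + be0| <= 1) ->
  (forall z, a <= z <= b -> enorm (g z - x) <= r) -> r <= d0 ->
  enorm v <= V -> `|1 - l| + `|be| * enorm h <= 1 / 2 -> enorm h <= d0 ->
  enorm h <= (b - a) * (`|1 - l| + `|be| * enorm h) -> 0 < lam ->
  exists s z, [/\ curve A (l * a + c) (l * b + c) s z,
    forall t, s t = g (l^-1 * t + - (c / l)) + (be * (l^-1 * t + - (c / l)) + be0) *: h &
    int (l * a + c) (l * b + c) (fun t => L (s t) (z t)) <=
      int a b (fun t => L (g t) (w t)) +
      (b - a) * ((1 - l) * (dotv (DvL L x v) v - L x v) + be * dotv (DvL L x v) h) +
      12 * C * (1 + V) ^+ 2 * (`|1 - l| + `|be| * enorm h) *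
      (int a b (fun t => enorm (w t - v) ^+ 2) / lam +
       (lam + r + (b - a) + (`|1 - l| + `|be| * enorm h)) * ((b - a) + int a b (fun t => enorm (w t) ^+ 2)))].
Proof.
move=> V0 ab cw hA phi1 gr rd vV small hd0 hsmall lam0.
have l0 : 0 < l.
  have : `|1 - l| <= 1 / 2 by apply: le_trans small; rewrite lerDl mulr_ge0 ?enorm_ge0.
  by rewrite ler_norml => /andP[]; lra.
have cp := curve_perturb A a b g w h be be0 ab cw hA.
have cs := curve_affine A a b _ _ l c l0 cp.
have ab' : l * a + c <= l * b + c by rewrite lerD2r ler_pM2l.
have isg := curve_lagrangian_itg _ _ _ _ _ _ _ cd _ _ _ _ ab' cs.
have [is1 es] := int_subst l c l0 _ _ _ isg.
do 2 eexists; split; [exact: cs|by []|].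
have e t : l^-1 * (l * t + c) + - (c / l) = t by field; rewrite gt_eqF.
have [h1 _ h3 h4] := cw.
have iL := curve_lagrangian_itg _ _ _ _ _ _ _ cd _ _ _ _ ab cw.
have iv := curve_itg_sqrB A a b g w v cw.
have HL := cd_L _ _ _ _ _ _ _ cd.
rewrite es -intZ//.
have [B eB] : exists B, B = 12 * C * (1 + V) ^+ 2 * (`|1 - l| + `|be| * enorm h) by eexists.
have [k ek] : exists k, k = lam + r + (b - a) + (`|1 - l| + `|be| * enorm h) by eexists.
have [q eq] : exists q, q = (1 - l) * (dotv (DvL L x v) v - L x v) + be * dotv (DvL L x v) h by eexists.
rewrite -eB -ek -eq.
have i1 : itg a b (fun t => B * (lam^-1 * enorm (w t - v) ^+ 2 + k * (1 + enorm (w t) ^+ 2))).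
  by apply/itgZ/itgD; apply: itgZ => //; apply: itgD => //; exact: itg_cst.
have -> : int a b (fun t => L (g t) (w t)) + (b - a) * q +
      B * (int a b (fun t => enorm (w t - v) ^+ 2) / lam + k * ((b - a) + int a b (fun t => enorm (w t) ^+ 2)))
  = int a b (fun t => L (g t) (w t) + q + B * (lam^-1 * enorm (w t - v) ^+ 2 + k * (1 + enorm (w t) ^+ 2))).
  rewrite intD//; last by apply: itgD => //; exact: itg_cst.
  rewrite intD ?itg_cst// int_cst// intZ; last first.
    by apply/itgD; apply: itgZ => //; apply: itgD => //; exact: itg_cst.
  rewrite intD; [|exact: itgZ|by apply: itgZ; apply: itgD => //; exact: itg_cst].
  rewrite (intZ _ _ lam^-1)// (intZ _ _ k); last by apply: itgD => //; exact: itg_cst.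
  by rewrite intD ?itg_cst// int_cst// mulr1 [_ / lam]mulrC.
apply: int_le; [exact: itgZ|by apply: itgD => //; apply: itgD => //; exact: itg_cst|].
move=> t tab; rewrite e.
have Ag := h3 t tab.
have := perturbation_pointwise U L C V HL V0 x (g t) v (w t) h (1 - l) be (be * t + be0) (b - a) r lam.
rewrite -eB -ek subKr eq addrA => PW; rewrite [_ / lam]mulrC in PW; apply: PW => //.
- exact: cd_sub cd _ Ag.
- apply: (cd_segment _ _ _ _ _ _ _ cd) => //.
  by rewrite addrAC subrr add0r enormZ (le_trans _ hd0)// ler_piMl ?enorm_ge0// phi1.
- apply: (cd_segment _ _ _ _ _ _ _ cd) => //.
  by rewrite enormB (le_trans (gr t tab)).
- exact: phi1.
- by rewrite subr_ge0.
- exact: gr.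
Qed.

End variation.

(** * Gluing of curves; constant curves and segments *)

Section glue.
Context {R : realType} {n : nat}.
Implicit Types (g w : R -> 'rV[R]_n) (x y v h : 'rV[R]_n) (A U : set 'rV[R]_n).

(** Allows a velocity to be redefined at a junction time without affecting integrals. *)
Lemma itg_point (a b p : R) (k : R -> R) : (forall x : R, x != p -> k x = 0) ->
  itg a b k /\ int a b k = 0.
Proof.
move=> k0.
have mk : measurable_fun (`[a, b]%classic : set (measurableTypeR R)) k.
  have -> : k = (fun x : measurableTypeR R => k p * \1_[set p] x).
    apply/funext => x; rewrite indicE; have [->|xp] := eqVneq x p; first by rewrite mem_set// mulr1.
    by rewrite memNset ?mulr0 ?k0//= => /eqP; rewrite (negbTE xp).
  by apply: measurable_funM => //; exact: measurable_indic.
have ik : itg a b k.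
  apply: (itg_le _ _ _ (fun=> `|k p|)) => //; last exact: itg_cst.
  by move=> x _; have [->|/k0 ->] := eqVneq x p; rewrite ?normr0.
split=> //; rewrite /int /Rintegral.
rewrite (integral_eq_off_null _ [set p] _ (cst 0%E))//.
- by rewrite integral0.
- exact: lebesgue_measure_set1.
- by move=> x _ /= /eqP xp; rewrite k0.
Qed.

Lemma eq_itg_point (a b p : R) (k k' : R -> R) : (forall x : R, x != p -> k x = k' x) ->
  itg a b k -> itg a b k' /\ int a b k = int a b k'.
Proof.
move=> kk ik.
have [z zp|i0 e0] := itg_point a b p (fun z => k' z - k z) _; first by rewrite kk// subrr.
have e : forall z, a <= z <= b -> k z + (k' z - k z) = k' z by move=> z _; rewrite addrC subrK.
split; first by apply: eq_itg e _; exact: itgD.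
by rewrite -(eq_int _ _ _ _ e) intD// e0 addr0.
Qed.

(** At the junction the velocity is that of the right-hand arc, so the integrals over the left-hand
    arc see an integrand changed at a single point. *)
Lemma curve_glue A (a b c : R) g w g' w' : a <= b -> b <= c ->
  curve A a b g w -> curve A b c g' w' -> g b = g' b ->
  exists g'' w'', [/\ curve A a c g'' w'',
    forall r, r <= b -> g'' r = g r, forall r, b <= r -> g'' r = g' r,
    forall r, r < b -> w'' r = w r & forall r, b <= r -> w'' r = w' r].
Proof.
move=> ab bc [h1 h2 h3 h4] [k1 k2 k3 k4] gg.
exists (fun r => if r <= b then g r else g' r), (fun r => if r < b then w r else w' r).
have eL r : r <= b -> (if r <= b then g r else g' r) = g r by move=> ->.
have eR r : b <= r -> (if r <= b then g r else g' r) = g' r.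
  by move=> br; case: ifP => // rb; have -> : r = b by apply/eqP; rewrite eq_le rb br.
have wL r : r < b -> (if r < b then w r else w' r) = w r by move=> ->.
have wR r : b <= r -> (if r < b then w r else w' r) = w' r by rewrite ltNge => ->.
have PL (K : 'rV[R]_n -> R) r s : s <= b -> itg r s (K \o w) ->
    itg r s (fun z => K (if z < b then w z else w' z)) /\
    int r s (K \o w) = int r s (fun z => K (if z < b then w z else w' z)).
  move=> sb iK.
  have [i e] := eq_itg_point r s b _ (fun z => if z == b then K (w' b) else K (w z))
    (fun z (zb : z != b) => esym (ifN_eq _ _ zb)) iK.
  have ee z : r <= z <= s -> (if z == b then K (w' b) else K (w z)) = K (if z < b then w z else w' z).
    by move=> /andP[_ zs]; have := le_trans zs sb; rewrite le_eqVlt => /orP[/eqP ->|zb];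
      rewrite ?eqxx ?ltxx// zb lt_eqF.
  split; first exact: eq_itg ee i.
  by rewrite e; apply: eq_int.
have PR (K : 'rV[R]_n -> R) r s : b <= r ->
    (itg r s (K \o w') -> itg r s (fun z => K (if z < b then w z else w' z))) /\
    int r s (K \o w') = int r s (fun z => K (if z < b then w z else w' z)).
  move=> br.
  have ee z : r <= z <= s -> (K \o w') z = K (if z < b then w z else w' z).
    by move=> /andP[rz _] /=; rewrite wR// (le_trans br).
  by split; [exact: eq_itg|exact: eq_int].
split => //; split.
- move=> i; apply: (itg_cat _ _ b) => //.
    by have [] := PL (fun v => v ord0 i) a b (lexx _) (h1 i).
  by apply: (PR (fun v => v ord0 i) b c (lexx _)).1; exact: k1.
- have PLi r s i : a <= r -> r <= s -> s <= b ->
      g s ord0 i - g r ord0 i = int r s (fun z => (if z < b then w z else w' z) ord0 i).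
    move=> ar rs sb; rewrite h2//.
    by have [] := PL (fun v => v ord0 i) r s sb (itg_sub _ _ _ _ _ ar sb (h1 i)).
  have PRi r s i : b <= r -> r <= s -> s <= c ->
      g' s ord0 i - g' r ord0 i = int r s (fun z => (if z < b then w z else w' z) ord0 i).
    by move=> br rs sc; rewrite k2//; have [] := PR (fun v => v ord0 i) r s br.
  move=> i r s ar rs sc.
  case/orP: (le_total s b) => [sb|bs].
    by rewrite (eL s)// (eL r) ?(le_trans rs)// PLi.
  case/orP: (le_total r b) => [rb|br]; last by rewrite (eR s)// (eR r)// PRi.
  rewrite (eR s)// (eL r)// (int_cat r s b)//; first by rewrite -PLi// -PRi// gg; ring.
  apply: (itg_cat _ _ b) => //.
    by have [] := PL (fun v => v ord0 i) r b (lexx _) (itg_sub _ _ _ _ _ ar (lexx _) (h1 i)).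
  by apply: (PR (fun v => v ord0 i) b s (lexx _)).1; exact: itg_sub (k1 i).
- move=> r /andP[ar rc]; case: (leP r b) => rb; first by apply: h3; rewrite ar.
  by apply: k3; rewrite ltW.
- apply: (itg_cat _ _ b) => //.
    by have [] := PL (fun v => enorm v ^+ 2) a b (lexx _) h4.
  by apply: (PR (fun v => enorm v ^+ 2) b c (lexx _)).1; exact: k4.
Qed.

Lemma curve_cst A (a b : R) x : A x -> curve A a b (fun=> x) (fun=> 0).
Proof.
move=> Ax; split => //.
- by move=> i; apply: (eq_itg _ _ (cst 0)) => [r _|]; [rewrite mxE|exact: itg_cst].
- move=> i r s ar rs sb; rewrite subrr (eq_int _ _ _ (cst 0)) => [|z _]; last by rewrite mxE.
  by rewrite int_cst// mulr0.
- exact: itg_cst.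
Qed.

Lemma curve_segment A (a b : R) x v : a <= b ->
  (forall r, a <= r <= b -> A (x + (r - a) *: v)) ->
  curve A a b (fun r => x + (r - a) *: v) (fun=> v).
Proof.
move=> ab hA.
have Ax : A x by have := hA a; rewrite subrr scale0r addr0 lexx; apply.
apply: (eq_curve _ _ _ (fun r => x + (1 * r + - a) *: v) (fun=> 0 + 1 *: v)).
- by move=> r _; rewrite mul1r.
- by move=> r _; rewrite add0r scale1r.
- by apply: curve_perturb => //; [exact: curve_cst|move=> r rab; rewrite mul1r; exact: hA].
Qed.

End glue.

(** * Dynamic programming and near-optimal curves *)

Section dpp.
Context {R : realType} {n : nat}.
Implicit Types (g w : R -> 'rV[R]_n) (x y v h : 'rV[R]_n).

Lemma eq_int_lt (a b : R) (k k' : R -> R) : (forall z, a <= z < b -> k z = k' z) ->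
  itg a b k -> int a b k = int a b k'.
Proof.
move=> kk ik.
have [i ->] := eq_itg_point a b b k (fun z => if z == b then k' b else k z)
    (fun z (zb : z != b) => esym (ifN_eq _ _ zb)) ik.
apply: eq_int => z /andP[az zb]; case: eqVneq => [->//|zb'].
by rewrite kk// az lt_neqAle zb'.
Qed.

Context (A U : set 'rV[R]_n) (T : R) (L : 'rV[R]_n -> 'rV[R]_n -> R)
  (f : 'rV[R]_n -> R -> R) (C d0 : R) (h : 'rV[R]_n -> R) (u : R -> 'rV[R]_n -> R).
Hypothesis cd : control_data A U T L f C d0.
Hypothesis vd : value_data A T L f C h u.

Let run := running L f.

(** Following [g] until time [b] and a near-optimal curve afterwards is a competitor from time
    [a]. *)
Lemma dpp_le a b g w : 0 <= a -> a <= b -> b <= T -> curve A a b g w ->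
  u a (g a) <= run a b g w + u b (g b).
Proof.
move=> a0 ab bT cw; apply/ler_addgt0Pr => e e0.
have [_ _ h3 _] := cw.
have b0T : 0 <= b <= T by rewrite (le_trans a0).
have Agb : A (g b) by apply: h3; rewrite ab lexx.
have [g' [w' [cw' gb ve]]] := vd_opt _ _ _ _ _ _ _ vd b (g b) b0T Agb e e0.
have [g2 [w2 [cw2 e1 e2 e3 e4]]] := curve_glue A a b T g w g' w' ab bT cw cw' (esym gb).
have aT := le_trans ab bT.
have a0T : 0 <= a <= T by rewrite a0.
have := vd_le _ _ _ _ _ _ _ vd a g2 w2 a0T cw2.
have ca : curve A a b g2 w2 by exact: curve_sub cw2.
rewrite e1// e2// (running_cat _ _ _ _ _ _ _ cd a T b)//.
have -> : running L f a b g2 w2 = running L f a b g w.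
  apply: eq_int_lt.
    by move=> z /andP[_ zb]; rewrite /lag e1 ?e3// ltW.
  exact: curve_lag_itg cd _ _ _ _ a0 ab bT ca.
have -> : running L f b T g2 w2 = running L f b T g' w'.
  by apply: eq_int => z /andP[bz _]; rewrite /lag e2 ?e4.
by rewrite /run; lra.
Qed.

(** The defect [e] is required on every subinterval, so that the notion passes to restrictions. *)
Definition near_opt (e a b : R) g w := curve A a b g w /\
  forall r s, a <= r -> r <= s -> s <= b -> run r s g w + u s (g s) <= u r (g r) + e.

Lemma near_opt_sub e a b a' b' g w : a <= a' -> b' <= b -> near_opt e a b g w ->
  near_opt e a' b' g w.
Proof.
move=> aa bb [cw H]; split; first exact: curve_sub cw.
by move=> r s ar rs sb; apply: H => //; [exact: le_trans ar|exact: le_trans bb].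
Qed.

(** The defects over the three intervals cut at [r] and [s] are nonnegative, and their sum is at
    most [e]. *)
Lemma near_opt_cost e a g w : 0 <= a <= T -> curve A a T g w ->
  run a T g w + h (g T) <= u a (g a) + e -> near_opt e a T g w.
Proof.
move=> /andP[a0 aT] cw H; split=> // r s ar rs sT.
have r0 := le_trans a0 ar; have s0 := le_trans r0 rs; have rT := le_trans rs sT.
have as_ := le_trans ar rs.
have cr : curve A a r g w by exact: curve_sub cw.
have cs : curve A s T g w by exact: curve_sub cw.
have crs : curve A a s g w by exact: curve_sub cw.
have := dpp_le a r g w a0 ar rT cr.
have s0T : 0 <= s <= T by rewrite s0.
have := vd_le _ _ _ _ _ _ _ vd s g w s0T cs.
move: H; rewrite /run (running_cat _ _ _ _ _ _ _ cd a T s)//.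
by rewrite (running_cat _ _ _ _ _ _ _ cd a s r)//; lra.
Qed.

Lemma near_opt_exists e t x : 0 < e -> 0 <= t <= T -> A x ->
  exists g w, near_opt e t T g w /\ g t = x.
Proof.
move=> e0 tT Ax; have [g [w [cw gt ve]]] := vd_opt _ _ _ _ _ _ _ vd t x tT Ax e e0.
by exists g, w; split => //; apply: near_opt_cost => //; rewrite gt.
Qed.

Lemma lag_lower x v (t : R) : 0 <= t <= T -> A x ->
  enorm v ^+ 2 <= C * (L x v + f x t + 2 * C).
Proof.
move=> tT Ax; have [C0 HL _ _ _] := cd_L _ _ _ _ _ _ _ cd.
have [+ _] := HL x v (cd_sub _ _ _ _ _ _ _ cd x Ax).
have := cd_fbd _ _ _ _ _ _ _ cd t x tT Ax; rewrite ler_norml => /andP[k1 k2] k.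
apply: (le_trans k); rewrite ler_pM2l//; lra.
Qed.

Lemma lag_upper x v (t : R) : 0 <= t <= T -> A x -> L x v + f x t <= C * (2 + enorm v ^+ 2).
Proof.
move=> tT Ax; have [C0 HL _ _ _] := cd_L _ _ _ _ _ _ _ cd.
have [_ k] := HL x v (cd_sub _ _ _ _ _ _ _ cd x Ax).
have := cd_fbd _ _ _ _ _ _ _ cd t x tT Ax; have := le_trans (ler_norm _) k.
by move=> k1 k2; have := le_trans (ler_norm _) k2; lra.
Qed.

Lemma running_coercive a b g w : 0 <= a -> a <= b -> b <= T -> curve A a b g w ->
  int a b (fun r => enorm (w r) ^+ 2) <= C * (run a b g w + 2 * C * (b - a)).
Proof.
move=> a0 ab bT cw.
have il := curve_lag_itg _ _ _ _ _ _ _ cd _ _ _ _ a0 ab bT cw.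
have [_ _ h3 h4] := cw.
have -> : C * (run a b g w + 2 * C * (b - a)) = int a b (fun r => C * (lag L f g w r + 2 * C)).
  rewrite intZ; last by apply: itgD => //; exact: itg_cst.
  by rewrite intD ?itg_cst// int_cst// [_ * (b - a)]mulrC.
apply: int_le => //; first by apply/itgZ/itgD => //; exact: itg_cst.
move=> r rab; apply: lag_lower; last exact: h3.
by move: rab => /andP[ar rb]; rewrite (le_trans a0)//= (le_trans rb).
Qed.

Lemma running_segment a b x v (V : R) : 0 <= a -> a <= b -> b <= T ->
  (forall r, a <= r <= b -> A (x + (r - a) *: v)) -> enorm v <= V ->
  u a x <= (b - a) * (C * (2 + V ^+ 2)) + u b (x + (b - a) *: v).
Proof.
move=> a0 ab bT hA vV; have [C0 _ _ _ _] := cd_L _ _ _ _ _ _ _ cd.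
have cw := curve_segment A a b x v ab hA.
have := dpp_le _ _ _ _ a0 ab bT cw; rewrite subrr scale0r addr0 => /le_trans; apply.
rewrite lerD2r -int_cst//; apply: int_le; [|exact: itg_cst|].
  exact: curve_lag_itg cd _ _ _ _ a0 ab bT cw.
move=> r rab; have [_ _ h3 _] := cw.
have rT : 0 <= r <= T by move: rab => /andP[ar rb]; rewrite (le_trans a0)//= (le_trans rb).
apply: (le_trans (lag_upper _ v _ rT (h3 r rab))).
by rewrite ler_pM2l// lerD2l lerXn2r ?nnegrE ?enorm_ge0//; apply: le_trans vV; exact: enorm_ge0.
Qed.

Lemma running_lower a b g w : 0 <= a -> a <= b -> b <= T -> curve A a b g w ->
  - (2 * C * (b - a)) <= run a b g w.
Proof.
move=> a0 ab bT cw; have [C0 _ _ _ _] := cd_L _ _ _ _ _ _ _ cd.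
have := running_coercive a b g w a0 ab bT cw.
have : 0 <= int a b (fun r => enorm (w r) ^+ 2) by apply: int_ge0 => r _; exact: sqr_ge0.
by move=> k1 k2; have := le_trans k1 k2; rewrite pmulr_rge0//; lra.
Qed.

(** Above by the cost of staying at [x], below because the running cost is bounded from below. *)
Lemma value_bound : exists B : R, forall t x, 0 <= t <= T -> A x -> `|u t x| <= B.
Proof.
have [C0 _ _ _ _] := cd_L _ _ _ _ _ _ _ cd.
have T0 := cd_T _ _ _ _ _ _ _ cd.
exists (2 * C * T + C + 1) => t x tT Ax; have /andP[t0 t1] := tT.
rewrite ler_norml; apply/andP; split.
  have [g [w [cw gt ve]]] := vd_opt _ _ _ _ _ _ _ vd t x tT Ax 1 ltr01.
  have := running_lower _ _ _ _ t0 t1 (lexx _) cw; rewrite /run.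
  have [_ _ h3 _] := cw.
  have := vd_h _ _ _ _ _ _ _ vd (g T) (h3 T _); rewrite t1 lexx => /(_ isT).
  rewrite ler_norml => /andP[k1 _] k2.
  have : 2 * C * (T - t) <= 2 * C * T by rewrite ler_pM2l//; lra.
  lra.
have := running_segment t T x 0 0 t0 t1 (lexx _).
have uT : u T x <= C.
  have cw := curve_cst A T T x Ax.
  have := vd_le _ _ _ _ _ _ _ vd T _ _ _ cw; rewrite lexx ltW// => /(_ isT).
  have -> : running L f T T (fun=> x) (fun=> 0) = 0.
    rewrite /running /int set_itv1 /Rintegral integral_set1//.
  have := vd_h _ _ _ _ _ _ _ vd x Ax; rewrite ler_norml; lra.
have : (T - t) * (C * (2 + 0 ^+ 2)) <= 2 * C * T.
  by rewrite expr0n/= addr0 mulrC [C * 2]mulrC ler_pM2l//; lra.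
rewrite enorm0 lexx !scaler0 addr0 => k1 k2.
have := k2 _ isT; have : forall r, t <= r <= T -> A (x + (r - t) *: 0) by move=> r _; rewrite scaler0 addr0.
move=> k3 /(_ k3); lra.
Qed.

(** Coercivity bounds the energy by the running cost, which near optimality bounds by a difference
    of values of [u]. *)
Lemma near_opt_energy : exists2 E : R, 0 < E & forall e a b g w, e <= 1 -> 0 <= a -> a <= b -> b <= T ->
  near_opt e a b g w -> int a b (fun r => enorm (w r) ^+ 2) <= E.
Proof.
have [C0 _ _ _ _] := cd_L _ _ _ _ _ _ _ cd.
have T0 := cd_T _ _ _ _ _ _ _ cd.
have [B HB] := value_bound.
exists (C * (2 * `|B| + 1 + 2 * C * T)).
  by rewrite mulr_gt0//; have := normr_ge0 B; have := mulr_gt0 C0 T0; lra.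
move=> e a b g w e1 a0 ab bT [cw H].
apply: (le_trans (running_coercive _ _ _ _ a0 ab bT cw)); rewrite ler_pM2l//.
have := H a b (lexx _) ab (lexx _).
have [_ _ h3 _] := cw.
have := HB a (g a) _ (h3 a _); rewrite a0 lexx ab (le_trans ab)// => /(_ isT isT).
have := HB b (g b) _ (h3 b _); rewrite bT lexx ab (le_trans a0)// => /(_ isT isT).
have : 2 * C * (b - a) <= 2 * C * T by rewrite ler_pM2l//; lra.
have := ler_norm B; rewrite !ler_norml => k1 k2 /andP[k3 k4] /andP[k5 k6]; lra.
Qed.

End dpp.

(** * Length estimates and uniform continuity of near-optimal arcs *)

Section lipschitz.
Context {R : realType} {n : nat}.
Implicit Types (g w : R -> 'rV[R]_n) (x y v h : 'rV[R]_n).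

Lemma curve_length A a b g w (r s l : R) : curve A a b g w -> a <= r -> r <= s -> s <= b -> 0 < l ->
  int r s (fun z => enorm (w z)) <= l / 2 * int r s (fun z => enorm (w z) ^+ 2) + (s - r) / (2 * l).
Proof.
move=> cw ar rs sb l0.
have crs : curve A r s g w by exact: curve_sub cw.
have [_ _ _ h4] := crs.
have i1 := curve_itg_enorm _ _ _ _ _ crs.
have -> : l / 2 * int r s (fun z => enorm (w z) ^+ 2) + (s - r) / (2 * l) =
    int r s (fun z => l / 2 * enorm (w z) ^+ 2 + 1 / (2 * l)).
  rewrite intD ?itg_cst//; last exact: itgZ.
  by rewrite intZ// int_cst// mul1r.
apply: int_le => // [|z _]; first by apply: itgD; [exact: itgZ|exact: itg_cst].
by rewrite [_ / 2 * _]mulrAC amgm.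
Qed.

Lemma int_enorm_continuous A a b g w : curve A a b g w ->
  forall r, a <= r <= b -> forall e : R, 0 < e -> exists2 d : R, 0 < d &
    forall s, a <= s <= b -> `|s - r| < d ->
      `|int a s (fun z => enorm (w z)) - int a r (fun z => enorm (w z))| < e.
Proof.
move=> cw r /andP[ar rb] e e0; have [_ _ _ h4] := cw.
have [E [E0 HE]] : exists E, 0 < E /\ int a b (fun z => enorm (w z) ^+ 2) <= E.
  exists (`|int a b (fun z => enorm (w z) ^+ 2)| + 1); split; first by rewrite ltr_wpDl.
  by rewrite (le_trans (ler_norm _))// lerDl.
have ie := curve_itg_enorm _ _ _ _ _ cw.
have main p q : a <= p -> p <= q -> q <= b -> q - p < e ^+ 2 / E ->
    `|int a q (fun z => enorm (w z)) - int a p (fun z => enorm (w z))| < e.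
  move=> ap pq qb pqe.
  rewrite (int_cat a q p)//; last exact: itg_sub ie.
  rewrite addrC addKr ger0_norm; last by apply: int_ge0 => z _; exact: enorm_ge0.
  have l0 : 0 < e / E by rewrite divr_gt0.
  apply: (le_lt_trans (curve_length _ _ _ _ _ p q _ cw ap pq qb l0)).
  have Epq : int p q (fun z => enorm (w z) ^+ 2) <= E.
    apply: le_trans HE; rewrite (int_cat a b p)//; last exact: le_trans qb.
    rewrite (int_cat p b q)//; last by apply: itg_sub h4.
    have k1 : 0 <= int a p (fun z => enorm (w z) ^+ 2) by apply: int_ge0 => z _; exact: sqr_ge0.
    have k2 : 0 <= int q b (fun z => enorm (w z) ^+ 2) by apply: int_ge0 => z _; exact: sqr_ge0.
    by lra.
  have : e / E / 2 * int p q (fun z => enorm (w z) ^+ 2) <= e / E / 2 * E.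
    by rewrite ler_pM2l// divr_gt0.
  have : (q - p) / (2 * (e / E)) < e ^+ 2 / E / (2 * (e / E)).
    by rewrite ltr_pM2r// invr_gt0 mulr_gt0.
  have -> : e / E / 2 * E = e / 2 by field; rewrite gt_eqF.
  have -> : e ^+ 2 / E / (2 * (e / E)) = e / 2 by field; rewrite !gt_eqF.
  lra.
exists (e ^+ 2 / E); first by rewrite divr_gt0// exprn_gt0.
move=> s /andP[as_ sb]; case/orP: (le_total r s) => rs.
  by rewrite ger0_norm ?subr_ge0//; exact: main.
by rewrite distrC ger0_norm ?subr_ge0// => k; rewrite distrC; exact: main.
Qed.

(** [k] is the length of the arc between the two parameters, a difference of values of the primitive
    [V] of the speed. A substitution computes its integral, of order [de] times the length, although
    the pointwise distance need not be of order [de]. *)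
Lemma curve_shift_dist A a b g w (l c de : R) : a < b -> curve A a b g w -> 0 <= de -> de < b - a ->
  l = 1 - de / (b - a) -> l * a + c = a + de -> l * b + c = b ->
  exists k, [/\ itg (a + de) b k,
    forall r, a + de <= r <= b -> enorm (g (l^-1 * r + - (c / l)) - g r) <= k r &
    int (a + de) b k <= de * int a b (fun z => enorm (w z))].
Proof.
move=> ab cw de0 dab el ea eb.
have ba0 : 0 < b - a by rewrite subr_gt0.
have ba1 : b - a != 0 by rewrite gt_eqF.
have l0 : 0 < l by rewrite el subr_gt0 ltr_pdivrMr// mul1r.
have l1 : l <= 1 by rewrite el lerBlDr lerDl divr_ge0// ltW.
have ie := curve_itg_enorm _ _ _ _ _ cw.
have [V eV] : exists V, V = fun r => int a r (fun z => enorm (w z)) by eexists.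
have iV : itg a b V.
  by rewrite eV; apply: continuous_on_int_itg; [exact: ltW|exact: int_enorm_continuous cw].
have V0 r : 0 <= V r by rewrite eV; apply: int_ge0 => z _; exact: enorm_ge0.
have Vb r : a <= r <= b -> V r <= V b.
  move=> /andP[ar rb]; rewrite eV (int_cat a b r)// lerDl.
  by apply: int_ge0 => z _; exact: enorm_ge0.
have [] := @int_subst R l^-1 (- (c / l)) _ V (a + de) b.
- by rewrite invr_gt0.
- have -> : l^-1 * (a + de) + - (c / l) = a by rewrite -ea; field; rewrite gt_eqF.
  by have -> : l^-1 * b + - (c / l) = b by rewrite -{1}eb; field; rewrite gt_eqF.
have -> : l^-1 * (a + de) + - (c / l) = a by rewrite -ea; field; rewrite gt_eqF.
have -> : l^-1 * b + - (c / l) = b by rewrite -{1}eb; field; rewrite gt_eqF.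
move=> i1 e1.
have i2 : itg (a + de) b V by apply: itg_sub iV => //; rewrite lerDl.
exists (fun r => V r - V (l^-1 * r + - (c / l))); split; first exact: itgB.
- move=> r /andP[r1 r2].
  have th1 : a <= l^-1 * r + - (c / l).
    have {1}-> : a = l^-1 * (a + de) + - (c / l) by rewrite -ea; field; rewrite gt_eqF.
    by rewrite lerD2r ler_pM2l ?invr_gt0.
  have th2 : l^-1 * r + - (c / l) <= r.
    have -> : l^-1 * r + - (c / l) = b - l^-1 * (b - r).
      have -> : c = b - l * b by lra.
      by field; rewrite gt_eqF.
    have : 1 * (b - r) <= l^-1 * (b - r).
      by rewrite ler_wpM2r ?subr_ge0// invf_ge1.
    lra.
  rewrite enormB (le_trans (curve_dist _ _ _ _ _ _ _ cw th1 th2 r2))//.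
  rewrite eV (int_cat a r (l^-1 * r + - (c / l)))//; last exact: itg_sub ie.
  by rewrite addrAC subrr add0r.
- rewrite intB//.
  have -> : int (a + de) b (fun r => V (l^-1 * r + - (c / l))) = l * int a b V.
    by rewrite e1 mulrA mulfV ?mul1r// gt_eqF.
  have : int (a + de) b V <= int a b V.
    rewrite (int_cat a b (a + de))//; [|by rewrite lerDl|by lra].
    by rewrite lerDr; apply: int_ge0 => z _.
  have ab' := ltW ab.
  have Vb' : int a b V <= (b - a) * V b.
    by rewrite -int_cst//; apply: int_le => //; exact: itg_cst.
  have : de / (b - a) * int a b V <= de / (b - a) * ((b - a) * V b).
    by rewrite ler_wpM2l ?divr_ge0 ?subr_ge0.
  have -> : de / (b - a) * ((b - a) * V b) = de * V b by field.
  rewrite el mulrBl mul1r eV; lra.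
Qed.

Context (Om : set 'rV[R]_n) (U : set 'rV[R]_n) (T : R) (L : 'rV[R]_n -> 'rV[R]_n -> R)
  (f : 'rV[R]_n -> R -> R) (C d0 : R) (h0 : 'rV[R]_n -> R) (u : R -> 'rV[R]_n -> R).
Let A := closure Om.
Hypothesis cd : control_data A U T L f C d0.
Hypothesis vd : value_data A T L f C h0 u.

(** The uniform energy bound makes near-optimal arcs Hoelder continuous of exponent 1/2 with a
    common constant. *)
Lemma near_opt_stay (rad : R) : 0 < rad -> exists2 de : R, 0 < de &
  forall e a b g w, e <= 1 -> 0 <= a -> a <= b -> b <= T -> b - a <= de ->
  near_opt A L f u e a b g w -> forall r s, a <= r <= b -> a <= s <= b -> enorm (g r - g s) <= rad.
Proof.
move=> rad0; have [E E0 HE] := near_opt_energy _ _ _ _ _ _ _ _ _ cd vd.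
exists (rad ^+ 2 / E); first by rewrite divr_gt0// exprn_gt0.
move=> e a b g w e1 a0 ab bT bad no.
have [cw _] := no; have [_ _ _ h4] := cw.
suff main r s : a <= r -> r <= s -> s <= b -> enorm (g s - g r) <= rad.
  move=> r s /andP[ar rb] /andP[as_ sb]; case/orP: (le_total r s) => rs; last exact: main.
  by rewrite enormB; exact: main.
move=> ar rs sb.
have l0 : 0 < rad / E by rewrite divr_gt0.
apply: (le_trans (curve_dist_energy _ _ _ _ _ r s _ cw ar rs sb l0)).
have := HE e r s g w e1 (le_trans a0 ar) rs (le_trans sb bT) (near_opt_sub _ _ _ _ _ _ _ _ _ _ _ ar sb no).
move=> k.
have : rad / E / 2 * int r s (fun z => enorm (w z) ^+ 2) <= rad / E / 2 * E.
  by rewrite ler_pM2l// divr_gt0.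
have : (s - r) / (2 * (rad / E)) <= rad ^+ 2 / E / (2 * (rad / E)).
  have k2 : s - r <= b - a by exact: lerB.
  by rewrite ler_pM2r; [exact: le_trans k2 bad|rewrite invr_gt0 mulr_gt0].
have -> : rad / E / 2 * E = rad / 2 by field; rewrite gt_eqF.
have -> : rad ^+ 2 / E / (2 * (rad / E)) = rad / 2 by field; rewrite !gt_eqF.
lra.
Qed.

End lipschitz.

(** * Inward displacements near a point of the closed domain *)

Section local_lipschitz.
Context {R : realType} {n : nat}.
Implicit Types (g w : R -> 'rV[R]_n) (x y v h : 'rV[R]_n).

(** The last condition describes a cone of inward displacements, narrower for larger [c]. As long as
    everything stays within [c] of [x0], such an [h] and all its fractions may be added to any point
    of the closed domain. *)
Lemma chart_cone (Om : set 'rV[R]_n) rho x0 G N (r K c phi : R) y h : chart Om rho x0 G N r K ->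
  closure Om y -> enorm (y - x0) <= r -> enorm h <= r -> 0 <= phi <= 1 ->
  enorm (y - x0) + enorm h <= c -> dotv G h + K * enorm h * c <= 0 -> closure Om (y + phi *: h).
Proof.
move=> [[r0 K0] _ _ _ [CH _]] cy yr hr /andP[p0 p1] yc hc.
have ph : enorm (phi *: h) = phi * enorm h by rewrite enormZ ger0_norm.
have phh : phi * enorm h <= enorm h by rewrite ler_piMl ?enorm_ge0.
apply: CH => //; rewrite ph; first exact: le_trans hr.
rewrite dotvZr.
have : K * (phi * enorm h) * (enorm (y - x0) + phi * enorm h) <= K * (phi * enorm h) * c.
  by rewrite ler_wpM2l ?mulr_ge0 ?enorm_ge0//; lra.
have : phi * (dotv G h + K * enorm h * c) <= 0 by rewrite mulr_ge0_le0.
move: (enorm (y - x0) + _) => z; move: (enorm h) (dotv G h) => a b; lra.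
Qed.

End local_lipschitz.

Section local_setting.
Context {R : realType} {n : nat}.

Record local_setting (Om U : set 'rV[R]_n) (T : R) (L : 'rV[R]_n -> 'rV[R]_n -> R)
    (f : 'rV[R]_n -> R -> R) (C d0 : R) (h0 : 'rV[R]_n -> R) (u : R -> 'rV[R]_n -> R)
    (rho : 'rV[R]_n -> R) (t0 : R) (x0 G N : 'rV[R]_n) (r0 K : R) : Prop := {
  ls_cd : control_data (closure Om) U T L f C d0;
  ls_vd : value_data (closure Om) T L f C h0 u;
  ls_t0 : 0 < t0 < T;
  ls_x0 : closure Om x0;
  ls_chart : chart Om rho x0 G N r0 K }.
End local_setting.

(** * Perturbation of the coupling term and local Lipschitz continuity of the value function *)

Section potential.
Context {R : realType} {n : nat}.
Implicit Types (g w : R -> 'rV[R]_n).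
Context (A U : set 'rV[R]_n) (T : R) (L : 'rV[R]_n -> 'rV[R]_n -> R)
  (f : 'rV[R]_n -> R -> R) (C d0 : R).
Hypothesis cd : control_data A U T L f C d0.

(** Comparing the two curves at equal times reduces the difference of the coupling terms to the
    Lipschitz dependence of [f] on the point. *)
Lemma potential_forward (a b a' : R) g w s z (k : R -> R) (H : R) :
  0 <= a -> a <= a' -> a' <= b -> b <= T -> curve A a b g w -> curve A a' b s z ->
  itg a' b k -> (forall r, a' <= r <= b -> enorm (s r - g r) <= H + k r) ->
  (forall r, a' <= r <= b -> enorm (s r - g r) <= d0) ->
  int a' b (fun r => f (s r) r) - int a' b (fun r => f (g r) r) <=
  C * ((b - a') * H + int a' b k).
Proof.
move=> a0 aa ab bT cg cs ik sk sd.
have a'0 := le_trans a0 aa.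
have cg' : curve A a' b g w by exact: curve_sub cg.
have i1 := curve_potential_itg _ _ _ _ _ _ _ cd a' b s z a'0 ab bT cs.
have i2 := curve_potential_itg _ _ _ _ _ _ _ cd a' b g w a'0 ab bT cg'.
have [C0 _ _ _ _] := cd_L _ _ _ _ _ _ _ cd.
rewrite -intB//.
have -> : C * ((b - a') * H + int a' b k) = int a' b (fun r => C * (H + k r)).
  rewrite intZ; last by apply: itgD => //; exact: itg_cst.
  by rewrite intD ?itg_cst// int_cst.
apply: int_le; [exact: itgB|by apply/itgZ/itgD => //; exact: itg_cst|].
move=> r rab; have [_ _ h3 _] := cg'.
have rT : 0 <= r <= T by move: rab => /andP[ar rb]; rewrite (le_trans a'0)//= (le_trans rb).
have seg : segment_in U (g r) (s r) by apply: cd_segment cd _ _ _ _; [exact: h3|exact: sd].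
have := cd_flip _ _ _ _ _ _ _ cd r _ _ rT seg; rewrite distrC => k1.
apply: (le_trans (ler_norm _)); apply: (le_trans k1).
by rewrite ler_pM2l// enormB sk.
Qed.

End potential.

(** A near-optimal arc from [(s, y)] is compressed in time so as to start at [s + de], and displaced
    by a multiple of [h] that decreases from 1 to 0, so that it starts at [y + h] and ends at the
    old endpoint at time [s + tau]. The variation formula is taken with velocity 0, where its linear
    part is bounded. *)
Lemma lip_cone (R : realType) (n : nat) {Om U T L f C d0 h0 u rho t0 x0 G N r0 K}
  (S : @local_setting R n Om U T L f C d0 h0 u rho t0 x0 G N r0 K) (c : R) : 0 < c -> exists C1 d1 : R, [/\ 0 < C1, 0 < d1 &
  forall s y de (h : 'rV[R]_n), `|s - t0| <= d1 -> closure Om y -> enorm (y - x0) <= d1 -> 0 <= de <= d1 ->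
    enorm h <= d1 -> dotv G h + K * enorm h * c <= 0 ->
    u (s + de) (y + h) <= u s y + C1 * (de + enorm h)].
Proof.
case: S => cd vd t0T Ax0 ch c0; have [[r00 K0] _ _ _ _] := ch.
have d00 := cd_d0 _ _ _ _ _ _ _ cd.
have [C0 _ _ _ _] := cd_L _ _ _ _ _ _ _ cd.
have [m0 [m00 mr md mc]] : exists m0 : R, [/\ 0 < m0, 3 * m0 <= r0, 3 * m0 <= d0 & 3 * m0 <= c].
  exists (Num.min r0 (Num.min d0 c) / 3); rewrite divr_gt0 ?lt_min ?r00 ?d00//.
  have -> : 3 * (Num.min r0 (Num.min d0 c) / 3) = Num.min r0 (Num.min d0 c) by field.
  by rewrite !ge_min !lexx !orbT.
have [t1 t10 stay] := near_opt_stay _ _ _ _ _ _ _ _ _ cd vd m0 m00.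
have [E E0 HE] := near_opt_energy _ _ _ _ _ _ _ _ _ cd vd.
have /andP[tp tT] := t0T.
have [tau [tau0 tau1 tau2]] : exists tau : R, [/\ 0 < tau, tau <= t1 & tau <= (T - t0) / 2].
  exists (Num.min t1 ((T - t0) / 2)); rewrite lt_min t10 !ge_min !lexx !orbT; split => //=; lra.
have [d1 [d10 d1m d1t d1a d1b]] : exists d1 : R,
    [/\ 0 < d1, d1 <= m0, d1 <= tau / 8, d1 <= t0 & d1 <= (T - t0) / 2].
  exists (Num.min m0 (Num.min (tau / 8) (Num.min t0 ((T - t0) / 2)))).
  by split; rewrite ?lt_min ?ge_min ?lexx ?orbT// m00 tp !divr_gt0// subr_gt0.
have [M1 eM1] : exists M1, M1 = `|L x0 0| + enorm (DvL L x0 0) by eexists.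
have [M2 eM2] : exists M2, M2 = 12 * C / tau * (E + (2 + 2 * m0 + tau) * (tau + E)) by eexists.
have [M3 eM3] : exists M3, M3 = C * (E + 2 * tau + 1) by eexists.
have M10 : 0 <= M1 by rewrite eM1 addr_ge0 ?enorm_ge0.
have M20 : 0 <= M2.
  rewrite eM2; apply: mulr_ge0; first by rewrite divr_ge0 ?mulr_ge0 ?ltW.
  by apply: addr_ge0; [exact: ltW|apply: mulr_ge0; lra].
have M30 : 0 < M3 by rewrite eM3 mulr_gt0//; lra.
exists (M1 + M2 + M3), d1; split => //; first lra.
move=> s y de h sd Ay yd /andP[de0 ded] hd hc.
have h00 := enorm_ge0 h.
apply/ler_addgt0Pr => e e0.
have [ep [ep0 epe ep1]] : exists ep : R, [/\ 0 < ep, ep <= e & ep <= 1].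
  by exists (Num.min e 1); rewrite lt_min e0 ltr01 !ge_min !lexx orbT.
move: sd; rewrite ler_norml => /andP[sd1 sd2].
have s0 : 0 <= s by move: sd1 d1a; clear; lra.
have sT : s + tau <= T by move: sd2 d1b tau2; clear; lra.
have sl : 0 <= s <= T by rewrite s0 /=; move: sT tau0; clear; lra.
have ss : s <= s + tau by rewrite lerDl ltW.
have [g [w [no' gs]]] := near_opt_exists _ _ _ _ _ _ _ _ _ cd vd ep s y ep0 sl Ay.
have no := near_opt_sub _ _ _ _ _ s T s (s + tau) g w (lexx _) sT no'.
have [cw Hno] := no; have [_ _ h3 _] := cw.
have st : forall p q : R, s <= p <= s + tau -> s <= q <= s + tau -> enorm (g p - g q) <= m0.
  by apply: (stay ep s (s + tau) g w ep1 s0 ss sT _ no); rewrite addrC addKr.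
have gx p : s <= p <= s + tau -> enorm (g p - x0) <= 2 * m0.
  move=> pp; apply: (le_trans (enorm_triangle _ y _)).
  have : enorm (g p - g s) <= m0 by apply: st => //; rewrite lexx.
  by rewrite gs; move: yd d1m; clear; move: (enorm _) (enorm _) => *; lra.
have Ew : int s (s + tau) (fun r => enorm (w r) ^+ 2) <= E by exact: HE no.
have Ew0 : 0 <= int s (s + tau) (fun r => enorm (w r) ^+ 2) by apply: int_ge0 => p _; exact: sqr_ge0.
(* The dilation that carries [s, s + tau] onto [s + de, s + tau]. *)
have [l el] : exists l, l = 1 - de / tau by eexists.
have [cc ec] : exists cc, cc = s + de - l * s by eexists.
have taun : tau != 0 by rewrite gt_eqF.
have e1 : l * s + cc = s + de by rewrite ec addrC subrK.
have e2 : l * (s + tau) + cc = s + tau by rewrite ec el; field.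
have l0 : 0 < l by rewrite el subr_gt0 ltr_pdivrMr// mul1r; move: ded d1t tau0; clear; lra.
have a0e : `|1 - l| + `|- tau^-1| * enorm h = (de + enorm h) / tau.
  have ti : 0 <= tau^-1 by rewrite invr_ge0 ltW.
  by rewrite el subKr normrN (ger0_norm ti) ger0_norm ?mulr_ge0//; field.
have phi01 p : s <= p <= s + tau -> 0 <= - tau^-1 * p + (s + tau) / tau <= 1.
  move=> /andP[p1 p2]; have -> : - tau^-1 * p + (s + tau) / tau = (s + tau - p) / tau by field.
  apply/andP; split; [by rewrite divr_ge0 ?subr_ge0// ltW|by rewrite ler_pdivrMr//; move: p1; clear; lra].
have adm p : s <= p <= s + tau -> closure Om (g p + (- tau^-1 * p + (s + tau) / tau) *: h).
  move=> pp; have gp := gx p pp; apply: (chart_cone _ _ _ _ _ _ _ c _ _ _ ch) => //.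
  - exact: h3.
  - by move: gp mr m00; clear; move: (enorm _) => *; lra.
  - by move: hd d1m mr m00; clear; move: (enorm _) => *; lra.
  - exact: phi01.
  - by move: gp hd d1m mc; clear; move: (enorm _) (enorm _) => *; lra.
have est : s + tau - s = tau by rewrite addrC addKr.
have Hv := variation _ _ _ _ _ _ _ cd 0 s (s + tau) g w x0 0 h l cc (- tau^-1) ((s + tau) / tau) (2 * m0) 1.
have p1 p : s <= p <= s + tau -> `|- tau^-1 * p + (s + tau) / tau| <= 1.
  by move=> /phi01 /andP[q0 q1]; rewrite ger0_norm.
have {}Hv := Hv (lexx _) ss cw adm p1 gx; rewrite est a0e enorm0 in Hv.
have [a1 [a10 a11 ea1]] : exists a1, [/\ 0 <= a1, a1 <= 1 / 2 & a1 = (de + enorm h) / tau].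
  exists ((de + enorm h) / tau); split => //; first by apply: divr_ge0; [exact: addr_ge0|exact: ltW].
  by rewrite ler_pdivrMr//; move: ded hd d1t tau0; clear; move: (enorm _) => *; lra.
have eta1 : tau * a1 = de + enorm h by rewrite ea1 mulrC divfK.
rewrite -ea1 eta1 in Hv.
have hh : enorm h <= de + enorm h by rewrite lerDr.
have rd : 2 * m0 <= d0 by move: md m00; clear; lra.
have hd0' : enorm h <= d0 by move: hd d1m md m00; clear; move: (enorm _) => *; lra.
have [sg [z [cs es Ls]]] := Hv rd (lexx _) a11 hd0' hh ltr01.
rewrite e1 e2 in cs Ls.
have th1 : l^-1 * (s + de) + - (cc / l) = s by rewrite -e1; field; rewrite gt_eqF.
have th2 : l^-1 * (s + tau) + - (cc / l) = s + tau by rewrite -{1}e2; field; rewrite gt_eqF.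
have sg1 : sg (s + de) = y + h.
  rewrite es th1 gs; have -> : - tau^-1 * s + (s + tau) / tau = 1 by field.
  by rewrite scale1r.
have sg2 : sg (s + tau) = g (s + tau).
  rewrite es th2; have -> : - tau^-1 * (s + tau) + (s + tau) / tau = 0 by field.
  by rewrite scale0r addr0.
have sds : s + de <= s + tau by move: ded d1t tau0; clear; lra.
have sd0 : s <= s + de by rewrite lerDl.
have thr p : s + de <= p <= s + tau -> s <= l^-1 * p + - (cc / l) <= s + tau.
  move=> /andP[q1 q2]; apply/andP; split.
    by rewrite -[leLHS]th1 lerD2r ler_pM2l ?invr_gt0.
  by rewrite -[leRHS]th2 lerD2r ler_pM2l ?invr_gt0.
have detau : de < tau by move: ded d1t tau0; clear; lra.
have [k [ik kd ki]] : exists k, [/\ itg (s + de) (s + tau) k,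
    forall r, s + de <= r <= s + tau -> enorm (g (l^-1 * r + - (cc / l)) - g r) <= k r &
    int (s + de) (s + tau) k <= de * int s (s + tau) (fun z => enorm (w z))].
  apply: (curve_shift_dist _ _ _ _ _ _ _ _ _ cw) => //; rewrite ?est ?ltrDl//.
have sgd p : s + de <= p <= s + tau -> enorm (sg p - g p) <= enorm h + enorm (g (l^-1 * p + - (cc / l)) - g p).
  move=> pp; rewrite es addrAC addrC; apply: (le_trans (enormD _ _)); rewrite lerD2r enormZ.
  by rewrite ler_piMl ?enorm_ge0// p1// thr.
have PF := potential_forward _ _ _ _ _ _ _ cd s (s + tau) (s + de) g w sg z k (enorm h) s0 sd0 sds sT cw cs ik.
have {}PF : int (s + de) (s + tau) (fun r => f (sg r) r) - int (s + de) (s + tau) (fun r => f (g r) r) <=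
    C * (tau * enorm h + de * (E + tau)).
  apply: (le_trans (PF _ _)).
  - by move=> p pp; apply: (le_trans (sgd p pp)); rewrite lerD2l kd.
  - move=> p pp; apply: (le_trans (sgd p pp)).
    have : enorm (g (l^-1 * p + - (cc / l)) - g p) <= m0.
      apply: st; first exact: thr.
      by move: pp => /andP[q1 ->]; rewrite andbT; apply: le_trans q1.
    by move: hd d1m md m00; clear; move: (enorm _) => *; lra.
  - rewrite ler_pM2l//; apply: lerD.
      by rewrite ler_wpM2r// opprD addrACA subrr add0r gerDl oppr_le0.
    apply: (le_trans ki); rewrite ler_wpM2l//.
    have := curve_length _ _ _ _ _ s (s + tau) 1 cw (lexx _) ss (lexx _) ltr01.
    by rewrite est mulr1; move: Ew tau0 E0; clear; move: (int _ _ _) (int _ _ _) => *; lra.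
have cl := curve_potential_itg _ _ _ _ _ _ _ cd s (s + tau) g w s0 ss sT cw.
(* On [s, s + de] only the original arc carries a coupling term, which is at least [- (C * de)]. *)
have FC : int s (s + tau) (fun r => f (g r) r) = int s (s + de) (fun r => f (g r) r) + int (s + de) (s + tau) (fun r => f (g r) r).
  exact: int_cat.
have FL : - (C * de) <= int s (s + de) (fun r => f (g r) r).
  have -> : - (C * de) = int s (s + de) (fun=> - C) by rewrite int_cst//; ring.
  apply: int_le; [exact: itg_cst|exact: itg_sub cl|].
  move=> p /andP[q1 q2]; have pp : s <= p <= s + tau by rewrite q1 (le_trans q2).
  have pT : 0 <= p <= T by rewrite (le_trans s0)//= (le_trans q2)// (le_trans sds).
  by have := cd_fbd _ _ _ _ _ _ _ cd p _ pT (h3 p pp); rewrite ler_norml => /andP[].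
have sde0 : 0 <= s + de by rewrite addr_ge0.
have D1 := dpp_le _ _ _ _ _ _ _ _ _ cd vd _ _ sg z sde0 sds sT cs.
have D2 := Hno s (s + tau) (lexx _) ss (lexx _).
rewrite sg1 sg2 (runningE _ _ _ _ _ _ _ cd _ _ _ _ sde0 sds sT cs) in D1.
rewrite gs (runningE _ _ _ _ _ _ _ cd _ _ _ _ s0 ss sT cw) FC in D2.
have B1 : tau * ((1 - l) * (dotv (DvL L x0 0) 0 - L x0 0) + - tau^-1 * dotv (DvL L x0 0) h) <= M1 * (de + enorm h).
  have -> : tau * ((1 - l) * (dotv (DvL L x0 0) 0 - L x0 0) + - tau^-1 * dotv (DvL L x0 0) h) =
      de * (- L x0 0) + - dotv (DvL L x0 0) h by rewrite dotv0 el; field.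
  rewrite eM1; have k1 := cauchy_schwarz (- DvL L x0 0) h; rewrite dotvNl enormN in k1.
  have k2 : de * (- L x0 0) <= de * `|L x0 0| by rewrite ler_wpM2l// -normrN ler_norm.
  have k3 := mulr_ge0 de0 (enorm_ge0 (DvL L x0 0)).
  have k4 := mulr_ge0 h00 (normr_ge0 (L x0 0)).
  move: k1 k2 k3 k4; clear; move: (enorm h) (enorm (DvL L x0 0)) (`|L x0 0|) (L x0 0) (dotv _ _) => *; lra.
have B2 : 12 * C * (1 + 0) ^+ 2 * a1 * (int s (s + tau) (fun t => enorm (w t - 0) ^+ 2) / 1 +
     (1 + 2 * m0 + tau + a1) * (tau + int s (s + tau) (fun t => enorm (w t) ^+ 2))) <= M2 * (de + enorm h).
  rewrite (eq_int _ _ (fun t => enorm (w t - 0) ^+ 2) (fun t => enorm (w t) ^+ 2)); last by move=> p _; rewrite subr0.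
  rewrite eM2 -eta1 addr0 expr1n mulr1 divr1.
  have -> : 12 * C / tau * (E + (2 + 2 * m0 + tau) * (tau + E)) * (tau * a1) =
    12 * C * a1 * (E + (2 + 2 * m0 + tau) * (tau + E)) by field.
  have c12 : 0 <= 12 * C * a1 by rewrite !mulr_ge0// ltW.
  rewrite ler_wpM2l//; apply: lerD => //.
  apply: ler_pM; [by move: m00 tau0 a10; clear; lra|by move: Ew0 tau0; clear; move: (int _ _ _) => *; lra|by move: a11; clear; lra|by rewrite lerD2l].
have B3 : C * (tau * enorm h + de * (E + tau)) + C * de <= M3 * (de + enorm h).
  rewrite eM3 -mulrDr -mulrA ler_pM2l//.
  have := h00; have := mulr_ge0 h00 (ltW E0); have := mulr_ge0 h00 (ltW tau0); have := mulr_ge0 de0 (ltW tau0).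
  by clear; move: (enorm h) => *; lra.
rewrite !mulrDl; move: B1 B2 B3 PF FL Ls D1 D2 epe; rewrite -!mulrDl; clear.
move: (tau * (_ + _)) (12 * _ * _ * _ * _) => b1 b2.
move: (int (s + de) (s + tau) (fun t => L (sg t) (z t))) (int s (s + tau) (fun t => L (g t) (w t))) => i1 i2.
move: (int (s + de) (s + tau) (fun r => f (sg r) r)) (int (s + de) (s + tau) (fun r => f (g r) r)) (int s (s + de) _) => i3 i4 i5.
move: (u (s + tau) _) (u (s + de) _) (u s y) (C * (_ + _)) (C * de) (de + enorm h) => *; lra.
Qed.

(** So far only displacements that are inward and later are controlled. From [(s', y')] one waits
    until the later of the two times and then moves, during a time [de], along a segment to [z],
    which is [y] pushed inwards in proportion to [enorm (y' - y)]. Both [z - y] and [z - y'] lie in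
    the cone, and the one-sided estimate compares [z] with [y]. *)
Lemma lip (R : realType) (n : nat) {Om U T L f C d0 h0 u rho t0 x0 G N r0 K}
  (S : @local_setting R n Om U T L f C d0 h0 u rho t0 x0 G N r0 K) :
  exists C1 d1 : R, [/\ 0 < C1, 0 < d1 & forall s s' y y', `|s - t0| <= d1 -> `|s' - t0| <= d1 ->
    closure Om y -> closure Om y' -> enorm (y - x0) <= d1 -> enorm (y' - x0) <= d1 ->
    `|u s' y' - u s y| <= C1 * (`|s' - s| + enorm (y' - y))].
Proof.
case: (S) => cd vd t0T Ax0 ch; have [[r00 K0] hin hout _ _] := ch.
have [C0 _ _ _ _] := cd_L _ _ _ _ _ _ _ cd.
have GN : G = 0 /\ N = 0 /\ K = 0 \/ dotv G N = 1.
  by have [/hin [-> -> ->]|/hout [_ ->]] := pselect (Om x0); [left|right].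
(* The push dominates [dotv G (y - y')], which is at most [enorm G * enorm (y' - y)], and the added
   unit pays for the opening of the cone. *)
have [ka [ka0 eka]] : exists ka, 0 <= ka /\ ka = enorm G + 1.
  by exists (enorm G + 1); rewrite addr_ge0 ?enorm_ge0.
have [V [V0 eV]] : exists V, 1 <= V /\ V = 1 + ka * enorm N.
  by exists (1 + ka * enorm N); rewrite lerDl mulr_ge0 ?enorm_ge0.
have KV0 : 0 <= K * V by rewrite mulr_ge0//; move: V0; clear; lra.
have [c [c0 cK]] : exists c, 0 < c /\ K * V * c <= 1.
  exists (K * V + 1)^-1; rewrite invr_gt0; split; first by rewrite ltr_wpDl.
  by rewrite ler_pdivrMr ?mul1r ?ltr_wpDl// lerDl.
have [C1 [d1 [C10 d10 H]]] := lip_cone R n S c c0.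
have /andP[tp tT] := t0T.
have [d2 [d20 d21 d2T d2r [d2c d2t]]] : exists d2, [/\ 0 < d2, d2 * (3 + 2 * V) <= d1,
    d2 * 4 <= T - t0, d2 * (1 + 2 * V) <= r0 & d2 * (1 + 2 * V) <= c /\ d2 <= t0].
  have W0 : 0 < 3 + 2 * V by move: V0; clear; lra.
  have W1 : 0 < 1 + 2 * V by move: V0; clear; lra.
  exists (Num.min (d1 / (3 + 2 * V)) (Num.min ((T - t0) / 4) (Num.min (r0 / (1 + 2 * V)) (Num.min (c / (1 + 2 * V)) t0)))).
  have T4 : 0 < (T - t0) / 4 by move: tT; clear; lra.
  split; first by rewrite !lt_min T4 tp !divr_gt0.
  - by rewrite -ler_pdivlMr// ge_min lexx.
  - by rewrite -ler_pdivlMr// !ge_min lexx orbT.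
  - by rewrite -ler_pdivlMr// !ge_min lexx !orbT.
  - by split; rewrite -?ler_pdivlMr// !ge_min !lexx !orbT.
have [C2 eC2] : exists C2, C2 = 2 * C + C * (2 + V ^+ 2) + C1 * (2 + V) by eexists.
have CV0 : 0 <= C * (2 + V ^+ 2) by rewrite mulr_ge0 ?ltW// addr_gt0// exprn_gt0//; move: V0; clear; lra.
have C1V : 0 < C1 * (2 + V) by rewrite mulr_gt0//; move: V0; clear; lra.
exists C2, d2; split => //; first by rewrite eC2; move: C0 CV0 C1V; clear; lra.
suff main s s' y y' : `|s - t0| <= d2 -> `|s' - t0| <= d2 ->
    closure Om y -> closure Om y' -> enorm (y - x0) <= d2 -> enorm (y' - x0) <= d2 ->
    u s' y' - u s y <= C2 * (`|s' - s| + enorm (y' - y)).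
  move=> s s' y y' h1 h2 h3 h4 h5 h6; rewrite ler_norml main// andbT lerNl opprB distrC enormB.
  exact: main.
rewrite !ler_norml => /andP[s1 s2] /andP[s1' s2'] Ay Ay' yd yd'.
have [z ez] : exists z, z = y - (ka * enorm (y' - y)) *: N by eexists.
have [de [de0 ede]] : exists de, 0 <= de /\ de = enorm (y' - y) by exists (enorm (y' - y)); rewrite enorm_ge0.
have de2 : de <= 2 * d2.
  have := enorm_triangle y' x0 y; rewrite (enormB x0) ede; move: yd yd'; clear.
  by move: (enorm _) (enorm _) (enorm _) => *; lra.
have [hh ehh] : exists hh, hh = - (ka * de) *: N by eexists.
have zy : z = y + hh by rewrite ez ehh scaleNr ede.
have nh : enorm hh = ka * de * enorm N by rewrite ehh enormZ normrN ger0_norm// mulr_ge0.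
have nhV : enorm hh <= V * de by rewrite nh eV mulrDl mul1r mulrAC lerDr.
have Gh : dotv G hh = - (ka * de) * dotv G N by rewrite ehh dotvZr.
have Vd : V * de <= V * (2 * d2) by rewrite ler_wpM2l//; move: V0; clear; lra.
have cone1 : dotv G hh + K * enorm hh * c <= 0.
  rewrite Gh; case: GN => [[_ [N0 K00]]|->].
    by rewrite N0 K00 dotv0 mulr0 !mul0r addr0.
  have : K * enorm hh * c <= K * (V * de) * c by rewrite ler_wpM2r ?ler_wpM2l// ltW.
  have : K * V * c * de <= 1 * de by rewrite ler_wpM2r.
  have : 1 * de <= ka * de by rewrite ler_wpM2r// eka lerDr enorm_ge0.
  by clear; lra.
have [h2 eh2] : exists h2, h2 = z - y' by eexists.
have h2e : h2 = (y - y') + hh by rewrite eh2 zy addrAC.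
have nh2 : enorm h2 <= V * de.
  rewrite h2e (le_trans (enormD _ _))// enormB -ede nh eV mulrDl mul1r lerD2l.
  by rewrite mulrAC.
have cone2 : dotv G h2 + K * enorm h2 * c <= 0.
  rewrite h2e dotvDr Gh -h2e; case: GN => [[-> [N0 K00]]|->].
    by rewrite N0 K00 !dot0v mulr0 !mul0r !addr0.
  have : K * enorm h2 * c <= K * (V * de) * c by rewrite ler_wpM2r ?ler_wpM2l// ltW.
  have : K * V * c * de <= 1 * de by rewrite ler_wpM2r.
  have := cauchy_schwarz G (y - y'); rewrite (enormB y) -ede eka.
  by clear; move: (enorm G) (dotv _ _) (enorm h2) => *; lra.
have [s1m [ss1 ss1' s1l s1u]] : exists s1, [/\ s <= s1, s' <= s1, s1 - s <= `|s' - s| /\ s1 - s' <= `|s' - s| & s1 <= t0 + d2].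
  exists (Num.max s s'); rewrite !le_max !lexx orbT; split => //; last by rewrite ge_max; apply/andP; split; move: s2 s2'; clear; lra.
  have := ler_norm (s' - s); have := ler_norm (s - s'); rewrite (distrC s) => k1 k2.
  by have := normr_ge0 (s' - s); case: (leP s s') => k3 k4; split; rewrite ?subrr.
case: s1l => s1l s1l'.
have s'0 : 0 <= s' by move: s1' d2t; clear; lra.
have s10 := le_trans s'0 ss1'.
have s1T : s1m + de <= T by move: s1u de2 d2T d20; clear; lra.
have s1d : s1m <= s1m + de by rewrite lerDl.
have I1 := running_segment _ _ _ _ _ _ _ _ _ cd vd s' s1m y' 0 0 s'0 ss1' (le_trans s1d s1T).
have {}I1 : u s' y' <= (s1m - s') * (2 * C) + u s1m y'.
  have := I1 _; rewrite enorm0 lexx scaler0 addr0 expr0n/= addr0 [C * 2]mulrC; apply => //.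
  by move=> r _; rewrite scaler0 addr0.
have th01 r : s1m <= r <= s1m + de -> 0 <= (r - s1m) * de^-1 <= 1.
  move=> /andP[r1 r2]; rewrite mulr_ge0 ?subr_ge0 ?invr_ge0//=.
  have [->|dn] := eqVneq de 0; first by rewrite invr0 mulr0.
  by rewrite ler_pdivrMr ?lt_neqAle ?(eq_sym 0) ?dn// mul1r; move: r2; clear; lra.
have dd : de *: (de^-1 *: h2) = h2.
  rewrite scalerA; have [de00|dn] := eqVneq de 0; last by rewrite mulfV// scale1r.
  rewrite de00 mul0r scale0r; apply/esym/enorm0_eq0/eqP; rewrite eq_le enorm_ge0 andbT.
  by move: nh2; rewrite de00 mulr0.
have Vn : enorm (de^-1 *: h2) <= V.
  rewrite enormZ ger0_norm ?invr_ge0//.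
  have [->|dn] := eqVneq de 0; first by rewrite invr0 mul0r; move: V0; clear; lra.
  have dp : 0 < de by rewrite lt_neqAle eq_sym dn.
  by rewrite mulrC ler_pdivrMr.
have V20 : V * de <= V * (2 * d2) by exact: Vd.
have I2 := running_segment _ _ _ _ _ _ _ _ _ cd vd s1m (s1m + de) y' (de^-1 *: h2) V s10 s1d s1T.
have {}I2 : u s1m y' <= de * (C * (2 + V ^+ 2)) + u (s1m + de) z.
  have := I2 _ Vn; rewrite addrAC subrr add0r dd eh2 (addrC y') subrK; apply.
  move=> r rr; rewrite scalerA; apply: (chart_cone _ _ _ _ _ _ _ c _ _ _ ch) => //.
  - by move: yd' d2r (mulr_ge0 (ltW d20) (le_trans ler01 V0)); clear; move: (enorm _) => *; lra.
  - by move: nh2 V20 d2r d20; rewrite eh2; clear; move: (enorm _) => *; lra.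
  - exact: th01.
  - by move: yd' nh2 V20 d2c; rewrite eh2; clear; move: (enorm _) (enorm _) => *; lra.
  - by rewrite -eh2.
have V2d : 0 <= V * d2 - d2 by have := ler_wpM2r (ltW d20) V0; clear; lra.
have I3 := H s y (s1m - s + de) hh.
have {}I3 : u (s1m + de) z <= u s y + C1 * (s1m - s + de + enorm hh).
  have : s + (s1m - s + de) = s1m + de by clear; lra.
  rewrite zy => <-; apply: I3 => //.
  - by rewrite ler_norml; move: s1 s2 d21 V2d; clear => *; apply/andP; split; lra.
  - by move: yd d21 V2d d20; clear; move: (enorm _) => *; lra.
  - rewrite addr_ge0 ?subr_ge0//=; move: s1 s1u de2 d21 V2d d20; clear; lra.
  - by move: nhV V20 d21 V2d d20; clear; move: (enorm _) => *; lra.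
have k1 : (s1m - s') * (2 * C) <= `|s' - s| * (2 * C) by rewrite ler_wpM2r// mulr_ge0// ltW.
have k2 : C1 * (s1m - s + de + enorm hh) <= C1 * (`|s' - s| + de + V * de).
  by rewrite ler_pM2l// lerD// lerD2r.
have k3 := mulr_ge0 (ltW C10) (mulr_ge0 (le_trans ler01 V0) (normr_ge0 (s' - s))).
have k4 := mulr_ge0 (ltW C10) (normr_ge0 (s' - s)).
have k5 := mulr_ge0 CV0 (normr_ge0 (s' - s)).
have k6 := mulr_ge0 (ltW C0) de0.
have k7 := mulr_ge0 (ltW C10) de0.
rewrite -ede eC2; move: I1 I2 I3 k1 k2 k3 k4 k5 k6 k7; clear.
move: (C * (2 + _)) (enorm hh) (`|s' - s|) (u _ z) (u s1m y') (u s' y') (u s y) => *; lra.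
Qed.

(** Lipschitz continuity of [u] bounds the running cost by the duration plus the distance between
    the endpoints; the distance is absorbed into the energy by Young's inequality with weight
    [(C * C1)^-1]. *)
Lemma near_opt_energy_local (R : realType) (n : nat) {Om U T L f C d0 h0 u rho t0 x0 G N r0 K}
  (S : @local_setting R n Om U T L f C d0 h0 u rho t0 x0 G N r0 K) :
  exists C2 d2 : R, [/\ 0 < C2, 0 < d2 & forall e a b g w, a <= b -> 0 <= e ->
    (forall r, a <= r <= b -> `|r - t0| <= d2 /\ enorm (g r - x0) <= d2) ->
    near_opt (closure Om) L f u e a b g w ->
    int a b (fun r => enorm (w r) ^+ 2) <= C2 * (b - a + e)].
Proof.
case: (S) => cd vd t0T Ax0 ch; have [C0 _ _ _ _] := cd_L _ _ _ _ _ _ _ cd.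
have [C1 [d1 [C10 d10 H]]] := lip R n S.
have /andP[tp tT] := t0T.
have CC : 0 < C * C1 by exact: mulr_gt0.
exists (2 * C * (C1 + C1 * (C * C1) + 2 * C + 1)), (Num.min d1 (Num.min t0 (T - t0))); split.
- have CCC := mulr_gt0 C10 CC.
  by rewrite mulr_gt0 ?mulr_gt0//; move: C0 C10 CCC; clear; lra.
- by rewrite !lt_min d10 tp subr_gt0.
move=> e a b g w ab e0 box [cw Hno].
have [_ _ h3 h4] := cw.
have [] := box a; first by rewrite lexx.
have [] := box b; first by rewrite lexx ab.
rewrite !le_min => /and3P[b1 b2 b3] /and3P[gb1 _ _] /and3P[a1 a2 a3] /and3P[ga1 _ _].
have a0 : 0 <= a by move: a2; rewrite ler_norml => /andP[]; clear; lra.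
have bT : b <= T by move: b3; rewrite ler_norml => /andP[_]; clear; lra.
have Aa : closure Om (g a) by apply: h3; rewrite lexx.
have Ab : closure Om (g b) by apply: h3; rewrite lexx ab.
have := H a b (g a) (g b) a1 b1 Aa Ab ga1 gb1; rewrite distrC => /(le_trans (ler_norm _)) I1.
have I2 := Hno a b (lexx _) ab (lexx _).
have l0 : 0 < (C * C1)^-1 by rewrite invr_gt0.
have I3 := curve_dist_energy _ _ _ _ _ a b _ cw (lexx _) ab (lexx _) l0.
have I4 := running_coercive _ _ _ _ _ _ _ cd a b g w a0 ab bT cw.
have [I5 I50] : exists I5, I5 = int a b (fun r => enorm (w r) ^+ 2) by eexists.
rewrite -I50 in I3 I4 *.
have k1 : C * C1 * enorm (g b - g a) <= I5 / 2 + (b - a) * (C * C1) ^+ 2 / 2.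
  have -> : I5 / 2 + (b - a) * (C * C1) ^+ 2 / 2 = C * C1 * ((C * C1)^-1 / 2 * I5 + (b - a) / (2 * (C * C1)^-1)).
    by field; rewrite !gt_eqF.
  by rewrite ler_pM2l.
have k2 : C * (running L f a b g w + 2 * C * (b - a)) <=
   C * (C1 * (b - a) + C1 * enorm (g b - g a) + e + 2 * C * (b - a)).
  rewrite ler_pM2l//; move: I1 I2; rewrite (@ger0_norm _ (b - a)) ?subr_ge0// mulrDr; clear.
  by move: (running _ _ _ _ _ _) (u _ _) (u _ _) (enorm _) => *; lra.
have k3 : 0 <= b - a by rewrite subr_ge0.
have k4 := mulr_ge0 (ltW C0) k3; have k5 := mulr_ge0 (ltW C0) e0.
have k6 := mulr_ge0 (mulr_ge0 (ltW CC) (ltW CC)) k3; have k7 := mulr_ge0 (ltW CC) e0.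
have k8 := mulr_ge0 (mulr_ge0 (ltW CC) (ltW CC)) e0; have k9 := mulr_ge0 (mulr_ge0 (ltW C0) (ltW C0)) e0.
have k10 := mulr_ge0 (ltW CC) k3.
move: I4 k1 k2 k3 k4 k5 k6 k7 k8 k9 k10; rewrite !expr2; clear.
by move: (running _ _ _ _ _ _) (enorm _) => *; lra.
Qed.

(** * Bent chords and regularity of near-optimal arcs *)

Section quadratic_curve.
Context {R : realType} {n : nat}.
Implicit Types (x v p : 'rV[R]_n).

(** The value over [0, q] results from computing the integral over [0, 2 q] once by doubling and
    once by translation. *)
Lemma int_id (a b : R) : a <= b -> itg a b (fun z => z) /\ int a b (fun z => z) = (b ^+ 2 - a ^+ 2) / 2.
Proof.
have I (p q : R) : p <= q -> itg p q (fun z => z).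
  move=> pq; apply: continuous_on_int_itg => // r _ e e0; by exists e.
have Tr (p q c : R) : p <= q -> int (p + c) (q + c) (fun z => z) = int p q (fun z => z) + (q - p) * c.
  move=> pq; have i1 : itg (1 * p + c) (1 * q + c) (fun z : R => z) by apply: I; rewrite !mul1r lerD2r.
  have [_] := int_subst 1 c ltr01 _ _ _ i1; rewrite !mul1r => ->.
  rewrite -int_cst// -intD; [|exact: I|exact: itg_cst].
  by apply: eq_int => z _; rewrite mul1r.
have Z (q : R) : 0 <= q -> int 0 q (fun z => z) = q ^+ 2 / 2.
  move=> q0; have i2 : itg (2 * 0 + 0) (2 * q + 0) (fun z : R => z) by apply: I; rewrite lerD2r ler_pM2l.
  have [_] := int_subst 2 0 (ltr0n _ 2) _ _ _ i2; rewrite mulr0 !addr0.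
  have -> : int 0 q (fun r => 2 * r + 0) = 2 * int 0 q (fun z => z).
    by rewrite -intZ; [apply: eq_int => z _; rewrite addr0|exact: I].
  have qq : q <= 2 * q by lra.
  rewrite (int_cat 0 (2 * q) q)//; last by apply: I; lra.
  have := Tr 0 q q q0; rewrite add0r => e.
  have -> : 2 * q = q + q by ring.
  by rewrite e; lra.
move=> ab; split; first exact: I.
have := Tr 0 (b - a) a; rewrite add0r subrK subr0 Z ?subr_ge0// => ->//.
by rewrite !expr2; field.
Qed.

Lemma curve_quadratic A (a b : R) x v p : a <= b ->
  (forall r, a <= r <= b -> A (x + (r - a) *: v + ((r - a) * (b - r)) *: p)) ->
  curve A a b (fun r => x + (r - a) *: v + ((r - a) * (b - r)) *: p)
    (fun r => v + (a + b - 2 * r) *: p).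
Proof.
move=> ab hA.
have iw r s (i : 'I_n) : r <= s -> itg r s (fun z => (v ord0 i + (a + b) * p ord0 i) + (- 2 * p ord0 i) * z).
  by move=> rs; apply: itgD; [exact: itg_cst|apply/itgZ; have [] := int_id r s rs].
have ew i z : (v ord0 i + (a + b) * p ord0 i) + (- 2 * p ord0 i) * z = (v + (a + b - 2 * z) *: p) ord0 i.
  by rewrite !mxE; ring.
have h1 i : itg a b (fun r => (v + (a + b - 2 * r) *: p) ord0 i).
  by apply: (eq_itg _ _ _ _ _ (iw a b i ab)) => z _; rewrite ew.
split => //.
- move=> i r s ar rs sb; rewrite -(eq_int _ _ _ _ (fun z _ => ew i z)).
  have [i1 e1] := int_id r s rs.
  rewrite intD ?itg_cst//; last exact: itgZ.
  by rewrite int_cst// intZ// e1 !mxE; field.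
- apply: (itg_le _ _ _ (fun=> (enorm v + (b - a) * enorm p) ^+ 2)); last exact: itg_cst.
    apply: (eq_measurable_fun (fun r : measurableTypeR R => enorm (v + (a + b - 2 * r) *: p - 0) ^+ 2)).
      by move=> r _; rewrite subr0.
    apply: measurable_enorm_sqr => //.
    by move=> i; exact: itg_measurable (h1 i).
  move=> r /andP[ar rb]; rewrite ger0_norm ?sqr_ge0//.
  rewrite lerXn2r ?nnegrE ?enorm_ge0 ?addr_ge0 ?mulr_ge0 ?enorm_ge0 ?subr_ge0//.
  rewrite (le_trans (enormD _ _))// lerD2l enormZ ler_wpM2r ?enorm_ge0//.
  by rewrite ler_norml; apply/andP; split; lra.
Qed.

End quadratic_curve.

(** The gain is in [arc_straight]: the mean square deviation of the velocity from one vector [v] is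
    of the order of the duration. The term [e] in [arc_dist] accounts for the defect of
    optimality. *)
Record arc (R : realType) (n : nat) (M e a b : R) (g w : R -> 'rV[R]_n) (v : 'rV[R]_n) : Prop := {
  arc_v : enorm v <= M;
  arc_energy : int a b (fun r => enorm (w r) ^+ 2) <= M * (b - a);
  arc_straight : int a b (fun r => enorm (w r - v) ^+ 2) <= M * (b - a) ^+ 2;
  arc_dist : forall p q, a <= p <= b -> a <= q <= b -> enorm (g p - g q) <= M * (`|p - q| + e) }.

(* A near-optimal arc is compared with the chord between its endpoints, bent inwards by the
   quadratic correction that keeps it in the closed domain. *)
Lemma near_opt_arc (R : realType) (n : nat) {Om U T L f C d0 h0 u rho t0 x0 G N r0 K}
  (S : @local_setting R n Om U T L f C d0 h0 u rho t0 x0 G N r0 K) :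
  exists M d : R, [/\ 0 < M, 0 < d & forall e a b g w, a < b -> 0 <= e <= (b - a) ^+ 2 ->
    (forall r, a <= r <= b -> `|r - t0| <= d /\ enorm (g r - x0) <= d) ->
    near_opt (closure Om) L f u e a b g w ->
    arc R n M e a b g w ((b - a)^-1 *: (g b - g a))].
Proof.
case: (S) => cd vd t0T Ax0 ch; have [C0 _ _ _ _] := cd_L _ _ _ _ _ _ _ cd.
have [C2 [d2 [C20 d20 HE]]] := near_opt_energy_local R n S.
have [[r00 K0] _ _ _ [_ CH1]] := ch.
have d00 := cd_d0 _ _ _ _ _ _ _ cd.
have /andP[tp tT] := t0T.
have N0 := enorm_ge0 N.
have [D [D1 eD]] : exists D, 1 <= D /\ D = C2 + 1 by exists (C2 + 1); rewrite lerDr ltW.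
have [V [V2 eV]] : exists V, 2 <= V /\ V = 2 * D by exists (2 * D); split=> //; move: D1; clear; lra.
have V0 : 0 <= V by move: V2; clear; lra.
have [B [B0 eB]] : exists B, 0 <= B /\ B = K * V ^+ 2 * enorm N.
  exists (K * V ^+ 2 * enorm N); split=> //; apply: mulr_ge0 => //; apply: mulr_ge0 => //; exact: sqr_ge0.
have VB0 : 0 <= V + B by exact: addr_ge0.
have C0' := ltW C0; have C20' := ltW C20.
have [P1 [P10 eP1]] : exists P, 0 <= P /\ P = C * (1 + (V + B) ^+ 2) * (V + B) + C * (1 + V) * B + C * B ^+ 2.
  eexists; split; last by [].
  apply: addr_ge0; [apply: addr_ge0|]; repeat (apply: mulr_ge0 => //); rewrite ?sqr_ge0//.
  - by rewrite addr_ge0 ?sqr_ge0.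
  - by rewrite addr_ge0.
have [P [P0 eP]] : exists P, 0 <= P /\ P = P1 + C * (2 * V + B) + C * V * (1 + 2 * C2).
  eexists; split; last by [].
  apply: addr_ge0; [apply: addr_ge0 => //|]; repeat (apply: mulr_ge0 => //).
  - by move: V0 B0; clear; lra.
  - by move: C20'; clear; lra.
have CP : 0 < C * (P + 1) by rewrite mulr_gt0// ltr_wpDl.
have [M [M0 M1 M2 M3]] : exists M, [/\ 0 < M, V <= M, 2 * C2 <= M & C * (P + 1) <= M].
  by exists (V + 2 * C2 + C * (P + 1)); split; move: V0 C20' CP; clear; lra.
have [d [dp dd2 ddr ddd [dt [dT dB]]]] : exists d, [/\ 0 < d, d <= d2, d <= r0, 4 * d <= d0 & d <= t0 /\
    (d <= T - t0 /\ d * (2 * (V + B)) <= Num.min (d0 / 4) (1 / 2))].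
  have DB : 0 < 2 * (V + B) by move: V2 B0; clear; lra.
  exists (Num.min (Num.min (d2) (Num.min r0 (d0 / 4))) (Num.min (Num.min t0 (T - t0)) (Num.min (d0 / 4) (1 / 2) / (2 * (V + B))))).
  have d04 : 0 < d0 / 4 by rewrite divr_gt0.
  split; first by rewrite !lt_min d20 r00 d04 tp subr_gt0 tT/= divr_gt0// lt_min d04 divr_gt0.
  - by rewrite !ge_min lexx.
  - by rewrite !ge_min lexx !orbT.
  - by rewrite -ler_pdivlMl// mulrC !ge_min lexx !orbT.
  - by split; [|split]; rewrite -?ler_pdivlMr// !ge_min lexx !orbT.
move: dB; rewrite le_min => /andP[dB1 dB2].
exists M, d; split => // e a b g w ab /andP[e0 ee] box Hno.
have [cw Hn] := Hno; have [_ _ h3 h4] := cw.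
have abl := ltW ab.
have [tau [tau0 et]] : exists tau, 0 < tau /\ tau = b - a by exists (b - a); rewrite subr_gt0.
have tau2 : tau <= 2 * d.
  have [] := box a; first by rewrite lexx.
  have [] := box b; first by rewrite lexx abl.
  by rewrite !ler_norml et => /andP[_ +] _ /andP[+ _] _; clear; lra.
have dhalf : 2 * d <= 1 / 2.
  have := ler_wpM2l (ltW dp) V2; have := mulr_ge0 (ltW dp) B0; move: dB2; clear; lra.
have taul1 : tau <= 1 / 2 by move: tau2 dhalf; clear; lra.
have etau : e <= tau.
  rewrite -et in ee; apply: (le_trans ee); rewrite expr2 ler_piMl ?ltW//; move: taul1; clear; lra.
have HEsub p q : a <= p -> p <= q -> q <= b -> int p q (fun r => enorm (w r) ^+ 2) <= C2 * (q - p + e).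
  move=> ap pq qb; apply: HE => //; last exact: near_opt_sub Hno.
  move=> r /andP[r1 r2]; have [] := box r; first by rewrite (le_trans ap)//= (le_trans r2).
  by move=> k1 k2; split; apply: (le_trans _ dd2).
have len p q : a <= p -> p <= q -> q <= b -> enorm (g q - g p) <= D * (q - p + e).
  move=> ap pq qb; have := curve_dist_energy _ _ _ _ _ p q 1 cw ap pq qb ltr01.
  have := HEsub p q ap pq qb; have k : 0 <= q - p by rewrite subr_ge0.
  have k2 := mulr_ge0 (ltW C20) k; have k3 := mulr_ge0 (ltW C20) e0.
  rewrite eD; move: k k2 k3 e0; clear; move: (enorm _) (int _ _ _) => *; lra.
have lenabs p q : a <= p <= b -> a <= q <= b -> enorm (g p - g q) <= D * (`|p - q| + e).
  move=> /andP[ap pb] /andP[aq qb]; case/orP: (le_total p q) => pq.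
    by rewrite enormB distrC ger0_norm ?subr_ge0// len.
  by rewrite ger0_norm ?subr_ge0// len.
have lenV p q : a <= p <= b -> a <= q <= b -> enorm (g p - g q) <= V * tau.
  move=> pp qq; apply: (le_trans (lenabs p q pp qq)); rewrite eV [2 * D]mulrC -mulrA ler_wpM2l//.
    by move: D1; clear; lra.
  have : `|p - q| <= tau.
    by move: pp qq => /andP[p1 p2] /andP[q1 q2]; rewrite et ler_norml; apply/andP; split; move: p1 p2 q1 q2; clear; lra.
  by move: etau; clear; lra.
have Vtau0 : 0 <= V * tau by rewrite mulr_ge0// ltW.
have aab : a <= a <= b by rewrite lexx.
have bab : a <= b <= b by rewrite lexx abl.
have tn : tau != 0 by rewrite gt_eqF.
rewrite -et.
have [v ev] : exists v, v = tau^-1 *: (g b - g a) by eexists.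
rewrite -ev.
have dg : tau *: v = g b - g a by rewrite ev scalerA mulfV// scale1r.
have nv : enorm v <= V.
  by rewrite ev enormZ ger0_norm ?invr_ge0 ?(ltW tau0)// mulrC ler_pdivrMr// lenV.
have [pp [np epp]] : exists p, enorm p <= B /\ p = - (K * enorm (g a - g b) ^+ 2 / tau ^+ 2) *: N.
  eexists; split; last by [].
  have k0 : 0 <= K * enorm (g a - g b) ^+ 2 / tau ^+ 2.
    by apply: divr_ge0; [apply: mulr_ge0 => //; exact: sqr_ge0|exact: sqr_ge0].
  rewrite enormZ normrN (ger0_norm k0) eB ler_wpM2r// -mulrA ler_wpM2l// ler_pdivrMr ?exprn_gt0//.
  by rewrite -exprMn lerXn2r ?nnegrE ?enorm_ge0// lenV.
have Agr r : a <= r <= b -> closure Om (g a + (r - a) *: v + ((r - a) * (b - r)) *: pp).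
  move=> rab; have [b1 b2] := box a aab; have [b3 b4] := box b bab.
  have th : 0 <= (r - a) / tau <= 1.
    move: rab => /andP[r1 r2]; rewrite divr_ge0 ?subr_ge0 ?(ltW tau0)//= ler_pdivrMr// mul1r et.
    by rewrite lerD2r.
  have := CH1 (g a) (g b) ((r - a) / tau) (h3 a aab) (h3 b bab) (le_trans b2 ddr) (le_trans b4 ddr) th.
  congr (closure Om _); apply/rowP => i; rewrite epp ev !mxE.
  have -> : b = a + tau by rewrite et addrC subrK.
  by field.
have cs := curve_quadratic _ a b (g a) v pp abl Agr.
have [sg esg] : exists sg : R -> 'rV[R]_n, sg = fun r => g a + (r - a) *: v + ((r - a) * (b - r)) *: pp by eexists.
have [z ez] : exists z : R -> 'rV[R]_n, z = fun r => v + (a + b - 2 * r) *: pp by eexists.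
rewrite -esg -ez in cs.
have zb r : a <= r <= b -> enorm (z r - v) <= tau * B.
  move=> /andP[r1 r2]; rewrite ez addrAC subrr add0r enormZ; apply: ler_pM => //; first exact: enorm_ge0.
  by rewrite et ler_norml; apply/andP; split; move: r1 r2; clear; lra.
have tauB : tau * B <= B by rewrite ler_piMl//; move: taul1; clear; lra.
have zb2 r : a <= r <= b -> enorm (z r) <= V + B.
  move=> rab; rewrite -[z r](subrK v) (le_trans (enormD _ _))// addrC lerD//.
  exact: le_trans (zb r rab) tauB.
have sgb r : a <= r <= b -> enorm (sg r - g a) <= tau * (V + B).
  move=> /andP[r1 r2]; rewrite esg /= -(addrA (g a)) (addrC (g a)) addrK (le_trans (enormD _ _))// [tau * _]mulrDr.
  have ra : 0 <= r - a by rewrite subr_ge0.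
  have br : 0 <= b - r by rewrite subr_ge0.
  have rat : r - a <= tau by rewrite et lerD2r.
  rewrite !enormZ (ger0_norm ra) ger0_norm ?mulr_ge0// lerD//; first by apply: ler_pM => //; exact: enorm_ge0.
  apply: ler_pM => //; [exact: mulr_ge0|exact: enorm_ge0|].
  rewrite -[leRHS]mulr1; apply: ler_pM => //; move: taul1 r1 r2; rewrite et; clear; lra.
have dVB : tau * (V + B) <= d0 / 4.
  apply: (le_trans _ dB1); rewrite mulrA ler_wpM2r//; move: tau2; clear; lra.
have seg_sg r : a <= r <= b -> segment_in U (sg r) (g a).
  move=> rab; apply: (cd_segment _ _ _ _ _ _ _ cd); first by rewrite esg; exact: Agr.
  by rewrite enormB (le_trans (sgb r rab))// (le_trans dVB)//; move: d00; clear; lra.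
have Vtau : V * tau <= d0 / 4.
  apply: le_trans dVB; rewrite mulrC ler_pM2l//; move: B0; clear; lra.
have seg_g r : a <= r <= b -> segment_in U (g r) (g a).
  move=> rab; apply: (cd_segment _ _ _ _ _ _ _ cd); first exact: h3.
  by rewrite (le_trans (lenV _ _ aab rab))// (le_trans Vtau)//; move: d00; clear; lra.
have [CL HL HD [HQ HDL] [HLx HDx]] := cd_L _ _ _ _ _ _ _ cd.
have Ua : U (g a) by apply: (cd_sub _ _ _ _ _ _ _ cd); exact: h3.
(* Along the bent chord both the position and the velocity stay within order [tau] of [(g a, v)]. *)
have U1 r : a <= r <= b -> L (sg r) (z r) <= L (g a) v + tau * P1.
  move=> rab.
  have q1 := HLx _ _ (z r) (seg_sg r rab).
  have [_ q2] := HQ (g a) v (z r - v) Ua; rewrite (addrC v) subrK in q2.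
  have q3 : C * (1 + enorm (z r) ^+ 2) * enorm (sg r - g a) <= C * (1 + (V + B) ^+ 2) * (tau * (V + B)).
    apply: ler_pM; [by rewrite mulr_ge0 ?addr_ge0 ?sqr_ge0|exact: enorm_ge0| |exact: sgb].
    by rewrite ler_pM2l// lerD2l lerXn2r ?nnegrE ?enorm_ge0 ?zb2.
  have q4 : dotv (DvL L (g a) v) (z r - v) <= C * (1 + V) * (tau * B).
    apply: (le_trans (cauchy_schwarz _ _)); apply: ler_pM; rewrite ?enorm_ge0 ?zb//.
    by apply: (le_trans (HD _ _ Ua)); rewrite ler_pM2l// lerD2l.
  have q5 : C * enorm (z r - v) ^+ 2 <= C * (tau * B ^+ 2).
    rewrite ler_pM2l// (@le_trans _ _ ((tau * B) ^+ 2))//.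
      by rewrite lerXn2r ?nnegrE ?enorm_ge0 ?zb// mulr_ge0// ltW.
    by rewrite exprMn ler_wpM2r ?sqr_ge0// expr2 ler_piMl ?(ltW tau0)//; move: taul1; clear; lra.
  rewrite eP1; move: (le_trans (ler_norm _) q1) q2 q3 q4 q5; clear.
  move: (dotv _ _) (L (sg r) _) (L (g a) (z r)) (L (g a) v) (enorm (sg r - _)) (enorm (z r) ^+ 2) (enorm (_ - v) ^+ 2) => *.
  by rewrite mulrDr mulrDr; lra.
have is1 := curve_lagrangian_itg _ _ _ _ _ _ _ cd _ _ _ _ abl cs.
have is2 := curve_lagrangian_itg _ _ _ _ _ _ _ cd _ _ _ _ abl cw.
have U2 : int a b (fun r => L (sg r) (z r)) <= tau * (L (g a) v + tau * P1).
  by rewrite et -int_cst// -et; apply: int_le => //; exact: itg_cst.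
have iv := curve_itg_sqrB _ _ _ _ _ v cw.
have [idv edv] := curve_dotv _ _ _ _ _ (DvL L (g a) v) a b cw (lexx _) abl (lexx _).
(* Strong convexity at [v]. As [v] is the average velocity, the linear term has integral zero and
   the quadratic excess remains. *)
have U3 : C^-1 * int a b (fun r => enorm (w r - v) ^+ 2) + tau * L (g a) v
    - C * (V * tau) * (tau + int a b (fun r => enorm (w r) ^+ 2)) <= int a b (fun r => L (g r) (w r)).
  have i1 : itg a b (fun r => C * (V * tau) * (1 + enorm (w r) ^+ 2)) by apply/itgZ/itgD => //; exact: itg_cst.
  have i2 : itg a b (fun r => C^-1 * enorm (w r - v) ^+ 2) by exact: itgZ.
  have i3 : itg a b (fun r => dotv (w r) (DvL L (g a) v) + (L (g a) v - dotv v (DvL L (g a) v))).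
    by apply: itgD => //; exact: itg_cst.
  have -> : C^-1 * int a b (fun r => enorm (w r - v) ^+ 2) + tau * L (g a) v
    - C * (V * tau) * (tau + int a b (fun r => enorm (w r) ^+ 2)) =
    int a b (fun r => C^-1 * enorm (w r - v) ^+ 2 + (dotv (w r) (DvL L (g a) v) + (L (g a) v - dotv v (DvL L (g a) v)))
      - C * (V * tau) * (1 + enorm (w r) ^+ 2)).
    have e1 := intZ _ _ C^-1 _ iv.
    have e2 := intD _ _ _ _ idv (itg_cst a b (L (g a) v - dotv v (DvL L (g a) v))).
    have i4 := itgD _ _ _ _ (itg_cst a b 1) h4.
    have e3 := intZ _ _ (C * (V * tau)) _ i4.
    have e4 := intD _ _ _ _ (itg_cst a b 1) h4.
    rewrite intB//; last exact: itgD.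
    rewrite (intD _ _ _ _ i2 i3) e1 e2 e3 e4 !int_cst// -edv -dg dotvZl mulr1 -et; ring.
  apply: int_le => //; first by apply: itgB => //; exact: itgD.
  move=> r rab.
  have q1 := HLx _ _ (w r) (seg_g r rab).
  have [q2 _] := HQ (g a) v (w r - v) Ua; rewrite (addrC v) subrK in q2.
  have q3 : C * (1 + enorm (w r) ^+ 2) * enorm (g r - g a) <= C * (1 + enorm (w r) ^+ 2) * (V * tau).
    by apply: ler_wpM2l; [rewrite mulr_ge0 ?addr_ge0 ?sqr_ge0|exact: lenV].
  have q4 : C^-1 * enorm (w r - v) ^+ 2 <= L (g a) (w r) - L (g a) v - dotv (DvL L (g a) v) (w r - v).
    by rewrite mulrC ler_pdivrMr// mulrC.
  move: q4 q3; move: q1; rewrite distrC => /(le_trans (ler_norm _)); clear.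
  rewrite dotvBr [dotv (w r) _]dotvC [dotv v _]dotvC.
  by move: (dotv _ (w r)) (dotv _ v) (L (g r) _) (L (g a) (w r)) (L (g a) v) (_ * enorm (w r - v) ^+ 2) (enorm (g r - _)) (enorm (w r) ^+ 2) => *; lra.
have a0 : 0 <= a by have [+ _] := box a aab; rewrite ler_norml => /andP[+ _]; move: dt; clear; lra.
have bT : b <= T by have [+ _] := box b bab; rewrite ler_norml => /andP[_ +]; move: dT; clear; lra.
have sgg r : a <= r <= b -> enorm (sg r - g r) <= tau * (2 * V + B) + 0.
  move=> rab; rewrite (le_trans (enorm_triangle _ (g a) _))// addr0.
  by have := sgb r rab; have := lenV a r aab rab; clear; move: (enorm _) (enorm _) => *; lra.
have ik0 : itg a b (fun=> 0) by exact: itg_cst.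
have PF := potential_forward _ _ _ _ _ _ _ cd a b a g w sg z (fun=> 0) _ a0 (lexx _) abl bT cw cs ik0 sgg.
have {}PF : int a b (fun r => f (sg r) r) - int a b (fun r => f (g r) r) <= C * (tau * (tau * (2 * V + B))).
  have := PF _; rewrite int_cst// mulr0 addr0 -et; apply.
  move=> r rab; apply: (le_trans (sgg r rab)); rewrite addr0.
  by move: dVB Vtau d00; clear; lra.
have sga : sg a = g a by rewrite esg subrr scale0r mul0r scale0r !addr0.
have sgb' : sg b = g b by rewrite esg -et dg subrr mulr0 scale0r addr0 addrC subrK.
have D2 := dpp_le _ _ _ _ _ _ _ _ _ cd vd a b sg z a0 abl bT cs.
have D3 := Hn a b (lexx _) abl (lexx _).
rewrite sga sgb' (runningE _ _ _ _ _ _ _ cd _ _ _ _ a0 abl bT cs) in D2.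
rewrite (runningE _ _ _ _ _ _ _ cd _ _ _ _ a0 abl bT cw) in D3.
have E2 : int a b (fun r => enorm (w r) ^+ 2) <= 2 * C2 * tau.
  apply: (le_trans (HEsub a b (lexx _) abl (lexx _))); rewrite -et [2 * C2]mulrC -mulrA ler_pM2l//.
  by move: etau; clear; lra.
split.
- exact: le_trans M1.
- by rewrite -et; apply: (le_trans E2); rewrite ler_pM2r.
- rewrite -et; apply: (@le_trans _ _ (C * (P + 1) * tau ^+ 2)); last by rewrite ler_wpM2r ?sqr_ge0.
  (* Both curves join the same endpoints in the same time, so near optimality bounds the excess by
     terms of order [tau ^+ 2], [e] included. *)
  have k : C^-1 * int a b (fun r => enorm (w r - v) ^+ 2) <= (P + 1) * tau ^+ 2.
    have q : C * (V * tau) * (tau + int a b (fun r => enorm (w r) ^+ 2)) <= C * (V * tau) * (tau + 2 * C2 * tau).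
      by rewrite ler_wpM2l ?lerD2l// mulr_ge0.
    rewrite -et in ee; rewrite eP; move: q U3 U2 PF D2 D3 ee; clear.
    move: (C^-1 * _) (int a b (fun r => L (g r) (w r))) (int a b (fun r => L (sg r) (z r))) => j1 j2 j3.
    move: (int a b (fun r => f (sg r) r)) (int a b (fun r => f (g r) r)) => j4 j5.
    move: (int a b _) (L (g a) v) (u a _) (u b _) => *; rewrite !expr2; lra.
  by rewrite -mulrA -ler_pdivrMl.
- move=> p q pab qab; apply: (le_trans (lenabs p q pab qab)); rewrite ler_wpM2r ?addr_ge0//.
  by apply: le_trans M1; rewrite eV; move: D1; clear; lra.
Qed.

(** Selects a parameter below finitely many positive thresholds at once, as the later estimates
    repeatedly require. *)
Lemma exists_lower_bound (R : realType) (s : seq R) : all (fun y => 0 < y) s ->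
  exists2 x : R, 0 < x & all (fun y => x <= y) s.
Proof.
elim: s => [_|y s IH /= /andP[y0 /IH[x x0 xs]]]; first by exists 1.
exists (Num.min x y); first by rewrite lt_min x0.
rewrite ge_min lexx orbT/=; apply: sub_all xs => z xz.
by rewrite ge_min xz.
Qed.

(** * Integrals over moving intervals and first-order perturbation of the cost *)

Section moving_interval.
Context {R : realType}.
Implicit Types (a b : R) (q : R -> R).

Lemma int_bound a b q (om : R) : a <= b -> itg a b q ->
  (forall r, a <= r <= b -> `|q r| <= om) -> `|int a b q| <= (b - a) * om.
Proof.
move=> ab iq hq; apply: (le_trans (int_abs _ _ _ iq)); rewrite -int_cst//.
by apply: int_le => //; [exact: itg_abs|exact: itg_cst].
Qed.

(** The integrands are compared pointwise on the common part [m1, m2]; on the remaining pieces, of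
    total length at most that of the two endpoint shifts, each is bounded by [om]. *)
Lemma int_move a b a' b' q1 q2 (om ka : R) : itg a' b' q1 -> itg a b q2 ->
  a <= b -> a' <= b' -> a <= b' -> a' <= b -> 0 <= ka -> 0 <= om ->
  (forall r, a' <= r <= b' -> `|q1 r| <= om) -> (forall r, a <= r <= b -> `|q2 r| <= om) ->
  (forall r, a <= r <= b -> a' <= r <= b' -> q1 r - q2 r <= ka) ->
  int a' b' q1 - int a b q2 <= ka * (b - a) + om * (`|a' - a| + `|b' - b|).
Proof.
move=> i1 i2 ab ab' aB Ab ka0 om0 h1 h2 h3.
have [m1 [m2 [[am1 am1' m1e] [bm2 bm2' m2e] m12]]] : exists m1 m2,
    [/\ [/\ a <= m1, a' <= m1 & (m1 - a) + (m1 - a') <= `|a' - a|],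
        [/\ m2 <= b, m2 <= b' & (b - m2) + (b' - m2) <= `|b' - b|] & m1 <= m2].
  exists (Num.max a a'), (Num.min b b').
  rewrite !le_max !ge_min !lexx !orbT !ge_max !le_min ab ab' aB Ab; split => //; split => //.
    case: (leP a a') => h; first by rewrite ger0_norm ?subr_ge0//; lra.
    by rewrite ltr0_norm ?subr_lt0//; lra.
  case: (leP b b') => h; first by rewrite ger0_norm ?subr_ge0//; lra.
  by rewrite ltr0_norm ?subr_lt0//; lra.
have j1 := itg_sub _ _ _ _ _ am1' bm2' i1.
have j2 := itg_sub _ _ _ _ _ am1 bm2 i2.
rewrite (int_cat a' b' m1)//; last exact: le_trans bm2'.
rewrite (int_cat m1 b' m2)//; last exact: itg_sub i1.
rewrite (int_cat a b m1)//; last exact: le_trans bm2.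
rewrite (int_cat m1 b m2)//; last exact: itg_sub i2.
have k1 : int m1 m2 q1 - int m1 m2 q2 <= ka * (b - a).
  rewrite -intB//; apply: (@le_trans _ _ (int m1 m2 (fun=> ka))).
    apply: int_le; [exact: itgB|exact: itg_cst|].
    move=> r /andP[r1 r2]; apply: h3.
      by rewrite (le_trans am1)//= (le_trans r2).
    by rewrite (le_trans am1')//= (le_trans r2).
  by rewrite int_cst// mulrC ler_wpM2l//; lra.
have B1 p r : a' <= p -> p <= r -> r <= b' -> `|int p r q1| <= (r - p) * om.
  move=> ap pr rb; apply: int_bound => //; first exact: itg_sub i1.
  by move=> z /andP[z1 z2]; apply: h1; rewrite (le_trans ap)//= (le_trans z2).
have B2 p r : a <= p -> p <= r -> r <= b -> `|int p r q2| <= (r - p) * om.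
  move=> ap pr rb; apply: int_bound => //; first exact: itg_sub i2.
  by move=> z /andP[z1 z2]; apply: h2; rewrite (le_trans ap)//= (le_trans z2).
have c1 := ler_normlW (B1 a' m1 (lexx _) am1' (le_trans m12 bm2')).
have c2 := ler_normlW (B1 m2 b' (le_trans am1' m12) bm2' (lexx _)).
have := B2 a m1 (lexx _) am1 (le_trans m12 bm2); rewrite ler_norml => /andP[c3 _].
have := B2 m2 b (le_trans am1 m12) bm2 (lexx _); rewrite ler_norml => /andP[c4 _].
have k2 : om * ((m1 - a) + (m1 - a') + ((b - m2) + (b' - m2))) <= om * (`|a' - a| + `|b' - b|).
  by rewrite ler_wpM2l// lerD.
move: k1 k2 c1 c2 c3 c4; move: (int a' m1 _) (int m2 b' _) (int m1 m2 q1) (int m1 m2 q2) (int a m1 _) (int m2 b _).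
by move: (om * (`|_| + _)) (ka * _) => *; lra.
Qed.

(** The displacement is affine in [z], hence a convex combination of its values at the two ends. *)
Lemma affine_shift a b (l c z : R) : a < b -> a <= z <= b ->
  `|l * z + c - z| <= `|l * a + c - a| + `|l * b + c - b|.
Proof.
move=> ab /andP[az zb]; have ba : 0 < b - a by rewrite subr_gt0.
have k1 : 0 <= b - z by rewrite subr_ge0.
have k2 : 0 <= z - a by rewrite subr_ge0.
rewrite -(ler_pM2l ba) -{1}(gtr0_norm ba) -normrM.
have -> : (b - a) * (l * z + c - z) = (l * a + c - a) * (b - z) + (l * b + c - b) * (z - a) by ring.
apply: (le_trans (ler_normD _ _)); rewrite !normrM (ger0_norm k1) (ger0_norm k2).
have := mulr_ge0 (normr_ge0 (l * a + c - a)) k2; have := mulr_ge0 (normr_ge0 (l * b + c - b)) k1.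
by move: (`|_|) (`|_|) => *; lra.
Qed.

End moving_interval.

(** The variation formula with remainders below [eta] times the size of the perturbation. The
    deviation of the velocity contributes at most [M * tau ^+ 2], and with [tau] below the square of
    the weight this remains a small multiple of [tau] after division by the weight. The change of
    duration adds [f x0 t0] to the linear part. *)
Lemma perturb_cost (R : realType) (n : nat) {Om U T L f C d0 h0 u rho t0 x0 G N r0 K}
  (S : @local_setting R n Om U T L f C d0 h0 u rho t0 x0 G N r0 K) (M eta c : R) :
  0 < M -> 0 < eta -> 0 < c ->
  exists2 tau1 : R, 0 < tau1 & forall tau, 0 < tau <= tau1 -> exists2 d : R, 0 < d &
  forall a b g w v e l cc be be0 (h : 'rV[R]_n),
    b - a = tau -> 0 <= a -> b <= T -> curve (closure Om) a b g w -> arc R n M e a b g w v ->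
    0 <= e <= tau -> (exists p, [/\ a <= p <= b, `|p - t0| <= d & enorm (g p - x0) <= d]) ->
    `|be| = tau^-1 -> (forall z, a <= z <= b -> 0 <= be * z + be0 <= 1) ->
    enorm h <= d -> dotv G h + K * enorm h * c <= 0 ->
    0 <= l * a + cc -> l * b + cc <= T -> `|1 - l| * tau <= d ->
    `|l * a + cc - a| + `|l * b + cc - b| <= `|1 - l| * tau ->
    exists s z, [/\ curve (closure Om) (l * a + cc) (l * b + cc) s z,
      s (l * a + cc) = g a + (be * a + be0) *: h, s (l * b + cc) = g b + (be * b + be0) *: h &
      running L f (l * a + cc) (l * b + cc) s z <= running L f a b g w +
        tau * ((1 - l) * (dotv (DvL L x0 v) v - L x0 v - f x0 t0) + be * dotv (DvL L x0 v) h) +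
        eta * (`|1 - l| * tau + enorm h) + C * M * e].
Proof.
move=> M0 eta0 c0; case: (S) => cd vd t0T Ax0 ch; have [C0 _ _ _ _] := cd_L _ _ _ _ _ _ _ cd.
have [[r00 K0] _ _ _ _] := ch.
have d00 := cd_d0 _ _ _ _ _ _ _ cd.
have /andP[tp tT] := t0T.
have t00T : 0 <= t0 <= T by rewrite !ltW.
have C0' := ltW C0; have M0' := ltW M0.
have [Q [Q0 eQ]] : exists Q, 0 <= Q /\ Q = 12 * C * (1 + M) ^+ 2 * (1 + M).
  eexists; split; last by [].
  by apply: mulr_ge0; [apply: mulr_ge0; [apply: mulr_ge0|exact: sqr_ge0]|exact: addr_ge0].
have e16 : 0 < eta / 16 by rewrite divr_gt0.
have [dt dt0 Hdt] := cd_fcont _ _ _ _ _ _ _ cd t0 t00T _ e16.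
have CM : 0 < 8 * C * (1 + M) by rewrite !mulr_gt0// addr_gt0.
have Q1 : 0 < Q + 1 by rewrite ltr_wpDl.
(* [et] bounds the distance of the arc from [x0] and also serves as the weight in the variation
   formula. *)
have [|et et0] := exists_lower_bound R [:: eta / (10 * (Q + 1)); r0 / 4; c / 4; d0 / 4; 1 / 2; eta / (32 * C); dt / 4; eta / (8 * C * (1 + M))].
  by rewrite /= !divr_gt0// mulr_gt0.
rewrite /= => /andP[et1] /andP[et2] /andP[et3] /andP[et4] /andP[et5] /andP[et6] /andP[et7] /andP[et8 _].
have {}et1 : Q * (5 * et) <= eta / 2.
  move: et1; rewrite ler_pdivlMr ?mulr_gt0//; have := mulr_ge0 Q0 (ltW et0); move: et0; clear; lra.
have {}et6 : C * (2 * et) <= eta / 16.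
  move: et6; rewrite ler_pdivlMr ?mulr_gt0//; clear; lra.
have {}et8 : C * (1 + M) * et <= eta / 8.
  move: et8; rewrite ler_pdivlMr//; clear; lra.
have [|tau1 tau10] := exists_lower_bound R [:: et ^+ 2; et / (4 * M); et; 1].
  by rewrite /= exprn_gt0// divr_gt0 ?mulr_gt0//= et0 ltr01.
rewrite /= => /andP[ta1] /andP[ta2] /andP[ta3] /andP[ta4 _].
exists tau1 => // tau /andP[tau0 tau01].
have {}ta1 := le_trans tau01 ta1; have {}ta2 := le_trans tau01 ta2.
have {}ta3 := le_trans tau01 ta3; have {}ta4 := le_trans tau01 ta4.
have {}ta2 : M * (2 * tau) <= et / 2 by move: ta2; rewrite ler_pdivlMr ?mulr_gt0//; clear; lra.
have [|d d_0] := exists_lower_bound R [:: et / 2; tau * et / 2; tau / 2].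
  by rewrite /= !divr_gt0 ?mulr_gt0.
rewrite /= => /andP[da1] /andP[da2] /andP[da3 _].
exists d => // a b g w v e l cc be be0 h bat a0 bT cw ar /andP[e0 etau] [p0 [pab pt px]] beE phi01 hd hc la0 lbT ld lsh.
have [_ _ g3 _] := cw; case: ar => vM EM SM DM.
have ab : a < b by rewrite -subr_gt0 bat.
have abl := ltW ab.
have tn : tau != 0 by rewrite gt_eqF.
have [mv [mv0 emv]] : exists mv, 0 <= mv /\ mv = `|1 - l| * tau by exists (`|1 - l| * tau); rewrite mulr_ge0 ?normr_ge0 ?ltW.
rewrite -emv in ld lsh *.
have h00 := enorm_ge0 h.
have [al [al0 eal]] : exists al, 0 <= al /\ al = `|1 - l| + `|be| * enorm h.
  by exists (`|1 - l| + `|be| * enorm h); rewrite addr_ge0 ?mulr_ge0.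
have altau : tau * al = mv + enorm h by rewrite eal emv beE; field.
have alet : al <= et.
  have : tau * al <= tau * et by rewrite altau; move: ld hd da2; clear; move: (enorm _) => *; lra.
  by rewrite ler_pM2l.
have distap z z' : a <= z <= b -> a <= z' <= b -> `|z - z'| <= tau.
  by move=> /andP[q1 q2] /andP[q3 q4]; rewrite -bat ler_norml; apply/andP; split; move: q1 q2 q3 q4; clear; lra.
have gx z : a <= z <= b -> enorm (g z - x0) <= et.
  move=> zab; apply: (le_trans (enorm_triangle _ (g p0) _)).
  have k1 := DM z p0 zab pab.
  have : M * (`|z - p0| + e) <= M * (2 * tau).
    by rewrite ler_pM2l//; have := distap z p0 zab pab; move: etau; clear; move: (`|_|) => *; lra.
  by move: k1 px da1 ta2; clear; move: (enorm _) (enorm _) (M * _) (M * _) => *; lra.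
have tx z : a <= z <= b -> `|z - t0| <= d + tau.
  move=> zab; have := ler_normD (z - p0) (p0 - t0); rewrite addrA subrK.
  by have := distap z p0 zab pab; move: pt; clear; move: (`|_|) (`|_|) (`|_|) => *; lra.
have phi1 z : a <= z <= b -> `|be * z + be0| <= 1 by move=> /phi01 /andP[k1 k2]; rewrite ger0_norm.
have adm z : a <= z <= b -> closure Om (g z + (be * z + be0) *: h).
  move=> zab; have gz := gx z zab; apply: (chart_cone _ _ _ _ _ _ _ c _ _ _ ch) => //.
  - exact: g3.
  - by move: gz et2 r00; clear; move: (enorm _) => *; lra.
  - by move: hd da1 et2 r00 et0; clear; move: (enorm _) => *; lra.
  - exact: phi01.
  - by move: gz hd da1 et3 c0 et0; clear; move: (enorm _) (enorm _) => *; lra.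
have rd : et <= d0 by move: et4 d00; clear; lra.
have al2 : al <= 1 / 2 by exact: le_trans alet et5.
have hd0 : enorm h <= d0 by move: hd da1 et4 d00 et0; clear; move: (enorm _) => *; lra.
have hal : enorm h <= (b - a) * al by rewrite bat altau lerDr.
have Hv := variation _ _ _ _ _ _ _ cd M a b g w x0 v h l cc be be0 et et M0' abl cw adm phi1 gx rd vM.
rewrite -eal in Hv; have [s [z [cs es Ls]]] := Hv al2 hd0 hal et0.
have l0 : 0 < l.
  have k : `|1 - l| <= 1 / 2 by apply: le_trans al2; rewrite eal lerDl mulr_ge0.
  by move: k; rewrite ler_norml => /andP[_]; clear; lra.
have ln : l != 0 by rewrite gt_eqF.
have th r : l^-1 * (l * r + cc) + - (cc / l) = r by field.
exists s, z; split => //; [by rewrite es th|by rewrite es th|].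
have [a' ea'] : exists a', a' = l * a + cc by eexists.
have [b' eb'] : exists b', b' = l * b + cc by eexists.
rewrite -ea' -eb' in la0 lbT lsh cs Ls *.
have lsum := lsh; have na := normr_ge0 (a' - a); have nb := normr_ge0 (b' - b).
have ab' : a' <= b' by rewrite ea' eb' lerD2r ler_pM2l.
have dtau : d <= tau / 2 by exact: da3.
have aB : a <= b'.
  have : `|b' - b| <= d by move: na nb lsum ld; clear; move: (`|_|) (`|_|) => *; lra.
  by rewrite ler_norml -bat in dtau * => /andP[+ _]; move: dtau abl; clear; lra.
have Ab : a' <= b.
  have : `|a' - a| <= d by move: na nb lsum ld; clear; move: (`|_|) (`|_|) => *; lra.
  by rewrite ler_norml -bat in dtau * => /andP[_]; move: dtau abl; clear; lra.
have thr r : a' <= r <= b' -> exists2 y, a <= y <= b & r = l * y + cc.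
  move=> /andP[r1 r2]; exists (l^-1 * r + - (cc / l)); last by field.
  apply/andP; split.
    by rewrite -[leLHS]th -ea' lerD2r ler_pM2l ?invr_gt0.
  by rewrite -[leRHS]th -eb' lerD2r ler_pM2l ?invr_gt0.
have sg y : a <= y <= b -> enorm (s (l * y + cc) - g y) <= enorm h.
  move=> yab; rewrite es th addrAC subrr add0r enormZ ler_piMl ?enorm_ge0//; exact: phi1.
have rt r : a' <= r <= b' -> `|r - t0| <= 2 * d + tau.
  move=> /thr[y yab ->]; have k1 := tx y yab; have := affine_shift a b l cc y ab yab; rewrite -ea' -eb'.
  have := ler_normD (l * y + cc - y) (y - t0); rewrite addrA subrK.
  by move: k1 lsum ld; clear; move: (`|_|) (`|_|) (`|_|) (`|_|) (`|_|) => *; lra.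
have lT r : a' <= r <= b' -> 0 <= r <= T by move=> /andP[r1 r2]; rewrite (le_trans la0)//= (le_trans r2).
have lT2 r : a <= r <= b -> 0 <= r <= T by move=> /andP[r1 r2]; rewrite (le_trans a0)//= (le_trans r2).
have [_ _ s3 _] := cs.
have flip2 (y : 'rV[R]_n) r : 0 <= r <= T -> closure Om y -> enorm (y - x0) <= 2 * et -> `|r - t0| <= 2 * d + tau ->
    `|f y r - f x0 t0| <= eta / 8.
  move=> rT Ay yx rr.
  have seg : segment_in U x0 y.
    apply: (cd_segment _ _ _ _ _ _ _ cd) => //; apply: (le_trans yx); move: et4 d00; clear; lra.
  have k1 := cd_flip _ _ _ _ _ _ _ cd r _ _ rT seg.
  have k2 : C * enorm (x0 - y) <= eta / 16 by apply: le_trans et6; rewrite ler_pM2l// enormB.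
  have k3 : `|f x0 r - f x0 t0| <= eta / 16.
    apply: Hdt => //; apply: (le_lt_trans rr); move: da1 ta3 et7 dt0 et0; clear; lra.
  have := ler_normD (f y r - f x0 r) (f x0 r - f x0 t0); rewrite addrA subrK (distrC (f y r) (f x0 r)).
  by move: (le_trans k1 k2) k3; clear; lra.
have i1 := curve_potential_itg _ _ _ _ _ _ _ cd a' b' s z la0 ab' lbT cs.
have i2 := curve_potential_itg _ _ _ _ _ _ _ cd a b g w a0 abl bT cw.
(* After subtraction of this constant the coupling is small along both arcs, so the parts of the two
   time intervals that do not overlap cost a small multiple of their length. *)
have [F0 eF0] : exists F0, F0 = f x0 t0 by eexists.
have ka0 : 0 <= C * (enorm h + M * (mv + e)) by rewrite mulr_ge0// addr_ge0// mulr_ge0// addr_ge0.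
have PF := int_move a b a' b' (fun r => f (s r) r - F0) (fun r => f (g r) r - F0) (eta / 8) (C * (enorm h + M * (mv + e)))
  (itgB _ _ _ _ i1 (itg_cst _ _ F0)) (itgB _ _ _ _ i2 (itg_cst _ _ F0)) abl ab' aB Ab ka0.
have {}PF : int a' b' (fun r => f (s r) r - F0) - int a b (fun r => f (g r) r - F0) <=
    C * (enorm h + M * (mv + e)) * tau + eta / 8 * mv.
  have e8 : 0 <= eta / 8 by rewrite divr_ge0 ?ltW.
  apply: (le_trans (PF e8 _ _ _)); last by rewrite bat lerD2l ler_wpM2l.
  - move=> r rr; rewrite eF0; apply: flip2; [exact: lT|exact: s3| |exact: rt].
    have [y yab ry] := thr r rr; rewrite ry; apply: (le_trans (enorm_triangle _ (g y) _)).
    by have := sg y yab; have := gx y yab; move: hd da1 et0; clear; move: (enorm _) (enorm _) (enorm _) => *; lra.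
  - move=> r rr; rewrite eF0; apply: flip2; [exact: lT2|exact: g3| |].
      by apply: (le_trans (gx r rr)); move: et0; clear; lra.
    by apply: (le_trans (tx r rr)); move: d_0; clear; lra.
  - move=> r rr rr'; have [y yab ry] := thr r rr'.
    rewrite opprB addrA subrK.
    have sgr : enorm (s r - g r) <= enorm h + M * (mv + e).
      rewrite [in s r]ry; apply: (le_trans (enorm_triangle _ (g y) _)); apply: lerD; first exact: sg.
      apply: (le_trans (DM y r yab rr)); rewrite ler_pM2l// lerD2r distrC ry.
      by apply: le_trans lsum; rewrite ea' eb'; exact: affine_shift.
    have seg : segment_in U (g r) (s r).
      apply: (cd_segment _ _ _ _ _ _ _ cd); first exact: g3.
      have k : M * (mv + e) <= M * (2 * tau) by rewrite ler_pM2l//; move: ld dtau etau tau0; clear; lra.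
      by move: sgr k ta2 hd da1 et4 et0 d00; clear; move: (enorm _) (enorm _) (M * _) (M * _) => *; lra.
    have := cd_flip _ _ _ _ _ _ _ cd r _ _ (lT r rr') seg; rewrite distrC => /(le_trans (ler_norm _)) k1.
    by apply: (le_trans k1); rewrite ler_pM2l// enormB.
rewrite (intB _ _ _ _ i1 (itg_cst _ _ _)) (intB _ _ _ _ i2 (itg_cst _ _ _)) !int_cst// in PF.
have bl : b' - a' = l * tau by rewrite ea' eb' -bat; ring.
rewrite bl bat in PF.
rewrite (runningE _ _ _ _ _ _ _ cd _ _ _ _ la0 ab' lbT cs) (runningE _ _ _ _ _ _ _ cd _ _ _ _ a0 abl bT cw).
have B1 : 12 * C * (1 + M) ^+ 2 * al * (int a b (fun t => enorm (w t - v) ^+ 2) / et +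
       (et + et + (b - a) + al) * ((b - a) + int a b (fun t => enorm (w t) ^+ 2))) <= eta / 2 * (mv + enorm h).
  have k1 : int a b (fun t => enorm (w t - v) ^+ 2) / et <= (1 + M) * tau * et.
    rewrite ler_pdivrMr//; apply: (le_trans SM); rewrite bat.
    have -> : (1 + M) * tau * et * et = (1 + M) * (tau * et ^+ 2) by ring.
    apply: ler_pM; rewrite ?sqr_ge0// ?lerDr//.
    by rewrite expr2 ler_pM2l.
  have k2 : (et + et + (b - a) + al) * ((b - a) + int a b (fun t => enorm (w t) ^+ 2)) <= (4 * et) * ((1 + M) * tau).
    have k20 : 0 <= int a b (fun t => enorm (w t) ^+ 2) by apply: int_ge0 => r _; exact: sqr_ge0.
    rewrite bat in EM *; apply: ler_pM.
    - by move: et0 tau0 al0; clear; lra.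
    - by move: tau0 k20; clear; move: (int _ _ _) => *; lra.
    - by move: ta3 alet; clear; lra.
    - by move: EM; clear; move: (int _ _ _) => *; lra.
  have k3 : 0 <= 12 * C * (1 + M) ^+ 2 * al.
    by apply: mulr_ge0 => //; apply: mulr_ge0; [exact: mulr_ge0|exact: sqr_ge0].
  apply: (le_trans (ler_wpM2l k3 (lerD k1 k2))); rewrite -altau.
  have -> : 12 * C * (1 + M) ^+ 2 * al * ((1 + M) * tau * et + 4 * et * ((1 + M) * tau)) = Q * (5 * et) * (tau * al).
    by rewrite eQ; ring.
  by apply: ler_wpM2r => //; rewrite mulr_ge0// ltW.
have B2 : C * (enorm h + M * (mv + e)) * tau <= eta / 8 * (mv + enorm h) + C * M * e.
  have k1 : C * (1 + M) * tau * (mv + enorm h) <= eta / 8 * (mv + enorm h).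
    apply: ler_wpM2r; first exact: addr_ge0.
    by apply: le_trans et8; rewrite ler_wpM2l// mulr_ge0// addr_ge0.
  have k2 : C * M * e * tau <= C * M * e by rewrite ler_piMr// !mulr_ge0.
  have k3 : 0 <= C * (M * enorm h + mv) * tau.
    by apply: mulr_ge0; [apply: mulr_ge0 => //; apply: addr_ge0 => //; exact: mulr_ge0|exact: ltW].
  by move: k1 k2 k3; clear; move: (enorm h) => *; lra.
have B3 : eta / 8 * mv <= eta / 8 * (mv + enorm h) by rewrite ler_pM2l ?divr_gt0// lerDl.
have B4 : 0 <= eta * (mv + enorm h) by rewrite mulr_ge0 ?addr_ge0// ltW.
rewrite -eF0; rewrite bat in Ls; move: Ls PF B4; move: B1 B2 B3; rewrite bat; clear.
move: (12 * _ * _ * _ * _) (C * (_ + _) * tau) (C * M * e) (mv + enorm h) => b1 b2 b3 b4.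
move: (int a' b' (fun r => L (s r) (z r))) (int a' b' (fun r => f (s r) r)) (int a b (fun r => L (g r) (w r))) (int a b (fun r => f (g r) r)) => j1 j2 j3 j4.
move: (dotv _ v) (L x0 v) (dotv _ h) => *; lra.
Qed.

(** By Legendre duality this is [Ham L x (- DvL L x v) - F0], the time derivative that the
    Hamilton-Jacobi equation associates with the slope [- DvL L x v]. *)
Definition tslope (R : realType) (n : nat) (L : 'rV[R]_n -> 'rV[R]_n -> R) (F0 : R) x v : R :=
  dotv (DvL L x v) v - L x v - F0.
Arguments tslope {R n}.

(** * Displacement of one endpoint: one-sided and two-sided slopes *)

Section endpoints.
Context (R : realType) (n : nat) (Om U : set 'rV[R]_n) (T : R) (L : 'rV[R]_n -> 'rV[R]_n -> R)
    (f : 'rV[R]_n -> R -> R) (C d0 : R) (h0 : 'rV[R]_n -> R) (u : R -> 'rV[R]_n -> R)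
    (rho : 'rV[R]_n -> R) (t0 : R) (x0 G N : 'rV[R]_n) (r0 K : R).
Hypothesis S : local_setting Om U T L f C d0 h0 u rho t0 x0 G N r0 K.
Let cd := ls_cd _ _ _ _ _ _ _ _ _ _ _ _ _ _ _ _ S.
Let vd := ls_vd _ _ _ _ _ _ _ _ _ _ _ _ _ _ _ _ S.

(** The start of the arc is moved and its end is kept, which bounds [u] from above near the
    start. *)
Lemma perturb_left (M eta c : R) : 0 < M -> 0 < eta -> 0 < c ->
  exists2 tau1 : R, 0 < tau1 & forall tau, 0 < tau <= tau1 -> exists2 d : R, 0 < d &
  forall a b g w v e s' (h : 'rV[R]_n),
    b - a = tau -> 0 <= a -> b <= T -> near_opt (closure Om) L f u e a b g w -> arc R n M e a b g w v ->
    0 <= e <= tau -> `|a - t0| <= d -> enorm (g a - x0) <= d ->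
    enorm h <= d -> dotv G h + K * enorm h * c <= 0 -> `|s' - a| <= d -> 0 <= s' ->
    u s' (g a + h) <= u a (g a) + (s' - a) * tslope L (f x0 t0) x0 v - dotv (DvL L x0 v) h +
      eta * (`|s' - a| + enorm h) + (1 + C * M) * e.
Proof.
move=> M0 eta0 c0; have [tau1 tau10 H] := perturb_cost R n S M eta c M0 eta0 c0.
exists tau1 => // tau tt; have [d' d'0 Hd] := H tau tt; have /andP[tau0 _] := tt.
exists (Num.min d' (tau / 2)); first by rewrite lt_min d'0 divr_gt0.
move=> a b g w v e s' h bat a0 bT no ar eb.
rewrite !le_min => /andP[at0 _] /andP[gx _] /andP[hd _] hc /andP[sd sd2] s'0.
have [cw Hn] := no.
have abl : a <= b by rewrite -subr_ge0 bat ltW.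
have tn : tau != 0 by rewrite gt_eqF.
have [l el] : exists l, l = 1 - (s' - a) / tau by eexists.
have [cc ec] : exists cc, cc = b - l * b by eexists.
have eb' : l * b + cc = b by rewrite ec addrC subrK.
have ea' : l * a + cc = s'.
  have -> : l * a + cc = b - l * (b - a) by rewrite ec; ring.
  by rewrite bat el mulrBl divfK// mul1r -bat; ring.
have l1 : `|1 - l| * tau = `|s' - a|.
  by rewrite el subKr normrM normfV (gtr0_norm tau0) divfK.
have s'b : s' <= b.
  by move: sd2; rewrite ler_norml -bat => /andP[_]; move: abl; lra.
have [] := Hd a b g w v e l cc (- tau^-1) (b / tau) h bat a0 bT cw ar eb.
- by exists a; rewrite lexx abl.
- by rewrite normrN gtr0_norm// invr_gt0.
- move=> z /andP[az zb]; have -> : - tau^-1 * z + b / tau = (b - z) / tau by field.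
  apply/andP; split; first by rewrite divr_ge0 ?subr_ge0// ltW.
  by rewrite ler_pdivrMr// mul1r -bat lerD2l lerN2.
- exact: hd.
- exact: hc.
- by rewrite ea'.
- by rewrite eb'.
- by rewrite l1.
- by rewrite ea' eb' subrr normr0 addr0 l1.
rewrite ea' eb' l1 => s [z [cs sa sb rs]].
have D1 := dpp_le _ _ _ _ _ _ _ _ _ cd vd s' b s z s'0 s'b bT cs.
have D2 := Hn a b (lexx _) abl (lexx _).
have e1 : - tau^-1 * a + b / tau = 1.
  have -> : - tau^-1 * a + b / tau = (b - a) / tau by field.
  by rewrite bat mulfV.
have e2 : - tau^-1 * b + b / tau = 0 by field.
rewrite sa sb e1 e2 scale1r scale0r addr0 in D1.
have e3 : tau * ((1 - l) * (dotv (DvL L x0 v) v - L x0 v - f x0 t0) + - tau^-1 * dotv (DvL L x0 v) h) =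
    (s' - a) * tslope L (f x0 t0) x0 v - dotv (DvL L x0 v) h.
  by rewrite /tslope el; field.
rewrite e3 in rs.
move: D1 D2 rs; move: (running _ _ _ _ s z) (running _ _ _ _ g w) ((s' - a) * _) (dotv _ h) (eta * _) => *; lra.
Qed.

(** The end of the arc is moved and its start is kept, which bounds [u] from below near the end. *)
Lemma perturb_right (M eta c : R) : 0 < M -> 0 < eta -> 0 < c ->
  exists2 tau1 : R, 0 < tau1 & forall tau, 0 < tau <= tau1 -> exists2 d : R, 0 < d &
  forall a b g w v e s' (h : 'rV[R]_n),
    b - a = tau -> 0 <= a -> b <= T -> near_opt (closure Om) L f u e a b g w -> arc R n M e a b g w v ->
    0 <= e <= tau -> `|b - t0| <= d -> enorm (g b - x0) <= d ->
    enorm h <= d -> dotv G h + K * enorm h * c <= 0 -> `|s' - b| <= d -> s' <= T ->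
    u b (g b) <= u s' (g b + h) - (s' - b) * tslope L (f x0 t0) x0 v + dotv (DvL L x0 v) h +
      eta * (`|s' - b| + enorm h) + (1 + C * M) * e.
Proof.
move=> M0 eta0 c0; have [tau1 tau10 H] := perturb_cost R n S M eta c M0 eta0 c0.
exists tau1 => // tau tt; have [d' d'0 Hd] := H tau tt; have /andP[tau0 _] := tt.
exists (Num.min d' (tau / 2)); first by rewrite lt_min d'0 divr_gt0.
move=> a b g w v e s' h bat a0 bT no ar eb.
rewrite !le_min => /andP[at0 _] /andP[gx _] /andP[hd _] hc /andP[sd sd2] s'T.
have [cw Hn] := no.
have abl : a <= b by rewrite -subr_ge0 bat ltW.
have tn : tau != 0 by rewrite gt_eqF.
have [l el] : exists l, l = 1 + (s' - b) / tau by eexists.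
have [cc ec] : exists cc, cc = a - l * a by eexists.
have ea' : l * a + cc = a by rewrite ec addrC subrK.
have eb' : l * b + cc = s'.
  have -> : l * b + cc = a + l * (b - a) by rewrite ec; ring.
  by rewrite bat el mulrDl divfK// mul1r -bat; ring.
have l1 : `|1 - l| * tau = `|s' - b|.
  by rewrite el opprD addrA subrr add0r normrN normrM normfV (gtr0_norm tau0) divfK.
have s'b : a <= s'.
  by move: sd2; rewrite ler_norml -bat => /andP[+ _]; move: abl; lra.
have [] := Hd a b g w v e l cc (tau^-1) (- (a / tau)) h bat a0 bT cw ar eb.
- by exists b; rewrite lexx abl.
- by rewrite gtr0_norm// invr_gt0.
- move=> z /andP[az zb]; have -> : tau^-1 * z + - (a / tau) = (z - a) / tau by field.
  apply/andP; split; first by rewrite divr_ge0 ?subr_ge0// ltW.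
  by rewrite ler_pdivrMr// mul1r -bat lerD2r.
- exact: hd.
- exact: hc.
- by rewrite ea'.
- by rewrite eb'.
- by rewrite l1.
- by rewrite ea' eb' subrr normr0 add0r l1.
rewrite ea' eb' l1 => s [z [cs sa sb rs]].
have D1 := dpp_le _ _ _ _ _ _ _ _ _ cd vd a s' s z a0 s'b s'T cs.
have D2 := Hn a b (lexx _) abl (lexx _).
have e1 : tau^-1 * b + - (a / tau) = 1.
  have -> : tau^-1 * b + - (a / tau) = (b - a) / tau by field.
  by rewrite bat mulfV.
have e2 : tau^-1 * a + - (a / tau) = 0 by field.
rewrite sa sb e1 e2 scale1r scale0r addr0 in D1.
have e3 : tau * ((1 - l) * (dotv (DvL L x0 v) v - L x0 v - f x0 t0) + tau^-1 * dotv (DvL L x0 v) h) =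
    - ((s' - b) * tslope L (f x0 t0) x0 v) + dotv (DvL L x0 v) h.
  by rewrite /tslope el; field.
rewrite e3 in rs.
move: D1 D2 rs; move: (running _ _ _ _ s z) (running _ _ _ _ g w) ((s' - b) * _) (dotv _ h) (eta * _) => *; lra.
Qed.

End endpoints.

(** From a general point only a near-optimal arc forward in time is available, so the expansion is
    one-sided. The vector [v] depends on the point and on [e], while the radius [d] does not. *)
Lemma upper_slope (R : realType) (n : nat) {Om U T L f C d0 h0 u rho t0 x0 G N r0 K}
  (S : @local_setting R n Om U T L f C d0 h0 u rho t0 x0 G N r0 K) :
  exists2 M : R, 0 < M & forall eta c : R, 0 < eta -> 0 < c -> exists2 d : R, 0 < d &
  forall s y e, `|s - t0| <= d -> closure Om y -> enorm (y - x0) <= d -> 0 < e ->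
    exists2 v, enorm v <= M & forall s' h, `|s' - s| <= d -> enorm h <= d ->
      dotv G h + K * enorm h * c <= 0 ->
      u s' (y + h) <= u s y + (s' - s) * tslope L (f x0 t0) x0 v - dotv (DvL L x0 v) h +
        eta * (`|s' - s| + enorm h) + e.
Proof.
case: (S) => cd vd t0T Ax0 ch; have [C0 _ _ _ _] := cd_L _ _ _ _ _ _ _ cd.
have [M [dA [M0 dA0 HA]]] := near_opt_arc R n S.
have /andP[tp tT] := t0T.
exists M => // eta c eta0 c0.
have [tau1 tau10 H] := perturb_left _ _ _ _ _ _ _ _ _ _ _ _ _ _ _ _ _ _ S M eta c M0 eta0 c0.
have dA2 : 0 < dA / 2 by rewrite divr_gt0.
have [ds ds0 stay] := near_opt_stay _ _ _ _ _ _ _ _ _ cd vd _ dA2.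
have [|tau tau0] := exists_lower_bound R [:: tau1; ds; dA / 2; (T - t0) / 2; 1].
  by rewrite /= tau10 ds0 dA2 divr_gt0 ?subr_gt0 ?ltr01.
rewrite /= => /andP[ta1] /andP[ta2] /andP[ta3] /andP[ta4] /andP[ta5 _].
have [|d1 d10 Hd] := H tau; first by rewrite tau0.
have [|d d_0] := exists_lower_bound R [:: d1; dA / 2; t0 / 2; (T - t0) / 2].
  by rewrite /= d10 dA2 !divr_gt0 ?subr_gt0.
rewrite /= => /andP[db1] /andP[db2] /andP[db3] /andP[db4 _].
exists d => // s y e sd Ay yd e0.
have CM : 0 < 1 + C * M by rewrite addr_gt0// mulr_gt0.
have [|ep ep0] := exists_lower_bound R [:: tau ^+ 2; e / (1 + C * M)].
  by rewrite /= exprn_gt0// divr_gt0.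
rewrite /= => /andP[ep1] /andP[ep2 _].
rewrite ler_pdivlMr// in ep2.
have ept : ep <= tau by apply: (le_trans ep1); rewrite expr2 ler_piMr// ltW.
have sd' := sd; move: sd'; rewrite ler_norml => /andP[sd1 sd2].
have s0 : 0 <= s by move: sd1 db3 tp; clear; lra.
have sT : s + tau <= T by move: sd2 db4 ta4; clear; lra.
have sl : 0 <= s <= T by rewrite s0 (le_trans _ sT)// lerDl ltW.
have [g [w [no' gs]]] := near_opt_exists _ _ _ _ _ _ _ _ _ cd vd ep s y ep0 sl Ay.
have no := near_opt_sub _ _ _ _ _ s T s (s + tau) g w (lexx _) sT no'.
have ss : s <= s + tau by rewrite lerDl ltW.
have bst : s + tau - s = tau by rewrite addrC addKr.
have st := stay ep s (s + tau) g w (le_trans ept ta5) s0 ss sT.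
have ab : s < s + tau by rewrite ltrDl.
have ebd : 0 <= ep <= (s + tau - s) ^+ 2 by rewrite bst ltW.
have ar : arc R n M ep s (s + tau) g w ((s + tau - s)^-1 *: (g (s + tau) - g s)).
  apply: HA => // r rr; have /andP[r1 r2] := rr; split.
    by rewrite ler_norml; apply/andP; split; move: r1 r2 sd1 sd2 ta3 db2; clear; lra.
  apply: (le_trans (enorm_triangle _ y _)); rewrite -gs in yd *.
  have : enorm (g r - g s) <= dA / 2 by apply: st => //; rewrite ?bst ?lexx.
  by move: yd db2; clear; move: (enorm _) (enorm _) => *; lra.
move: ar; move: (_ *: (g (s + tau) - g s)) => v ar.
exists v; first by case: ar.
move=> s' h s'd hd hc; rewrite -gs.
have s'0 : 0 <= s' by move: s'd; rewrite ler_norml => /andP[+ _]; move: sd1 db3; clear; lra.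
have et : 0 <= ep <= tau by rewrite ltW.
have := Hd s (s + tau) g w v ep s' h bst s0 sT no ar et (le_trans sd db1) _ (le_trans hd db1) hc (le_trans s'd db1) s'0.
rewrite gs => /(_ (le_trans yd db1)) /le_trans; apply; rewrite lerD2l.
by rewrite mulrC.
Qed.

(** Young's inequality with weight [ka] turns mean-square straightness into closeness of [g b - g a]
    to [tau *: v], tested against [G]. *)
Lemma straight_dot (R : realType) (n : nat) (A : set 'rV[R]_n) (a b tau M ka : R)
    (g w : R -> 'rV[R]_n) (v G : 'rV[R]_n) : curve A a b g w -> a <= b -> b - a = tau ->
  int a b (fun r => enorm (w r - v) ^+ 2) <= 4 * M * tau ^+ 2 -> 0 < ka ->
  `|dotv (g b - g a) G - tau * dotv v G| <= enorm G * (2 * M * tau ^+ 2 / ka + ka * tau / 2).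
Proof.
move=> cw ab bat sm ka0.
have [i1 ->] := curve_dotv _ _ _ _ _ G a b cw (lexx _) ab (lexx _).
rewrite -bat -int_cst// -intB//; last exact: itg_cst.
have i2 : itg a b (fun z => dotv (w z) G - dotv v G) by apply: itgB => //; exact: itg_cst.
apply: (le_trans (int_abs _ _ _ i2)).
have i3 := curve_itg_sqrB _ _ _ _ _ v cw.
have i4 : itg a b (fun z => enorm G * (ka^-1 / 2 * enorm (w z - v) ^+ 2 + ka / 2)).
  by apply: itgZ; apply: itgD; [exact: itgZ|exact: itg_cst].
apply: (@le_trans _ _ (int a b (fun z => enorm G * (ka^-1 / 2 * enorm (w z - v) ^+ 2 + ka / 2)))).
  apply: int_le => //; first exact: itg_abs.
  move=> z _; rewrite -dotvBl; apply: (le_trans (cauchy_schwarz_norm _ _)).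
  rewrite mulrC ler_wpM2l ?enorm_ge0//.
  have k0 : 0 < ka^-1 by rewrite invr_gt0.
  have := amgm (enorm (w z - v)) ka^-1 k0.
  have -> : 1 / (2 * ka^-1) = ka / 2 by field; rewrite gt_eqF.
  by rewrite mulrAC.
rewrite intZ; last by apply: itgD; [exact: itgZ|exact: itg_cst].
rewrite intD ?itg_cst//; last exact: itgZ.
rewrite (intZ _ _ _ _ i3) int_cst// ler_wpM2l ?enorm_ge0// bat.
have : ka^-1 / 2 * int a b (fun x => enorm (w x - v) ^+ 2) <= ka^-1 / 2 * (4 * M * tau ^+ 2).
  by rewrite ler_wpM2l// divr_ge0// invr_ge0 ltW.
have -> : ka^-1 / 2 * (4 * M * tau ^+ 2) = 2 * M * tau ^+ 2 / ka by field; rewrite gt_eqF.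
move: (_ * int _ _ _) (_ / ka) => *; lra.
Qed.

(** Differentiability up to a relative error [eta], tested on displacements of size at most [d] in
    the inward cone. *)
Definition cone_diff (R : realType) (n : nat) (L : 'rV[R]_n -> 'rV[R]_n -> R)
    (F0 : R) (u : R -> 'rV[R]_n -> R) (t0 : R) (x0 y G : 'rV[R]_n) (K eta c d : R) v : Prop :=
  forall s' h, `|s' - t0| <= d -> enorm h <= d -> dotv G h + K * enorm h * c <= 0 ->
    `|u s' (y + h) - u t0 y - (s' - t0) * tslope L F0 x0 v + dotv (DvL L x0 v) h| <=
    eta * (`|s' - t0| + enorm h).
Arguments cone_diff {R n}.

(** An optimal curve is straight around [t0] with one vector [v], its average velocity on
    [t0 - tau, t0 + tau]. The part after [t0] gives the upper estimate and the part before it the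
    lower one. The component of [v] along [G] is small because the curve stays in the domain on both
    sides of [t0]. *)
Lemma two_sided (R : realType) (n : nat) {Om U T L f C d0 h0 u rho t0 x0 G N r0 K}
  (S : @local_setting R n Om U T L f C d0 h0 u rho t0 x0 G N r0 K) :
  exists2 M : R, 0 < M & forall eta c : R, 0 < eta -> 0 < c -> exists2 d : R, 0 < d &
  forall g w, near_opt (closure Om) L f u 0 0 T g w -> enorm (g t0 - x0) <= d ->
    exists v, [/\ enorm v <= M, `|dotv v G| <= eta &
      cone_diff L (f x0 t0) u t0 x0 (g t0) G K eta c d v].
Proof.
case: (S) => cd vd t0T Ax0 ch; have [C0 _ _ _ _] := cd_L _ _ _ _ _ _ _ cd.
have [M [dA [M0 dA0 HA]]] := near_opt_arc R n S.
have /andP[tp tT] := t0T.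
have [[r00 K0] _ _ CH0 _] := ch.
have M40 : 0 < 4 * M by rewrite mulr_gt0.
exists M => // eta c eta0 c0.
have [tau1 tau10 H1] := perturb_left _ _ _ _ _ _ _ _ _ _ _ _ _ _ _ _ _ _ S (4 * M) eta c M40 eta0 c0.
have [tau2 tau20 H2] := perturb_right _ _ _ _ _ _ _ _ _ _ _ _ _ _ _ _ _ _ S (4 * M) eta c M40 eta0 c0.
have dA2 : 0 < dA / 2 by rewrite divr_gt0.
have [ds ds0 stay] := near_opt_stay _ _ _ _ _ _ _ _ _ cd vd _ dA2.
have G0 := enorm_ge0 G.
have [ka [ka0 Gka]] : exists ka, 0 < ka /\ enorm G * ka <= eta.
  exists (eta / (enorm G + 1)); have G1 : 0 < enorm G + 1 by rewrite ltr_wpDl.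
  split; first by rewrite divr_gt0.
  by rewrite mulrA ler_pdivrMr// mulrC ler_pM2l// lerDl.
have [Z [Z0 eZ]] : exists Z, 0 <= Z /\ Z = K * (4 * M + 1) ^+ 2 + enorm G + enorm G * (2 * M / ka).
  eexists; split; last by [].
  apply: addr_ge0; [apply: addr_ge0 => //; apply: mulr_ge0 => //; exact: sqr_ge0|].
  by apply: mulr_ge0 => //; apply: divr_ge0; [apply: mulr_ge0 => //|]; exact: ltW.
have M41 : 0 < 4 * M + 1 by rewrite addr_gt0.
have [|tau tau0] := exists_lower_bound R [:: tau1; tau2; ds / 2; dA / 2; t0; T - t0; 1; r0 / (4 * M + 1); eta / (2 * (Z + 1))].
  by rewrite /= tau10 tau20 tp subr_gt0 tT ltr01 !divr_gt0// mulr_gt0// ltr_wpDl.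
rewrite /= => /andP[ta1] /andP[ta2] /andP[ta3] /andP[ta4] /andP[ta5] /andP[ta6] /andP[ta7] /andP[ta8] /andP[ta9 _].
rewrite ler_pdivlMr// in ta8.
have {}ta9 : Z * tau <= eta / 2.
  move: ta9; rewrite ler_pdivlMr; last by rewrite mulr_gt0// ltr_wpDl.
  by move: tau0; clear; lra.
have [|dl dl0 H1d] := H1 tau; first by rewrite tau0.
have [|dr dr0 H2d] := H2 tau; first by rewrite tau0.
have [|d d_0] := exists_lower_bound R [:: dl; dr; dA / 2; tau ^+ 2; t0; T - t0].
  by rewrite /= dl0 dr0 dA2 exprn_gt0// tp subr_gt0 tT.
rewrite /= => /andP[db1] /andP[db2] /andP[db3] /andP[db4] /andP[db5] /andP[db6 _].
exists d => // g w no gx.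
have T0 : 0 <= t0 - tau by rewrite subr_ge0.
have TT : t0 + tau <= T by move: ta6; clear; lra.
have no1 := near_opt_sub _ _ _ _ _ 0 T (t0 - tau) (t0 + tau) g w T0 TT no.
have no2 := near_opt_sub _ _ _ _ _ 0 T t0 (t0 + tau) g w (ltW tp) TT no.
have no3 := near_opt_sub _ _ _ _ _ 0 T (t0 - tau) t0 g w T0 (ltW tT) no.
have ab : t0 - tau < t0 + tau by move: tau0; clear; lra.
have e1 : t0 + tau - (t0 - tau) = 2 * tau by ring.
have e2 : t0 + tau - t0 = tau by ring.
have e3 : t0 - (t0 - tau) = tau by ring.
have l1 : t0 - tau <= t0 by move: tau0; clear; lra.
have l2 : t0 <= t0 + tau by move: tau0; clear; lra.
have tin : t0 - tau <= t0 <= t0 + tau by rewrite l1.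
have ds2 : t0 + tau - (t0 - tau) <= ds by rewrite e1; move: ta3; clear; lra.
have st := stay 0 _ _ g w ler01 T0 (ltW ab) TT ds2 no1.
have ebd : 0 <= (0 : R) <= (t0 + tau - (t0 - tau)) ^+ 2 by rewrite lexx sqr_ge0.
have := HA 0 _ _ g w ab ebd _ no1.
move: (_ *: (g (t0 + tau) - _)) => v Hv.
have {Hv} [nv En Sm Dm] : arc R n M 0 (t0 - tau) (t0 + tau) g w v.
  apply: Hv => r rr; have /andP[r1 r2] := rr; split.
    by rewrite ler_norml; apply/andP; split; move: r1 r2 ta4 dA0; clear; lra.
  apply: (le_trans (enorm_triangle _ (g t0) _)).
  have := st r t0 rr tin; move: gx db3; clear.
  by move: (enorm _) (enorm _) => *; lra.
have [c1 _] := no1; have [_ _ g3 E4] := c1; have E5 := curve_itg_sqrB _ _ _ _ _ v c1.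
have sub p q (k : R -> R) : t0 - tau <= p -> p <= q -> q <= t0 + tau -> (forall r, 0 <= k r) ->
    itg (t0 - tau) (t0 + tau) k -> int p q k <= int (t0 - tau) (t0 + tau) k.
  move=> p1 pq q1 k0 ik; rewrite (int_cat (t0 - tau) (t0 + tau) p)//; last exact: le_trans q1.
  rewrite (int_cat p (t0 + tau) q)//; last exact: itg_sub ik.
  have : 0 <= int (t0 - tau) p k by apply: int_ge0.
  have : 0 <= int q (t0 + tau) k by apply: int_ge0.
  by clear; lra.
rewrite e1 in En Sm.
have M4 : M <= 4 * M by move: M0; clear; lra.
(* Passing to one half of the interval while keeping [v] multiplies the constant by 4, as the bound
   on the deviation is quadratic in the duration. *)
have arcsub p q : t0 - tau <= p -> q - p = tau -> q <= t0 + tau -> arc R n (4 * M) 0 p q g w v.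
  move=> p1 pq q1; have pq' : p <= q by rewrite -subr_ge0 pq ltW.
  split; rewrite ?pq.
  - exact: le_trans M4.
  - apply: (le_trans (sub _ _ _ p1 pq' q1 _ E4)); first by move=> r; exact: sqr_ge0.
    by apply: (le_trans En); have := mulr_ge0 (ltW M0) (ltW tau0); clear; lra.
  - apply: (le_trans (sub _ _ _ p1 pq' q1 _ E5)); first by move=> r; exact: sqr_ge0.
    by apply: (le_trans Sm); have -> : M * (2 * tau) ^+ 2 = 4 * M * tau ^+ 2 by ring.
  - move=> r s /andP[r1 r2] /andP[s1 s2].
    have rr : t0 - tau <= r <= t0 + tau by rewrite (le_trans p1)//= (le_trans r2).
    have ss : t0 - tau <= s <= t0 + tau by rewrite (le_trans p1)//= (le_trans s2).
    by apply: (le_trans (Dm r s rr ss)); rewrite ler_wpM2r// addr0.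
have A1 := arcsub t0 (t0 + tau) l1 e2 (lexx _).
have A2 := arcsub (t0 - tau) t0 (lexx _) e3 l2.
exists v; split => //.
(* The outward increments before and after [t0] are at most of order [tau ^+ 2], whereas they are
   close to [tau * dotv v G] with opposite signs. *)
- have Gd q : t0 - tau <= q <= t0 + tau -> `|q - t0| <= tau -> dotv G (g q - g t0) <= (K * (4 * M + 1) ^+ 2 + enorm G) * tau ^+ 2.
    move=> qq qt.
    have k1 : enorm (g q - x0) <= (4 * M + 1) * tau.
      apply: (le_trans (enorm_triangle _ (g t0) _)); have := Dm q t0 qq tin; rewrite addr0.
      have : M * `|q - t0| <= M * tau by rewrite ler_pM2l.
      have : d <= tau by apply: (le_trans db4); rewrite expr2 ler_piMr// ltW.
      have := mulr_ge0 (ltW M0) (ltW tau0).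
      by move: gx; clear; move: (enorm _) (enorm _) (M * `|_|) => *; lra.
    have k2 : enorm (g q - x0) <= r0 by rewrite mulrC in ta8; exact: le_trans k1 ta8.
    have k3 := CH0 _ (g3 q qq) k2.
    have k4 : K * enorm (g q - x0) ^+ 2 <= K * ((4 * M + 1) * tau) ^+ 2.
      by rewrite ler_wpM2l// lerXn2r ?nnegrE ?enorm_ge0 ?mulr_ge0// ltW.
    have k5 := cauchy_schwarz G (x0 - g t0).
    have k6 : enorm G * enorm (x0 - g t0) <= enorm G * tau ^+ 2.
      by rewrite ler_wpM2l// enormB (le_trans gx).
    have -> : dotv G (g q - g t0) = dotv G (g q - x0) + dotv G (x0 - g t0) by rewrite !dotvE; ring.
    rewrite exprMn in k4; move: k3 k4 k5 k6; clear.
    by move: (dotv _ _) (dotv _ _) (K * enorm _ ^+ 2) (enorm G * enorm _) => *; lra.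
  have B : tau * ((K * (4 * M + 1) ^+ 2 + enorm G) * tau) + enorm G * (2 * M * tau ^+ 2 / ka + ka * tau / 2) <= tau * eta.
    have -> : tau * ((K * (4 * M + 1) ^+ 2 + enorm G) * tau) + enorm G * (2 * M * tau ^+ 2 / ka + ka * tau / 2)
      = tau * (Z * tau + enorm G * ka / 2) by rewrite eZ; field; rewrite gt_eqF.
    by rewrite ler_pM2l//; move: ta9 Gka; clear; lra.
  have [_ _ S1 _] := A1; have [_ _ S2 _] := A2; rewrite e2 in S1; rewrite e3 in S2.
  have D1 := straight_dot _ _ _ _ _ _ M ka _ _ v G (proj1 no2) l2 e2 S1 ka0.
  have D2 := straight_dot _ _ _ _ _ _ M ka _ _ v G (proj1 no3) l1 e3 S2 ka0.
  have q1 : dotv G (g (t0 + tau) - g t0) <= (K * (4 * M + 1) ^+ 2 + enorm G) * tau ^+ 2.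
    by apply: Gd; rewrite ?lexx ?(ltW ab)// addrC addKr ger0_norm// ltW.
  have q2 : dotv G (g (t0 - tau) - g t0) <= (K * (4 * M + 1) ^+ 2 + enorm G) * tau ^+ 2.
    by apply: Gd; rewrite ?lexx ?(ltW ab)// addrAC subrr add0r normrN ger0_norm// ltW.
  have q3 : dotv (g t0 - g (t0 - tau)) G = - dotv G (g (t0 - tau) - g t0) by rewrite dotvC !dotvE; ring.
  rewrite q3 in D2; rewrite [dotv (g (t0 + tau) - _) _]dotvC in D1.
  rewrite -(ler_pM2l tau0) -{1}(gtr0_norm tau0) -normrM.
  move: D1 D2 q1 q2 B; rewrite !ler_norml => /andP[p1 p2] /andP[p3 p4] q1 q2 B.
  rewrite expr2 mulrCA in q1 q2.
  apply/andP; split; move: p1 p2 p3 p4 q1 q2 B; clear;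
  move: (dotv G (g (t0 + tau) - g t0)) (dotv G (g (t0 - tau) - g t0)) (tau * dotv v G) (tau * (_ * tau)) (enorm G * _) (tau * eta) => *; lra.
- move=> s' h sd hd hc.
  have z0 : 0 <= (0 : R) <= tau by rewrite lexx ltW.
  have t00 : forall dd, d <= dd -> `|t0 - t0| <= dd.
    by move=> dd ddd; rewrite subrr normr0 (le_trans _ ddd)// ltW.
  have s'0 : 0 <= s' by move: sd; rewrite ler_norml => /andP[+ _]; move: db5; clear; lra.
  have s'T : s' <= T by move: sd; rewrite ler_norml => /andP[_]; move: db6; clear; lra.
  have k1 := H1d t0 (t0 + tau) g w v 0 s' h e2 (ltW tp) TT no2 A1 z0 (t00 _ db1) (le_trans gx db1) (le_trans hd db1) hc (le_trans sd db1) s'0.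
  have k2 := H2d (t0 - tau) t0 g w v 0 s' h e3 T0 (ltW tT) no3 A2 z0 (t00 _ db2) (le_trans gx db2) (le_trans hd db2) hc (le_trans sd db2) s'T.
  rewrite !mulr0 !addr0 in k1 k2.
  rewrite ler_norml; apply/andP; split; move: k1 k2; clear;
  move: (_ * tslope _ _ _ _) (dotv _ _) (eta * _) (u s' _) (u t0 _) => *; lra.
Qed.

(** * Passage to the limit at a point approached by optimal curves *)

Lemma cluster_bounded_seq (R : realType) (n : nat) (v : nat -> 'rV[R]_n) (V : R) :
  (forall k, enorm (v k) <= V) -> exists2 l, enorm l <= V &
  forall de : R, 0 < de -> forall k0, exists2 k, (k0 <= k)%N & enorm (v k - l) < de.
Proof.
move=> vV.
have := @compact_enorm_ball R n V (v @ \oo) _; case.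
  by exists 0%N => // k _; exact: vV.
move=> l [lV cl]; exists l => // de de0 k0.
have [||x [[k /= k0k <-] xl]] := cl [set x | exists2 k, (k0 <= k)%N & v k = x] [set x | enorm (x - l) < de].
- by exists k0 => // k kk; exists k.
- by apply/nbhs_enormP; exists de.
- by exists k.
Qed.

Lemma tslope_lipschitz (R : realType) (n : nat) (U : set 'rV[R]_n) L (C F0 M : R) x v w :
  lagrangian_bounds U L C -> U x -> enorm v <= M -> enorm w <= M ->
  `|tslope L F0 x v - tslope L F0 x w| <= 3 * C * M * enorm (v - w).
Proof.
move=> [C0 _ _ [HQ HDL] _] Ux vM wM.
have [q1 q2] := HQ x w (v - w) Ux; rewrite (addrC w) subrK in q1 q2.
have -> : tslope L F0 x v - tslope L F0 x w =
    dotv (DvL L x v - DvL L x w) v - (L x v - L x w - dotv (DvL L x w) (v - w)).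
  by rewrite /tslope !dotvE; ring.
have k1 : `|dotv (DvL L x v - DvL L x w) v| <= C * enorm (v - w) * M.
  by apply: (le_trans (cauchy_schwarz_norm _ _)); apply: ler_pM; rewrite ?enorm_ge0// HDL.
have k2 : enorm (v - w) <= 2 * M.
  by apply: (le_trans (enormBD _ _)); move: vM wM; move: (enorm _) (enorm _) => *; lra.
have k3 : C * enorm (v - w) ^+ 2 <= C * (enorm (v - w) * (2 * M)).
  by rewrite ler_pM2l// expr2 ler_wpM2l// enorm_ge0.
have k4 : 0 <= L x v - L x w - dotv (DvL L x w) (v - w).
  by rewrite -(pmulr_rge0 _ C0) (le_trans _ q1)// sqr_ge0.
apply: (le_trans (ler_normB _ _)); rewrite (ger0_norm k4).
move: k1 q2 k3; move: (L x v - _ - _) (`|_|) (enorm (v - w)) (_ ^+ 2) => *; lra.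
Qed.

Lemma exists_invS_lt (R : realType) (e : R) : 0 < e -> exists k0 : nat,
  forall k, (k0 <= k)%N -> k.+1%:R^-1 < e.
Proof.
move=> e0; have [k hk] := ltr_add_invr e0; rewrite add0r in hk.
exists k => j kj; apply: le_lt_trans hk.
by rewrite lef_pV2 ?posrE// ler_nat.
Qed.

Lemma cone_diff_perturb (R : realType) (n : nat) {Om U T L f C d0 h0 u rho t0 x0 G N r0 K}
  (S : @local_setting R n Om U T L f C d0 h0 u rho t0 x0 G N r0 K) (M eta c d : R) y v w :
  enorm v <= M -> enorm w <= M -> cone_diff L (f x0 t0) u t0 x0 y G K eta c d v ->
  cone_diff L (f x0 t0) u t0 x0 y G K (eta + C * (3 * M + 1) * enorm (v - w)) c d w.
Proof.
move=> vM wM H s' h sd hd hc; case: S => cd _ _ Ax0 _.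
have HL := cd_L _ _ _ _ _ _ _ cd; have [C0 _ _ [_ HDL] _] := HL.
have Ux := cd_sub _ _ _ _ _ _ _ cd _ Ax0.
have k1 := tslope_lipschitz R n U L C (f x0 t0) M x0 v w HL Ux vM wM.
have k2 : `|dotv (DvL L x0 v - DvL L x0 w) h| <= C * enorm (v - w) * enorm h.
  by apply: (le_trans (cauchy_schwarz_norm _ _)); rewrite ler_wpM2r ?enorm_ge0// HDL.
have k3 := H s' h sd hd hc.
have -> : u s' (y + h) - u t0 y - (s' - t0) * tslope L (f x0 t0) x0 w + dotv (DvL L x0 w) h =
  (u s' (y + h) - u t0 y - (s' - t0) * tslope L (f x0 t0) x0 v + dotv (DvL L x0 v) h) +
  (s' - t0) * (tslope L (f x0 t0) x0 v - tslope L (f x0 t0) x0 w) - dotv (DvL L x0 v - DvL L x0 w) h.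
  by rewrite !dotvE; ring.
have k4 : `|(s' - t0) * (tslope L (f x0 t0) x0 v - tslope L (f x0 t0) x0 w)| <= `|s' - t0| * (3 * C * M * enorm (v - w)).
  by rewrite normrM ler_wpM2l.
apply: (le_trans (ler_normB _ _)); apply: (le_trans (lerD (ler_normD _ _) (lexx _))).
have M0 : 0 <= M by apply: le_trans vM; exact: enorm_ge0.
have q1 : 0 <= `|s' - t0| * (C * enorm (v - w)) by rewrite !mulr_ge0 ?enorm_ge0// ltW.
have q2 : 0 <= enorm h * (C * M * enorm (v - w)) by rewrite !mulr_ge0 ?enorm_ge0// ltW.
move: k2 k3 k4 q1 q2; clear.
move: (`|dotv _ _|) (`|_ * (_ - _)|) (`|_ + _|) (`|s' - t0|) (enorm h) (enorm (v - w)) => *; lra.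
Qed.

(** Optimal curves come close to [x0] but may miss it. For fixed [eta] and [c] the radius is common
    to all of them; a cluster point of their vectors is taken, and Lipschitz continuity of [u]
    carries the estimate to [x0]. *)
Lemma cone_diff_limit (R : realType) (n : nat) {Om U T L f C d0 h0 u rho t0 x0 G N r0 K}
  (S : @local_setting R n Om U T L f C d0 h0 u rho t0 x0 G N r0 K) :
  (forall de : R, 0 < de -> exists g w, near_opt (closure Om) L f u 0 0 T g w /\ enorm (g t0 - x0) < de) ->
  exists2 M : R, 0 < M & forall eta c : R, 0 < eta -> 0 < c ->
  exists d v, [/\ 0 < d, enorm v <= M, `|dotv v G| <= eta &
    cone_diff L (f x0 t0) u t0 x0 x0 G K eta c d v].
Proof.
move=> app; have [M M0 H] := two_sided R n S; exists M => // eta c eta0 c0.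
have [d d_0 Hd] := H eta c eta0 c0.
case: (S) => cd vd t0T Ax0 ch; have HL := cd_L _ _ _ _ _ _ _ cd; have [C0 _ _ [_ HDL] _] := HL.
have [C1 [d1 [C10 d10 Hlip]]] := lip R n S.
have [[r00 K0] _ _ _ _] := ch.
have /andP[tp tT] := t0T.
have [|d' d'0] := exists_lower_bound R [:: d; d1 / 2; c / 2; r0].
  by rewrite /= d_0 r00 !divr_gt0.
rewrite /= => /andP[da1] /andP[da2] /andP[da3] /andP[da4 _].
have ex k : exists p : 'rV[R]_n * 'rV[R]_n, [/\ closure Om p.1,
    enorm (p.1 - x0) <= d' /\ enorm (p.1 - x0) < k.+1%:R^-1, enorm p.2 <= M, `|dotv p.2 G| <= eta &
    cone_diff L (f x0 t0) u t0 x0 p.1 G K eta c d p.2].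
  have m0 : 0 < Num.min d' k.+1%:R^-1 by rewrite lt_min d'0 invr_gt0 ltr0n.
  have [g [w [no]]] := app _ m0; rewrite lt_min => /andP[g1 g2].
  have [v [v1 v2 v3]] := Hd g w no (le_trans (ltW g1) da1).
  exists (g t0, v) => /=; split => //; first by case: no => -[_ _ + _] _; apply; rewrite !ltW.
  by split => //; exact: ltW.
have [p Hp] := choice ex.
have [l lM cl] := cluster_bounded_seq _ _ (fun k => (p k).2) M (fun k => let: And5 _ _ h _ _ := Hp k in h).
exists d', l; split => //.
  apply/ler_addgt0Pr => e e0.
  have G1 : 0 < enorm G + 1 by rewrite ltr_wpDl ?enorm_ge0.
  have [k _ kl] := cl (e / (enorm G + 1)) (divr_gt0 e0 G1) 0%N.
  have [_ _ _ k2 _] := Hp k.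
  have -> : l = (p k).2 - ((p k).2 - l) by rewrite opprB addrC subrK.
  rewrite dotvBl; apply: (le_trans (ler_normB _ _)); apply: lerD => //.
  apply: (le_trans (cauchy_schwarz_norm _ _)).
  move: (ltW kl); rewrite ler_pdivlMr//; have := enorm_ge0 ((p k).2 - l); clear.
  by move: (enorm (_ - l)) (enorm G) => *; lra.
move=> s' h sd hd hc; apply/ler_addgt0Pr => e e0.
have W0 : 0 < C * (3 * M + 1) * (d' + d') + 1.
  by rewrite ltr_wpDl// !mulr_ge0 ?addr_ge0 ?mulr_ge0 ?ltW.
have e2 : 0 < e / 2 / (C * (3 * M + 1) * (d' + d') + 1) by rewrite !divr_gt0.
have e3 : 0 < e / 4 / C1 by rewrite !divr_gt0.
have [k0 hk0] := exists_invS_lt R _ e3.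
have [k kk0 kl] := cl _ e2 k0.
have [Ak [xk1 xk2] vk _ ck] := Hp k.
have {}hk0 := hk0 k kk0.
have sd1 := le_trans sd da1; have hd1 := le_trans hd da1.
have k1 := cone_diff_perturb R n S M eta c d _ _ l vk lM ck s' h sd1 hd1 hc.
have adm y : closure Om y -> enorm (y - x0) <= d' -> closure Om (y + h).
  move=> Ay yx; rewrite -[h]scale1r; apply: (chart_cone _ _ _ _ _ _ _ c _ _ _ ch) => //.
  - exact: le_trans da4.
  - exact: le_trans da4.
  - by rewrite ler01 lexx.
  - by move: yx hd da3; clear; move: (enorm _) (enorm _) => *; lra.
have x00 : enorm (x0 - x0) <= d' by rewrite subrr enorm0 ltW.
have bx y : enorm (y - x0) <= d' -> enorm (y + h - x0) <= d1.
  move=> yx; rewrite addrAC (le_trans (enormD _ _))//.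
  by move: yx hd da2; clear; move: (enorm _) (enorm _) => *; lra.
have xd1 y : enorm (y - x0) <= d' -> enorm (y - x0) <= d1.
  by move=> yx; move: yx d10 da2; clear; move: (enorm _) => *; lra.
have s'd1 : `|s' - t0| <= d1 by move: sd d10 da2; clear; move: (`|_|) => *; lra.
have t0d1 : `|t0 - t0| <= d1 by rewrite subrr normr0 ltW.
have q1 := Hlip s' s' _ _ s'd1 s'd1 (adm _ Ax0 x00) (adm _ Ak xk1) (bx _ x00) (bx _ xk1).
have q2 := Hlip t0 t0 _ _ t0d1 t0d1 Ax0 Ak (xd1 _ x00) (xd1 _ xk1).
have e5 : (p k).1 + h - (x0 + h) = (p k).1 - x0 by rewrite opprD addrACA subrr addr0.
rewrite e5 subrr normr0 add0r in q1; rewrite subrr normr0 add0r in q2.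
have q3 : C1 * enorm ((p k).1 - x0) <= e / 4.
  by rewrite mulrC -ler_pdivlMr// (le_trans (ltW xk2))// ltW.
have q4 : C * (3 * M + 1) * enorm ((p k).2 - l) * (`|s' - t0| + enorm h) <= e / 2.
  have : C * (3 * M + 1) * (`|s' - t0| + enorm h) <= C * (3 * M + 1) * (d' + d').
    by rewrite ler_wpM2l ?lerD// mulr_ge0 ?addr_ge0 ?mulr_ge0 ?ltW.
  move: (ltW kl); rewrite ler_pdivlMr// => z1 z2.
  have := ler_wpM2l (enorm_ge0 ((p k).2 - l)) z2.
  have := enorm_ge0 ((p k).2 - l); move: z1; clear.
  move: (enorm (_ - l)) (C * _) (d' + d') (_ + enorm h) => *; lra.
have -> : u s' (x0 + h) - u t0 x0 - (s' - t0) * tslope L (f x0 t0) x0 l + dotv (DvL L x0 l) h =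
  (u s' ((p k).1 + h) - u t0 (p k).1 - (s' - t0) * tslope L (f x0 t0) x0 l + dotv (DvL L x0 l) h)
  - (u s' ((p k).1 + h) - u s' (x0 + h)) + (u t0 (p k).1 - u t0 x0) by ring.
apply: (le_trans (ler_normD _ _)); apply: (le_trans (lerD (ler_normB _ _) (lexx _))).
rewrite (mulrDl eta) in k1; have {}k1 := le_trans k1 (lerD (lexx _) q4).
apply: (le_trans (lerD (lerD k1 (le_trans q1 q3)) (le_trans q2 q3))).
by move: (eta * _) => *; lra.
Qed.

(** One vector for all [eta]: a cluster point of those found with error and cone parameter
    [k.+1%:R^-1]. A large [k] also covers the cone of parameter [eta], which is contained in that of
    the smaller parameter. *)
Lemma cone_diff_support (R : realType) (n : nat) {Om U T L f C d0 h0 u rho t0 x0 G N r0 K}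
  (S : @local_setting R n Om U T L f C d0 h0 u rho t0 x0 G N r0 K) :
  (forall de : R, 0 < de -> exists g w, near_opt (closure Om) L f u 0 0 T g w /\ enorm (g t0 - x0) < de) ->
  exists2 v, dotv v G = 0 & forall eta, 0 < eta -> exists2 d, 0 < d &
    cone_diff L (f x0 t0) u t0 x0 x0 G K eta eta d v.
Proof.
move=> app; have [M M0 H] := cone_diff_limit R n S app.
case: (S) => cd vd t0T Ax0 ch; have HL := cd_L _ _ _ _ _ _ _ cd; have [C0 _ _ _ _] := HL.
have [[r00 K0] _ _ _ _] := ch.
have i0 k : 0 < (k.+1%:R^-1 : R) by rewrite invr_gt0.
have ex k : exists p : R * 'rV[R]_n, [/\ 0 < p.1, enorm p.2 <= M, `|dotv p.2 G| <= k.+1%:R^-1 &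
    cone_diff L (f x0 t0) u t0 x0 x0 G K k.+1%:R^-1 k.+1%:R^-1 p.1 p.2].
  by have [d [v ?]] := H _ _ (i0 k) (i0 k); exists (d, v).
have [p Hp] := choice ex.
have [l lM cl] := cluster_bounded_seq _ _ (fun k => (p k).2) M (fun k => let: And4 _ h _ _ := Hp k in h).
exists l.
  apply/eqP; rewrite -normr_le0; apply/ler_addgt0Pr => e e0; rewrite add0r.
  have e2 : 0 < e / 2 by rewrite divr_gt0.
  have G1 : 0 < enorm G + 1 by rewrite ltr_wpDl ?enorm_ge0.
  have [k0 hk0] := exists_invS_lt R _ e2.
  have [k kk kl] := cl (e / 2 / (enorm G + 1)) (divr_gt0 e2 G1) k0.
  have [_ _ k2 _] := Hp k; have {}hk0 := hk0 k kk.
  have -> : l = (p k).2 - ((p k).2 - l) by rewrite opprB addrC subrK.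
  rewrite dotvBl; apply: (le_trans (ler_normB _ _)).
  have k3 := cauchy_schwarz_norm ((p k).2 - l) G.
  move: (ltW kl); rewrite ler_pdivlMr//; have := enorm_ge0 ((p k).2 - l); move: k2 k3 hk0; clear.
  by move: (enorm (_ - l)) (enorm G) (`|dotv (_ - _) _|) (`|_|) (_^-1) => *; lra.
move=> eta eta0; have e2 : 0 < eta / 2 by rewrite divr_gt0.
have CM : 0 < C * (3 * M + 1) by rewrite mulr_gt0// addr_gt0// mulr_gt0.
have [k0 hk0] := exists_invS_lt R _ e2.
have [k kk kl] := cl _ (divr_gt0 e2 CM) k0.
have [p0 pM _ cp] := Hp k; have {}hk0 := hk0 k kk.
exists (p k).1 => // s' h sd hd hc.
have hc' : dotv G h + K * enorm h * k.+1%:R^-1 <= 0.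
  apply: le_trans hc; rewrite lerD2l ler_wpM2l ?mulr_ge0 ?enorm_ge0// (le_trans (ltW hk0))//.
  by move: eta0; clear; lra.
apply: (le_trans (cone_diff_perturb R n S M _ _ _ _ _ l pM lM cp s' h sd hd hc')).
rewrite ler_wpM2r ?addr_ge0 ?enorm_ge0//.
move: (ltW kl); rewrite ler_pdivlMr// mulrC; move: hk0; clear.
by move: (_ * enorm _) (_^-1) => *; lra.
Qed.

(** In contrast with [diff_at], test points range over the closed domain. *)
Definition diff_cl (R : realType) (n : nat) (Om : set 'rV[R]_n) (T : R)
    (u : R -> 'rV[R]_n -> R) (t : R) (x : 'rV[R]_n) (p1 : R) (p2 : 'rV[R]_n) : Prop :=
  forall e : R, 0 < e -> exists2 d : R, 0 < d & forall s y,
    0 < s < T -> closure Om y -> `|s - t| + enorm (y - x) < d ->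
    `|u s y - u t x - p1 * (s - t) - dotv p2 (y - x)| <= e * (`|s - t| + enorm (y - x)).
Arguments diff_cl {R n}.

Lemma chart_alternative (R : realType) (n : nat) (Om : set 'rV[R]_n) rho x0 G N (r0 K : R) :
  chart Om rho x0 G N r0 K -> [/\ G = 0, N = 0 & K = 0] \/ dotv G N = 1.
Proof. by case=> _ hin hout _ _; have [/hin|/hout[_]] := pselect (Om x0); [left|right]. Qed.

(** A displacement [y - x0] within the closed domain may lie outside the cone. Subtracting
    [(k * eta * de) *: N], with [de] its length, brings it back, at a relative cost of order [eta]
    by Lipschitz continuity of [u]. The same [eta] is the error and the parameter of the cone. *)
Lemma support_diff (R : realType) (n : nat) {Om U T L f C d0 h0 u rho t0 x0 G N r0 K}
  (S : @local_setting R n Om U T L f C d0 h0 u rho t0 x0 G N r0 K) :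
  (forall de : R, 0 < de -> exists g w, near_opt (closure Om) L f u 0 0 T g w /\ enorm (g t0 - x0) < de) ->
  exists2 v, dotv v G = 0 &
    diff_cl Om T u t0 x0 (tslope L (f x0 t0) x0 v) (- DvL L x0 v).
Proof.
move=> app; have [v vG H] := cone_diff_support R n S app; exists v => // e e0.
case: (S) => cd vd t0T Ax0 ch; have HL := cd_L _ _ _ _ _ _ _ cd; have [C0 _ _ _ _] := HL.
have [C1 [d1 [C10 d10 Hlip]]] := lip R n S.
have [[r00 K0] _ _ _ _] := ch.
have N0 := enorm_ge0 N; have D0 := enorm_ge0 (DvL L x0 v).
have N1 : 0 < 1 + enorm N by rewrite ltr_pwDl.
(* One half of [k] compensates the curvature term of the chart, the other half the cone
   condition. *)
have [k [k0 ek]] : exists k, 0 <= k /\ k = 2 * K * (1 + enorm N).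
  by exists (2 * K * (1 + enorm N)); rewrite !mulr_ge0// ltW.
have [W [W0 eW]] : exists W, 0 <= W /\ W = 1 + enorm N + (C1 + enorm (DvL L x0 v)) * (k * enorm N).
  eexists; split; last by [].
  by rewrite addr_ge0 ?(ltW N1)// !mulr_ge0// addr_ge0// ltW.
have [|eta eta0] := exists_lower_bound R [:: e / (W + 1); (k + 1)^-1; 1].
  by rewrite /= divr_gt0 ?invr_gt0 ?ltr01//= ltr_wpDl.
rewrite /= => /andP[et1] /andP[et2] /andP[et3 _].
rewrite ler_pdivlMr ?ltr_wpDl// in et1.
have [d d_0 Hd] := H eta eta0.
have kappa1 : k * eta <= 1.
  have k1 : 0 < k + 1 by rewrite ltr_wpDl.
  have := ler_wpM2l k0 et2; have : k * (k + 1)^-1 <= 1 by rewrite ler_pdivrMr// mul1r lerDl.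
  by clear; lra.
have [|dd dd0] := exists_lower_bound R [:: d / (1 + enorm N); d1 / (1 + enorm N); r0 / (1 + enorm N); eta / (1 + enorm N); d; d1; eta].
  by rewrite /= d_0 d10 eta0 !divr_gt0.
rewrite /= => /andP[a1] /andP[a2] /andP[a3] /andP[a4] /andP[a5] /andP[a6] /andP[a7 _].
rewrite !ler_pdivlMr// in a1 a2 a3 a4.
exists dd => // s y sT Ay near.
have yx0 := enorm_ge0 (y - x0); have sn := normr_ge0 (s - t0).
have [de ede] : exists de, de = enorm (y - x0) by eexists.
rewrite -ede in yx0 near *.
have dedd : de < dd by apply: le_lt_trans near; rewrite lerDr.
have sdd : `|s - t0| < dd by apply: le_lt_trans near; rewrite lerDl.
have [h eh] : exists h, h = (y - x0) - (k * eta * de) *: N by eexists.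
have kd0 : 0 <= k * eta * de by rewrite !mulr_ge0// ltW.
have nh : enorm h <= (1 + enorm N) * de.
  rewrite eh (le_trans (enormBD _ _))// -ede enormZ ger0_norm// mulrDl mul1r lerD2l mulrC ler_wpM2l//.
  by rewrite ler_piMl.
have nh2 x : dd * (1 + enorm N) <= x -> enorm h <= x.
  by move=> k1; apply: (le_trans nh); apply: le_trans k1; rewrite mulrC ler_wpM2r ?ltW.
have hc : dotv G h + K * enorm h * eta <= 0.
  have [[G0 _ K00]|GN] := chart_alternative _ _ _ _ _ _ _ _ _ ch.
    by rewrite G0 K00 dot0v !mul0r addr0.
  have [_ _ _ CH0 _] := ch.
  have yr : enorm (y - x0) <= r0.
    rewrite -ede; apply: (le_trans (ltW dedd)); apply: le_trans a3; rewrite ler_peMr ?(ltW dd0)//.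
    by rewrite lerDl.
  have Gh : dotv G h = dotv G (y - x0) - k * eta * de by rewrite eh (dotvBr (y - x0)) dotvZr GN mulr1.
  have q1 := CH0 y Ay yr; rewrite -ede in q1; rewrite Gh.
  have q2 : K * enorm h * eta <= K * ((1 + enorm N) * de) * eta by rewrite ler_wpM2r ?ler_wpM2l// ltW.
  have q3 : K * de ^+ 2 <= K * (de * eta) by rewrite ler_wpM2l// expr2 ler_wpM2l// (le_trans (ltW dedd)).
  have q4 : K * (de * eta) <= K * (1 + enorm N) * (de * eta).
    by apply: ler_wpM2r; [rewrite mulr_ge0// ltW|rewrite ler_peMr// lerDl].
  have q5 : k * eta * de = 2 * (K * (1 + enorm N) * (de * eta)) by rewrite ek; ring.
  have q6 : K * ((1 + enorm N) * de) * eta = K * (1 + enorm N) * (de * eta) by ring.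
  move: q1 q2 q3 q4 q5 q6; clear.
  move: (K * (1 + _) * _) (K * (de * _)) (K * de ^+ 2) (K * enorm h * eta) (k * eta * de) (dotv _ _) (K * (_ * de) * eta) => *; lra.
have Axh : closure Om (x0 + h).
  rewrite -[h]scale1r; apply: (chart_cone _ _ _ _ _ _ _ eta _ _ _ ch) => //.
  - by rewrite subrr enorm0 ltW.
  - exact: nh2.
  - by rewrite ler01 lexx.
  - by rewrite subrr enorm0 add0r nh2.
have q1 := Hd s h (ltW (lt_le_trans sdd a5)) (nh2 _ a1) hc.
have sd1 : `|s - t0| <= d1 by rewrite (le_trans (ltW sdd)).
have y1 : enorm (y - x0) <= d1 by rewrite -ede (le_trans (ltW dedd)).
have h1 : enorm (x0 + h - x0) <= d1 by rewrite addrAC subrr add0r nh2.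
have q2 := Hlip s s _ _ sd1 sd1 Axh Ay h1 y1.
have e5 : y - (x0 + h) = (k * eta * de) *: N by rewrite eh opprD addrA opprB addrC subrK.
rewrite e5 subrr normr0 add0r enormZ (ger0_norm kd0) in q2.
have e6 : y - x0 = h + (k * eta * de) *: N by rewrite eh subrK.
have q3 : `|dotv (DvL L x0 v) ((k * eta * de) *: N)| <= enorm (DvL L x0 v) * (k * eta * de * enorm N).
  by apply: (le_trans (cauchy_schwarz_norm _ _)); rewrite enormZ ger0_norm.
have -> : u s y - u t0 x0 - tslope L (f x0 t0) x0 v * (s - t0) - dotv (- DvL L x0 v) (y - x0) =
  (u s (x0 + h) - u t0 x0 - (s - t0) * tslope L (f x0 t0) x0 v + dotv (DvL L x0 v) h) +
  (u s y - u s (x0 + h)) + dotv (DvL L x0 v) ((k * eta * de) *: N).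
  by rewrite e6 dotvNl dotvDr; ring.
apply: (le_trans (ler_normD _ _)); apply: (le_trans (lerD (ler_normD _ _) (lexx _))).
apply: (le_trans (lerD (lerD q1 q2) q3)).
have q4 : eta * (`|s - t0| + enorm h) <= eta * (`|s - t0| + (1 + enorm N) * de) by rewrite ler_pM2l// lerD2l.
have q5 : 0 <= eta * (`|s - t0| * (W - 1)).
  have W1 : 0 <= W - 1.
    have -> : W - 1 = enorm N + (C1 + enorm (DvL L x0 v)) * (k * enorm N) by rewrite eW; ring.
    by rewrite addr_ge0// mulr_ge0 ?mulr_ge0// addr_ge0// ltW.
  by rewrite !mulr_ge0// ltW.
have q6 : W * eta * (`|s - t0| + de) <= e * (`|s - t0| + de).
  by rewrite ler_wpM2r ?addr_ge0//; move: et1 eta0; clear; lra.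
have q7 : eta * (`|s - t0| + (1 + enorm N) * de) + C1 * (k * eta * de * enorm N) + enorm (DvL L x0 v) * (k * eta * de * enorm N) <= W * eta * (`|s - t0| + de).
  move: q5; rewrite eW; clear; move: (enorm N) (enorm (DvL _ _ _)) (`|_|) => *; lra.
by apply: le_trans q6; apply: le_trans q7; rewrite !lerD2r.
Qed.

(** * Linear inequalities on cones and convergence of slopes *)

Lemma cone_scale (R : realType) (n : nat) (a e ro K c : R) (b G : 'rV[R]_n) : 0 < ro ->
  (forall s h, `|s| + enorm h <= ro -> dotv G h + K * enorm h * c <= 0 -> a * s + dotv b h <= e * ro) ->
  forall s h, dotv G h + K * enorm h * c <= 0 -> a * s + dotv b h <= e * (`|s| + enorm h).
Proof.
move=> ro0 H s h hc.
have := normr_ge0 s; have := enorm_ge0 h => h0 s0.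
have [m0|mn] := eqVneq (`|s| + enorm h) 0.
  have hz : h = 0 by apply: enorm0_eq0; move: m0 h0 s0; move: (enorm h) (`|s|) => *; lra.
  have sz : s = 0.
    by apply/eqP; rewrite -normr_eq0; apply/eqP; move: m0 h0 s0; move: (enorm h) (`|s|) => *; lra.
  by rewrite m0 hz sz dotv0 !mulr0 addr0.
have m0 : 0 < `|s| + enorm h by rewrite lt_neqAle eq_sym mn addr_ge0.
(* Rescaling to total size [ro]: the constraint is a cone and the inequality is positively
   homogeneous. *)
have [k [k0 ek]] : exists k, 0 < k /\ k * (`|s| + enorm h) = ro.
  by exists (ro / (`|s| + enorm h)); rewrite divr_gt0 ?divfK.
have := H (k * s) (k *: h); rewrite normrM enormZ gtr0_norm// -mulrDr ek lexx !dotvZr => /(_ isT).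
have -> : k * dotv G h + K * (k * enorm h) * c = k * (dotv G h + K * enorm h * c) by ring.
rewrite pmulr_rle0// => /(_ hc).
have -> : a * (k * s) + k * dotv b h = k * (a * s + dotv b h) by ring.
by rewrite -ek mulrCA ler_pM2l.
Qed.

(** [X] is tested with its normalised tangential part tilted inwards by [ka], just enough to enter
    the cone; the tilt costs at most [ka * enorm X]. *)
Lemma tangential_bound (R : realType) (n : nat) (X G : 'rV[R]_n) (K e1 e ka : R) : 0 < enorm G -> 0 <= K ->
  0 <= e -> 0 <= e1 -> 0 <= ka <= 1 -> 2 * K * e1 <= ka * enorm G ->
  (forall h, dotv G h + K * enorm h * e1 <= 0 -> dotv X h <= e * enorm h) ->
  enorm (X - dotv X ((enorm G)^-1 *: G) *: ((enorm G)^-1 *: G)) <= 2 * e + ka * enorm X.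
Proof.
move=> G0 K0 e0 e10 /andP[ka0 ka1] Kk H.
have [nu_ enu] : exists nu, nu = (enorm G)^-1 *: G by eexists.
rewrite -enu.
have nn : dotv nu_ nu_ = 1.
  by rewrite enu !dotvE -sqr_enorm; field; rewrite gt_eqF.
have n1 : enorm nu_ = 1 by rewrite enu enormZ gtr0_norm ?invr_gt0// mulVf// gt_eqF.
have GE : G = enorm G *: nu_ by rewrite enu scalerA mulfV ?scale1r// gt_eqF.
have [Y eY] : exists Y, Y = X - dotv X nu_ *: nu_ by eexists.
rewrite -eY.
have Yn : dotv Y nu_ = 0 by rewrite eY !dotvE nn; ring.
have XY : dotv X Y = enorm Y ^+ 2.
  have -> : X = Y + dotv X nu_ *: nu_ by rewrite eY subrK.
  by rewrite dotvDl dotvZl [dotv nu_ Y]dotvC Yn mulr0 addr0 sqr_enorm.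
have X0 := enorm_ge0 X.
have [Yz|Yz] := eqVneq (enorm Y) 0; first by rewrite Yz addr_ge0 ?mulr_ge0.
have Y0 : 0 < enorm Y by rewrite lt_neqAle eq_sym Yz enorm_ge0.
have [h eh] : exists h, h = (enorm Y)^-1 *: Y - ka *: nu_ by eexists.
have nh : enorm h <= 2.
  rewrite eh (le_trans (enormBD _ _))// !enormZ n1 mulr1 gtr0_norm ?invr_gt0// mulVf ?gt_eqF//.
  by rewrite ger0_norm//; move: ka1; clear; lra.
have Gh : dotv G h = - (ka * enorm G).
  by rewrite [in LHS]GE eh !dotvE nn [dotv nu_ Y]dotvC Yn; ring.
have := H h; rewrite Gh.
have -> : dotv X h = enorm Y - ka * dotv X nu_.
  by rewrite eh !dotvE XY; field.
have k1 : K * enorm h * e1 <= K * 2 * e1 by rewrite ler_wpM2r// ler_wpM2l.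
have k2 : e * enorm h <= e * 2 by rewrite ler_wpM2l.
have k3 : ka * dotv X nu_ <= ka * enorm X.
  by rewrite ler_wpM2l// (le_trans (cauchy_schwarz _ _))// n1 mulr1.
have k4 : - (ka * enorm G) + K * enorm h * e1 <= 0.
  by move: k1 Kk; clear; move: (K * enorm h * e1) (ka * _) => *; lra.
by move=> /(_ k4); move: k2 k3; clear; move: (e * enorm h) (ka * dotv _ _) (ka * enorm X) (enorm Y) => *; lra.
Qed.

(** The slopes at [(s, y)] and those at [(t0, x0)] are both compared with one upper slope at
    [(s, y)], which settles the time component and the tangential component. The normal component is
    left undetermined by inward displacements and is recovered from the Hamilton-Jacobi inequality,
    tested at velocities [v + t *: nu_]. *)
Lemma slope_limit (R : realType) (n : nat) {Om U T L f C d0 h0 u rho t0 x0 G N r0 K}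
  (S : @local_setting R n Om U T L f C d0 h0 u rho t0 x0 G N r0 K) v : dotv v G = 0 ->
  diff_cl Om T u t0 x0 (tslope L (f x0 t0) x0 v) (- DvL L x0 v) ->
  forall eta : R, 0 < eta -> exists2 d : R, 0 < d & forall s y q1 q2, 0 < s < T -> closure Om y ->
    `|s - t0| <= d -> enorm (y - x0) <= d -> diff_cl Om T u s y q1 q2 ->
    (forall w, - dotv q2 w - L y w <= f y s + q1) ->
    `|q1 - tslope L (f x0 t0) x0 v| <= eta /\ enorm (q2 - - DvL L x0 v) <= eta.
Proof.
move=> vG dif eta eta0.
case: (S) => cd vd t0T Ax0 ch; have HL := cd_L _ _ _ _ _ _ _ cd.
have [C0 HL0 HD [HQ _] [HLx _]] := HL; have C0' := ltW C0.
have Ux0 := cd_sub _ _ _ _ _ _ _ cd _ Ax0.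
have [[r00 K0] _ _ _ _] := ch.
have d00 := cd_d0 _ _ _ _ _ _ _ cd.
have t0T' := t0T; have /andP[tp tT] := t0T'.
have t00 : 0 <= t0 <= T by rewrite !ltW.
have [C1 [d1 [C10 d10 Hlip]]] := lip R n S.
have [M M0 HU] := upper_slope R n S.
have [p1 ep1] : exists p1, p1 = tslope L (f x0 t0) x0 v by eexists.
have [p2 ep2] : exists p2, p2 = - DvL L x0 v by eexists.
rewrite -ep1 -ep2 in dif *.
have v0 := enorm_ge0 v; have p20 := enorm_ge0 p2.
have [B [B0 eB]] : exists B, 0 <= B /\ B = 3 * C + `|p1| + 8 + C * (1 + M) + enorm p2.
  eexists; split; last by [].
  by rewrite !addr_ge0 ?mulr_ge0 ?addr_ge0// ltW.
have [C' [C'0 CC' BC']] : exists C', [/\ 0 < C', C <= C' & B <= C'].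
  by exists (C + B); split; move: C0 B0; clear; lra.
have [k1 [k10 ek1]] : exists k1, 0 < k1 /\ k1 = 2 * K / enorm G + 1.
  eexists; split; last by []; by rewrite ltr_wpDl// divr_ge0 ?mulr_ge0 ?enorm_ge0.
have [A1 [A10 eA1]] : exists A1, 0 < A1 /\ A1 = 16 + 2 * k1 * B.
  eexists; split; last by []; by rewrite ltr_pwDl// mulr_ge0// mulr_ge0// ltW.
have [A2 [A20 eA2]] : exists A2, 0 < A2 /\ A2 = 10 + A1 * enorm v.
  eexists; split; last by []; by rewrite ltr_pwDl// mulr_ge0// ltW.
have [|e1 e10] := exists_lower_bound R [:: 1; eta / 8; eta / (2 * A1); eta ^+ 2 / (16 * C' * A2); k1^-1].
  by rewrite /= ltr01 invr_gt0 k10 !divr_gt0 ?exprn_gt0 ?mulr_gt0.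
rewrite /= => /andP[e11] /andP[e12] /andP[e13] /andP[e14] /andP[e15 _].
rewrite ler_pdivlMr ?mulr_gt0// in e13; rewrite ler_pdivlMr ?mulr_gt0// in e14.
have {}e15 : k1 * e1 <= 1.
  by have := ler_wpM2l (ltW k10) e15; rewrite mulfV// gt_eqF.
have [dU dU0 HdU] := HU e1 e1 e10 e10.
have [d2 d20 Hd2] := dif e1 e10.
have T00 : 0 < T - t0 by rewrite subr_gt0.
have [|s0 s00] := exists_lower_bound R [:: dU; d2 / 2; d1 / 2; r0; e1 / 2; t0 / 2; (T - t0) / 2].
  by rewrite /= dU0 r00 !divr_gt0.
rewrite /= => /andP[sa1] /andP[sa2] /andP[sa3] /andP[sa4] /andP[sa5] /andP[sa6] /andP[sa7 _].
have e1h : 0 < e1 / 2 by rewrite divr_gt0.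
have [dt dt0 Hdt] := cd_fcont _ _ _ _ _ _ _ cd t0 t00 _ e1h.
have V20 : 0 < C * (1 + (enorm v + 1) ^+ 2) by rewrite mulr_gt0// ltr_pwDl// sqr_ge0.
have [|d d_0] := exists_lower_bound R [:: dU; e1 * s0 / (4 * C1); d1 / 2; dt / 2; e1 / 2 / C; e1 / (C * (1 + (enorm v + 1) ^+ 2)); d0; r0; e1 / 2].
  by rewrite /= dU0 d00 r00 !divr_gt0 ?V20 ?mulr_gt0.
rewrite /= => /andP[da1] /andP[da2] /andP[da3] /andP[da4] /andP[da5] /andP[da6] /andP[da7] /andP[da8] /andP[da9 _].
rewrite ler_pdivlMr ?mulr_gt0// in da2; rewrite ler_pdivlMr// in da5; rewrite ler_pdivlMr// in da6.
exists d => // s y q1 q2 /andP[s_0 sT] Ay sd yd dq sub.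
have sT0 : 0 < T - s by rewrite subr_gt0.
have [dqr dq0 Hq] := dq e1 e10.
have [|ro ro0] := exists_lower_bound R [:: dqr / 2; dU; s / 2; (T - s) / 2; e1 / 2; r0].
  by rewrite /= dU0 r00 !divr_gt0.
rewrite /= => /andP[ra1] /andP[ra2] /andP[ra3] /andP[ra4] /andP[ra5] /andP[ra6 _].
(* The upper slope at [(s, y)] is used at two scales, [ro] for differentiability at [(s, y)] and the
   fixed [s0] for differentiability at [(t0, x0)]; its additive error has to be small against
   both. *)
have [|m m0] := exists_lower_bound R [:: ro; s0]; first by rewrite /= ro0 s00.
rewrite /= => /andP[mr] /andP[ms _].
have [v' v'M Hv'] := HdU s y (e1 * m) (le_trans sd da1) Ay (le_trans yd da1) (mulr_gt0 e10 m0).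
have [Pt ePt] : exists Pt, Pt = tslope L (f x0 t0) x0 v' by eexists.
have [D' eD'] : exists D', D' = DvL L x0 v' by eexists.
have nD' : enorm D' <= C * (1 + M).
  by rewrite eD' (le_trans (HD _ _ Ux0))// ler_pM2l// lerD2l.
rewrite -ePt -eD' in Hv'.
have e1m1 : e1 * m <= e1 * ro by rewrite ler_pM2l.
have e1m2 : e1 * m <= e1 * s0 by rewrite ler_pM2l.
have small (r' : R) sg (h : 'rV[R]_n) : `|sg| + enorm h <= r' -> [/\ `|sg| <= r', enorm h <= r', - r' <= sg & sg <= r'].
  move=> H; have q : `|sg| <= r' by apply: le_trans H; rewrite lerDl enorm_ge0.
  split => //; first by apply: le_trans H; rewrite lerDr.
  - by move: q; rewrite ler_norml => /andP[].
  - by move: q; rewrite ler_norml => /andP[].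
have admy (h : 'rV[R]_n) : enorm h <= e1 / 2 -> enorm h <= r0 -> dotv G h + K * enorm h * e1 <= 0 -> closure Om (y + h).
  move=> h1 h2 hc; rewrite -[h]scale1r; apply: (chart_cone _ _ _ _ _ _ _ e1 _ _ _ ch) => //.
  - exact: le_trans da8.
  - by rewrite ler01 lexx.
  - by have := le_trans yd da9; move: h1; clear; move: (enorm _) (enorm _) => *; lra.
have admx (h : 'rV[R]_n) : enorm h <= e1 / 2 -> enorm h <= r0 -> dotv G h + K * enorm h * e1 <= 0 -> closure Om (x0 + h).
  move=> h1 h2 hc; rewrite -[h]scale1r; apply: (chart_cone _ _ _ _ _ _ _ e1 _ _ _ ch) => //.
  - by rewrite subrr enorm0 ltW.
  - by rewrite ler01 lexx.
  - by rewrite subrr enorm0 add0r; move: h1 e10; clear; move: (enorm _) => *; lra.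
(* The scale [ro] is not controlled by the data at [(t0, x0)]; homogeneity removes it from the
   conclusion. *)
have XA := cone_scale R n (q1 - Pt) (4 * e1) ro K e1 (q2 + D') G ro0 _.
have {}XA : forall sg h, dotv G h + K * enorm h * e1 <= 0 -> (q1 - Pt) * sg + dotv (q2 + D') h <= 4 * e1 * (`|sg| + enorm h).
  apply: XA => sg h shr hc; have [b1 b2 b3 b4] := small _ _ _ shr.
  have Ah := admy h (le_trans b2 ra5) (le_trans b2 ra6) hc.
  have U1 := Hv' (s + sg) h; rewrite [s + sg]addrC addrK in U1.
  have {}U1 := U1 (le_trans b1 ra2) (le_trans b2 ra2) hc.
  have Q1 := Hq (s + sg) (y + h); rewrite [s + sg]addrC addrK [y + h]addrC addrK in Q1.
  rewrite [h + y]addrC in Q1.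
  have {}Q1 := Q1 _ Ah (le_lt_trans shr _).
  have {}Q1 : `|u (sg + s) (y + h) - u s y - q1 * sg - dotv q2 h| <= e1 * (`|sg| + enorm h).
    apply: Q1; last by apply: (le_lt_trans ra1); rewrite ltr_pdivrMr// ltr_pMr// ltr1n.
    by apply/andP; split; move: b3 b4 ra3 ra4 s_0 sT ro0; clear; lra.
  have k : e1 * (`|sg| + enorm h) <= e1 * ro by rewrite ler_pM2l.
  move: Q1; rewrite ler_norml => /andP[Q1 _].
  have er := ltW (mulr_gt0 e10 ro0).
  rewrite dotvDl -[4 * e1 * _]mulrA; move: Q1 U1 k e1m1 er; clear.
  move: (e1 * (_ + _)) (e1 * m) (e1 * ro) (dotv q2 h) (dotv D' h) (u (sg + s) _) (u s y) => *; lra.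
have YB := cone_scale R n (p1 - Pt) (4 * e1) s0 K e1 (p2 + D') G s00 _.
have {}YB : forall sg h, dotv G h + K * enorm h * e1 <= 0 -> (p1 - Pt) * sg + dotv (p2 + D') h <= 4 * e1 * (`|sg| + enorm h).
  apply: YB => sg h shr hc; have [b1 b2 b3 b4] := small _ _ _ shr.
  have Ah := admy h (le_trans b2 sa5) (le_trans b2 sa4) hc.
  have Axh := admx h (le_trans b2 sa5) (le_trans b2 sa4) hc.
  have U1 := Hv' (s + sg) h; rewrite [s + sg]addrC addrK in U1.
  have {}U1 := U1 (le_trans b1 sa1) (le_trans b2 sa1) hc.
  have Q1 := Hd2 (t0 + sg) (x0 + h); rewrite [t0 + sg]addrC addrK [x0 + h]addrC addrK in Q1.
  rewrite [h + x0]addrC in Q1.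
  have {}Q1 : `|u (sg + t0) (x0 + h) - u t0 x0 - p1 * sg - dotv p2 h| <= e1 * (`|sg| + enorm h).
    apply: Q1 => //; last by apply: (le_lt_trans shr); move: sa2 s00 d20; clear; lra.
    by apply/andP; split; move: b3 b4 sa6 sa7 tp tT s00; clear; lra.
  have k : e1 * (`|sg| + enorm h) <= e1 * s0 by rewrite ler_pM2l.
  have bt : `|sg + t0 - t0| <= d1 by rewrite addrK; move: b1 sa3 d10; clear; move: (`|_|) => *; lra.
  have bs : `|sg + s - t0| <= d1.
    by rewrite -addrA (le_trans (ler_normD _ _))//; move: b1 sa3 sd da3; clear; move: (`|_|) (`|_|) => *; lra.
  have bx : enorm (x0 + h - x0) <= d1.
    by rewrite addrAC subrr add0r; move: b2 sa3 d10; clear; move: (enorm _) => *; lra.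
  have by_ : enorm (y + h - x0) <= d1.
    by rewrite addrAC (le_trans (enormD _ _))//; move: b2 sa3 yd da3; clear; move: (enorm _) (enorm _) => *; lra.
  have l1 := Hlip _ _ _ _ bs bt Ah Axh by_ bx.
  have bt0 : `|t0 - t0| <= d1 by rewrite subrr normr0 ltW.
  have bs0 : `|s - t0| <= d1 by move: sd da3 d10; clear; move: (`|_|) => *; lra.
  have bx0 : enorm (x0 - x0) <= d1 by rewrite subrr enorm0 ltW.
  have by0 : enorm (y - x0) <= d1 by move: yd da3 d10; clear; move: (enorm _) => *; lra.
  have l2 := Hlip _ _ _ _ bt0 bs0 Ax0 Ay bx0 by0.
  have e5 : x0 + h - (y + h) = x0 - y by rewrite opprD addrACA subrr addr0.
  have e6 : sg + t0 - (sg + s) = t0 - s by rewrite opprD addrACA subrr add0r.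
  rewrite e5 e6 enormB distrC in l1.
  have l3 : C1 * (`|s - t0| + enorm (y - x0)) <= e1 * s0 / 2.
    have : C1 * (`|s - t0| + enorm (y - x0)) <= C1 * (d + d) by rewrite ler_pM2l// lerD.
    by move: da2; clear; lra.
  move: Q1; rewrite ler_norml => /andP[Q1 _].
  have := le_trans l2 l3; rewrite ler_norml => /andP[_ l2'].
  rewrite (distrC t0 s) in l1; have := le_trans l1 l3; rewrite ler_norml => /andP[l1a l1b].
  have er := ltW (mulr_gt0 e10 s00).
  rewrite dotvDl -[4 * e1 * _]mulrA; move: Q1 U1 k er e1m2 l2' l1a l1b; clear.
  move: (e1 * (_ + _)) (e1 * m) (e1 * s0) (dotv p2 h) (dotv D' h) (u (sg + s) _) (u s y) (u (sg + t0) _) (u t0 _) => *; lra.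
have c00 : dotv G 0 + K * enorm (0 : 'rV[R]_n) * e1 <= 0 by rewrite dotv0 enorm0 mulr0 mul0r addr0.
have t1 : `|q1 - p1| <= 8 * e1.
  have := XA 1 0 c00; have := XA (-1) 0 c00; have := YB 1 0 c00; have := YB (-1) 0 c00.
  rewrite !dotv0 enorm0 !addr0 normrN normr1 !mulr1 !mulrN1; clear => *.
  by rewrite ler_norml; apply/andP; split; lra.
have e8 : 8 * e1 <= eta by move: e12; clear; lra.
split; first exact: le_trans t1 e8.
have XA0 h : dotv G h + K * enorm h * e1 <= 0 -> dotv (q2 + D') h <= 4 * e1 * enorm h.
  by move=> /(XA 0); rewrite mulr0 normr0 !add0r.
have YB0 h : dotv G h + K * enorm h * e1 <= 0 -> dotv (p2 + D') h <= 4 * e1 * enorm h.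
  by move=> /(YB 0); rewrite mulr0 normr0 !add0r.
have eZ : q2 - p2 = (q2 + D') - (p2 + D') by rewrite opprD addrACA subrr addr0.
have [[G0 _ K00]|GN] := chart_alternative _ _ _ _ _ _ _ _ _ ch.
  have self X : (forall h, dotv G h + K * enorm h * e1 <= 0 -> dotv X h <= 4 * e1 * enorm h) -> enorm X <= 4 * e1.
    move=> H; have := H X; rewrite G0 K00 dot0v !mul0r addr0 -sqr_enorm => /(_ (lexx _)).
    have := enorm_ge0 X; rewrite le_eqVlt => /orP[/eqP <- _|X0]; first by rewrite mulr_ge0// ltW.
    by rewrite expr2 ler_pM2r.
  rewrite eZ (le_trans (enormBD _ _))//; have := self _ XA0; have := self _ YB0.
  by move: e8; clear; move: (enorm _) (enorm _) => *; lra.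
have Gp : 0 < enorm G.
  apply: enorm_gt0; apply/eqP => G0; move: GN; rewrite G0 dot0v => /eqP.
  by rewrite eq_sym oner_eq0.
have ty : `|f y s - f x0 t0| <= e1.
  have segy : segment_in U x0 y by apply: (cd_segment _ _ _ _ _ _ _ cd) => //; exact: le_trans da7.
  have s0T : 0 <= s <= T by rewrite !ltW.
  have f1 := cd_flip _ _ _ _ _ _ _ cd s _ _ s0T segy.
  have f2 : `|f x0 s - f x0 t0| <= e1 / 2.
    by apply: Hdt => //; apply: (le_lt_trans sd); move: da4 dt0; clear; lra.
  have f3 : C * enorm (x0 - y) <= e1 / 2.
    by apply: le_trans da5; rewrite [d * C]mulrC ler_pM2l// enormB.
  have := ler_normD (f y s - f x0 s) (f x0 s - f x0 t0); rewrite addrA subrK (distrC (f y s) (f x0 s)).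
  by move: (le_trans f1 f3) f2; clear; lra.
(* The Hamilton-Jacobi inequality at the unit velocity opposite to [q2] bounds the norm of [q2]. *)
have nq2 : enorm q2 <= 3 * C + `|p1| + 8.
  have [->|qn] := eqVneq q2 0; first by rewrite enorm0 !addr_ge0// mulr_ge0.
  have qp := enorm_gt0 _ qn.
  have := sub (- (enorm q2)^-1 *: q2); rewrite dotvZr mulNr opprK -sqr_enorm expr2 mulrA mulVf ?gt_eqF// mul1r.
  have [_ ] := HL0 y (- (enorm q2)^-1 *: q2) (cd_sub _ _ _ _ _ _ _ cd _ Ay).
  rewrite enormZ normrN (@gtr0_norm _ (enorm q2)^-1) ?invr_gt0// mulVf ?gt_eqF// expr1n => /(le_trans (ler_norm _)) l1.
  have s0T : 0 <= s <= T by rewrite !ltW.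
  have := le_trans (ler_norm _) (cd_fbd _ _ _ _ _ _ _ cd s y s0T Ay).
  have := le_trans (ler_norm _) t1; have := ler_norm p1; move: l1 e11; clear.
  by lra.
have [nu_ enu] : exists nu, nu = (enorm G)^-1 *: G by eexists.
have n1 : enorm nu_ = 1 by rewrite enu enormZ gtr0_norm ?invr_gt0// mulVf// gt_eqF.
have k1e : 0 <= k1 * e1 <= 1 by rewrite e15 mulr_ge0 ?ltW.
have Kk : 2 * K * e1 <= k1 * e1 * enorm G.
  have -> : k1 * e1 * enorm G = 2 * K * e1 + e1 * enorm G by rewrite ek1; field; rewrite gt_eqF.
  by rewrite lerDl mulr_ge0 ?ltW.
have e40 : 0 <= 4 * e1 by rewrite mulr_ge0 ?ltW.
have tX := tangential_bound R n _ G K e1 _ (k1 * e1) Gp K0 e40 (ltW e10) k1e Kk XA0.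
have tY := tangential_bound R n _ G K e1 _ (k1 * e1) Gp K0 e40 (ltW e10) k1e Kk YB0.
rewrite -enu in tX tY.
have nX : enorm (q2 + D') <= B.
  by apply: (le_trans (enormD _ _)); rewrite eB; move: nq2 nD' p20; clear; move: (enorm q2) (enorm D') (enorm p2) (C * _) => *; lra.
have nY : enorm (p2 + D') <= B.
  apply: (le_trans (enormD _ _)); rewrite eB; move: nD' C0 (normr_ge0 p1); clear.
  by move: (enorm D') (enorm p2) (C * (_ + _)) (`|_|) => *; lra.
have [Z eZ'] : exists Z, Z = q2 - p2 by eexists.
have nZ : enorm Z <= B.
  rewrite eZ' (le_trans (enormBD _ _))// eB; move: nq2 (mulr_ge0 C0' (addr_ge0 ler01 (ltW M0))); clear.
  by move: (enorm q2) (enorm p2) (C * (_ + _)) => *; lra.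
have [la ela] : exists la, la = dotv Z nu_ by eexists.
have Zt : enorm (Z - la *: nu_) <= A1 * e1.
  have -> : Z - la *: nu_ = (q2 + D' - dotv (q2 + D') nu_ *: nu_) - (p2 + D' - dotv (p2 + D') nu_ *: nu_).
    by rewrite ela eZ' eZ (dotvBl (q2 + D')); apply/rowP => i; rewrite !mxE; ring.
  apply: (le_trans (enormBD _ _)); apply: (le_trans (lerD tX tY)).
  have [ke0 _] := andP k1e.
  have m1 : k1 * e1 * enorm (q2 + D') <= k1 * e1 * B by rewrite ler_wpM2l.
  have m2 : k1 * e1 * enorm (p2 + D') <= k1 * e1 * B by rewrite ler_wpM2l.
  by rewrite eA1; move: m1 m2; clear; move: (_ * enorm _) (_ * enorm _) => *; lra.
have vn : dotv v nu_ = 0 by rewrite enu dotvZr vG mulr0.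
have Zv : `|dotv Z v| <= A1 * e1 * enorm v.
  have -> : dotv Z v = dotv (Z - la *: nu_) v by rewrite dotvBl dotvZl [dotv nu_ v]dotvC vn mulr0 subr0.
  by apply: (le_trans (cauchy_schwarz_norm _ _)); rewrite ler_wpM2r.
have laB : `|la| <= B by rewrite ela (le_trans (cauchy_schwarz_norm _ _))// n1 mulr1.
(* As [v] is tangential, [dotv Z v] is already small; the velocity [v + t *: nu_] isolates the
   normal component [la] to first order in [t], at a quadratic price. *)
have main (t : R) : `|t| <= 1 -> - (t * la) - C * t ^+ 2 <= A2 * e1.
  move=> tl.
  have ntn : enorm (t *: nu_) = `|t| by rewrite enormZ n1 mulr1.
  have H1 := sub (v + t *: nu_).
  have segy : segment_in U y x0.
    by apply: (cd_segment _ _ _ _ _ _ _ cd) => //; rewrite enormB (le_trans yd da7).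
  have H2 := le_trans (ler_norm _) (HLx y x0 (v + t *: nu_) segy).
  have H2' : C * (1 + enorm (v + t *: nu_) ^+ 2) * enorm (y - x0) <= e1.
    apply: le_trans da6; rewrite [d * _]mulrC; apply: ler_pM => //; [by rewrite mulr_ge0 ?addr_ge0 ?sqr_ge0|exact: enorm_ge0|].
    rewrite ler_pM2l// lerD2l lerXn2r ?nnegrE ?enorm_ge0 ?addr_ge0//.
    by rewrite (le_trans (enormD _ _))// ntn lerD2l.
  have [_ H3] := HQ x0 v (t *: nu_) Ux0.
  rewrite ntn real_normK ?num_real// dotvZr in H3.
  have q2E : q2 = Z + p2 by rewrite eZ' subrK.
  rewrite q2E dotvDl !dotvDr !dotvZr -ela ep2 !dotvNl in H1.
  have := ep1; rewrite /tslope => ep1'.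
  move: H1 H2 H2' H3 t1 ty Zv ep1'; rewrite eA2 !ler_norml; clear => H1 H2 H2' H3 /andP[t1 t1'] /andP[ty ty'] /andP[Zv Zv'] ep1'.
  have {H2 H2'} H2 := le_trans H2 H2'.
  move: H1 H2 H3 t1 t1' ty ty' Zv Zv' ep1'.
  move: (dotv Z v) (dotv (DvL _ _ _) v) (dotv (DvL _ _ _) nu_) (L y _) (L x0 (v + _)) (L x0 v) (f y s) (f x0 t0) (enorm v) (C * _) (t * la) => *; lra.
(* The choice [t = - (la / (2 * C'))] makes the left-hand side of [main] at least
   [la ^+ 2 / (4 * C')]. *)
have lasq : la ^+ 2 <= (eta / 2) ^+ 2.
  have tl : `|- (la / (2 * C'))| <= 1.
    rewrite normrN normrM normfV (@gtr0_norm _ (2 * C')) ?mulr_gt0// ler_pdivrMr ?mulr_gt0//.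
    by move: (le_trans laB BC') C'0; clear; move: (`|_|) => *; lra.
  have := main _ tl.
  have -> : - (- (la / (2 * C')) * la) - C * (- (la / (2 * C'))) ^+ 2 = la ^+ 2 / (2 * C') - C * (la ^+ 2 / (4 * C' ^+ 2)).
    by field; rewrite gt_eqF.
  have k2 : C * (la ^+ 2 / (4 * C' ^+ 2)) <= C' * (la ^+ 2 / (4 * C' ^+ 2)).
    by rewrite ler_wpM2r// divr_ge0 ?sqr_ge0// mulr_ge0 ?sqr_ge0.
  have e7 : C' * (la ^+ 2 / (4 * C' ^+ 2)) = la ^+ 2 / (4 * C') by field; rewrite gt_eqF.
  have e9 : la ^+ 2 / (2 * C') = 2 * (la ^+ 2 / (4 * C')) by field; rewrite gt_eqF.
  rewrite e9 => k3; have k4 : la ^+ 2 / (4 * C') <= A2 * e1 by move: k2 k3; rewrite e7; clear; lra.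
  rewrite ler_pdivrMr ?mulr_gt0// in k4; apply: (le_trans k4).
  by move: e14; clear; rewrite !expr2; lra.
have la2 : `|la| <= eta / 2.
  by rewrite -(@ler_pXn2r _ 2%N) ?nnegrE ?normr_ge0 ?divr_ge0 ?(ltW eta0)// real_normK ?num_real.
rewrite -eZ'.
have -> : Z = (Z - la *: nu_) + la *: nu_ by rewrite subrK.
apply: (le_trans (enormD _ _)); rewrite enormZ n1 mulr1.
by move: Zt e13 la2; clear; move: (enorm _) (`|_|) => *; lra.
Qed.

(* Approximate semiconcavity: the one-sided estimate is applied at the intermediate point of a
   chord, whose slope is controlled by the superdifferential at its left end. *)
Lemma superdiff_chord (R : realType) (n : nat) {Om U T L f C d0 h0 u rho t0 x0 G N r0 K}
  (S : @local_setting R n Om U T L f C d0 h0 u rho t0 x0 G N r0 K) : Om x0 ->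
  forall e : R, 0 < e -> exists2 d : R, 0 < d & forall s y r1 r2 sg h,
    `|s - t0| <= d -> enorm (y - x0) <= d -> closure Om y -> superdiff Om T u s y r1 r2 ->
    `|sg| <= d -> enorm h <= d ->
    u (s + sg) (y + h) - u s y <= r1 * sg + dotv r2 h + e * (`|sg| + enorm h).
Proof.
move=> Omx0 e e0; have [M M0 HU] := upper_slope R n S.
case: (S) => cd vd t0T Ax0 ch; have [[r00 K0] /(_ Omx0)[G0 N0 K00] _ _ _] := ch.
have /andP[tp tT] := t0T.
have e3 : 0 < e / 3 by rewrite divr_gt0.
have [dU dU0 HdU] := HU (e / 3) 1 e3 ltr01.
have [|d d_0] := exists_lower_bound R [:: dU / 2; r0 / 2; 1 / 4; t0 / 4; (T - t0) / 4].
  by rewrite /= !divr_gt0 ?subr_gt0.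
rewrite /= => /andP[a1] /andP[a2] /andP[a3] /andP[a4] /andP[a5 _].
exists d => // s y r1 r2 sg h sd yd Ay sup sgd hd.
have h00 := enorm_ge0 h; have sg00 := normr_ge0 sg.
have hc k (z : R) : dotv G k + K * z * 1 <= 0 by rewrite G0 K00 dot0v !mul0r addr0.
have [m [m0 em]] : exists m, 0 <= m /\ m = `|sg| + enorm h by exists (`|sg| + enorm h); rewrite addr_ge0.
rewrite -em; apply/ler_addgt0Pr => ep ep0.
have [d1 d10 Hs] := sup (e / 3) e3.
(* The intermediate point sits at the fraction [la] of the chord, close enough to [y] for the
   superdifferential to act with relative error [e / 3]. *)
have [la [la0 la1 lad]] : exists la : R, [/\ 0 < la, la <= 1 & la * m < d1].
  exists (Num.min 1 (d1 / 2 / (m + 1))).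
  have m1 : 0 < m + 1 by rewrite ltr_wpDl.
  have q : 0 < d1 / 2 by rewrite divr_gt0.
  split; [by rewrite lt_min ltr01 divr_gt0|by rewrite ge_min lexx|].
  apply: (@le_lt_trans _ _ (d1 / 2 / (m + 1) * (m + 1))); last by rewrite divfK ?gt_eqF// ltr_pdivrMr// ltr_pMr// ltr1n.
  by apply: ler_pM; rewrite ?le_min ?ler01 ?ge_min ?lexx ?orbT ?lerDl// ltW// divr_gt0.
have adm th : 0 <= th <= 1 -> closure Om (y + th *: h).
  move=> thh; apply: (chart_cone _ _ _ _ _ _ _ 1 _ _ _ ch) => //.
  - by apply: (le_trans yd); move: a2 r00; clear; lra.
  - by apply: (le_trans hd); move: a2 r00; clear; lra.
  - by move: yd hd a3; clear; move: (enorm _) (enorm _) => *; lra.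
have la01 : 0 <= la <= 1 by rewrite ltW.
have Az := adm la la01.
have zs : `|s + la * sg - t0| <= dU.
  rewrite addrAC (le_trans (ler_normD _ _))// normrM gtr0_norm//.
  have : la * `|sg| <= 1 * `|sg| by rewrite ler_wpM2r.
  by move: sd sgd a1; clear; move: (`|_|) (`|_|) (_ * `|_|) => *; lra.
have zy : enorm (y + la *: h - x0) <= dU.
  rewrite addrAC (le_trans (enormD _ _))// enormZ gtr0_norm//.
  have : la * enorm h <= 1 * enorm h by rewrite ler_wpM2r.
  by move: yd hd a1; clear; move: (enorm h) (enorm (y - _)) => *; lra.
have lep : 0 < la * ep by exact: mulr_gt0.
have [v _ Hv] := HdU _ _ (la * ep) zs Az zy lep.
have d_dU : d <= dU by move: a1 d_0; clear; lra.
(* Combined with weights [1 - la] and [la], the two estimates lose their linear parts. The additive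
   error was taken as [la * ep] because the result is divided by [la]. *)
have E1 := Hv s (- la *: h); have E2 := Hv (s + sg) ((1 - la) *: h).
have x1 : s - (s + la * sg) = - la * sg by ring.
have x2 : s + sg - (s + la * sg) = (1 - la) * sg by ring.
have x3 : y + la *: h + - la *: h = y by rewrite -addrA -scalerDl subrr scale0r addr0.
have x4 : y + la *: h + (1 - la) *: h = y + h by rewrite -addrA -scalerDl (addrC la) subrK scale1r.
have n1 : `|1 - la| = 1 - la by rewrite ger0_norm// subr_ge0.
have n2 : `|la| = la by rewrite gtr0_norm.
rewrite x1 x3 !normrM !enormZ normrN n2 in E1; rewrite x2 x4 !normrM !enormZ n1 in E2.
have b1 (k z : R) : 0 <= k <= 1 -> 0 <= z -> z <= d -> k * z <= dU.
  move=> /andP[k0 k1] z0 zd; apply: le_trans d_dU; apply: le_trans zd; by rewrite ler_piMl.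
have la01' : 0 <= 1 - la <= 1 by move: la0 la1; clear => *; apply/andP; split; lra.
have {}E1 := E1 (b1 _ _ la01 sg00 sgd) (b1 _ _ la01 h00 hd) (hc _ _).
have {}E2 := E2 (b1 _ _ la01' sg00 sgd) (b1 _ _ la01' h00 hd) (hc _ _).
rewrite -!mulrDr -em !dotvZr in E1 E2.
have := Hs (s + la * sg) (y + la *: h).
have y1 : s + la * sg - s = la * sg by ring.
have y2 : y + la *: h - y = la *: h by rewrite addrC addKr.
rewrite y1 y2 normrM enormZ n2 -mulrDr -em dotvZr => Q.
have {}Q : u (s + la * sg) (y + la *: h) - u s y - r1 * (la * sg) - la * dotv r2 h <= e / 3 * (la * m).
  apply: Q => //.
  have sg1 : `|la * sg| <= d.
    by rewrite normrM n2; apply: le_trans sgd; rewrite ler_piMl.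
  by move: sg1 sd; rewrite !ler_norml => /andP[p1 p2] /andP[p3 p4]; apply/andP; split; move: p1 p2 p3 p4 a4 a5 tp tT; clear; lra.
have la1' : 0 <= 1 - la by rewrite subr_ge0.
have {}E1 := ler_wpM2l la1' E1; have {}E2 := ler_wpM2l (ltW la0) E2.
rewrite -(ler_pM2l la0).
have z1 : 0 <= e / 3 * (la * (la * m)) by rewrite !mulr_ge0 ?invr_ge0// ltW.
move: E1 E2 Q z1; clear.
move: (u (s + sg) _) (u s y) (u _ _) (tslope _ _ _ _) (dotv r2 h) (dotv _ h) => *; lra.
Qed.

(** The chord estimate holds with one radius for all nearby points and all their superdifferentials,
    so it survives the limit. *)
Lemma limsup_superdiff_sub (R : realType) (n : nat) {Om U T L f C d0 h0 u rho t0 x0 G N r0 K}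
  (S : @local_setting R n Om U T L f C d0 h0 u rho t0 x0 G N r0 K) q1 q2 : Om x0 ->
  limsup_superdiff Om T u t0 x0 q1 q2 -> superdiff Om T u t0 x0 q1 q2.
Proof.
move=> Omx0 [s [y [p1 [p2 [sy [cs [cy [sup [cp1 cp2]]]]]]]]] e e0.
have e2 : 0 < e / 2 by rewrite divr_gt0.
have [d d_0 Hd] := superdiff_chord R n S Omx0 _ e2.
case: (S) => cd vd t0T Ax0 ch; have [[r00 K0] /(_ Omx0)[G0 N0 K00] _ _ _] := ch.
have [C1 [d1 [C10 d10 Hlip]]] := lip R n S.
have [|dd dd0] := exists_lower_bound R [:: d; d1 / 2; r0; 1].
  by rewrite /= d_0 r00 ltr01 !divr_gt0.
rewrite /= => /andP[a1] /andP[a2] /andP[a3] /andP[a4 _].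
exists (dd / 2); first by rewrite divr_gt0.
move=> s' y' sT' Ay' near.
have := normr_ge0 (s' - t0); have := enorm_ge0 (y' - x0) => h00 sg00.
have sgd : `|s' - t0| <= dd / 2 by move: near h00; clear; move: (enorm _) (`|_|) => *; lra.
have hd : enorm (y' - x0) <= dd / 2 by move: near sg00; clear; move: (enorm _) (`|_|) => *; lra.
apply/ler_addgt0Pr => ep ep0.
have q0 : 0 < 2 * C1 + 1 + 1 by rewrite !addr_gt0// mulr_gt0.
have [de [de0 [de1 de2]]] : exists de, 0 < de /\ (de * (4 * C1 + 2) <= ep /\ de <= dd / 2).
  exists (Num.min (ep / (4 * C1 + 2)) (dd / 2)).
  have W : 0 < 4 * C1 + 2 by rewrite addr_gt0// mulr_gt0.
  by rewrite lt_min !divr_gt0// -ler_pdivlMr// !ge_min !lexx orbT.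
have cR (a : nat -> R) (l : R) : a @ \oo --> l -> \forall k \near \oo, `|a k - l| < de.
  by move=> /cvgrPdist_lt /(_ de de0) H; near=> k; rewrite distrC; near: k.
have [k [k1 k2 k3 k4]] : exists k, [/\ `|s k - t0| < de, enorm (y k - x0) < de, `|p1 k - q1| < de & enorm (p2 k - q2) < de].
  have H : \forall k \near \oo, [/\ `|s k - t0| < de, enorm (y k - x0) < de, `|p1 k - q1| < de & enorm (p2 k - q2) < de].
    near=> k; split; near: k; [exact: cR|exact: (proj1 (cvg_enormP _ _ _ _) cy)|exact: cR|exact: (proj1 (cvg_enormP _ _ _ _) cp2)].
  by have [k0 _ Hk] := H; exists k0; apply: Hk => /=.
have [sk yk] := sy k.
have Ayk : closure Om (y k) by exact: subset_closure.
have ddd : dd / 2 <= d by move: a1 dd0; clear; lra.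
have ed : de <= d by exact: le_trans de2 ddd.
have D := Hd (s k) (y k) (p1 k) (p2 k) (s' - t0) (y' - x0) (le_trans (ltW k1) ed) (le_trans (ltW k2) ed) Ayk (sup k) (le_trans sgd ddd) (le_trans hd ddd).
have Az : closure Om (y k + (y' - x0)).
  rewrite -[y' - x0]scale1r; apply: (chart_cone _ _ _ _ _ _ _ 1 _ _ _ ch) => //.
  - by apply: (le_trans (ltW k2)); move: de2 a3 dd0; clear; lra.
  - by apply: (le_trans hd); move: a3 dd0; clear; lra.
  - by rewrite ler01 lexx.
  - by move: k2 de2 hd a4; clear; move: (enorm _) (enorm _) => *; lra.
  - by rewrite G0 K00 dot0v !mul0r addr0.
have b1 : `|s k + (s' - t0) - t0| <= d1.
  by rewrite addrAC (le_trans (ler_normD _ _))//; move: k1 sgd de2 a2 d10; clear; move: (`|_|) (`|_|) => *; lra.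
have b2 : enorm (y k + (y' - x0) - x0) <= d1.
  by rewrite addrAC (le_trans (enormD _ _))//; move: k2 hd de2 a2 d10; clear; move: (enorm _) (enorm _) => *; lra.
have b3 : `|s' - t0| <= d1 by move: sgd a2 d10 dd0; clear; move: (`|_|) => *; lra.
have b4 : enorm (y' - x0) <= d1 by move: hd a2 d10 dd0; clear; move: (enorm _) => *; lra.
have b5 : `|t0 - t0| <= d1 by rewrite subrr normr0 ltW.
have b6 : enorm (x0 - x0) <= d1 by rewrite subrr enorm0 ltW.
have b7 : `|s k - t0| <= d1 by move: k1 de2 a2 d10 dd0; clear; move: (`|_|) => *; lra.
have b8 : enorm (y k - x0) <= d1 by move: k2 de2 a2 d10 dd0; clear; move: (enorm _) => *; lra.
have l1 := Hlip _ _ _ _ b3 b1 Ay' Az b4 b2.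
have l2 := Hlip _ _ _ _ b5 b7 Ax0 Ayk b6 b8.
have e5 : y k + (y' - x0) - y' = y k - x0 by rewrite addrA addrAC addrK.
have e6 : s k + (s' - t0) - s' = s k - t0 by ring.
rewrite e5 e6 in l1.
have l3 : C1 * (`|s k - t0| + enorm (y k - x0)) <= C1 * (2 * de).
  by rewrite ler_pM2l//; move: k1 k2; clear; move: (enorm _) (`|_|) => *; lra.
have {}l1 := le_trans l1 l3; have {}l2 := le_trans l2 l3.
have d1' : (p1 k - q1) * (s' - t0) <= de * 1.
  apply: (le_trans (ler_norm _)); rewrite normrM; apply: ler_pM => //; first exact: ltW.
  by apply: (le_trans sgd); move: a4 dd0; clear; lra.
have d2' : dotv (p2 k - q2) (y' - x0) <= de * 1.
  apply: (le_trans (cauchy_schwarz _ _)); apply: ler_pM; rewrite ?enorm_ge0//; first exact: ltW.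
  by apply: (le_trans hd); move: a4 dd0; clear; lra.
have e7 : e / 2 * (`|s' - t0| + enorm (y' - x0)) <= e * (`|s' - t0| + enorm (y' - x0)).
  by apply: ler_wpM2r; [exact: addr_ge0|move: e0; clear; lra].
rewrite (dotvBl (p2 k)) in d2'.
move: D l1 l2 d1' d2' e7 de1; rewrite !ler_norml; clear => D /andP[l1 l1'] /andP[l2 l2'] d1' d2' e7 de1.
move: D l1 l1' l2 l2' d1' d2' e7 de1.
move: (dotv (p2 k) _) (dotv q2 _) (u (s k + _) _) (u s' y') (u t0 x0) (u (s k) _) (`|s' - t0| + _) => *; lra.
Unshelve. all: by end_near. Qed.

(** * From costs of absolutely continuous curves to curves of finite energy *)

Section curves_and_costs.
Context {R : realType} {n : nat}.
Implicit Types (g w : R -> 'rV[R]_n) (x y v : 'rV[R]_n) (A U Om : set 'rV[R]_n).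
Local Notation mu := (@lebesgue_measure R).

(** The lower bound on [k] makes the integral of the negative part finite; an integral below
    infinity then bounds that of the positive part. *)
Lemma integral_lt_pinfty_itg (a b c : R) (k : R -> R) : a <= b -> 0 <= c ->
  measurable_fun (`[a, b]%classic : set (measurableTypeR R)) k ->
  (forall r, a <= r <= b -> - c <= k r) ->
  (\int[mu]_(r in `[a, b]%classic) (k r)%:E < +oo)%E -> itg a b k.
Proof.
move=> ab c0 mk kc fin.
have mk' : measurable_fun (`[a, b]%classic : set (measurableTypeR R)) (EFin \o k) by exact/measurable_EFinP.
have mab := measurable_cc a b.
have Nfin : (\int[mu]_(r in `[a, b]%classic) (EFin \o k)^\- r < +oo)%E.
  apply: (@le_lt_trans _ _ (\int[mu]_(r in `[a, b]%classic) (cst c%:E) r)%E).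
    apply: ge0_le_integral => //.
    - exact: measurable_funeneg.
    - move=> r; rewrite /= in_itv /= => rab; rewrite funenegE /= ge_max.
      by apply/andP; split; rewrite lee_fin// lerNl; exact: kc.
  rewrite integral_cst//; apply: lte_mul_pinfty; rewrite ?lee_fin//.
  exact: (eq_ind_r (fun z => (z < +oo)%E) (ltry _) (lebesgue_measure_cc a b ab)).
have Pfin : (\int[mu]_(r in `[a, b]%classic) (EFin \o k)^\+ r < +oo)%E.
  have : (\int[mu]_(r in `[a, b]%classic) (EFin \o k) r < +oo)%E by [].
  rewrite integralE; move: Nfin.
  have : (0 <= \int[mu]_(r in `[a, b]%classic) (EFin \o k)^\- r)%E by exact: integral_ge0.
  case: (\int[mu]_(r in `[a, b]%classic) (EFin \o k)^\- r)%E => // N _ _.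
  by case: (\int[mu]_(r in `[a, b]%classic) (EFin \o k)^\+ r)%E => // p _; exact: ltry.
apply/integrableP; split => //.
have -> : (fun r => `|(EFin \o k) r|)%E = (fun r => (EFin \o k)^\+ r + (EFin \o k)^\- r)%E.
  by apply/funext => r; have := fune_abse (EFin \o k) => /(congr1 (fun h => h r)).
rewrite ge0_integralD//; first exact: lte_add_pinfty.
- exact: measurable_funepos.
- exact: measurable_funeneg.
Qed.

(** [derive1 g] agrees with the measurable velocity [w] off a null set, to which the two endpoints 0
    and [T] are added. *)
Lemma traj_cost_integral (T t : R) L (F G : 'rV[R]_n -> PrV R n -> R) m g w :
  traj T g w -> 0 <= t -> measurable_fun (`[t, T]%classic : set (measurableTypeR R)) (lag L (fun x s => F x (m s)) g w) ->
  cost L F G m T t g =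
    (\int[mu]_(r in `[t, T]%classic) (lag L (fun x s => F x (m s)) g w r)%:E + (G (g T) (m T))%:E)%E.
Proof.
move=> gw t0 ml; rewrite /cost; congr (_ + _)%E.
have [N [mN N0 HN]] := traj_derive _ _ _ gw.
have m1 (p : R) : measurable (set1 p : set (measurableTypeR R)) by exact: measurable_set1.
apply: (integral_eq_off_null _ (N `|` (set1 0 `|` set1 T))).
- exact: measurable_cc.
- by apply: measurableU => //; exact: measurableU.
- have n1 (p : R) : mu.-negligible (set1 p) by exists (set1 p); split => //; exact: lebesgue_measure_set1.
  apply: measure_negligible; first by apply: measurableU => //; exact: measurableU.
  by apply: negligibleU; [exists N; split => //; exact: subset_refl|exact: negligibleU].
- exact/measurable_EFinP.
- move=> r; rewrite /= in_itv /= => /andP[r1 r2] rN; rewrite /lag; congr (_%:E); congr (L _ _ + _).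
  have r0 : r != 0 by apply/eqP => E; apply: rN; right; left.
  have rT : r != T by apply/eqP => E; apply: rN; right; right.
  apply: contrapT => nd; apply: rN; left; apply: HN => /= H; apply: nd; apply: H.
  by rewrite !lt_neqAle eq_sym r0 rT r2 (le_trans t0).
Qed.

Lemma itg_cost (T t : R) L (F G : 'rV[R]_n -> PrV R n -> R) m g w :
  traj T g w -> 0 <= t -> itg t T (lag L (fun x s => F x (m s)) g w) ->
  cost L F G m T t g = (running L (fun x s => F x (m s)) t T g w + G (g T) (m T))%:E.
Proof.
move=> gw t0 il; rewrite (traj_cost_integral _ _ _ _ _ _ _ _ gw t0); last exact: itg_measurable il.
rewrite EFinD; congr (_ + _)%E; rewrite /running /int /Rintegral fineK//.
exact: (@integrable_fin_num _ _ _ mu _ (measurable_cc t T) _ il).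
Qed.

(** The velocity is extended by zero, since [primitive] asks for integrability on the whole line. *)
Lemma curve_traj Om (T : R) g w : curve (closure Om) 0 T g w ->
  exists2 w', traj T g w' & forall r, 0 <= r <= T -> w' r = w r.
Proof.
move=> [h1 h2 _ _]; exists (fun r => if 0 <= r <= T then w r else 0); last by move=> r ->.
move=> i; split.
  have := h1 i; rewrite /itg => /(integrable_mkcond _ (measurable_cc 0 T)).1.
  congr (integrable _ _ _); apply/funext => r; rewrite /patch mem_setE in_itv/=.
  by case: ifP => //; rewrite mxE.
move=> a b a0 ab bT.
have e r : a <= r <= b -> w r ord0 i = (if 0 <= r <= T then w r else 0) ord0 i.
  by move=> /andP[ar rb]; rewrite (le_trans a0)//= (le_trans rb).
have ii : itg a b (fun r => (if 0 <= r <= T then w r else 0) ord0 i).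
  by apply: (eq_itg _ _ _ _ e); exact: itg_sub (h1 i).
rewrite h2// Rintegral_itv_obnd_cbnd; first by apply: eq_int.
apply: (integrableS _ _ _ ii) => //.
by move=> r /=; rewrite !in_itv /= => /andP[/ltW -> ->].
Qed.

Lemma abs_cont_continuous (T : R) g : abs_cont_on T g -> forall r, 0 <= r <= T ->
  forall e : R, 0 < e -> exists2 d : R, 0 < d &
    forall s, 0 <= s <= T -> `|s - r| < d -> enorm (g s - g r) < e.
Proof.
move=> ac r rT e e0; have [d d0 H] := ac e e0; exists d => // s sT sr.
have main (p q : R) : 0 <= p -> p <= q -> q <= T -> q - p < d -> enorm (g q - g p) < e.
  move=> p0 pq qT pd; have := H 1%N (fun=> p) (fun=> q).
  rewrite !big_ord1; apply => //.
  by move=> i j; rewrite !ltnS !leqn0 => /eqP -> /eqP ->.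
move: rT sT sr => /andP[r0 rT] /andP[s0 sT]; case/orP: (le_total r s) => rs.
  by rewrite ger0_norm ?subr_ge0// => k; exact: main.
by rewrite ler0_norm ?subr_le0// opprB enormB => k; exact: main.
Qed.

Context (Om U : set 'rV[R]_n) (T : R) (L : 'rV[R]_n -> 'rV[R]_n -> R)
  (F G : 'rV[R]_n -> PrV R n -> R) (m : R -> PrV R n) (C d0 : R).
Hypothesis cd : control_data (closure Om) U T L (fun x s => F x (m s)) C d0.
Let f := fun x (s : R) => F x (m s).

Lemma curve_cost g w : curve (closure Om) 0 T g w -> Gamma Om T g /\
  forall t, 0 <= t <= T -> cost L F G m T t g = (running L f t T g w + G (g T) (m T))%:E.
Proof.
move=> cw; have [w' tw ww] := curve_traj _ _ _ _ cw.
have [_ _ h3 _] := cw.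
split; first by split => //; exact: traj_abs_cont tw.
move=> t /andP[t0 tT].
have e r : t <= r <= T -> lag L f g w r = lag L f g w' r.
  by move=> /andP[tr rT]; rewrite /lag ww// (le_trans t0).
have ct : curve (closure Om) t T g w by exact: curve_sub cw.
have il := curve_lag_itg _ _ _ _ _ _ _ cd _ _ _ _ t0 tT (lexx _) ct.
rewrite (itg_cost _ _ _ _ _ _ _ _ tw t0); last exact: eq_itg e il.
by rewrite /running -(eq_int _ _ _ _ e).
Qed.

(** Coercivity turns finite cost into finite energy, so that every competitor of finite cost is a
    [curve]. *)
Lemma cost_curve g t (B : R) : Gamma Om T g -> 0 <= t <= T -> (cost L F G m T t g <= B%:E)%E ->
  exists2 w, curve (closure Om) t T g w & running L f t T g w + G (g T) (m T) <= B.
Proof.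
move=> [ac gA] /andP[t0 tT] cB; have T0 := cd_T _ _ _ _ _ _ _ cd.
have [C0 HL _ _ _] := cd_L _ _ _ _ _ _ _ cd.
have [w tw] := abs_cont_traj _ _ T0 ac; exists w.
all: have prim i := primitive_int _ _ _ (tw i).
all: have gA' r : t <= r <= T -> closure Om (g r) by (move=> /andP[tr rT]; apply: gA; rewrite (le_trans t0)).
all: have gc : forall r, t <= r <= T -> forall e : R, 0 < e -> exists2 d : R, 0 < d &
    forall s, t <= s <= T -> `|s - r| < d -> enorm (g s - g r) < e
  by (move=> r /andP[tr rT] e e0; have [|d d1 H] := abs_cont_continuous _ _ ac r _ e e0;
    [rewrite (le_trans t0)|exists d => // s /andP[ts sT]; apply: H; rewrite (le_trans t0)]).
all: have mw i : itg t T (fun r => w r ord0 i) by (have [i1 _] := prim i; exact: itg_sub i1).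
all: have mg i : itg t T (fun r => g r ord0 i)
  by (apply: continuous_on_int_itg => // r rr e e0; have [d d1 H] := gc r rr e e0; exists d => // s ss sr;
   apply: le_lt_trans (H s ss sr); have := coord_le_enorm (g s - g r) i; rewrite !mxE).
all: have pot : itg t T (fun r => f (g r) r)
  by (apply: continuous_on_int_itg => //; exact: (lag_potential_continuous _ _ _ _ _ _ _ cd t T g t0 (lexx _) gA' gc)).
all: have mL : measurable_fun (`[t, T]%classic : set (measurableTypeR R)) (fun r => L (g r) (w r))
  by (apply: (curve_lagrangian_measurable _ _ _ _ _ _ _ cd) => // [i|i];
    [exact: itg_measurable (mg i)|exact: itg_measurable (mw i)]).
all: have ml : measurable_fun (`[t, T]%classic : set (measurableTypeR R)) (lag L f g w)
  by (apply: measurable_funD => //; exact: itg_measurable pot).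
all: have low r : t <= r <= T -> enorm (w r) ^+ 2 <= C * (lag L f g w r + 2 * C)
  by (move=> rr; apply: (lag_lower _ _ _ _ _ _ _ cd); [move: rr => /andP[tr ->]; rewrite andbT (le_trans t0)|exact: gA']).
all: have il : itg t T (lag L f g w)
  by (apply: (integral_lt_pinfty_itg _ _ (2 * C)) => //; [rewrite mulr_ge0// ltW|
   move=> r rr; have := le_trans (sqr_ge0 _) (low r rr); rewrite pmulr_rge0//; lra|
   move: cB; rewrite (traj_cost_integral _ _ _ _ _ _ _ _ tw t0 ml);
   case: (\int[mu]_(r in `[t, T]%classic) (lag L f g w r)%:E)%E => //= r _; exact: ltry]).
- split => //.
  + move=> i r s tr rs sT; have [_ H] := prim i; apply: H => //; exact: le_trans tr.
  + apply: (itg_le _ _ _ (fun r => C * (lag L f g w r + 2 * C))).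
    * have -> : (fun r => enorm (w r) ^+ 2) = (fun r : measurableTypeR R => enorm (w r - 0) ^+ 2).
        by apply/funext => r; rewrite subr0.
      by apply: measurable_enorm_sqr => [|i]; [exact: measurable_cc|exact: itg_measurable (mw i)].
    * by move=> r rr; rewrite ger0_norm ?sqr_ge0// low.
    * by apply/itgZ/itgD => //; exact: itg_cst.
- by move: cB; rewrite (itg_cost _ _ _ _ _ _ _ _ tw t0 il) lee_fin.
Qed.

End curves_and_costs.

Lemma lagrangian_bounds_le (R : realType) (n : nat) (U : set 'rV[R]_n) L (C C' : R) :
  C <= C' -> lagrangian_bounds U L C -> lagrangian_bounds U L C'.
Proof.
move=> CC [C0 HL HD [HQ HDL] [HLx HDx]].
have up (a b : R) : 0 <= b -> a <= C * b -> a <= C' * b.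
  by move=> b0 /le_trans; apply; rewrite ler_wpM2r.
split; first exact: lt_le_trans CC.
- move=> x v Ux; have [h1 h2] := HL x v Ux; split; last by apply: up h2; rewrite addr_ge0 ?sqr_ge0.
  have k : 0 <= C + L x v by rewrite -(pmulr_rge0 _ C0) (le_trans _ h1)// sqr_ge0.
  apply: (le_trans h1); apply: ler_pM => //; [exact: ltW|by rewrite lerD2r].
- by move=> x v Ux; apply: up (HD x v Ux); rewrite addr_ge0 ?enorm_ge0.
- split; last by move=> x v w Ux; apply: up (HDL x v w Ux); exact: enorm_ge0.
  move=> x v h Ux; have [h1 h2] := HQ x v h Ux; split; last by apply: up h2; exact: sqr_ge0.
  by apply: (up _ _ _ h1); rewrite -(pmulr_rge0 _ C0) (le_trans _ h1)// sqr_ge0.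
- split=> x y v s.
  + by rewrite -mulrA; apply: up; rewrite ?mulrA; [rewrite mulr_ge0 ?enorm_ge0 ?addr_ge0 ?sqr_ge0|exact: HLx].
  + by rewrite -mulrA; apply: up; rewrite ?mulrA; [rewrite mulr_ge0 ?enorm_ge0 ?addr_ge0 ?enorm_ge0|exact: HDx].
Qed.

(** * The mild solution as the value function of a control problem *)

Section setup.
Context {R : realType} {n : nat}.
Context (Om : set 'rV[R]_n) (rho : 'rV[R]_n -> R) (U : set 'rV[R]_n) (T kappa M mu : R)
    (L : 'rV[R]_n -> 'rV[R]_n -> R) (F G : 'rV[R]_n -> PrV R n -> R)
    (u : R -> 'rV[R]_n -> R) (m : R -> PrV R n).
Hypothesis dom : bounded_C2_domain Om rho.
Hypothesis oU : open U.
Hypothesis OU : closure Om `<=` U.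
Hypothesis T0 : 0 < T.
Hypothesis mu0 : 0 < mu.
Hypothesis hD : hyp_D Om U kappa F G.
Hypothesis hL : hyp_L U M mu L.
Hypothesis ms : mild_solution Om T L F G u m.

Lemma closure_bounded : exists B : R, forall x, closure Om x -> enorm x <= B.
Proof.
have [_ [[B HB] _]] := dom; exists B => x /closure_enormP cx.
apply/ler_addgt0Pr => e e0; have [y Oy yx] := cx e e0.
have := ler_enormB x y; rewrite enormB; have := HB y Oy; move: yx.
by move: (enorm _) (enorm _) (enorm _) => *; lra.
Qed.

Lemma closure_cluster (x : nat -> 'rV[R]_n) : (forall k, closure Om (x k)) ->
  exists2 l, closure Om l & forall de : R, 0 < de -> forall k0, exists2 k, (k0 <= k)%N & enorm (x k - l) < de.
Proof.
move=> cx; have [B HB] := closure_bounded.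
have [l _ Hl] := cluster_bounded_seq _ _ x B (fun k => HB _ (cx k)).
exists l => //; apply/closure_enormP => e e0.
have e2 : 0 < e / 2 by rewrite divr_gt0.
have [k _ kl] := Hl _ e2 0%N.
have [y Oy yx] := (proj1 (closure_enormP _ _) (cx k)) _ e2.
exists y => //; apply: (le_lt_trans (enorm_triangle _ (x k) _)).
by move: kl yx; move: (enorm _) (enorm _) => *; lra.
Qed.

(** Compactness of the closed domain, in the form of a cluster point of a sequence of
    counterexamples. *)
Lemma neighbourhood_radius : exists2 d0 : R, 0 < d0 &
  forall x y, closure Om x -> enorm (y - x) <= d0 -> U y.
Proof.
apply: contrapT => no.
have H (k : nat) : exists p : 'rV[R]_n * 'rV[R]_n,
    [/\ closure Om p.1, enorm (p.2 - p.1) <= k.+1%:R^-1 & ~ U p.2].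
  apply: contrapT => nk; apply: no; exists k.+1%:R^-1; first by rewrite invr_gt0.
  by move=> x y cx yx; apply: contrapT => nU; apply: nk; exists (x, y).
have [p Hp] := choice H.
have [l cl Hl] := closure_cluster (fun k => (p k).1) (fun k => let: And3 h _ _ := Hp k in h).
have [d d_0 Hd] := (proj1 (open_enormP _) oU) l (OU _ cl).
have d2 : 0 < d / 2 by rewrite divr_gt0.
have [k0 hk0] := exists_invS_lt R _ d2.
have [k kk kl] := Hl _ d2 k0; have [_ h2 nU] := Hp k; apply: nU; apply: Hd.
apply: (le_lt_trans (enorm_triangle _ (p k).1 _)).
have := le_lt_trans h2 (hk0 k kk); move: kl; move: (enorm _) (enorm _) => *; lra.
Qed.

Let mP t : 0 <= t <= T -> is_in_P Om (m t).
Proof. by case: ms => _ [H _]; exact: H. Qed.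

Lemma coupling_continuous (t : R) : 0 <= t <= T -> forall e : R, 0 < e -> exists2 d : R, 0 < d &
  forall s, 0 <= s <= T -> `|s - t| < d -> forall x, closure Om x ->
    `|F x (m s) - F x (m t)| <= e.
Proof.
move=> tT e e0; have [hF [hG _]] := hD; have [_ [_ [mc _]]] := ms.
have k0 : 0 < `|kappa| + 1 by rewrite ltr_wpDl.
have [d d0 Hd] := mc t tT (e / (`|kappa| + 1)) (divr_gt0 e0 k0).
exists d => // s sT st x Ax; have Ux := OU _ Ax.
have h1 := hF x Ux (m s) (m t) (mP s sT) (mP t tT).
have kap : 0 <= kappa.
  have [_ [_ H]] := hG _ (mP t tT); apply: le_trans (H x Ux); by rewrite addr_ge0 ?enorm_ge0.
have h2 : kappa * d1 Om (m s) (m t) <= kappa * (e / (`|kappa| + 1)) by rewrite ler_wpM2l// ltW// Hd.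
have h3 : kappa * (e / (`|kappa| + 1)) <= e.
  by rewrite mulrA ler_pdivrMr// (ger0_norm kap) mulrC ler_pM2l// lerDl.
apply: le_trans (le_trans h2 h3); apply: le_trans h1; by rewrite lerDl.
Qed.

(** For each time there is a bound over [U]; continuity in time, uniform over the closed domain, and
    compactness of [0, T] give a common one. *)
Lemma coupling_bounded : exists B : R, forall t x, 0 <= t <= T -> closure Om x -> `|F x (m t)| <= B.
Proof.
apply: contrapT => no; have [_ [hG _]] := hD.
have H (k : nat) : exists p : R * 'rV[R]_n, [/\ 0 <= p.1 <= T, closure Om p.2 & k%:R < `|F p.2 (m p.1)|].
  apply: contrapT => nk; apply: no; exists k%:R => t x tT cx.
  by rewrite leNgt; apply/negP => h; apply: nk; exists (t, x).
have [p Hp] := choice H.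
(* Times are encoded as vectors of length one, so that the cluster argument for vectors applies. *)
pose v k : 'rV[R]_1 := const_mx (p k).1.
have nv (a b : R) : enorm (const_mx a - const_mx b : 'rV[R]_1) = `|a - b|.
  by rewrite /enorm /dotv big_ord1 !mxE -expr2 sqrtr_sqr.
have vb k : enorm (v k) <= T.
  rewrite -[v k]subr0 -(_ : const_mx 0 = 0); last by apply/rowP => i; rewrite !mxE.
  by rewrite nv subr0; have [/andP[t0 tT] _ _] := Hp k; rewrite ger0_norm.
have [l _ Hl] := cluster_bounded_seq _ _ v T vb.
have [t et] : exists t, l = const_mx t by exists (l ord0 ord0); apply/rowP => i; rewrite !mxE ord1.
have near e (e0 : 0 < e) k0 : exists2 k, (k0 <= k)%N & `|(p k).1 - t| < e.
  by have [k kk h] := Hl e e0 k0; exists k => //; rewrite -nv -et.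
have tT : 0 <= t <= T.
  apply/andP; split; apply/ler_addgt0Pr => e e0; have [k _] := near e e0 0%N;
    have [/andP[t0 tT] _ _] := Hp k; rewrite ltr_norml => /andP[]; move: t0 tT; move: (p k).1 => *; lra.
have [[_ [_ [B HB]]] _] := hG _ (mP t tT).
have [d d0 Hd] := coupling_continuous t tT 1 ltr01.
have [k kk kt] := near d d0 (Num.truncn (`|B| + 1)).+1.
have [pT cx big] := Hp k.
have h1 := Hd _ pT kt _ cx; have [h2 _] := HB _ (OU _ cx).
have h3 : `|B| + 1 < k%:R by apply: lt_le_trans (truncnS_gt _) _; rewrite ler_nat.
have h4 := ler_normD (F (p k).2 (m (p k).1) - F (p k).2 (m t)) (F (p k).2 (m t)); rewrite subrK in h4.
have h5 := lt_trans h3 (lt_le_trans big (le_trans h4 (lerD h1 h2))).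
by have := lt_le_trans h5 (lerD (lexx 1) (ler_norm B)); rewrite addrC ltxx.
Qed.

Lemma lagrangian_continuous x v : U x -> forall e : R, 0 < e -> exists2 d : R, 0 < d &
  forall y (w : 'rV[R]_n), enorm (y - x) < d -> enorm (w - v) < d -> `|L y w - L x v| < e.
Proof.
move=> Ux e e0; have [H _] := hL; have [df _] := H x v Ux.
have := differentiable_continuous df => /cvgrPdist_lt /(_ e e0) [[A B] /= [nA nB] AB].
have [d1 d10 H1] := (proj1 (nbhs_enormP _ _) nA).
have [d2 d20 H2] := (proj1 (nbhs_enormP _ _) nB).
exists (Num.min d1 d2); first by rewrite lt_min d10.
move=> y w; rewrite !lt_min => /andP[y1 _] /andP[_ w2].
by rewrite distrC; apply: (AB (y, w)); split; [exact: H1|exact: H2].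
Qed.

Lemma exists_control_data : exists C d0, control_data (closure Om) U T L (fun x t => F x (m t)) C d0 /\
  forall x, closure Om x -> `|G x (m T)| <= C.
Proof.
have [CL HL] := exists_lagrangian_bounds U M mu L mu0 hL.
have [B HB] := coupling_bounded; have [d0 d00 Hd0] := neighbourhood_radius.
have TT : 0 <= T <= T by rewrite ltW//=.
have [_ [hG _]] := hD; have [_ [[_ [_ [BG HBG]]] _]] := hG _ (mP T TT).
have [C [C1 C2 C3 C4]] : exists C, [/\ CL <= C, B <= C, BG <= C & kappa <= C].
  exists (Num.max (Num.max CL B) (Num.max BG kappa)).
  by split; rewrite !le_max lexx ?orbT.
exists C, d0; split; last by move=> x Ax; have [h _] := HBG x (OU _ Ax); exact: le_trans C3.
split => //.
- exact: lagrangian_bounds_le C1 HL.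
- exact: lagrangian_continuous.
- move=> t x y tT seg; have [[dF _] [_ H]] := hG _ (mP t tT).
  have [|c c01 ->] := mvt_grad (F ^~ (m t)) y x.
    move=> s /andP[s0 s1]; apply: dF.
    have -> : y + s *: (x - y) = x + (1 - s) *: (y - x) by apply/rowP => i; rewrite !mxE; ring.
    by apply: seg; apply/andP; split; lra.
  apply: (le_trans (cauchy_schwarz_norm _ _)); apply: ler_wpM2r; first exact: enorm_ge0.
  apply: le_trans C4.
  have Uc : U (y + c *: (x - y)).
    have -> : y + c *: (x - y) = x + (1 - c) *: (y - x) by apply/rowP => i; rewrite !mxE; ring.
    by apply: seg; move: c01 => /andP[c0 c1]; apply/andP; split; lra.
  by apply: le_trans (H _ Uc); rewrite lerDl enorm_ge0.
- exact: coupling_continuous.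
- by move=> t x tT Ax; apply: le_trans C2; exact: HB.
Qed.

Lemma exists_local_setting (t0 : R) x0 : 0 < t0 < T -> closure Om x0 ->
  exists C d0 Gc N r K, local_setting Om U T L (fun x t => F x (m t)) C d0 (fun x => G x (m T)) u rho t0 x0 Gc N r K.
Proof.
move=> t0T Ax0; have [C [d0 [cd hb]]] := exists_control_data.
have [Gc [N [r [K ch]]]] := exists_chart _ _ dom x0 Ax0.
exists C, d0, Gc, N, r, K; split => //.
have [_ [_ [_ [eta [_ uE]]]]] := ms.
split => //.
- move=> t g w tT cw; have /andP[tp tT'] := tT.
  have [_ _ h3 _] := cw.
  have Agt : closure Om (g t) by apply: h3; rewrite lexx.
  (* Competitors in the definition of [u] live on [0, T]; the curve is extended by standing still
     before time [t]. *)
  have [g2 [w2 [cw2 _ e2 _ e4]]] := curve_glue _ 0 t T _ _ g w tp tT' (curve_cst _ 0 t _ Agt) cw erefl.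
  have [Gg cg] := curve_cost Om U T L F G m C d0 cd g2 w2 cw2.
  have : ((u t (g t))%:E <= cost L F G m T t g2)%E.
    by rewrite (uE t _ tT Agt); apply: ereal_inf_lbound; exists g2 => //; split => //=; exact: e2.
  rewrite cg// lee_fin e2// => /le_trans; apply; rewrite lerD2r.
  have -> // : running L (fun x s => F x (m s)) t T g2 w2 = running L (fun x s => F x (m s)) t T g w.
  by apply: eq_int => r' /andP[r1 r2]; rewrite /lag e2 ?e4.
- move=> t x tT Ax e e0.
  have := uE t x tT Ax; set I := ereal_inf _ => uI.
  have If : I \is a fin_num by rewrite -uI.
  have [_ [g [Gg gt] <-] gl] := lb_ereal_inf_adherent e0 If.
  rewrite -/I -uI -EFinD in gl.
  have [w cw le] := cost_curve Om U T L F G m C d0 cd g t _ Gg tT (ltW gl).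
  by exists g, w.
Qed.

End setup.

(** * The support of a probability measure on curves *)

Section support.
Context {R : realType} {n : nat} (Om : set 'rV[R]_n) (T B0 : R).
Hypothesis T0 : 0 < T.
Hypothesis bnd : forall x, closure Om x -> enorm x <= B0.
Implicit Types (g : R -> 'rV[R]_n).

Lemma enorm_le_dunif g g' s : Gamma Om T g -> Gamma Om T g' -> 0 <= s <= T ->
  enorm (g s - g' s) <= dunif T g g'.
Proof.
move=> [_ gA] [_ gA'] sT; apply: ub_le_sup; last by exists s => //; rewrite /= in_itv.
exists (B0 + B0) => _ [r + <-]; rewrite /= in_itv /= => rT.
by apply: (le_trans (enormBD _ _)); apply: lerD; apply: bnd; [exact: gA|exact: gA'].
Qed.

Lemma dunif_le g g' (c : R) : (forall s, 0 <= s <= T -> enorm (g s - g' s) <= c) -> dunif T g g' <= c.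
Proof.
move=> H; apply: ge_sup => [|_ [s + <-]].
  by exists (enorm (g 0 - g' 0)), 0 => //; rewrite /= in_itv /= lexx ltW.
by rewrite /= in_itv /=; exact: H.
Qed.

Lemma measurable_Gamma_open (A : set (R -> 'rV[R]_n)) : Gamma_open Om T A ->
  measurable (A : set (CurveSpace Om T)).
Proof. exact: sub_sigma_algebra. Qed.

Lemma measurable_dunif_ball g (e : R) : Gamma Om T g ->
  measurable ([set g' | Gamma Om T g' /\ dunif T g g' < e] : set (CurveSpace Om T)).
Proof.
move=> Gg; apply: measurable_Gamma_open; split => [g' []//|g' [Gg' d]].
exists (e - dunif T g g'); first by rewrite subr_gt0.
move=> g2 Gg2 d2; split => //; apply: (@le_lt_trans _ _ (dunif T g g' + dunif T g' g2)).
  apply: dunif_le => s sT; apply: (le_trans (enorm_triangle _ (g' s) _)).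
  by apply: lerD; exact: enorm_le_dunif.
by rewrite -ltrBrDl.
Qed.

(** Curves uniformly close to a step function with rational values, on time cells of length
    [c.1.1.+1%:R^-1]. The codes form a countable type, which provides the separability of the space
    of curves. *)
Definition step_class (c : nat * seq 'rV[rat]_n * nat) : set (R -> 'rV[R]_n) :=
  [set g | Gamma Om T g /\ forall s, 0 <= s <= T ->
     enorm (g s - map_mx ratr (nth 0 c.1.2 (Num.truncn (s * c.1.1.+1%:R)))) <= c.2.+1%:R^-1].

Lemma step_class_exists g j : Gamma Om T g -> exists c, c.2 = j /\ step_class c g.
Proof.
move=> Gg; have [ac _] := Gg.
have [e [e0 ej]] : exists e : R, 0 < e /\ e = j.+1%:R^-1 by exists j.+1%:R^-1; rewrite invr_gt0.
have e2 : 0 < e / 2 by rewrite divr_gt0.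
have [d d0 Hd] := ac _ e2.
have [k0 hk0] := exists_invS_lt R d d0.
have k1 : 0 < (k0.+1%:R : R) by rewrite ltr0n.
have en : 0 < e / 2 / (n%:R + 1) by rewrite divr_gt0// ltr_wpDl.
have [q Hq] := choice (fun i : nat => rational_approx (g (i%:R / k0.+1%:R)) _ en).
exists (k0, mkseq q (Num.truncn (T * k0.+1%:R)).+1, j); split => //; split => // s /andP[s0 sT] /=.
have sk0 : 0 <= s * k0.+1%:R by rewrite mulr_ge0// ltW.
have /andP[i1 i2] := truncn_itv sk0.
have [i ei] : exists i, i = Num.truncn (s * k0.+1%:R) by eexists.
rewrite -ei in i1 i2 *.
have iN : (i < (Num.truncn (T * k0.+1%:R)).+1)%N.
  by rewrite ltnS ei; apply: le_truncn; rewrite ler_pM2r.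
rewrite nth_mkseq//.
have t1 : i%:R / k0.+1%:R <= s by rewrite ler_pdivrMr.
have t2 : s - i%:R / k0.+1%:R < d.
  apply: lt_trans (hk0 k0 (leqnn _)).
  have : s < i.+1%:R / k0.+1%:R by rewrite ltr_pdivlMr.
  by rewrite -natr1 mulrDl mul1r; clear; move: (_^-1) (_ / _) => *; lra.
have t0 : 0 <= i%:R / k0.+1%:R :> R by rewrite divr_ge0.
apply: (le_trans (enorm_triangle _ (g (i%:R / k0.+1%:R)) _)); rewrite -ej.
have h1 : enorm (g s - g (i%:R / k0.+1%:R)) <= e / 2.
  apply: ltW; have := Hd 1%N (fun=> i%:R / k0.+1%:R) (fun=> s).
  rewrite !big_ord1; apply => //.
  by move=> a b; rewrite !ltnS !leqn0 => /eqP -> /eqP ->.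
have h2 : enorm (g (i%:R / k0.+1%:R) - map_mx ratr (q i)) <= e / 2.
  apply: (le_trans (enorm_le_sum _)).
  apply: (@le_trans _ _ (\sum_(l < n) e / 2 / (n%:R + 1))).
    by apply: ler_sum => l _; rewrite !mxE; exact/ltW/Hq.
  rewrite sumr_const card_ord -[leLHS]mulr_natl mulrCA ler_piMr ?ltW//.
  by rewrite ltr_pdivrMr ?ltr_wpDl// mul1r ltrDl.
by move: h1 h2; clear; move: (enorm _) (enorm _) => *; lra.
Qed.

(** Curves outside the support are covered by countably many negligible step classes, so a set of
    positive measure contains a curve of the support. Negligibility is used for the classes, whose
    measurability is left open. *)
Lemma support_curve_near (eta : probability (CurveSpace Om T) R) (mt : PrV R n) t x (e : R) :
  0 <= t <= T -> 0 < e ->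
  (forall B : set (BorelV R n), measurable B -> mt B = eta (Gamma Om T `&` (fun g => g t) @^-1` B)) ->
  in_supp mt x -> exists2 g, in_supp_curve Om T eta g & enorm (g t - x) < e.
Proof.
move=> tT e0 mE xs; apply: contrapT => no.
have mB : measurable ([set y | enorm (y - x) < e] : set (BorelV R n)).
  apply: sub_sigma_algebra; apply/open_enormP => y /= yx.
  exists (e - enorm (y - x)); first by rewrite subr_gt0.
  move=> z zy; apply: (le_lt_trans (enorm_triangle _ y _)).
  by move: zy; clear; move: (enorm _) (enorm _) => *; lra.
have := xs e e0; rewrite mE//.
set A := (X in eta X); suff -> : eta A = 0%E by rewrite ltxx.
have mA : measurable (A : set (CurveSpace Om T)).
  apply: measurable_Gamma_open; split => [g []//|g [Gg gB]].
  exists (e - enorm (g t - x)); first by rewrite subr_gt0.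
  move=> g' Gg' d; split => //=; apply: (le_lt_trans (enorm_triangle _ (g t) _)).
  have := enorm_le_dunif _ _ _ Gg Gg' tT; rewrite enormB; move: d; clear.
  by move: (enorm _) (enorm _) (dunif _ _ _) => *; lra.
apply: measure_negligible => //.
pose F (k : nat) : set (CurveSpace Om T) :=
  [set g | exists c, [/\ unpickle k = Some c, step_class c g & eta.-negligible (step_class c : set (CurveSpace Om T))]].
have nF k : eta.-negligible (F k).
  case E : (unpickle k : option (nat * seq 'rV[rat]_n * nat)) => [c|]; last first.
    by have -> : F k = set0; [rewrite -subset0 => g [c []]; rewrite E|exact: negligible_set0].
  have [nc|nc] := pselect (eta.-negligible (step_class c : set (CurveSpace Om T))).
    by apply: negligibleS nc => g [c' []]; rewrite E => -[<-].
  by have -> : F k = set0; [rewrite -subset0 => g [c' []]; rewrite E => -[<-] _ /nc|exact: negligible_set0].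
apply: negligibleS (negligible_bigcup nF) => g [Gg gB].
have [d [d0 nd]] : exists d : R, 0 < d /\ eta [set g' | Gamma Om T g' /\ dunif T g g' < d] = 0%E.
  apply: contrapT => nd; apply: no; exists g => //; split => // d d0.
  rewrite lt0e measure_ge0 andbT; apply/eqP => E; apply: nd; by exists d.
have d2 : 0 < d / 2 by rewrite divr_gt0.
have [j hj] := exists_invS_lt R _ d2.
have [c [cj cg]] := step_class_exists g j Gg.
exists (pickle c) => //; exists c; split => //; first by rewrite pickleK.
exists [set g' | Gamma Om T g' /\ dunif T g g' < d]; split => //; first exact: measurable_dunif_ball.
(* Two curves of one class are within [2 * j.+1%:R^-1], less than [d], so the class of [g] lies in
   its null ball. *)
move=> g' [Gg' H']; split => //; have [_ H] := cg.
apply: (@le_lt_trans _ _ (j.+1%:R^-1 + j.+1%:R^-1)).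
  apply: dunif_le => s sT; rewrite -cj.
  apply: (le_trans (enorm_triangle _ (map_mx ratr (nth 0 c.1.2 (Num.truncn (s * c.1.1.+1%:R)))) _)).
  by apply: lerD; [exact: H|rewrite enormB; exact: H'].
by have := hj j (leqnn _); move: (j.+1%:R^-1) => z *; lra.
Qed.

End support.

(** * Optimal curves near the support, and differentiability up to the boundary *)

Section support_points.
Context {R : realType} {n : nat}.
Context (Om : set 'rV[R]_n) (rho : 'rV[R]_n -> R) (U : set 'rV[R]_n) (T kappa M mu : R)
    (L : 'rV[R]_n -> 'rV[R]_n -> R) (F G : 'rV[R]_n -> PrV R n -> R)
    (u : R -> 'rV[R]_n -> R) (m : R -> PrV R n).
Hypothesis dom : bounded_C2_domain Om rho.
Hypothesis ms : mild_solution Om T L F G u m.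

(** A minimizer among the curves that start at [g 0] realises the value [u 0 (g 0)], hence has
    defect 0 on every subinterval. *)
Lemma support_near_opt (t0 : R) x0 C d0 Gc N r K :
  local_setting Om U T L (fun x t => F x (m t)) C d0 (fun x => G x (m T)) u rho t0 x0 Gc N r K ->
  in_supp (m t0) x0 -> forall de : R, 0 < de ->
  exists g w, near_opt (closure Om) L (fun x t => F x (m t)) u 0 0 T g w /\ enorm (g t0 - x0) < de.
Proof.
move=> S supp de de0; have [cd vd t0T _ _] := S.
have T0 := cd_T _ _ _ _ _ _ _ cd.
have [B HB] := closure_bounded _ _ dom.
have t0T' : 0 <= t0 <= T by move: t0T => /andP[h1 h2]; rewrite !ltW.
have [_ [_ [_ [eta [[_ [mE eE]] uE]]]]] := ms.
have [g sg gx] := support_curve_near Om T B T0 HB eta (m t0) t0 x0 de t0T' de0 (mE _ t0T') supp.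
have [Gg [_ mini]] := eE g sg; have [_ gA] := Gg.
have TT : 0 <= (0 : R) <= T by rewrite lexx ltW.
have cB : (cost L F G m T 0 g <= (u 0 (g 0))%:E)%E.
  rewrite (uE 0 _ TT (gA 0 TT)); apply: le_ereal_inf_tmp => _ [g' [Gg' g0] <-].
  by apply: mini.
have [w cw le] := cost_curve Om U T L F G m C d0 cd g 0 _ Gg TT cB.
exists g, w; split => //.
by apply: (near_opt_cost _ _ _ _ _ _ _ _ _ cd vd) => //; rewrite addr0.
Qed.

(** Points of the closure are limits of points of [Om], and both sides of the estimate are
    continuous. *)
Lemma diff_at_cl (t : R) y q1 q2 : 0 < t < T -> diff_at Om T u t y q1 q2 -> diff_cl Om T u t y q1 q2.
Proof.
move=> tT dif e e0; have [d d0 Hd] := dif e e0; exists d => // s z sT cz near.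
have [uc _] := ms; have sT' : 0 <= s <= T by move: sT => /andP[h1 h2]; rewrite !ltW.
apply/ler_addgt0Pr => ep ep0.
have ep3 : 0 < ep / 4 by rewrite divr_gt0.
have [d1 d10 H1] := uc s z sT' cz _ ep3.
have q20 : 0 < enorm q2 + 1 by rewrite ltr_wpDl ?enorm_ge0.
have [|de de0] := exists_lower_bound R [:: d1; d - (`|s - t| + enorm (z - y)); ep / 4 / (enorm q2 + 1); ep / 4 / e].
  by rewrite /= d10 subr_gt0 near !divr_gt0.
rewrite /= => /andP[a1] /andP[a2] /andP[a3] /andP[a4 _].
rewrite ler_pdivlMr// in a3; rewrite ler_pdivlMr// in a4.
have [z' Oz zz] := (proj1 (closure_enormP _ _) cz) de de0.
have tri : enorm (z' - y) <= enorm (z - y) + de.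
  by apply: (le_trans (enorm_triangle _ z _)); rewrite [X in X <= _]addrC lerD2l ltW.
have near' : `|s - t| + enorm (z' - y) < d.
  apply: (@le_lt_trans _ _ (`|s - t| + (enorm (z - y) + enorm (z' - z)))).
    by rewrite lerD2l [X in _ <= X]addrC; exact: enorm_triangle.
  by move: zz a2; move: (enorm (z' - z)) (`|s - t|) (enorm _) => *; lra.
have h1 := Hd s z' sT Oz near'.
have h2 : `|u s z' - u s z| < ep / 4.
  apply: H1 => //; first exact: subset_closure.
  by rewrite subrr normr0 add0r (lt_le_trans zz).
have h3 : `|dotv q2 (z' - z)| <= ep / 4.
  apply: (le_trans (cauchy_schwarz_norm _ _)); apply: le_trans a3.
  rewrite mulrC; apply: ler_pM; rewrite ?enorm_ge0//; [exact: ltW|by rewrite lerDl].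
have h4 : e * (`|s - t| + enorm (z' - y)) <= e * (`|s - t| + enorm (z - y)) + ep / 4.
  have : e * (`|s - t| + enorm (z' - y)) <= e * (`|s - t| + (enorm (z - y) + de)) by rewrite ler_pM2l// lerD2l.
  by move: a4; rewrite !mulrDr; move: (e * `|_|) (e * enorm _) (e * enorm _) => *; lra.
have -> : u s z - u t y - q1 * (s - t) - dotv q2 (z - y) =
  (u s z' - u t y - q1 * (s - t) - dotv q2 (z' - y)) - (u s z' - u s z) + dotv q2 (z' - z).
  by rewrite !dotvE; ring.
apply: (le_trans (ler_normD _ _)); apply: (le_trans (lerD (ler_normB _ _) (lexx _))).
apply: (le_trans (lerD (lerD (le_trans h1 h4) (ltW h2)) h3)).
by move: (e * _) => *; lra.
Qed.

End support_points.

(** * Identification of slopes and the Hamilton-Jacobi inequality *)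

Section slopes.
Context {R : realType} {n : nat}.
Implicit Types (p q v : 'rV[R]_n).

Lemma small_linear_eq0 (a : R) (b : 'rV[R]_n) :
  (forall e s h, 0 < e -> a * s + dotv b h <= e * (`|s| + enorm h)) -> a = 0 /\ b = 0.
Proof.
move=> H; split.
  apply/eqP; rewrite -normr_le0; apply/ler_addgt0Pr => e e0; rewrite add0r.
  have := H e a 0 e0; rewrite dotv0 enorm0 !addr0 -expr2 -real_normK ?num_real//.
  have := normr_ge0 a; rewrite le_eqVlt => /orP[/eqP <- _|a0]; first exact: ltW.
  by rewrite expr2 ler_pM2r.
apply: enorm0_eq0; apply/eqP; rewrite eq_le enorm_ge0 andbT; apply/ler_addgt0Pr => e e0; rewrite add0r.
have := H e 0 b e0; rewrite mulr0 normr0 !add0r -sqr_enorm.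
have := enorm_ge0 b; rewrite le_eqVlt => /orP[/eqP <- _|a0]; first exact: ltW.
by rewrite expr2 ler_pM2r.
Qed.

Lemma superdiff_diff_eq {Om U T L f C d0 h0 u rho t0 x0 G N r0 K}
  (S : @local_setting R n Om U T L f C d0 h0 u rho t0 x0 G N r0 K) (p1 : R) p2 (q1 : R) q2 : Om x0 ->
  diff_cl Om T u t0 x0 p1 p2 -> superdiff Om T u t0 x0 q1 q2 -> q1 = p1 /\ q2 = p2.
Proof.
move=> Omx0 dif sup; case: (S) => cd vd t0T Ax0 ch.
have [[r00 _] /(_ Omx0)[G0 N0 K0] _ _ _] := ch; have /andP[tp tT] := t0T.
have [h1 h2] : p1 - q1 = 0 /\ p2 - q2 = 0; last by split; apply/esym/eqP; rewrite -subr_eq0 ?h1 ?h2.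
apply: small_linear_eq0 => e s h e0.
have e2 : 0 < e / 2 by rewrite divr_gt0.
have [d1 d10 H1] := dif _ e2; have [d2 d20 H2] := sup _ e2.
have [|ro ro0] := exists_lower_bound R [:: d1 / 2; d2 / 2; t0 / 2; (T - t0) / 2; r0; 1].
  by rewrite /= r00 ltr01 !divr_gt0 ?subr_gt0.
rewrite /= => /andP[a1] /andP[a2] /andP[a3] /andP[a4] /andP[a5] /andP[a6 _].
apply: (cone_scale R n _ e ro 0 1 _ 0 ro0); last by rewrite dot0v !mul0r addr0.
move=> s' h' shr _.
have hh : enorm h' <= ro by apply: le_trans shr; rewrite lerDr.
have sh : `|s'| <= ro by apply: le_trans shr; rewrite lerDl enorm_ge0.
have Ah : closure Om (x0 + h').
  rewrite -[h']scale1r; apply: (chart_cone _ _ _ _ _ _ _ 1 _ _ _ ch) => //.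
  - by rewrite subrr enorm0 ltW.
  - exact: le_trans a5.
  - by rewrite ler01 lexx.
  - by rewrite subrr enorm0 add0r (le_trans hh).
  - by rewrite G0 K0 dot0v !mul0r addr0.
have sT : 0 < t0 + s' < T.
  by move: sh; rewrite ler_norml => /andP[k1 k2]; apply/andP; split; lra.
have := H1 (t0 + s') (x0 + h') sT Ah; have := H2 (t0 + s') (x0 + h') sT Ah.
have -> : t0 + s' - t0 = s' by rewrite addrC addKr.
have -> : x0 + h' - x0 = h' by rewrite addrC addKr.
have d1r : `|s'| + enorm h' < d1 by apply: (le_lt_trans shr); lra.
have d2r : `|s'| + enorm h' < d2 by apply: (le_lt_trans shr); lra.
move=> /(_ d2r) k1 /(_ d1r); rewrite ler_norml => /andP[k2 _].
have k3 : e / 2 * (`|s'| + enorm h') <= e / 2 * ro by rewrite ler_pM2l.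
rewrite (dotvBl p2); move: k1 k2 k3; clear.
move: (`|s'| + _) (dotv p2 _) (dotv q2 _) (u (t0 + s') _) (u t0 x0) => *; lra.
Qed.

(** On inward displacements [p2 - p] is nonpositive up to [e]. As the cones open to the half-space,
    its tangential part has to vanish and its component along the outward normal to be
    nonnegative. *)
Lemma superdiff_x_normal {Om U T L f C d0 h0 u rho t0 x0 G N r0 K}
  (S : @local_setting R n Om U T L f C d0 h0 u rho t0 x0 G N r0 K) (p1 : R) p2 p : ~ Om x0 ->
  diff_cl Om T u t0 x0 p1 p2 -> superdiff_x Om u t0 x0 p ->
  exists2 a : R, 0 <= a & p = p2 - a *: nu rho x0.
Proof.
move=> nOm dif sup; case: (S) => cd vd t0T Ax0 ch.
have [[r00 K0] _ /(_ nOm)[GE GN] _ _] := ch.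
have Gp : 0 < enorm G.
  apply: enorm_gt0; apply/eqP => G0; move: GN; rewrite G0 dot0v => /eqP.
  by rewrite eq_sym oner_eq0.
have [nv env] : exists nv, nv = nu rho x0 by eexists.
have nvG : nv = (enorm G)^-1 *: G by rewrite env /nu GE.
have n1 : enorm nv = 1 by rewrite nvG enormZ gtr0_norm ?invr_gt0// mulVf// gt_eqF.
rewrite -env.
have cone e h : 0 < e -> dotv G h + K * enorm h * e <= 0 -> dotv (p2 - p) h <= e * enorm h.
  move=> e0 hc; have e2 : 0 < e / 2 by rewrite divr_gt0.
  have [d1 d10 H1] := dif _ e2; have [d2 d20 H2] := sup _ e2.
  have [|ro ro0] := exists_lower_bound R [:: d1 / 2; d2 / 2; r0; e].
    by rewrite /= r00 e0 !divr_gt0.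
  rewrite /= => /andP[a1] /andP[a2] /andP[a3] /andP[a4 _].
  have := @cone_scale R n 0 e ro K e (p2 - p) G ro0 _ 0 h hc.
  rewrite mulr0 normr0 !add0r; apply => s' h' shr hc'; rewrite mul0r add0r.
  have hh : enorm h' <= ro by apply: le_trans shr; rewrite lerDr.
  have Ah : closure Om (x0 + h').
    rewrite -[h']scale1r; apply: (chart_cone _ _ _ _ _ _ _ e _ _ _ ch) => //.
    - by rewrite subrr enorm0 ltW.
    - exact: le_trans a3.
    - by rewrite ler01 lexx.
    - by rewrite subrr enorm0 add0r (le_trans hh).
  have := H1 t0 (x0 + h') t0T Ah; have := H2 (x0 + h') Ah.
  have -> : x0 + h' - x0 = h' by rewrite addrC addKr.
  rewrite subrr normr0 add0r mulr0 subr0.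
  have d1r : enorm h' < d1 by apply: (le_lt_trans hh); lra.
  have d2r : enorm h' < d2 by apply: (le_lt_trans hh); lra.
  move=> /(_ d2r) k1 /(_ d1r); rewrite ler_norml => /andP[k2 _].
  have k3 : e / 2 * enorm h' <= e / 2 * ro by rewrite ler_pM2l.
  rewrite (dotvBl p2); move: k1 k2 k3; clear.
  move: (enorm h') (dotv p2 _) (dotv p _) (u t0 (x0 + _)) (u t0 x0) => *; lra.
have [k [k0 ek]] : exists k, 0 < k /\ k = 2 * K / enorm G + 1.
  eexists; split; last by []; by rewrite ltr_wpDl// divr_ge0 ?mulr_ge0 ?enorm_ge0.
have tan : p2 - p - dotv (p2 - p) nv *: nv = 0.
  apply: enorm0_eq0; apply/eqP; rewrite eq_le enorm_ge0 andbT; apply/ler_addgt0Pr => e e0; rewrite add0r.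
  have W0 : 0 < 2 + k * enorm (p2 - p) by rewrite ltr_pwDl// mulr_ge0 ?enorm_ge0// ltW.
  have [|e1 e10] := exists_lower_bound R [:: k^-1; e / (2 + k * enorm (p2 - p))].
    by rewrite /= invr_gt0 k0 divr_gt0.
  rewrite /= => /andP[b1] /andP[b2 _]; rewrite ler_pdivlMr// in b2.
  have ke : k * e1 <= 1 by have := ler_wpM2l (ltW k0) b1; rewrite mulfV// gt_eqF.
  have Kk : 2 * K * e1 <= k * e1 * enorm G.
    have -> : k * e1 * enorm G = 2 * K * e1 + e1 * enorm G by rewrite ek; field; rewrite gt_eqF.
    by rewrite lerDl mulr_ge0 ?ltW.
  have ke01 : 0 <= k * e1 <= 1 by rewrite ke mulr_ge0 ?ltW.
  have := tangential_bound R n (p2 - p) G K e1 e1 (k * e1) Gp K0 (ltW e10) (ltW e10) ke01 Kk (fun h => cone e1 h e10).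
  rewrite -nvG => /le_trans; apply; move: b2; clear; lra.
exists (dotv (p2 - p) nv); last first.
  have <- : p2 - p = dotv (p2 - p) nv *: nv by apply/eqP; rewrite -subr_eq0 tan.
  by rewrite subKr.
rewrite -oppr_le0 -dotvNr; apply/ler_addgt0Pr => e e0; rewrite add0r.
have [|e1 e10] := exists_lower_bound R [:: e; enorm G / (K + 1)].
  by rewrite /= e0 divr_gt0// ltr_wpDl.
rewrite /= => /andP[b1] /andP[b2 _]; rewrite ler_pdivlMr ?ltr_wpDl// in b2.
have := cone e1 (- nv) e10; rewrite enormN n1 !mulr1 => H; apply: (le_trans (H _)) => //.
rewrite dotvNr nvG dotvZr -sqr_enorm expr2 mulrA mulVf ?gt_eqF// mul1r.
by move: b2 e10; clear; lra.
Qed.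

Lemma dt_at_unique (T : R) (u : R -> 'rV[R]_n -> R) t x (p1 q1 : R) : 0 < t < T ->
  dt_at T u t x p1 -> dt_at T u t x q1 -> q1 = p1.
Proof.
move=> /andP[t0 tT] hp hq; apply/eqP; rewrite -subr_eq0 -normr_le0; apply/ler_addgt0Pr => e e0; rewrite add0r.
have e2 : 0 < e / 2 by rewrite divr_gt0.
have [d1 d10 H1] := hp _ e2; have [d2 d20 H2] := hq _ e2.
have [|ro ro0] := exists_lower_bound R [:: d1 / 2; d2 / 2; (T - t) / 2].
  by rewrite /= !divr_gt0 ?subr_gt0.
rewrite /= => /andP[a1] /andP[a2] /andP[a3 _].
have sT : 0 < t + ro < T by apply/andP; split; lra.
have := H1 (t + ro) sT; have := H2 (t + ro) sT.
have -> : t + ro - t = ro by rewrite addrC addKr.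
rewrite (gtr0_norm ro0) => k1 k2.
have {}k1 : `|u (t + ro) x - u t x - q1 * ro| <= e / 2 * ro by apply: k1; lra.
have {}k2 : `|u (t + ro) x - u t x - p1 * ro| <= e / 2 * ro by apply: k2; lra.
rewrite -(ler_pM2r ro0) -{1}(gtr0_norm ro0) -normrM.
have -> : (q1 - p1) * ro = (u (t + ro) x - u t x - p1 * ro) - (u (t + ro) x - u t x - q1 * ro) by ring.
apply: (le_trans (ler_normB _ _)); apply: (le_trans (lerD k2 k1)); lra.
Qed.

(** Convexity in the velocity makes [v] a maximiser, which also provides the upper bound that [sup]
    requires. *)
Lemma Ham_attained (U : set 'rV[R]_n) L (C : R) x v : lagrangian_bounds U L C -> U x ->
  (forall w, dotv (DvL L x v) w - L x w <= dotv (DvL L x v) v - L x v) /\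
  Ham L x (- DvL L x v) = dotv (DvL L x v) v - L x v.
Proof.
move=> [C0 _ _ [HQ _] _] Ux.
have conv w : dotv (DvL L x v) w - L x w <= dotv (DvL L x v) v - L x v.
  have [q _] := HQ x v (w - v) Ux; rewrite (addrC v) subrK in q.
  have : 0 <= L x w - L x v - dotv (DvL L x v) (w - v).
    by rewrite -(pmulr_rge0 _ C0) (le_trans _ q)// sqr_ge0.
  by rewrite (dotvBr w); move: (dotv _ w) (dotv _ v) (L x w) (L x v) => *; lra.
split => //; apply/eqP; rewrite eq_le; apply/andP; split.
  apply: ge_sup => [|_ [w _ <-]]; last by rewrite dotvNl opprK.
  by exists (- dotv (- DvL L x v) 0 - L x 0), 0.
apply: ub_le_sup; last by exists v => //; rewrite dotvNl opprK.
by exists (dotv (DvL L x v) v - L x v) => _ [w _ <-]; rewrite dotvNl opprK.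
Qed.

(** From an interior point a segment of any velocity [w] is admissible for a short time; dynamic
    programming along it, divided by the duration, gives the inequality. *)
Lemma diff_subsolution {Om U T L f C d0 h0 u rho t0 x0 G N r0 K}
  (S : @local_setting R n Om U T L f C d0 h0 u rho t0 x0 G N r0 K) (q1 : R) q2 : Om x0 ->
  diff_cl Om T u t0 x0 q1 q2 -> forall w, - dotv q2 w - L x0 w <= f x0 t0 + q1.
Proof.
move=> Omx0 dif w; case: (S) => cd vd t0T Ax0 ch; have HL := cd_L _ _ _ _ _ _ _ cd.
have [C0 _ _ _ [HLx _]] := HL; have C0' := ltW C0.
have [[r00 _] /(_ Omx0)[G0 N0 K0] _ _ _] := ch; have /andP[tp tT] := t0T.
have t00 : 0 <= t0 <= T by rewrite !ltW.
have d00 := cd_d0 _ _ _ _ _ _ _ cd.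
apply/ler_addgt0Pr => e e0.
have w0 := enorm_ge0 w.
have [W [W0 eW]] : exists W, 0 < W /\ W = 1 + enorm w by exists (1 + enorm w); rewrite ltr_pwDl.
have e4 : 0 < e / 4 by rewrite divr_gt0.
have eW4 : 0 < e / 4 / W by rewrite divr_gt0.
have [dq dq0 Hq] := dif _ eW4.
have [dt dt0 Hdt] := cd_fcont _ _ _ _ _ _ _ cd t0 t00 _ e4.
have V0 : 0 < C * (1 + enorm w ^+ 2) + C by rewrite addr_gt0// mulr_gt0// ltr_pwDl// sqr_ge0.
have [|ro ro0] := exists_lower_bound R [:: dq / 2 / W; dt / 2; (T - t0) / 2; r0 / W; d0 / W; 1 / W; e / 4 / (C * (1 + enorm w ^+ 2) + C) / W].
  by rewrite /= !divr_gt0 ?subr_gt0.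
rewrite /= => /andP[a1] /andP[a2] /andP[a3] /andP[a4] /andP[a5] /andP[a6] /andP[a7 _].
rewrite ler_pdivlMr// in a1; rewrite ler_pdivlMr// in a4; rewrite ler_pdivlMr// in a5.
rewrite ler_pdivlMr// in a6; rewrite ler_pdivlMr// in a7.
have rw z : 0 <= z -> z <= ro -> enorm (z *: w) <= ro * W.
  move=> z0 zr; rewrite enormZ ger0_norm//; apply: ler_pM => //; by rewrite eW lerDr.
have adm r : t0 <= r <= t0 + ro -> closure Om (x0 + (r - t0) *: w).
  move=> /andP[r1 r2]; have z0 : 0 <= r - t0 by rewrite subr_ge0.
  have zr : r - t0 <= ro by rewrite lerBlDl.
  rewrite -[(r - t0) *: w]scale1r; apply: (chart_cone _ _ _ _ _ _ _ 1 _ _ _ ch) => //.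
  - by rewrite subrr enorm0 ltW.
  - exact: le_trans (rw _ z0 zr) a4.
  - by rewrite ler01 lexx.
  - by rewrite subrr enorm0 add0r (le_trans (rw _ z0 zr)).
  - by rewrite G0 K0 dot0v !mul0r addr0.
have tr : t0 <= t0 + ro by rewrite lerDl ltW.
have trT : t0 + ro <= T by move: a3 tT; clear; lra.
have cw := curve_segment _ t0 (t0 + ro) x0 w tr adm.
have D := dpp_le _ _ _ _ _ _ _ _ _ cd vd _ _ _ _ (ltW tp) tr trT cw.
have il := curve_lag_itg _ _ _ _ _ _ _ cd _ _ _ _ (ltW tp) tr trT cw.
have ro_ : t0 + ro - t0 = ro by rewrite addrC addKr.
have rb : running L f t0 (t0 + ro) (fun r => x0 + (r - t0) *: w) (fun=> w) <= ro * (L x0 w + f x0 t0 + e / 2).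
  rewrite -[X in X * _]ro_ -int_cst//; apply: int_le => //; first exact: itg_cst.
  move=> r rr; rewrite /lag; have /andP[r1 r2] := rr.
  have z0 : 0 <= r - t0 by rewrite subr_ge0.
  have zr : r - t0 <= ro by rewrite lerBlDl.
  have dist : enorm (x0 + (r - t0) *: w - x0) <= ro * W by rewrite addrC addKr rw.
  have seg : segment_in U x0 (x0 + (r - t0) *: w).
    by apply: (cd_segment _ _ _ _ _ _ _ cd) => //; exact: le_trans dist a5.
  have rT : 0 <= r <= T by rewrite (le_trans (ltW tp))//= (le_trans r2).
  have l1 := HLx _ _ w seg; have l2 := cd_flip _ _ _ _ _ _ _ cd r _ _ rT seg.
  rewrite enormB in l1 l2.
  have l3 : `|f x0 r - f x0 t0| <= e / 4.
    by apply: Hdt => //; rewrite ger0_norm//; move: zr a2 dt0; clear; lra.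
  have l4 : (C * (1 + enorm w ^+ 2) + C) * enorm (x0 + (r - t0) *: w - x0) <= e / 4.
    rewrite ler_pdivlMr// in a7; rewrite mulrC; apply: le_trans a7.
    by rewrite ler_wpM2r// ltW.
  rewrite (distrC (L x0 w)) in l1; rewrite (distrC (f x0 r)) in l2.
  have k1 := le_trans (ler_norm _) l1; have k2 := le_trans (ler_norm _) l2; have k3 := le_trans (ler_norm _) l3.
  rewrite mulrDl in l4; move: k1 k2 k3 l4; clear.
  by move: (_ * enorm _) (C * enorm _) (L _ _) (L _ _) (f _ r) (f x0 r) (f x0 t0) => *; lra.
rewrite subrr scale0r addr0 ro_ in D.
have Ae : closure Om (x0 + ro *: w) by have := adm (t0 + ro); rewrite lexx tr ro_; apply.
have sT : 0 < t0 + ro < T by apply/andP; split; move: ro0 tp a3 tT; clear; lra.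
have n1 : ro + enorm (ro *: w) = ro * W by rewrite enormZ gtr0_norm// eW mulrDr mulr1.
have := Hq (t0 + ro) (x0 + ro *: w) sT Ae.
have -> : x0 + ro *: w - x0 = ro *: w by rewrite addrC addKr.
rewrite ro_ (gtr0_norm ro0) n1 dotvZr => Q.
have {}Q := le_trans (ler_norm _) (Q _).
have {}Q : u (t0 + ro) (x0 + ro *: w) - u t0 x0 - q1 * ro - ro * dotv q2 w <= e / 4 / W * (ro * W).
  by apply: Q; apply: (le_lt_trans a1); rewrite ltr_pdivrMr// ltr_pMr// ltr1n.
have e5 : e / 4 / W * (ro * W) = ro * (e / 4) by field; rewrite gt_eqF.
rewrite e5 in Q; rewrite -(ler_pM2l ro0).
move: D rb Q; move: (running _ _ _ _ _ _) (u _ _) (u t0 _) (dotv _ _) (L _ _) (f _ _) => *.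
have := mulr_gt0 ro0 e0; lra.
Qed.

(** [p2] is itself a superdifferential, and every other one is [p2] minus a nonnegative multiple of
    the normal; so all share one tangential part, and [p2] has the largest normal component. *)
Lemma boundary_slopes {Om U T L f C d0 h0 u rho t0 x0 G N r0 K}
  (S : @local_setting R n Om U T L f C d0 h0 u rho t0 x0 G N r0 K) (p1 : R) p2 : ~ Om x0 ->
  diff_cl Om T u t0 x0 p1 p2 ->
  [/\ dt_at T u t0 x0 p1, is_Dtau Om rho u t0 x0 (p2 - dotv p2 (nu rho x0) *: nu rho x0),
    is_lambda_plus Om rho u t0 x0 (p2 - dotv p2 (nu rho x0) *: nu rho x0) (dotv p2 (nu rho x0)) &
    forall (q1 : R) qtau (l : R), dt_at T u t0 x0 q1 -> is_Dtau Om rho u t0 x0 qtau ->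
      is_lambda_plus Om rho u t0 x0 qtau l -> q1 = p1 /\ qtau + l *: nu rho x0 = p2].
Proof.
move=> nOm dif; case: (S) => cd vd t0T Ax0 ch.
have nor := superdiff_x_normal S p1 p2 _ nOm dif.
have [_ _ /(_ nOm)[GE GN] _ _] := ch.
have Gp : 0 < enorm G.
  apply: enorm_gt0; apply/eqP => G0; move: GN; rewrite G0 dot0v => /eqP.
  by rewrite eq_sym oner_eq0.
have nn : dotv (nu rho x0) (nu rho x0) = 1.
  by rewrite -sqr_enorm /nu -GE enormZ gtr0_norm ?invr_gt0// mulVf ?expr1n// gt_eqF.
rewrite /is_Dtau /is_lambda_plus; move: (nu rho x0) nor nn => nv nor nn.
have sup2 : superdiff_x Om u t0 x0 p2.
  move=> e e0; have [d dp H] := dif e e0; exists d => // y cy yd.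
  have := H t0 y t0T cy; rewrite subrr normr0 add0r mulr0 subr0 => /(_ yd).
  exact: le_trans (ler_norm _).
have dotn a : dotv (p2 - a *: nv) nv = dotv p2 nv - a by rewrite dotvBl dotvZl nn mulr1.
have lplus a : superdiff_x Om u t0 x0 (p2 - dotv p2 nv *: nv + a *: nv) -> a <= dotv p2 nv.
  move=> /nor[b b0] E; have := congr1 (fun z => dotv z nv) E.
  by rewrite /= !dotvE !nn !mulr1; move: b0; clear; move: (dotv p2 _) => *; lra.
have dt1 : dt_at T u t0 x0 p1.
  move=> e e0; have [d dp H] := dif e e0; exists d => // s sT sd.
  by have := H s x0 sT Ax0; rewrite subrr enorm0 dotv0 subr0 !addr0; apply.
split; first exact: dt1.
- by move=> p /nor[a _ ->]; rewrite dotn scalerBl opprB addrA subrK.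
- by rewrite subrK; split => //; exact: lplus.
move=> q1 qtau l hq ht [hl hmax]; split; first exact: (dt_at_unique T u t0 x0 _ _ t0T dt1 hq).
have qE := ht _ sup2; rewrite -qE in hl hmax *.
suff -> : l = dotv p2 nv by rewrite subrK.
by apply/eqP; rewrite eq_le lplus//=; apply: hmax; rewrite subrK.
Qed.

End slopes.

Theorem theorem4p16 (R : realType) (n : nat) (Om : set 'rV[R]_n)
    (rho : 'rV[R]_n -> R) (U : set 'rV[R]_n) (T kappa M mu : R)
    (L : 'rV[R]_n -> 'rV[R]_n -> R) (F G : 'rV[R]_n -> PrV R n -> R)
    (u : R -> 'rV[R]_n -> R) (m : R -> PrV R n) :
  bounded_C2_domain Om rho ->
  open U -> closure Om `<=` U ->
  0 < T -> 0 < mu ->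
  hyp_D Om U kappa F G -> hyp_L U M mu L ->
  mild_solution Om T L F G u m ->
  (* (i) *)
  (forall t x, 0 < t < T -> Om x ->
     forall q1 q2, limsup_superdiff Om T u t x q1 q2 -> superdiff Om T u t x q1 q2) /\
  (forall t x, Qm Om T m t x ->
     exists p1 p2, diff_at Om T u t x p1 p2 /\
       forall q1 q2, limsup_superdiff Om T u t x q1 q2 <-> (q1 = p1 /\ q2 = p2)) /\
  (* (ii) and (iii) *)
  (forall t x, bQm Om T m t x ->
     exists (p1 : R) (ptau : 'rV[R]_n) (lam : R),
       dt_at T u t x p1 /\ is_Dtau Om rho u t x ptau /\ is_lambda_plus Om rho u t x ptau lam /\
       (* (ii) limit over differentiability points in (0,T) x Omega *)
       (forall e : R, 0 < e -> exists2 d : R, 0 < d & forall s y q1 q2,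
          0 < s < T -> Om y -> `|s - t| + enorm (y - x) < d ->
          diff_at Om T u s y q1 q2 ->
          `|q1 - p1| + enorm (q2 - (ptau + lam *: nu rho x)) < e) /\
       (* (ii) Hamilton-Jacobi equation on the boundary *)
       - p1 + Ham L x (ptau + lam *: nu rho x) = F x (m t) /\
       (* (iii) limit along dQ_m *)
       (forall e : R, 0 < e -> exists2 d : R, 0 < d & forall s y q1 qtau l,
          bQm Om T m s y -> `|s - t| + enorm (y - x) < d ->
          dt_at T u s y q1 -> is_Dtau Om rho u s y qtau -> is_lambda_plus Om rho u s y qtau l ->
          `|q1 - p1| + enorm ((qtau + l *: nu rho y) - (ptau + lam *: nu rho x)) < e)).
Proof.
move=> dom oU OU T0 mu0 hD hL ms.
have locs t x : 0 < t < T -> closure Om x -> exists C d0 Gc N r K, local_setting Om U T L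
    (fun x t => F x (m t)) C d0 (fun x => G x (m T)) u rho t x Gc N r K.
  by move=> *; eapply exists_local_setting; eassumption.
have supp t x C d0 Gc N r K : local_setting Om U T L
    (fun x t => F x (m t)) C d0 (fun x => G x (m T)) u rho t x Gc N r K -> in_supp (m t) x ->
  forall de : R, 0 < de -> exists g w,
    near_opt (closure Om) L (fun x t => F x (m t)) u 0 0 T g w /\ enorm (g t - x) < de.
  by move=> ? ?; eapply support_near_opt; eassumption.
have Lbd C d0 : control_data (closure Om) U T L (fun x t => F x (m t)) C d0 -> lagrangian_bounds U L C.
  by move=> cd; exact: (cd_L _ _ _ _ _ _ _ cd).
split; [|split].
- move=> t x tT Ox q1 q2; have [C [d0 [Gc [N [r [K S]]]]]] := locs t x tT (subset_closure Ox).
  exact: (limsup_superdiff_sub R n S _ _ Ox).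
- move=> t x [tT [Ox xm]]; have [C [d0 [Gc [N [r [K S]]]]]] := locs t x tT (subset_closure Ox).
  have [v vG dif] := support_diff R n S (supp _ _ _ _ _ _ _ _ S xm).
  exists (tslope L (F x (m t)) x v), (- DvL L x v); split.
    move=> e e0; have [d dp H] := dif e e0; exists d => // s y sT Oy.
    by apply: H => //; exact: subset_closure.
  move=> q1 q2; split => [lim|[-> ->]].
    exact: (superdiff_diff_eq S _ _ _ _ Ox dif (limsup_superdiff_sub R n S _ _ Ox lim)).
  (* Constant sequences give the converse inclusion. *)
  exists (fun=> t), (fun=> x), (fun=> tslope L (F x (m t)) x v), (fun=> - DvL L x v).
  split; first by [].
  split; first exact: cvg_cst.
  split; first exact: cvg_cst.
  split; last by split; exact: cvg_cst.
  move=> _ e e0; have [d dp H] := dif e e0; exists d => // s y sT cy yd.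
  exact: le_trans (ler_norm _) (H _ _ sT cy yd).
move=> t x [tT [[cx nOx] xm]]; have [C [d0 [Gc [N [r [K S]]]]]] := locs t x tT cx.
have [v vG dif] := support_diff R n S (supp _ _ _ _ _ _ _ _ S xm).
have [h1 h2 h3 _] := boundary_slopes S _ _ nOx dif.
(* Common to both boundary limits: the base points may be interior or on the boundary, provided that
   their slopes satisfy the Hamilton-Jacobi inequality. *)
have lim e : 0 < e -> exists2 d : R, 0 < d & forall s y (q1 : R) q2, 0 < s < T -> closure Om y ->
    `|s - t| + enorm (y - x) < d -> diff_cl Om T u s y q1 q2 ->
    (forall w, - dotv q2 w - L y w <= F y (m s) + q1) ->
    `|q1 - tslope L (F x (m t)) x v| + enorm (q2 - - DvL L x v) < e.
  move=> e0; have e3 : 0 < e / 3 by rewrite divr_gt0.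
  have [d dp H] := slope_limit R n S v vG dif _ e3.
  exists d => // s y q1 q2 sT cy yd dq sub.
  have n1 : `|s - t| <= d by apply: le_trans (ltW yd); rewrite lerDl enorm_ge0.
  have n2 : enorm (y - x) <= d by apply: le_trans (ltW yd); rewrite lerDr.
  have [k1 k2] := H s y q1 q2 sT cy n1 n2 dq sub.
  by apply: (le_lt_trans (lerD k1 k2)); move: e0; clear; lra.
exists (tslope L (F x (m t)) x v), (- DvL L x v - dotv (- DvL L x v) (nu rho x) *: nu rho x),
  (dotv (- DvL L x v) (nu rho x)).
split; first exact: h1.
split; first exact: h2.
split; first exact: h3.
rewrite subrK; split; [|split].
- move=> e /lim[d dp H]; exists d => // s y q1 q2 sT Oy yd dq.
  have dc := diff_at_cl Om T L F G u m ms s y q1 q2 sT dq.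
  apply: (H s y q1 q2 sT (subset_closure Oy) yd dc).
  have [C' [d0' [Gc' [N' [r' [K' S']]]]]] := locs s y sT (subset_closure Oy).
  exact: (diff_subsolution S' _ _ Oy dc).
- have [_ ->] := Ham_attained U L C x v (Lbd _ _ (ls_cd _ _ _ _ _ _ _ _ _ _ _ _ _ _ _ _ S)) (OU _ cx).
  by rewrite /tslope; ring.
move=> e /lim[d dp H]; exists d => // s y q1 qtau l [sT [[cy nOy] ym]] yd hq ht hl.
have [C' [d0' [Gc' [N' [r' [K' S']]]]]] := locs s y sT cy.
(* At a boundary point of the support the slopes come from a vector [w], and the Hamilton-Jacobi
   inequality follows from Legendre duality. *)
have [w wG dq] := support_diff R n S' (supp _ _ _ _ _ _ _ _ S' ym).
have [_ _ _ /(_ _ _ _ hq ht hl)[-> ->]] := boundary_slopes S' _ _ nOy dq.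
apply: (H s y _ _ sT cy yd dq) => w'.
have [/(_ w') k _] := Ham_attained U L C' y w (Lbd _ _ (ls_cd _ _ _ _ _ _ _ _ _ _ _ _ _ _ _ _ S')) (OU _ cy).
by rewrite dotvNl opprK /tslope [X in _ <= X]addrC subrK.
Qed.
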